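(* Let $F$ be an $\mathcal F_T$-measurable real random variable such that $E[e^{p'F^+}]<\infty$ for every $p'\ge1$ and $F^-\le k$ for some constant $k>0$, and let the portfolio constraint set be a closed convex cone $\mathcal C^c\subset\mathbb R^d$ with $0\in\mathcal C^c$. Then the utility indifference prices satisfy $$\lim_{\alpha\to0}C_0^\alpha(F)=C_0^0(F),$$ where $C^0(F)$ is the first component of the unique solution $(C^0(F),H^0(F))$ of the linear BSDE $$C_t^0(F)=F+\int_t^T(H_u^0(F))^{tr}\left(Z_u^1(0)-\mathrm{Proj}_{\sigma_u^{tr}\mathcal C^c}(Z_u^1(0)+\theta_u)\right)du-\int_t^T(H_u^0(F))^{tr}dB_u,\quad t\in[0,T].$$
   Context: Fix $T>0$ and integers $1\le d\le m$. $B$ is a standard $m$-dimensional Brownian motion on a complete probability space $(\Omega,\mathcal F,\mathbb P)$ with augmented natural filtration $(\mathcal F_t)$; predictability is with respect to this filtration, $E$ is expectation under $\mathbb P$, and $A^{tr}$ is the transpose of $A$. The processes $b$ ($\mathbb R^d$-valued) and $\sigma$ ($\mathbb R^{d\times m}$-valued) are predictable and bounded, $\sigma_t\sigma_t^{tr}$ is invertible, and $\theta_t=\sigma_t^{tr}(\sigma_t\sigma_t^{tr})^{-1}b_t$ is bounded. For a closed convex set $K\subset\mathbb R^m$, $\mathrm{dist}_K$ and $\mathrm{Proj}_K$ are the Euclidean distance to and projection onto $K$; $\sigma_t^{tr}\mathcal C^c=\{\sigma_t^{tr}\pi:\pi\in\mathcal C^c\}$. $y^+=\max\{y,0\}$,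 $y^-=\max\{-y,0\}$. For each risk aversion parameter $\alpha>0$ put, for $(t,z)\in[0,T]\times\mathbb R^m$, $$f^\alpha(t,z)=\frac{\alpha}{2}\mathrm{dist}^2_{\sigma_t^{tr}\mathcal C^c}\left(z+\frac1\alpha\theta_t\right)-z^{tr}\theta_t-\frac1{2\alpha}|\theta_t|^2 .$$ For $G\in\{F,0\}$, $(Y^\alpha(G),Z^\alpha(G))$ denotes the unique solution of $Y_t=G+\int_t^Tf^\alpha(s,Z_s)ds-\int_t^TZ_s^{tr}dB_s$ (predictable, $Y$ continuous) such that, for every $p'\ge1$, $E[\sup_{t\le T}e^{p'\alpha Y_t^+}]<\infty$ and $E[(\int_0^T|Z_s|^2ds)^{p'/2}]<\infty$, and $Y^-$ is bounded. In particular $Z^1(0)$ is the $Z$-component for $\alpha=1$ and zero terminal value. Utility indifference price: for $\alpha>0$, $C_0^\alpha(F)$ is the solution of $$\sup_{\pi\in\mathcal A}E\left[-e^{-\alpha(x+C_0^\alpha(F)+\int_0^T\pi_u^{tr}\sigma_u(dB_u+\theta_udu)-F)}\right]=\sup_{\pi\in\mathcal A'}E\left[-e^{-\alpha(x+\int_0^T\pi_u^{tr}\sigma_u(dB_u+\theta_udu))}\right],$$ where both $\mathcal A$ and $\mathcal A'$ consist of predictable $\mathbb R^d$-valued $\pi$ with $\int_0^T|\sigma_t^{tr}\pi_t|^2dt<\infty$ and $\pi_t\in\mathcal C^c$ a.s.; in $\mathcal A$ (the paper's $\mathcal A_D^{cone}$) one requires that $\{e^{-\alpha(X_\tau^\pi-Y_\tau^\alpha(F))}:\tau\text{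 stopping time}\le T\}$ is uniformly integrable, where $X_t^\pi$ is the wealth, and in $\mathcal A'$ that $X^\pi$ is a martingale under $\mathbb Q^\theta$, $d\mathbb Q^\theta/d\mathbb P=\mathcal E_T(-\int_0^\cdot\theta_t^{tr}dB_t)$. Equivalently, $C_0^\alpha(F)=Y_0^\alpha(F)-Y_0^\alpha(0)$. The solution of the linear BSDE is understood as the one with $C_t^0(F)=E^{\mathbb Q^Z}[F|\mathcal F_t]$, where $d\mathbb Q^Z/d\mathbb P=\mathcal E_T(\int_0^\cdot(Z_t^1(0)-\mathrm{Proj}_{\sigma_t^{tr}\mathcal C^c}(Z_t^1(0)+\theta_t))^{tr}dB_t)$ (a uniformly integrable stochastic exponential). *)

(* Defs.v *)
From HB Require Import structures.
From mathcomp Require Import all_boot all_order all_algebra.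
From mathcomp Require Import all_classical all_reals all_analysis.

Set Implicit Arguments.
Unset Strict Implicit.
Unset Printing Implicit Defensive.

Import Order.TTheory GRing.Theory Num.Theory.
Import numFieldNormedType.Exports.

Local Open Scope classical_set_scope.
Local Open Scope ring_scope.

Section euclidean.
Context {R : realType} {n : nat}.
Implicit Types (u v z : 'cV[R]_n) (K : set 'cV[R]_n).

Definition dotv u v : R := (u^T *m v) 0 0.

(* The norm that the library puts on matrices is the max norm. *)
Definition enorm u : R := Num.sqrt (dotv u u).

Definition dist_set K z : R := inf [set enorm (z - k) | k in K].

Definition proj_set K z : 'cV[R]_n :=
  xget 0 [set k | K k /\ enorm (z - k) = dist_set K z].

Definition closed_convex_cone K : Prop :=
  [/\ closed K, @convex_set R 'cV[R]_n K &
      forall a u, 0 < a -> K u -> K (a *: u)].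

End euclidean.

(* Processes are functions of a time in R and an outcome; only the times in
   `[0, T] matter. *)

Section stochastic_calculus.
Context {disp : measure_display} {Omega : measurableType disp} {R : realType}.
Variables (P : probability Omega R) (T : R).
Context {m : nat}.
Variable B : R -> Omega -> 'cV[R]_m.

Local Notation leb := (@lebesgue_measure R).
Local Notation measurableR := (@measurable _ (measurableTypeR R)).

Definition sets_of_past (t : R) : set (set Omega) :=
  [set A | exists s i U, [/\ 0 <= s <= t, measurableR U &
                             A = [set w | U (B s w i 0)]]].

(* A and the increment B t - B s are independent, the increment being centred
   Gaussian with covariance matrix (t - s) I; the second parameter of
   normal_prob is the standard deviation. *)
Definition brownian_motion : Prop :=
  [/\ forall t i, 0 <= t <= T ->
        measurable_fun setT (fun w => B t w i 0 : measurableTypeR R),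
      {ae P, forall w, B 0 w = 0},
      {ae P, forall w, forall i,
         {within `[0, T], continuous (fun t => B t w i 0)}} &
      forall s t (A : set Omega) (U : 'I_m -> set R),
        0 <= s -> s < t -> t <= T ->
        <<s sets_of_past s >> A -> (forall i, measurableR (U i)) ->
        P (A `&` [set w | forall i, U i (B t w i 0 - B s w i 0)]) =
        (P A * \prod_i normal_prob 0 (Num.sqrt (t - s)) (U i))%E].

Definition filtration (t : R) : set (set Omega) :=
  <<s sets_of_past t `|` [set N | P.-negligible N] >>.

Definition measurable_at (t : R) (X : Omega -> R) : Prop :=
  forall U, measurableR U -> filtration t (X @^-1` U).

Definition predictable_sets : set (set (R * Omega)) :=
  <<s `[0, T] `*` setT,
      [set [set 0] `*` A | A in filtration 0] `|`
      [set D | exists s t A, [/\ 0 <= s, s <= t, t <= T, filtration s A &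
                                 D = `]s, t] `*` A]] >>.

Definition predictable (X : R -> Omega -> R) : Prop :=
  forall U, measurableR U ->
    predictable_sets ((`[0, T] `*` setT) `&` [set q | U (X q.1 q.2)]).

Definition predictable_mx {p q} (X : R -> Omega -> 'M[R]_(p, q)) : Prop :=
  forall i j, predictable (fun t w => X t w i j).

Definition bounded_mx {p q} (X : R -> Omega -> 'M[R]_(p, q)) : Prop :=
  exists K, forall t w i j, 0 <= t <= T -> `|X t w i j| <= K.

Definition stopping_time (tau : Omega -> R) : Prop :=
  (forall w, 0 <= tau w <= T) /\
  (forall t, 0 <= t <= T -> filtration t [set w | tau w <= t]).

Definition uniformly_integrable (family : set (Omega -> R)) : Prop :=
  forall e : R, 0 < e -> exists c : R, forall X, family X ->
    (\int[P]_(w in [set w | (c < `|X w|)%R]) `|X w|%:E <= e%:E)%E.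

Definition martingale (Q : probability Omega R) (X : R -> Omega -> R) : Prop :=
  [/\ forall t, 0 <= t <= T -> measurable_at t (X t),
      forall t, 0 <= t <= T -> Q.-integrable setT (EFin \o X t) &
      forall s t A, 0 <= s -> s <= t -> t <= T -> filtration s A ->
        (\int[Q]_(w in A) (X t w)%:E = \int[Q]_(w in A) (X s w)%:E)%E].

(* C is a version of the conditional expectation of F under Q given the
   sigma-algebra at time t. *)
Definition conditional_expectation (Q : probability Omega R) (t : R)
    (F C : Omega -> R) : Prop :=
  [/\ Q.-integrable setT (EFin \o F), Q.-integrable setT (EFin \o C),
      measurable_at t C &
      forall A, filtration t A ->
        (\int[Q]_(w in A) (C w)%:E = \int[Q]_(w in A) (F w)%:E)%E].

(* The events A n have (outer) probability tending to 0; asking for measurable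
   covers avoids evaluating P on sets not known to be measurable. *)
Definition vanishing (A : nat -> set Omega) : Prop :=
  exists N : nat -> set Omega,
    [/\ forall n, measurable (N n), forall n, A n `<=` N n &
        P (N n) @[n --> \oo] --> 0%E].

Record simple_process := SimpleProcess {
  sp_card : nat;
  sp_start : 'I_sp_card -> R;
  sp_end : 'I_sp_card -> R;
  sp_coef : 'I_sp_card -> Omega -> 'cV[R]_m }.

Definition sp_adapted (S : simple_process) : Prop :=
  forall k : 'I_(sp_card S),
    [/\ 0 <= sp_start k, sp_start k <= sp_end k, sp_end k <= T,
        forall i, measurable_at (sp_start k) (fun w => sp_coef k w i 0) &
        exists K, forall w i, `|sp_coef k w i 0| <= K].

Definition sp_value (S : simple_process) (t : R) (w : Omega) : 'cV[R]_m :=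
  \sum_(k < sp_card S)
    (if sp_start k < t <= sp_end k then sp_coef k w else 0).

Definition sp_integral (S : simple_process) (t : R) (w : Omega) : R :=
  \sum_(k < sp_card S)
    dotv (sp_coef k w)
      (B (Num.min (sp_end k) t) w - B (Num.min (sp_start k) t) w).

Definition square_integrable {n} (H : R -> Omega -> 'cV[R]_n) : Prop :=
  {ae P, forall w,
     (\int[leb]_(t in `[0%R, T]) (enorm (H t w) ^+ 2)%:E < +oo)%E}.

(* I is a version of the process t |-> \int_0^t (H s)^T dB s, the Ito integral
   of a predictable H with \int_0^T |H s|^2 ds < +oo a.s.: the limit, uniformly
   on [0, T] in probability, of the integrals of simple processes that tend to
   H in L^2([0, T]) in probability. *)
Definition ito_integral (H : R -> Omega -> 'cV[R]_m) (I : R -> Omega -> R) :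
    Prop :=
  [/\ predictable_mx H, square_integrable H &
      exists S : nat -> simple_process,
        [/\ forall n, sp_adapted (S n),
            forall e : R, 0 < e -> vanishing (fun n => [set w |
              (e%:E < \int[leb]_(t in `[0%R, T])
                        (enorm (sp_value (S n) t w - H t w) ^+ 2)%:E)%E]) &
            forall e : R, 0 < e -> vanishing (fun n => [set w |
              exists2 t, 0 <= t <= T & e < `|sp_integral (S n) t w - I t w|])]].

(* Q has P-density the terminal value of the stochastic exponential of
   \int H^T dB. *)
Definition exponential_measure (H : R -> Omega -> 'cV[R]_m)
    (Q : probability Omega R) : Prop :=
  exists2 I, ito_integral H I &
    forall A, measurable A ->
      Q A = (\int[P]_(w in A) (expR (I T w - 2^-1 *
               \int[leb]_(t in `[0, T]) (enorm (H t w) ^+ 2)))%:E)%E.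

(* Y t = G + \int_t^T g(s, Z s) ds - \int_t^T (Z s)^T dB s *)
Definition bsde (g : R -> Omega -> 'cV[R]_m -> R) (G : Omega -> R)
    (Y : R -> Omega -> R) (Z : R -> Omega -> 'cV[R]_m) : Prop :=
  [/\ predictable Y,
      {ae P, forall w, {within `[0, T], continuous (fun t => Y t w)}} &
      exists2 I, ito_integral Z I &
        {ae P, forall w, forall t, 0 <= t <= T ->
           Y t w = G w + \int[leb]_(s in `[t, T]) g s w (Z s w)
                   - (I T w - I t w)}].

Section market.
Context {d : nat}.
Variables (b : R -> Omega -> 'cV[R]_d) (sigma : R -> Omega -> 'M[R]_(d, m)).
Variable C : set 'cV[R]_d.

Definition theta (t : R) (w : Omega) : 'cV[R]_m :=
  (sigma t w)^T *m invmx (sigma t w *m (sigma t w)^T) *m b t w.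

Definition market_assumptions : Prop :=
  [/\ predictable_mx b /\ bounded_mx b,
      predictable_mx sigma /\ bounded_mx sigma,
      forall t w, 0 <= t <= T -> sigma t w *m (sigma t w)^T \in unitmx &
      bounded_mx theta].

Definition sigmaC (t : R) (w : Omega) : set 'cV[R]_m :=
  [set (sigma t w)^T *m p | p in C].

Definition driver (alpha t : R) (w : Omega) (z : 'cV[R]_m) : R :=
  alpha / 2 * dist_set (sigmaC t w) (z + alpha^-1 *: theta t w) ^+ 2
  - dotv z (theta t w) - (2 * alpha)^-1 * enorm (theta t w) ^+ 2.

(* (Y, Z) is the pair (Y^alpha(G), Z^alpha(G)). *)
Definition utility_bsde (alpha : R) (G : Omega -> R)
    (Y : R -> Omega -> R) (Z : R -> Omega -> 'cV[R]_m) : Prop :=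
  [/\ bsde (driver alpha) G Y Z,
      forall p : R, 1 <= p ->
        (\int[P]_w ereal_sup
           [set (expR (p * alpha * Num.max (Y t w) 0))%:E | t in `[0%R, T]]
         < +oo)%E,
      forall p : R, 1 <= p ->
        (\int[P]_w poweR (\int[leb]_(t in `[0%R, T]) (enorm (Z t w) ^+ 2)%:E)
                         (p / 2)%R
         < +oo)%E &
      exists c : R, {ae P, forall w, forall t, 0 <= t <= T ->
                       Num.max (- Y t w) 0 <= c}].

(* X is the wealth process, with initial capital x, of the strategy pi, which
   takes its values in C. *)
Definition constrained_wealth (x : R) (pi : R -> Omega -> 'cV[R]_d)
    (X : R -> Omega -> R) : Prop :=
  let H t w := (sigma t w)^T *m pi t w in
  [/\ predictable_mx pi, square_integrable H,
      forall t, 0 <= t <= T -> {ae P, forall w, C (pi t w)} &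
      exists2 I, ito_integral H I &
        {ae P, forall w, forall t, 0 <= t <= T ->
           X t w = x + (I t w + \int[leb]_(u in `[0, t])
                                  dotv (H u w) (theta u w))}].

Definition admissible_D (alpha : R) (Y : R -> Omega -> R) (x : R)
    (pi : R -> Omega -> 'cV[R]_d) (X : R -> Omega -> R) : Prop :=
  constrained_wealth x pi X /\
  uniformly_integrable
    [set (fun w => expR (- alpha * (X (tau w) w - Y (tau w) w)))
      | tau in stopping_time].

Definition admissible_Q (Q : probability Omega R) (x : R)
    (pi : R -> Omega -> 'cV[R]_d) (X : R -> Omega -> R) : Prop :=
  constrained_wealth x pi X /\ martingale Q X.

Definition maximal_utility (alpha : R) (G : Omega -> R)
    (admissible : (R -> Omega -> 'cV[R]_d) -> (R -> Omega -> R) -> Prop) :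
    \bar R :=
  ereal_sup [set u | exists pi X, admissible pi X /\
    u = 'E_P[fun w => (- expR (- alpha * (X T w + G w)))%R]%E].

(* Y is Y^alpha(F), Q is the measure Q^theta and x the initial capital. *)
Definition indifference_price (Q : probability Omega R) (x : R)
    (F : Omega -> R) (alpha : R) (Y : R -> Omega -> R) (c : R) : Prop :=
  maximal_utility alpha (fun w => c - F w) (admissible_D alpha Y x) =
  maximal_utility alpha (fun=> 0) (admissible_Q Q x).

(* The integrand of the stochastic exponential defining Q^Z, for Z = Z^1(0). *)
Definition tilt (Z : R -> Omega -> 'cV[R]_m) (t : R) (w : Omega) : 'cV[R]_m :=
  Z t w - proj_set (sigmaC t w) (Z t w + theta t w).

Definition linear_bsde (Q : probability Omega R)
    (Z : R -> Omega -> 'cV[R]_m) (F : Omega -> R)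
    (C0 : R -> Omega -> R) (H0 : R -> Omega -> 'cV[R]_m) : Prop :=
  bsde (fun t w h => dotv h (tilt Z t w)) F C0 H0 /\
  forall t, 0 <= t <= T -> conditional_expectation Q t F (C0 t).

End market.

Definition same_solution (C0 C0' : R -> Omega -> R)
    (H0 H0' : R -> Omega -> 'cV[R]_m) : Prop :=
  {ae P, forall w, forall t, 0 <= t <= T -> C0 t w = C0' t w} /\
  {ae P, forall w, {ae leb, forall t, 0 <= t <= T -> H0 t w = H0' t w}}.

End stochastic_calculus.

(* Main.v *)
Require Import Defs.
From HB Require Import structures.
From mathcomp Require Import all_boot all_order all_algebra.
From mathcomp Require Import all_classical all_reals all_analysis.
From mathcomp Require Import measurable_realfun.
From mathcomp Require Import ring lra.

Set Implicit Arguments.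
Unset Strict Implicit.
Unset Printing Implicit Defensive.

Import Order.TTheory GRing.Theory Num.Theory.
Import numFieldNormedType.Exports.

Local Open Scope classical_set_scope.
Local Open Scope ring_scope.

(** An Ito integral I whose bracket is bounded satisfies E exp(I_T - <I>_T / 2) = 1;
    by stopping and by adding multiples of a second integral to I, this one identity
    gives the Girsanov theorem, the vanishing of means of stopped integrals and the
    control of brackets.

    Write Q for Q^Z. As C is a cone, the driver is homogeneous in the risk aversion: Y10 / alpha is the
    solution with terminal value 0. It is bounded, which yields a reverse Hoelder
    inequality for the density of Q. Under Q the process
    YF alpha - Y10 / alpha is a martingale minus an increasing process with density
    between 0 and (alpha / 2) |h|^2, where h is the integrand of the martingale, and its
    exponential with factor alpha has nondecreasing mean. The supporting line of exp at
    YF alpha bounds the utility with the claim from above; stopping the optimal strategy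
    without claim bounds the utilities from below. Together, for alpha <= 1,
      E_Q F <= YF alpha 0 - Y10 0 / alpha <= price alpha
            <= (1 / alpha) log E_Q exp(alpha F) <= E_Q F + K alpha.
    For alpha_n tending to 0 fast enough the same estimate makes the gap processes and
    their integrands converge, and the limit solves the linear equation. Two solutions
    have the same first component, so the bracket of their difference vanishes. *)

(** * Limits of expectations *)

(** The analytic core is the reverse Hoelder bound: exponential moments are known under [P], and a
    density with a moment of order [1 + e] carries them to [QZ]. It holds because, under [QZ], [Y10]
    minus half the bracket of the tilt is a martingale; as [Y10] oscillates by at most [2 c], each
    further slice of length [8 c] is reached with at most half of the remaining mass, and the
    bracket has exponential moments. One strategy serves both utilities, the projection of
    [Z10 + theta] divided by [alpha]. The marginal utility of its wealth is proportional to the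
    density of [QZ], and its stopped versions are admissible in both classes. In the martingale
    class only the losses of a strategy can be controlled: first under [Qtheta], then under [P]
    because [theta] is bounded, and from there under [QZ]. The rate [K alpha] compares the gap
    processes in [L^1] only. A maximal inequality turns this into control of the paths, and a lower
    bound on a Laplace transform into control of the brackets; this is what makes the integrands
    converge. *)

Section expectation.
Context {disp : measure_display} {Omega : measurableType disp} {R : realType}.
Variable P : probability Omega R.
Implicit Types X Y Z : Omega -> R.

Definition L1 X : Prop := P.-integrable setT (EFin \o X).
Definition Ex X : R := \int[P]_w X w.

Lemma L1_meas X : L1 X -> measurable_fun setT X.
Proof. by move=> /measurable_int /measurable_EFinP. Qed.

Lemma L1_cst (c : R) : L1 (cst c).
Proof. exact: finite_measure_integrable_cst. Qed.

Lemma Ex_cst (c : R) : Ex (fun=> c) = c.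
Proof. by rewrite /Ex /= -[RHS]mulr1 Rintegral_cst//; congr (_ * _); rewrite /= probability_setT. Qed.

Lemma L1D X Y : L1 X -> L1 Y -> L1 (fun w => X w + Y w).
Proof.
by move=> h1 h2; have := integrableD measurableT h1 h2.
Qed.

Lemma L1N X : L1 X -> L1 (fun w => - X w).
Proof. by move=> h1; have := integrableN h1. Qed.

Lemma L1B X Y : L1 X -> L1 Y -> L1 (fun w => X w - Y w).
Proof. by move=> h1 /L1N; exact: L1D. Qed.

Lemma L1Z (a : R) X : L1 X -> L1 (fun w => a * X w).
Proof. by move=> h1; have := integrableZl measurableT a h1. Qed.

Lemma ExD X Y : L1 X -> L1 Y -> Ex (fun w => X w + Y w) = Ex X + Ex Y.
Proof. exact: RintegralD. Qed.

Lemma ExZ (a : R) X : L1 X -> Ex (fun w => a * X w) = a * Ex X.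
Proof. exact: RintegralZl. Qed.

Lemma ExB X Y : L1 X -> L1 Y -> Ex (fun w => X w - Y w) = Ex X - Ex Y.
Proof. exact: RintegralB. Qed.

Lemma ExN X : L1 X -> Ex (fun w => - X w) = - Ex X.
Proof.
by move=> h; rewrite -mulN1r -ExZ//; congr Ex; apply/funext => w; rewrite mulN1r.
Qed.

Lemma Ex_ge0 X : (forall w, 0 <= X w) -> 0 <= Ex X.
Proof. by move=> h; exact: Rintegral_ge0. Qed.

Lemma EFin_Ex X : L1 X -> (Ex X)%:E = (\int[P]_w (X w)%:E)%E.
Proof. by move=> h; rewrite /Ex /Rintegral fineK//; exact: integrable_fin_num. Qed.

Lemma ae_measurable X Y : measure_is_complete P ->
  measurable_fun setT X -> {ae P, forall w, X w = Y w} -> measurable_fun setT Y.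
Proof.
move=> cP mX [N [mN N0 XY]] _ U mU; rewrite setTI.
rewrite (_ : Y @^-1` U = (X @^-1` U `&` ~` N) `|` (Y @^-1` U `&` N)).
  apply: measurableU; first apply: measurableI.
  - by rewrite -[X in measurable X]setTI; exact: mX.
  - exact: measurableC.
  - by apply: cP; exists N; split=> // w [].
apply/seteqP; split=> w /=.
  move=> Uw; have [Nw|Nw] := pselect (N w); [by right|left; split=> //].
  suff -> : X w = Y w by [].
  by apply: contrapT => h; apply: Nw; exact: XY.
case=> -[] //= Uw Nw; suff <- : X w = Y w by [].
by apply: contrapT => h; apply: Nw; exact: XY.
Qed.

Lemma L1_le X Y : measurable_fun setT X -> {ae P, forall w, `|X w| <= Y w} ->
  L1 Y -> L1 X.
Proof.
move=> mX XY iY; have mY := L1_meas iY.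
apply/integrableP; split; first exact/measurable_EFinP.
apply: (@le_lt_trans _ _ (\int[P]_w `|(Y w)%:E|)%E).
  apply: ae_ge0_le_integral => //.
  - by apply: measurableT_comp => //; exact/measurable_EFinP.
  - by apply: measurableT_comp => //; exact/measurable_EFinP.
  - apply: filterS XY => w h _; rewrite lee_fin (le_trans h)//; exact: ler_norm.
by case/integrableP : iY.
Qed.

Lemma L1_ae X Y : measurable_fun setT Y -> {ae P, forall w, X w = Y w} ->
  L1 X -> L1 Y.
Proof.
move=> mY XY iX; apply: (L1_le (Y := fun w => `|X w|)) => //.
  by apply: filterS XY => w ->.
exact: integrable_norm.
Qed.

Lemma L1_norm X : L1 X -> L1 (fun w => `|X w|).
Proof. exact: integrable_norm. Qed.

Lemma Ex_ae X Y : measurable_fun setT X -> measurable_fun setT Y ->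
  {ae P, forall w, X w = Y w} -> Ex X = Ex Y.
Proof.
move=> mX mY XY; rewrite /Ex /Rintegral; congr fine; apply: ae_eq_integral => //.
- exact/measurable_EFinP.
- exact/measurable_EFinP.
- by apply: filterS XY => w -> _.
Qed.

Lemma Ex_le X Y : L1 X -> L1 Y -> {ae P, forall w, X w <= Y w} -> Ex X <= Ex Y.
Proof.
move=> iX iY XY.
have mX := L1_meas iX; have mY := L1_meas iY.
have mm : measurable_fun setT (fun w => Num.min (X w) (Y w)).
  exact: measurable_minr.
have e : {ae P, forall w, X w = Num.min (X w) (Y w)}.
  by apply: filterS XY => w h; rewrite min_l.
rewrite (Ex_ae mX mm e); apply: le_Rintegral => //.
  exact: L1_ae e iX.
by move=> w _; rewrite ge_min lexx orbT.
Qed.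

Lemma Ex_ae_ge0 X : L1 X -> {ae P, forall w, 0 <= X w} -> 0 <= Ex X.
Proof. by move=> iX h; rewrite -(Ex_cst 0); apply: Ex_le => //; exact: L1_cst. Qed.

Lemma Ex_norm X : L1 X -> `|Ex X| <= Ex (fun w => `|X w|).
Proof. exact: le_normr_Rintegral. Qed.

Lemma L1_bounded X (K : R) : measurable_fun setT X ->
  {ae P, forall w, `|X w| <= K} -> L1 X.
Proof. by move=> mX XK; apply: (L1_le mX XK); exact: L1_cst. Qed.

Lemma Ex_eq0 X : L1 X -> {ae P, forall w, 0 <= X w} -> Ex X = 0 ->
  {ae P, forall w, X w = 0}.
Proof.
move=> iX X0 EX0.
have e : (\int[P]_w `|(X w)%:E| = 0)%E.
  rewrite -[RHS](congr1 EFin EX0) EFin_Ex//; apply/esym; apply: ae_eq_integral => //.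
  - exact: measurable_int iX.
  - by apply: measurableT_comp => //; exact: measurable_int iX.
  - by apply: filterS X0 => w h _; rewrite gee0_abs.
have [+ _] := ae_eq_integral_abs P measurableT (measurable_int _ iX).
by move=> /(_ e); apply: filterS => w /(_ I) [].
Qed.

Lemma L1_Ex_eq X (c : R) : measurable_fun setT X -> (forall w, 0 <= X w) ->
  (\int[P]_w (X w)%:E = c%:E)%E -> L1 X /\ Ex X = c.
Proof.
move=> mX X0 h; split; last by rewrite /Ex /Rintegral h.
apply/integrableP; split; first exact/measurable_EFinP.
under eq_integral => w _ do rewrite gee0_abs ?lee_fin//.
by rewrite h ltry.
Qed.

Lemma Ex_markov X (A : set Omega) (e : R) : 0 < e -> L1 X -> measurable A ->
  {ae P, forall w, 0 <= X w} -> {ae P, forall w, A w -> e <= X w} ->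
  (P A <= (Ex X / e)%:E)%E.
Proof.
move=> e0 iX mA X0 XA.
have -> : P A = (Ex (\1_A))%:E.
  rewrite EFin_Ex ?integral_indic// ?setIT//.
  exact: integrable_indic.
rewrite lee_fin ler_pdivlMr// mulrC -ExZ; last exact: integrable_indic.
apply: Ex_le => //; first by apply: L1Z; exact: integrable_indic.
apply: filterS2 X0 XA => w h1 h2; rewrite indicE.
have [Aw|Aw] := boolP (w \in A); rewrite ?mulr1 ?mulr0//.
by apply: h2; rewrite inE in Aw.
Qed.

Lemma cvgE (u : nat -> R) (l : R) :
  u n @[n --> \oo] --> l -> (u n)%:E @[n --> \oo] --> l%:E.
Proof. by move=> h; apply: cvg_EFin => //; exact: nearW. Qed.

Lemma fatou_Ex (Xn : nat -> Omega -> R) X C :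
  (forall n, L1 (Xn n)) -> measurable_fun setT X ->
  (forall n w, 0 <= Xn n w) ->
  {ae P, forall w, Xn n w @[n --> \oo] --> X w} ->
  (forall n, Ex (Xn n) <= C) -> L1 X /\ Ex X <= C.
Proof.
move=> iXn mX Xn0 cX XC.
have mXn n : measurable_fun setT (EFin \o Xn n).
  exact: measurable_int (iXn n).
have mEX : measurable_fun setT (EFin \o X) by exact/measurable_EFinP.
have X0 : {ae P, forall w, 0 <= X w}.
  apply: filterS cX => w h; rewrite -(cvg_lim _ h)//; apply: limr_ge.
    by apply/cvg_ex; exists (X w).
  by apply: nearW => n.
have le : (\int[P]_w `|(X w)%:E| <= C%:E)%E.
  have := fatou P measurableT mXn (fun n w _ => Xn0 n w).
  move=> F.
  apply: (@le_trans _ _ (\int[P]_w limn_einf (fun n => (EFin \o Xn n) w))%E).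
    rewrite le_eqVlt; apply/orP; left; apply/eqP; apply: ae_eq_integral => //.
    - exact: measurableT_comp.
    - under eq_fun => w do rewrite -[limn_einf _]oppeK -limn_esupN.
      by apply: measurableT_comp => //; apply: measurable_fun_limn_esup => n; exact: measurableT_comp.
    apply: filterS2 X0 cX => w h1 h2 _; rewrite gee0_abs//.
    apply/esym; rewrite is_cvg_limn_einfE.
      by apply/cvg_lim => //; exact: cvgE h2.
    by apply/cvg_ex; exists (X w)%:E; exact: cvgE h2.
  apply: (le_trans F); rewrite limn_einf_lim.
  apply: lime_le; first exact: is_cvg_einfs.
  apply: nearW => n; apply: (@le_trans _ _ (\int[P]_w (EFin \o Xn n) w)%E).
    by apply: ereal_inf_lbound; exists n => /=.
  by rewrite -EFin_Ex// lee_fin.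
have iX : L1 X.
  by apply/integrableP; split=> //; apply: (le_lt_trans le); exact: ltry.
split=> //; rewrite -lee_fin EFin_Ex//; apply: le_trans le.
by apply: le_integral => // [|w _]; [exact: integrable_abse|exact: lee_abs].
Qed.

Lemma bounded_cvg_Ex (Xn : nat -> Omega -> R) M :
  (forall n, measurable_fun setT (Xn n)) -> (forall n w, 0 <= Xn n w <= M) ->
  {ae P, forall w, Xn n w @[n --> \oo] --> 0} ->
  Ex (Xn n) @[n --> \oo] --> 0.
Proof.
move=> mX XM c0.
have bd w : forall n, setT w -> (`|(EFin \o Xn n) w| <= M%:E)%E.
  by move=> n _; rewrite lee_fin ger0_norm; have /andP[] := XM n w.
have [_ _] := @dominated_convergence _ _ _ P setT measurableT
  (fun n => EFin \o Xn n) (cst 0%E) (cst M%:E)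
  (fun n => (measurable_EFinP _ _).2 (mX n)) (measurable_cst _)
  (filterS (fun w h _ => cvgE h) c0) (L1_cst M)
  (aeW _ bd).
rewrite integral0 => h.
by have /fine_cvgP[] := h.
Qed.

(* The bound with [K + d * Z n] is de la Vallee-Poussin's form of uniform
   integrability. *)
Lemma vitali (Xn Z : nat -> Omega -> R) X C :
  (forall n, measurable_fun setT (Xn n)) -> measurable_fun setT X ->
  {ae P, forall w, Xn n w @[n --> \oo] --> X w} ->
  (forall n, L1 (Z n)) -> (forall n w, 0 <= Z n w) -> (forall n, Ex (Z n) <= C) ->
  (forall d : R, 0 < d -> exists K : R, forall n, {ae P, forall w, `|Xn n w| <= K + d * Z n w}) ->
  [/\ L1 X, forall n, L1 (Xn n) &
      Ex (fun w => `|Xn n w - X w|) @[n --> \oo] --> 0].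
Proof.
move=> mXn mX cX iZ Z0 ZC UI.
have iXn n : L1 (Xn n).
  have [K hK] := UI 1 ltr01.
  apply: (L1_le (mXn n) (hK n)); apply: L1D; first exact: L1_cst.
  exact: L1Z.
have C0 : 0 <= C by apply: le_trans (ZC 0%N); exact: Ex_ge0.
have tail (d : R) : 0 < d -> exists2 M, 0 <= M &
    (forall n, L1 (fun w => Num.max (`|Xn n w| - M) 0) /\ Ex (fun w => Num.max (`|Xn n w| - M) 0) <= d) /\
    (L1 (fun w => Num.max (`|X w| - M) 0) /\
     Ex (fun w => Num.max (`|X w| - M) 0) <= d).
  move=> d0.
  have [K hK] := UI (d / (C + 1)) (divr_gt0 d0 (ltr_wpDl C0 ltr01)).
  exists (Num.max K 0); first by rewrite le_max lexx orbT.
  have iT n : L1 (fun w => Num.max (`|Xn n w| - Num.max K 0) 0).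
    apply: (L1_le (Y := fun w => `|Xn n w|)).
    - apply: measurable_maxr => //; apply: measurable_funB => //.
      exact: measurableT_comp.
    - apply: aeW => w; rewrite ger0_norm ?le_max ?lexx ?orbT//.
      by rewrite ge_max normr_ge0 andbT lerBlDr lerDl le_max lexx orbT.
    - exact: L1_norm.
  have bT n : Ex (fun w => Num.max (`|Xn n w| - Num.max K 0) 0) <= d.
    apply: (@le_trans _ _ (Ex (fun w => d / (C + 1) * Z n w))).
      apply: Ex_le => //; first exact: L1Z.
      apply: filterS (hK n) => w h; rewrite ge_max mulr_ge0 ?Z0 ?andbT//.
        rewrite lerBlDr; apply: (le_trans h); rewrite addrC lerD2l.
        by rewrite le_max lexx.
      by rewrite divr_ge0 ?ltW// ltr_wpDl.
    rewrite ExZ// -mulrA; apply: ler_piMr; rewrite ?(ltW d0)// mulrC ler_pdivrMr ?mul1r; last exact: ltr_wpDl.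
    by rewrite (le_trans (ZC n))// lerDl.
  split=> //; apply: (fatou_Ex iT _ _ _ bT).
  - apply: measurable_maxr => //; apply: measurable_funB => //.
    exact: measurableT_comp.
  - by move=> n w; rewrite le_max lexx orbT.
  - apply: filterS cX => w h; apply: (@continuous_cvg _ _ _ _ _ _ (fun y : R => Num.max (`|y| - Num.max K 0) 0)) => //.
    apply: continuous_max => /=; last exact: cvg_cst.
    by apply: cvgB; [exact: norm_continuous|exact: cvg_cst].
have [M M0 [_ [iXM _]]] := tail 1 ltr01.
have iX : L1 X.
  apply: (L1_le (Y := fun w => M + Num.max (`|X w| - M) 0)) => //.
    by apply: aeW => w; rewrite -lerBlDl le_max lexx.
  by apply: L1D => //; exact: L1_cst.
split=> //; apply/cvgrPdist_le => e e0.
have {iXM M M0} [M M0 [bXn [iXM bX]]] := tail (e / 3) (divr_gt0 e0 (ltr0n _ 3)).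
have iT n := (bXn n).1.
have mT n : measurable_fun setT (fun w => Num.min `|Xn n w - X w| (2 * M)).
  apply: measurable_minr => //; apply: measurableT_comp => //.
  exact: measurable_funB.
have bT n w : 0 <= Num.min `|Xn n w - X w| (2 * M) <= 2 * M.
  by rewrite le_min normr_ge0 mulr_ge0//= ge_min lexx orbT.
have := @bounded_cvg_Ex _ _ mT bT.
have cT : {ae P, forall w, Num.min `|Xn n w - X w| (2 * M) @[n --> \oo] --> 0}.
  apply: filterS cX => w h.
  apply: (@squeeze_cvgr _ _ _ _ (cst 0) (fun n => `|Xn n w - X w|)).
  - by apply: nearW => n; rewrite le_min normr_ge0 mulr_ge0//= ge_min lexx.
  - exact: cvg_cst.
  - by apply/norm_cvg0P; apply/subr_cvg0.
move=> /(_ cT) /cvgrPdist_le /(_ (e / 3) (divr_gt0 e0 (ltr0n _ 3))).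
apply: filterS => n; rewrite !sub0r !normrN ger0_norm; last first.
  by apply: Ex_ge0 => w; have /andP[] := bT n w.
move=> h; rewrite ger0_norm; last exact: Ex_ge0.
have i1 : L1 (fun w => Num.min `|Xn n w - X w| (2 * M)).
  apply: (L1_bounded (K := 2 * M)) => //; apply: aeW => w.
  by have /andP[b1 b2] := bT n w; rewrite ger0_norm.
apply: (@le_trans _ _ (Ex (fun w => Num.min `|Xn n w - X w| (2 * M) +
   (Num.max (`|Xn n w| - M) 0 + Num.max (`|X w| - M) 0)))).
  apply: Ex_le.
  - by apply: L1_norm; exact: L1B.
  - by apply: L1D => //; exact: L1D.
  apply: aeW => w; have := ler_normB (Xn n w) (X w).
  have := normr_ge0 (Xn n w - X w).
  move: `|Xn n w - X w| `|Xn n w| `|X w| => a b1 b2 a0 ab.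
  rewrite /Num.min /Num.max; case: ifPn; rewrite -?leNgt => ?;
  case: ifPn; rewrite -?leNgt => ?; case: ifPn; rewrite -?leNgt => ?; lra.
rewrite !ExD//; last exact: L1D.
by have := (bXn n).2; lra.
Qed.

Lemma cvg_Ex (Xn : nat -> Omega -> R) X :
  L1 X -> (forall n, L1 (Xn n)) ->
  Ex (fun w => `|Xn n w - X w|) @[n --> \oo] --> 0 ->
  Ex (Xn n) @[n --> \oo] --> Ex X.
Proof.
move=> iX iXn h; apply/cvgrPdist_le => e e0.
move/cvgrPdist_le : h => /(_ e e0); apply: filterS => n.
rewrite sub0r normrN ger0_norm; last exact: Ex_ge0.
apply: le_trans; rewrite distrC -ExB//; apply: Ex_norm; exact: L1B.
Qed.

Lemma borel_cantelli_ae (A : nat -> set Omega) : (forall n, measurable (A n)) ->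
  (forall n, P (A n) <= ((2^-1 : R) ^+ n)%:E)%E ->
  {ae P, forall w, \forall n \near \oo, ~ A n w}.
Proof.
move=> mA hA; exists (lim_sup_set A); split.
- apply: bigcapT_measurable => n; apply: bigcup_measurable => k _; exact: mA.
- apply: lim_sup_set_cvg0 => //.
  apply: (@le_lt_trans _ _ (\sum_(n <oo) ((2^-1 : R) ^+ n)%:E)%E).
    by apply: lee_nneseries => n _ //; exact: hA.
  rewrite (_ : (\sum_(n <oo) _)%E = (2 / 2 ^+ 0)%:E :> \bar R) ?ltry//.
  apply/cvg_lim => //; have h := @cvg_geometric_eseries_half R 2 0.
  rewrite (_ : (fun n => _) = eseries (fun k => (2 / (2 ^ (k + 1))%:R)%:E))//.
  apply/funext => n; apply: eq_bigr => k _; congr EFin.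
  by rewrite addn1 natrX exprS invfM mulrA divff ?pnatr_eq0// mul1r exprVn.
move=> w /= h n _; apply: contrapT => h'; apply: h; exists n => // k /= nk Ak.
by apply: h'; exists k.
Qed.

End expectation.

(** * Euclidean inner product *)

Section dotv.
Context {R : realType} {n : nat}.
Implicit Types u v w : 'cV[R]_n.

Lemma dotvE u v : dotv u v = \sum_i u i 0 * v i 0.
Proof. by rewrite /dotv mxE; apply: eq_bigr => i _; rewrite mxE. Qed.

Lemma dotvC u v : dotv u v = dotv v u.
Proof. by rewrite !dotvE; apply: eq_bigr => i _; rewrite mulrC. Qed.

Lemma dotvDl u v w : dotv (u + v) w = dotv u w + dotv v w.
Proof. by rewrite !dotvE -big_split; apply: eq_bigr => i _; rewrite mxE mulrDl. Qed.

Lemma dotvDr u v w : dotv w (u + v) = dotv w u + dotv w v.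
Proof. by rewrite dotvC dotvDl !(dotvC w). Qed.

Lemma dotvZl a u v : dotv (a *: u) v = a * dotv u v.
Proof. by rewrite !dotvE mulr_sumr; apply: eq_bigr => i _; rewrite mxE mulrA. Qed.

Lemma dotvZr a u v : dotv u (a *: v) = a * dotv u v.
Proof. by rewrite dotvC dotvZl dotvC. Qed.

Lemma dotvNl u v : dotv (- u) v = - dotv u v.
Proof. by rewrite -scaleN1r dotvZl mulN1r. Qed.

Lemma dotvNr u v : dotv u (- v) = - dotv u v.
Proof. by rewrite dotvC dotvNl dotvC. Qed.

Lemma dotvBl u v w : dotv (u - v) w = dotv u w - dotv v w.
Proof. by rewrite dotvDl dotvNl. Qed.

Lemma dotvBr u v w : dotv w (u - v) = dotv w u - dotv w v.
Proof. by rewrite dotvDr dotvNr. Qed.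

Lemma dotv0l u : dotv 0 u = 0.
Proof. by rewrite dotvE big1// => i _; rewrite mxE mul0r. Qed.

Lemma dotv0r u : dotv u 0 = 0.
Proof. by rewrite dotvC dotv0l. Qed.

Lemma dotv_ge0 u : 0 <= dotv u u.
Proof. by rewrite dotvE sumr_ge0// => i _; rewrite -expr2 sqr_ge0. Qed.

Lemma dotv_coord u i : u i 0 ^+ 2 <= dotv u u.
Proof.
rewrite dotvE (bigD1 i)//= -expr2 lerDl sumr_ge0// => j _.
by rewrite -expr2 sqr_ge0.
Qed.

Lemma dotv_eq0 u : dotv u u = 0 -> u = 0.
Proof.
move=> h; apply/matrixP => i j; rewrite ord1 mxE.
by apply/eqP; rewrite -sqrf_eq0 eq_le sqr_ge0 -h dotv_coord.
Qed.

Lemma enormK u : enorm u ^+ 2 = dotv u u.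
Proof. by rewrite sqr_sqrtr ?dotv_ge0. Qed.

Lemma enorm_ge0 u : 0 <= enorm u.
Proof. exact: sqrtr_ge0. Qed.

Lemma dotv_young (e : R) u v : 0 < e ->
  2 * `|dotv u v| <= e * dotv u u + e^-1 * dotv v v.
Proof.
move=> e0; have e1 : e * e^-1 = 1 by rewrite divff ?gt_eqF.
have h1 := dotv_ge0 (e *: u - v); have h2 := dotv_ge0 (e *: u + v).
rewrite !(dotvBl, dotvBr, dotvZl, dotvZr) in h1.
rewrite !(dotvDl, dotvDr, dotvZl, dotvZr) in h2.
rewrite !(dotvC v u) in h1 h2.
have ei : 0 < e^-1 by rewrite invr_gt0.
suff : e * (2 * `|dotv u v|) <= e * (e * dotv u u + e^-1 * dotv v v) by rewrite ler_pM2l.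
rewrite mulrDr !mulrA e1 mul1r.
move: h1 h2; move: (dotv u v) (dotv u u) (dotv v v) => p q r h1 h2.
by case: (lerP 0 p) => hp; rewrite ?(ger0_norm hp) ?(ltr0_norm hp); lra.
Qed.

Lemma dotv_addsq u v : dotv (u + v) (u + v) <= 2 * dotv u u + 2 * dotv v v.
Proof.
have := dotv_ge0 (u - v); rewrite !(dotvBl, dotvBr, dotvDl, dotvDr) (dotvC v u).
by lra.
Qed.

End dotv.

(** * Transfer of integrals and Gaussian moments *)

Section transfer.
Context {d1 d2 : measure_display} {X : measurableType d1} {Z : measurableType d2}.
Context {R : realType}.
Import HBNNSimple.

(** One statement covers a density ([Y] the identity), the law of a random variable, and
    independence ([W] a factor independent of [Y], with mean [c]). Each case supplies the identity
    for indicators; simple functions and monotone convergence do the rest. *)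
Lemma integral_transfer (mu : {measure set X -> \bar R}) (nu : {measure set Z -> \bar R})
    (Y : X -> Z) (W : X -> R) (c : R) :
  measurable_fun setT Y -> measurable_fun setT W -> (forall x, 0 <= W x) -> 0 <= c ->
  (forall U, measurable U -> (\int[mu]_x (\1_U (Y x) * W x)%:E = c%:E * nu U)%E) ->
  forall g : Z -> R, measurable_fun setT g -> (forall z, 0 <= g z) ->
  (\int[mu]_x (g (Y x) * W x)%:E = c%:E * \int[nu]_z (g z)%:E)%E.
Proof.
move=> mY mW W0 c0 H g mg g0.
have mEg : measurable_fun setT (EFin \o g) by exact/measurable_EFinP.
pose h := nnsfun_approx measurableT mEg.
have g0' x : setT x -> (0 <= (EFin \o g) x)%E by move=> _; rewrite lee_fin.
have hc z : (EFin \o h^~ z) n @[n --> \oo] --> (g z)%:E.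
  exact: (cvg_nnsfun_approx measurableT mEg g0').
have mh n : measurable_fun setT (h n) by exact: measurable_funP.
have sf n : (\int[mu]_x (h n (Y x) * W x)%:E = c%:E * \int[nu]_z (h n z)%:E)%E.
  have mi r : measurable (h n @^-1` [set r]).
    by rewrite -[X in measurable X]setTI; exact: mh.
  transitivity (\int[mu]_x (\sum_(y \in range (h n))
      (y * (\1_(h n @^-1` [set y]) (Y x) * W x))%:E))%E.
    apply: eq_integral => x _; rewrite fsumEFin// [in LHS]fimfunE; congr EFin.
    rewrite mulrC mulr_fsumr; apply: eq_fsbigr => y _; ring.
  rewrite ge0_integral_fsum//; last 2 first.
    - move=> y; apply/measurable_EFinP; apply: measurable_funM => //.
      by apply: measurable_funM => //; apply: measurableT_comp.
    - move=> y x _; rewrite lee_fin.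
      (* A negative [y] is never a value of [h n], so its indicator vanishes. *)
      have [yr|/eqP] := pselect (0 <= y); first by rewrite !mulr_ge0.
      move=> /eqP yr; rewrite indicE [_ \in _]memNset ?mul0r ?mulr0//= => e.
      by apply: yr; rewrite -e; exact: fun_ge0.
  under [X in (_ = _ * X)%E]eq_integral do rewrite fimfunE -fsumEFin//.
  rewrite ge0_integral_fsum//; last 2 first.
    - by move=> y; apply/measurable_EFinP; apply: measurable_funM => //.
    - by move=> y x _; exact: nnfun_muleindic_ge0.
  rewrite ge0_mule_fsumr; last first.
    by move=> y; apply: integral_ge0 => x _; exact: nnfun_muleindic_ge0.
  apply: eq_fsbigr => y; rewrite inE => -[z _ zy].
  have y0 : 0 <= y by rewrite -zy.
  under eq_integral do rewrite EFinM.
  rewrite ge0_integralZl_EFin//; last 2 first.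
    - by move=> x _; rewrite lee_fin mulr_ge0.
    - apply/measurable_EFinP; apply: measurable_funM => //.
      by apply: measurableT_comp.
  under [X in (_ = _ * X)%E]eq_integral do rewrite EFinM.
  rewrite ge0_integralZl_EFin//; last exact/measurable_EFinP.
  by rewrite H// integral_indic// setIT muleCA.
transitivity (limn (fun n => \int[mu]_x (h n (Y x) * W x)%:E))%E.
  under eq_integral => x _.
    rewrite (_ : _%:E = limn (fun n => (h n (Y x) * W x)%:E)); last first.
      apply/esym/cvg_lim => //; rewrite EFinM.
      under eq_fun do rewrite EFinM.
      by apply: cvgeZr => //; exact: hc.
    over.
  apply: monotone_convergence => //.
  - move=> n; apply/measurable_EFinP; apply: measurable_funM => //.
    exact: measurableT_comp.
  - by move=> n x _; rewrite lee_fin mulr_ge0.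
  - move=> x _ a b ab; rewrite lee_fin ler_wpM2r//.
    exact/lefP/nd_nnsfun_approx.
under eq_fun do rewrite sf.
have -> : (\int[nu]_z (g z)%:E = limn (fun n => \int[nu]_z (h n z)%:E))%E.
  under eq_integral => x _.
    rewrite (_ : _%:E = limn (fun n => (h n x)%:E)); last first.
      by apply/esym/cvg_lim => //; exact: hc.
    over.
  apply: monotone_convergence => //.
  - by move=> n; apply/measurable_EFinP.
  - by move=> n x _; rewrite lee_fin.
  - by move=> x _ a b ab; rewrite lee_fin; exact/lefP/nd_nnsfun_approx.
apply/cvg_lim => //; apply: cvgeZl => //; apply: ereal_nondecreasing_is_cvgn => a b ab.
apply: ge0_le_integral => //.
- by move=> z _; rewrite lee_fin.
- exact/measurable_EFinP.
- exact/measurable_EFinP.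
- by move=> z _; rewrite lee_fin; exact/lefP/nd_nnsfun_approx.
Qed.

End transfer.

Section gaussian.
Context {R : realType}.

Lemma integral_normal_prob (s : R) (g : R -> R) :
  measurable_fun setT g -> (forall x, 0 <= g x) ->
  (\int[normal_prob 0 s]_x (g x)%:E = \int[lebesgue_measure]_x (g x * normal_pdf 0 s x)%:E)%E.
Proof.
move=> mg g0.
rewrite (@integral_transfer _ _ (measurableTypeR R) (measurableTypeR R) R lebesgue_measure (normal_prob 0 s) id (normal_pdf 0 s) 1)//.
- by rewrite mul1e.
- exact: measurable_normal_pdf.
- by move=> x; exact: normal_pdf_ge0.
move=> U mU; rewrite mul1e /normal_prob [RHS]integral_mkcond; apply: eq_integral => x _.
rewrite patchE indicE; case: ifPn => xU; rewrite ?mul1r ?mul0r//.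
Qed.

Lemma normal_mgf (s c : R) : 0 < s ->
  (\int[normal_prob 0 s]_x (expR (c * x))%:E = (expR (c ^+ 2 * s ^+ 2 / 2))%:E)%E.
Proof.
move=> s0; have sN0 : s != 0 by rewrite gt_eqF.
have mc : measurable_fun setT (fun x : R => expR (c * x)).
  by apply: measurableT_comp => //; exact: measurable_funM.
rewrite integral_normal_prob//.
(* Completing the square: the factor [expR (c * x)] moves the mean of the normal density from 0 to
   [c * s ^+ 2]. *)
transitivity (\int[lebesgue_measure]_x ((expR (c ^+ 2 * s ^+ 2 / 2))%:E * (normal_pdf (c * s ^+ 2) s x)%:E))%E.
  apply: eq_integral => x _; rewrite -EFinM; congr EFin.
  rewrite !normal_pdfE// mulrCA [RHS]mulrCA; congr (_ * _).
  rewrite /normal_fun -!expRD; congr expR; field; lra.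
rewrite ge0_integralZl_EFin//.
- by rewrite integral_normal_pdf mule1.
- by move=> x _; rewrite lee_fin normal_pdf_ge0.
- by apply/measurable_EFinP; exact: measurable_normal_pdf.
Qed.

End gaussian.

Lemma cvg_sumr {R : realType} {I} (r : seq I) (f : I -> nat -> R) (l : I -> R) :
  (forall i, f i n @[n --> \oo] --> l i) ->
  \sum_(i <- r) f i n @[n --> \oo] --> \sum_(i <- r) l i.
Proof.
move=> h; elim: r => [|i r ih].
  by under eq_fun do rewrite big_nil; rewrite big_nil; exact: cvg_cst.
by under eq_fun do rewrite big_cons; rewrite big_cons; exact: cvgD.
Qed.

(** Provides the domination that [vitali] asks for when the squares have bounded means. *)
Lemma ler_invD_sq {R : realFieldType} (d a : R) : 0 < d -> a <= d^-1 + d * a ^+ 2.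
Proof.
move=> d0; have h := sqr_ge0 (d * a - 1); have d1 : d * d^-1 = 1 by rewrite divff ?gt_eqF.
rewrite -(ler_pM2l d0) mulrDr d1.
by case: (lerP 0 (d * a)) => _; nra.
Qed.

(** * Square integrable paths *)

Section path.
Context {R : realType}.
Variable T : R.
Hypothesis T0 : 0 <= T.
Local Notation leb := (@lebesgue_measure R).

Definition path_integrable (f : R -> R) : Prop := leb.-integrable `[0, T] (EFin \o f).
Local Notation itg := path_integrable.

Definition rint (f : R -> R) (t : R) : R := \int[leb]_(s in `[0, t]) f s.

Let mDT : measurable (`[0, T]%classic : set (measurableTypeR R)).
Proof. exact: measurable_itv. Qed.

Lemma path_integrableS f a b (b0 b1 : bool) : 0 <= a -> b <= T -> itg f ->
  leb.-integrable [set` Interval (BSide b0 a) (BSide b1 b)] (EFin \o f).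
Proof.
move=> a0 bT; apply: integrableS => //.
by apply: subset_itv; [case: b0|case: b1]; rewrite bnd_simp// ltW.
Qed.

Let itgt f t : 0 <= t <= T -> itg f -> leb.-integrable `[0, t] (EFin \o f).
Proof. by move=> /andP[_ tT]; exact: path_integrableS. Qed.

Lemma path_integrableD f g : itg f -> itg g -> itg (fun s => f s + g s).
Proof. by move=> h1 h2; have := integrableD mDT h1 h2. Qed.

Lemma path_integrableZ a f : itg f -> itg (fun s => a * f s).
Proof. by move=> h; have := integrableZl mDT a h. Qed.

Lemma path_integrableN f : itg f -> itg (fun s => - f s).
Proof. by move=> h; have := integrableN h. Qed.

Lemma path_integrableB f g : itg f -> itg g -> itg (fun s => f s - g s).
Proof. by move=> h1 h2; apply: path_integrableD => //; exact: path_integrableN. Qed.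

Lemma path_integrable_le (f g : R -> R) : measurable_fun `[0, T] f ->
  (forall s, 0 <= s <= T -> `|f s| <= g s) -> itg g -> itg f.
Proof.
move=> mf fg; apply: le_integrable => //; first exact/measurable_EFinP.
move=> s; rewrite /= in_itv/= => hs; rewrite lee_fin.
by rewrite (le_trans (fg _ hs))// ler_norm.
Qed.

Lemma path_integrable_cst c : itg (fun=> c).
Proof.
apply: measurable_bounded_integrable => //.
- by rewrite /= lebesgue_measure_itv/=; case: ifP => // _; rewrite -EFinB ltry.
- by exists `|c|; split=> // M cM x _ /=; rewrite ltW.
Qed.

Lemma path_integrable_ext (f g : R -> R) : (forall s, 0 <= s <= T -> f s = g s) -> itg f -> itg g.
Proof.
move=> fg; apply: eq_integrable => // s; rewrite inE /= in_itv/= => hs.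
by rewrite fg.
Qed.

Lemma rintD f g t : 0 <= t <= T -> itg f -> itg g ->
  rint (fun s => f s + g s) t = rint f t + rint g t.
Proof. by move=> tT h1 h2; apply: RintegralD => //; exact: itgt. Qed.

Lemma rintZ a f t : 0 <= t <= T -> itg f -> rint (fun s => a * f s) t = a * rint f t.
Proof. by move=> tT h1; apply: RintegralZl => //; exact: itgt. Qed.

Lemma rintB f g t : 0 <= t <= T -> itg f -> itg g ->
  rint (fun s => f s - g s) t = rint f t - rint g t.
Proof. by move=> tT h1 h2; apply: RintegralB => //; exact: itgt. Qed.

Lemma rint_ext f g t : t <= T -> (forall s, 0 <= s <= T -> f s = g s) -> rint f t = rint g t.
Proof.
move=> tT fg; apply: eq_Rintegral => s; rewrite inE /= in_itv/= => /andP[s0 st].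
by apply: fg; rewrite s0 (le_trans st).
Qed.

Lemma rint_ge0 f t : t <= T -> (forall s, 0 <= s <= T -> 0 <= f s) -> 0 <= rint f t.
Proof.
move=> tT f0; apply: Rintegral_ge0 => s; rewrite /= in_itv/= => /andP[s0 st].
by apply: f0; rewrite s0 (le_trans st).
Qed.

Lemma rint_le f g t : 0 <= t <= T -> itg f -> itg g ->
  (forall s, 0 <= s <= T -> f s <= g s) -> rint f t <= rint g t.
Proof.
move=> tT h1 h2 fg; rewrite -subr_ge0 -rintB//; apply: rint_ge0; first by case/andP: tT.
by move=> s hs; rewrite subr_ge0 fg.
Qed.

Lemma rint0 f : rint f 0 = 0.
Proof. by rewrite /rint set_itv1 Rintegral_set1. Qed.

Lemma rint_cst c t : 0 <= t -> rint (fun=> c) t = c * t.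
Proof.
rewrite le_eqVlt => /predU1P[<-|t0]; first by rewrite rint0 mulr0.
rewrite /rint Rintegral_cst//; congr (_ * _).
by rewrite /= lebesgue_measure_itv/= lte_fin t0 -EFinB subr0.
Qed.

Lemma rint_incr f s t : 0 <= s -> s <= t -> t <= T -> itg f ->
  rint f t - rint f s = \int[leb]_(r in `]s, t]) f r.
Proof.
move=> s0 st tT h; apply: Rintegral_itvB; rewrite ?bnd_simp//.
exact: path_integrableS.
Qed.

Lemma rint_incr_cc f s t : 0 <= s -> s <= t -> t <= T -> itg f ->
  rint f t - rint f s = \int[leb]_(r in `[s, t]) f r.
Proof.
move=> s0 st tT h; rewrite rint_incr// Rintegral_itv_obnd_cbnd//.
exact: path_integrableS.
Qed.

Lemma rint_nd f s t : 0 <= s -> s <= t -> t <= T -> itg f ->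
  (forall r, 0 <= r <= T -> 0 <= f r) -> rint f s <= rint f t.
Proof.
move=> s0 st tT h f0; rewrite -subr_ge0 rint_incr//.
apply: Rintegral_ge0 => r; rewrite /= in_itv/= => /andP[sr rt].
by apply: f0; rewrite (le_trans s0 (ltW sr)) (le_trans rt).
Qed.

Lemma rint_continuous f : itg f -> {within `[0, T], continuous (rint f)}.
Proof. by move=> h; have := parameterized_integral_continuous T0 h. Qed.

Lemma rint_abs f t : 0 <= t <= T -> itg f -> `|rint f t| <= rint (fun s => `|f s|) T.
Proof.
move=> /andP[t0 tT] h; have h' : itg (fun s => `|f s|) by exact: integrable_norm.
apply: (@le_trans _ _ (rint (fun s => `|f s|) t)).
  by apply: le_normr_Rintegral => //; apply: itgt => //; rewrite t0.
exact: rint_nd.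
Qed.

(** The integrand of an integral stopped at [u]: it vanishes after [u], while the integral itself is
    frozen. *)
Definition stopped {V : zmodType} (u : R) (f : R -> V) (s : R) : V := if s <= u then f s else 0.

Lemma measurable_stopped u (f : R -> R) : measurable_fun `[0, T] f -> measurable_fun `[0, T] (stopped u f).
Proof.
move=> mf; rewrite (_ : stopped u f = fun s => \1_`]-oo, u] s * f s).
  apply: measurable_funM => //; exact: measurable_indic.
apply/funext => s; rewrite /stopped indicE; case: ifPn => su.
  by rewrite mem_set ?mul1r//= in_itv.
by rewrite memNset ?mul0r//= in_itv/=; exact/negP.
Qed.

Lemma path_integrable_stopped u (f : R -> R) : itg f -> itg (stopped u f).
Proof.
move=> h; apply: (@path_integrable_le _ (fun s => `|f s|)).
- by apply: measurable_stopped; have /measurable_EFinP := measurable_int _ h.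
- by move=> s _; rewrite /stopped; case: ifP; rewrite ?normr0.
- exact: integrable_norm.
Qed.

Lemma rint_stopped u f t : 0 <= u -> 0 <= t <= T -> itg f ->
  rint (stopped u f) t = rint f (Num.min u t).
Proof.
move=> u0 /andP[t0 tT] h; have h' := path_integrable_stopped u h.
have [ut|tu] := leP u t; last first.
  apply: eq_Rintegral => s; rewrite inE /= in_itv/= => /andP[_ st].
  by rewrite /stopped (le_trans st (ltW tu)).
rewrite -[LHS](subrK (rint (stopped u f) u)) rint_incr//.
rewrite (_ : \int[_]_(_ in _) _ = 0) ?add0r.
  by apply: eq_Rintegral => s; rewrite inE /= in_itv/= /stopped => /andP[_ ->].
rewrite (@eq_Rintegral _ _ _ _ _ (fun=> 0)) ?Rintegral_cst ?mul0r//.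
by move=> s; rewrite inE /= in_itv/= /stopped => /andP[us _]; rewrite leNgt us.
Qed.

Context {m : nat}.
Implicit Types f g h : R -> 'cV[R]_m.

Definition pathL2 f : Prop := (forall i, measurable_fun `[0, T] (fun s => f s i 0)) /\
  itg (fun s => dotv (f s) (f s)).

Definition ip f g (t : R) : R := rint (fun s => dotv (f s) (g s)) t.

Lemma measurable_dotv f g : (forall i, measurable_fun `[0, T] (fun s => f s i 0)) ->
  (forall i, measurable_fun `[0, T] (fun s => g s i 0)) ->
  measurable_fun `[0, T] (fun s => dotv (f s) (g s)).
Proof.
move=> h1 h2; rewrite (funext (fun s => dotvE (f s) (g s))).
by apply: measurable_sum => i; exact: measurable_funM.
Qed.

Lemma pathL2_dot f g : pathL2 f -> pathL2 g -> itg (fun s => dotv (f s) (g s)).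
Proof.
move=> [mf hf] [mg hg].
apply: (@path_integrable_le _ (fun s => dotv (f s) (f s) + dotv (g s) (g s))).
- exact: measurable_dotv.
- move=> s _; have := dotv_young (f s) (g s) ltr01; rewrite invr1 !mul1r.
  by have := normr_ge0 (dotv (f s) (g s)); lra.
- exact: path_integrableD.
Qed.

Lemma pathL2D f g : pathL2 f -> pathL2 g -> pathL2 (fun s => f s + g s).
Proof.
move=> hf hg; have [mf _] := hf; have [mg _] := hg.
have mfg i : measurable_fun `[0, T] (fun s => (f s + g s) i 0).
  by rewrite (funext (fun s => mxE _ _ i 0)); exact: measurable_funD.
split=> //; apply: (@path_integrable_ext (fun s => (dotv (f s) (f s) + dotv (f s) (g s)) + (dotv (g s) (f s) + dotv (g s) (g s)))).
  by move=> s _; rewrite !(dotvDl, dotvDr).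
by apply: path_integrableD; apply: path_integrableD; exact: pathL2_dot.
Qed.

Lemma pathL2Z a f : pathL2 f -> pathL2 (fun s => a *: f s).
Proof.
move=> [mf hf]; split.
  by move=> i; rewrite (funext (fun s => mxE _ _ i 0)); exact: measurable_funM.
apply: (@path_integrable_ext (fun s => a ^+ 2 * dotv (f s) (f s))).
  by move=> s _; rewrite dotvZl dotvZr mulrA.
exact: path_integrableZ.
Qed.

Lemma pathL2N f : pathL2 f -> pathL2 (fun s => - f s).
Proof.
by move=> h; rewrite (_ : (fun s => _) = fun s => -1 *: f s); [exact: pathL2Z|apply/funext => s; rewrite scaleN1r].
Qed.

Lemma pathL2B f g : pathL2 f -> pathL2 g -> pathL2 (fun s => f s - g s).
Proof. by move=> h1 h2; apply: pathL2D => //; exact: pathL2N. Qed.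

Lemma pathL2_stopped u f : pathL2 f -> pathL2 (stopped u f).
Proof.
move=> [mf hf]; split.
  move=> i; rewrite (_ : (fun s => _) = stopped u (fun s => f s i 0)); first exact: measurable_stopped.
  by apply/funext => s; rewrite /stopped; case: ifP => //; rewrite mxE.
apply: path_integrable_ext (path_integrable_stopped u hf) => s _.
by rewrite /stopped; case: ifP; rewrite ?dotv0l.
Qed.

Lemma pathL2_bounded f K : (forall i, measurable_fun `[0, T] (fun s => f s i 0)) ->
  (forall s, 0 <= s <= T -> dotv (f s) (f s) <= K) -> pathL2 f.
Proof.
move=> mf fK; split=> //; apply: (@path_integrable_le _ (fun=> K)).
- exact: measurable_dotv.
- by move=> s hs; rewrite ger0_norm ?dotv_ge0// fK.
- exact: path_integrable_cst.
Qed.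

Lemma ipC f g t : ip f g t = ip g f t.
Proof. by rewrite /ip; under [in LHS]eq_fun do rewrite dotvC. Qed.

Lemma ipDl f g h t : 0 <= t <= T -> pathL2 f -> pathL2 g -> pathL2 h ->
  ip (fun s => f s + g s) h t = ip f h t + ip g h t.
Proof.
move=> tT hf hg hh; rewrite /ip; under eq_fun do rewrite dotvDl.
by rewrite rintD//; exact: pathL2_dot.
Qed.

Lemma ipZl a f g t : 0 <= t <= T -> pathL2 f -> pathL2 g ->
  ip (fun s => a *: f s) g t = a * ip f g t.
Proof.
move=> tT hf hg; rewrite /ip; under eq_fun do rewrite dotvZl.
by rewrite rintZ//; exact: pathL2_dot.
Qed.

Lemma ipDr f g h t : 0 <= t <= T -> pathL2 f -> pathL2 g -> pathL2 h ->
  ip h (fun s => f s + g s) t = ip h f t + ip h g t.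
Proof. by move=> *; rewrite ipC ipDl// !(ipC h). Qed.

Lemma ipZr a f g t : 0 <= t <= T -> pathL2 f -> pathL2 g ->
  ip f (fun s => a *: g s) t = a * ip f g t.
Proof. by move=> *; rewrite ipC ipZl// ipC. Qed.

Lemma ipNl f g t : 0 <= t <= T -> pathL2 f -> pathL2 g -> ip (fun s => - f s) g t = - ip f g t.
Proof.
move=> tT hf hg; rewrite -mulN1r -ipZl//; congr (ip _ _ _).
by apply/funext => s; rewrite scaleN1r.
Qed.

Lemma ipBl f g h t : 0 <= t <= T -> pathL2 f -> pathL2 g -> pathL2 h ->
  ip (fun s => f s - g s) h t = ip f h t - ip g h t.
Proof. by move=> tT hf hg hh; rewrite ipDl ?ipNl//; exact: pathL2N. Qed.

Lemma ipBr f g h t : 0 <= t <= T -> pathL2 f -> pathL2 g -> pathL2 h ->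
  ip h (fun s => f s - g s) t = ip h f t - ip h g t.
Proof. by move=> *; rewrite ipC ipBl// !(ipC h). Qed.

Lemma ip_ge0 f t : t <= T -> 0 <= ip f f t.
Proof. by move=> tT; apply: rint_ge0 => // s _; exact: dotv_ge0. Qed.

Lemma ip_nd f s t : 0 <= s -> s <= t -> t <= T -> pathL2 f -> ip f f s <= ip f f t.
Proof. by move=> s0 st tT [_ h]; apply: rint_nd => // r _; exact: dotv_ge0. Qed.

Lemma ip_continuous f g : pathL2 f -> pathL2 g -> {within `[0, T], continuous (ip f g)}.
Proof. by move=> hf hg; apply: rint_continuous; exact: pathL2_dot. Qed.

Lemma ip_stopped u f g t : 0 <= u -> 0 <= t <= T -> pathL2 f -> pathL2 g ->
  ip (stopped u f) g t = ip f g (Num.min u t).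
Proof.
move=> u0 tT hf hg; rewrite /ip -rint_stopped//; last exact: pathL2_dot.
apply: rint_ext; first by case/andP: tT.
by move=> s _; rewrite /stopped; case: ifP; rewrite ?dotv0l.
Qed.

Lemma ip_stopped2 u v f g t : 0 <= u -> 0 <= v -> 0 <= t <= T -> pathL2 f -> pathL2 g ->
  ip (stopped u f) (stopped v g) t = ip f g (Num.min (Num.min u v) t).
Proof.
move=> u0 v0 tT hf hg; rewrite /ip -rint_stopped ?le_min ?u0//; last exact: pathL2_dot.
apply: rint_ext; first by case/andP: tT.
move=> s _; rewrite /stopped le_min.
by case: (s <= u); case: (s <= v); rewrite ?dotv0l ?dotv0r.
Qed.

(** The right-hand side is taken at [T], so that the bound is uniform in [t], as [ip_cvg]
    requires. *)
Lemma ip_young e f g t : 0 < e -> 0 <= t <= T -> pathL2 f -> pathL2 g ->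
  2 * `|ip f g t| <= e * ip f f T + e^-1 * ip g g T.
Proof.
move=> e0 tT hf hg; have hfg := pathL2_dot hf hg.
have [_ hf'] := hf; have [_ hg'] := hg.
have TT : 0 <= T <= T by rewrite T0 lexx.
apply: (@le_trans _ _ (2 * rint (fun s => `|dotv (f s) (g s)|) T)).
  by rewrite ler_pM2l//; exact: rint_abs.
rewrite -!rintZ//; last exact: integrable_norm.
rewrite -rintD//; [|exact: path_integrableZ|exact: path_integrableZ].
apply: rint_le => //.
- by apply: path_integrableZ; exact: integrable_norm.
- by apply: path_integrableD; exact: path_integrableZ.
- by move=> s _; exact: dotv_young.
Qed.

Lemma ip_addsq f g : pathL2 f -> pathL2 g ->
  ip (fun s => f s + g s) (fun s => f s + g s) T <= 2 * ip f f T + 2 * ip g g T.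
Proof.
move=> hf hg; have [_ hf'] := hf; have [_ hg'] := hg; have [_ h'] := pathL2D hf hg.
have TT : 0 <= T <= T by rewrite T0 lexx.
rewrite -!rintZ// -rintD//; [|exact: path_integrableZ|exact: path_integrableZ].
apply: rint_le => //.
- by apply: path_integrableD; exact: path_integrableZ.
- by move=> s _; exact: dotv_addsq.
Qed.

Definition cvgL2 (fn : nat -> R -> 'cV[R]_m) f : Prop :=
  ip (fun s => fn n s - f s) (fun s => fn n s - f s) T @[n --> \oo] --> 0.

Definition unif (xn : nat -> R -> R) (x : R -> R) : Prop :=
  forall e, 0 < e -> \forall n \near \oo, forall t, 0 <= t <= T -> `|xn n t - x t| <= e.

Lemma unif_cvg xn x t : 0 <= t <= T -> unif xn x -> xn n t @[n --> \oo] --> x t.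
Proof.
move=> tT h; apply/cvgrPdist_le => e e0; apply: filterS (h e e0) => n.
by rewrite distrC; exact.
Qed.

Lemma within_itvP (x : R -> R) : {within `[0, T], continuous x} <->
  forall t, 0 <= t <= T -> forall e : R, 0 < e -> exists2 d : R, 0 < d &
    forall s, 0 <= s <= T -> `|t - s| < d -> `|x t - x s| < e.
Proof.
rewrite subspace_continuousP; split=> h t.
  move=> tT e e0; have tT' : `[0, T]%classic t by rewrite /= in_itv.
  have /cvgrPdist_lt/(_ e e0)/nbhs_ballP[d /= d0 hd] := h t tT'.
  by exists d => // s sT ts; apply: hd => //=; rewrite in_itv.
rewrite /= in_itv/= => tT; apply/cvgrPdist_lt => e e0.
have [d d0 hd] := h t tT e e0.
by apply/nbhs_ballP; exists d => // s ts /=; rewrite in_itv/= => sT; exact: hd.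
Qed.

Lemma unif_within_continuous xn x : (forall n, {within `[0, T], continuous (xn n)}) ->
  unif xn x -> {within `[0, T], continuous x}.
Proof.
move=> cx h; apply/within_itvP => t tT e e0.
have e3 : 0 < e / 3 by rewrite divr_gt0.
have [n _ hn] := h _ e3; have {}hn := hn n (leqnn n).
have /within_itvP/(_ t tT _ e3)[d d0 hd] := cx n.
exists d => // s sT ts; have h1 := hn t tT; have h2 := hn s sT; have h3 := hd s sT ts.
rewrite (_ : x t - x s = - (xn n t - x t) + (xn n t - xn n s) + (xn n s - x s)); last ring.
apply: (le_lt_trans (ler_normD _ _)); apply: (le_lt_trans (lerD (ler_normD _ _) (lexx _))).
by rewrite normrN; lra.
Qed.

Lemma within_continuousD (x y : R -> R) : {within `[0, T], continuous x} ->
  {within `[0, T], continuous y} -> {within `[0, T], continuous (fun t => x t + y t)}.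
Proof. by move=> hx hy t; apply: cvgD; [exact: hx|exact: hy]. Qed.

Lemma within_continuousZ a (x : R -> R) : {within `[0, T], continuous x} ->
  {within `[0, T], continuous (fun t => a * x t)}.
Proof. by move=> hx t; apply: cvgM; [exact: cvg_cst|exact: hx]. Qed.

Lemma within_continuousN (x : R -> R) : {within `[0, T], continuous x} ->
  {within `[0, T], continuous (fun t => - x t)}.
Proof. by move=> hx t; apply: cvgN; exact: hx. Qed.

Lemma within_continuousB (x y : R -> R) : {within `[0, T], continuous x} ->
  {within `[0, T], continuous y} -> {within `[0, T], continuous (fun t => x t - y t)}.
Proof. by move=> hx hy; apply: within_continuousD => //; exact: within_continuousN. Qed.

Lemma within_continuous_sum I (r : seq I) (x : I -> R -> R) :
  (forall i, {within `[0, T], continuous (x i)}) ->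
  {within `[0, T], continuous (fun t => \sum_(i <- r) x i t)}.
Proof.
move=> h; elim: r => [|i r ih].
  by under [X in continuous X]eq_fun do rewrite big_nil; move=> t; exact: cvg_cst.
by under [X in continuous X]eq_fun do rewrite big_cons; exact: within_continuousD.
Qed.

Lemma within_continuous_ext (x y : R -> R) : (forall t, 0 <= t <= T -> x t = y t) ->
  {within `[0, T], continuous x} -> {within `[0, T], continuous y}.
Proof. by move=> xy; apply: subspace_eq_continuous => t; rewrite inE /= in_itv/=; exact: xy. Qed.

Lemma within_cvg (x : R -> R) (tn : nat -> R) t : {within `[0, T], continuous x} ->
  0 <= t <= T -> (forall n, 0 <= tn n <= T) -> tn n @[n --> \oo] --> t ->
  x (tn n) @[n --> \oo] --> x t.
Proof.
move=> /within_itvP h tT tnT ct; apply/cvgrPdist_lt => e e0.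
have [d d0 hd] := h t tT e e0.
move/cvgrPdist_lt : ct => /(_ d d0); apply: filterS => n; exact: hd.
Qed.

(** The approximating times lie above [t], as those of [grid_above] do; the two stopped paths then
    agree up to [t] and differ later by an oscillation of [x] between [t] and [tn n]. *)
Lemma unif_stopped (x : R -> R) (tn : nat -> R) t : {within `[0, T], continuous x} ->
  0 <= t <= T -> (forall n, t <= tn n <= T) -> tn n @[n --> \oo] --> t ->
  unif (fun n s => x (Num.min s (tn n))) (fun s => x (Num.min s t)).
Proof.
move=> /within_itvP h /[dup] tT /andP[t0 tT'] tnT ct e e0.
have [d d0 hd] := h t tT e e0.
move/cvgrPdist_lt : ct => /(_ d d0); apply: filterS => n hn s /andP[s0 sT].
have /andP[h1 h2] := tnT n.
have [st|ts] := leP s t; first by rewrite !min_l ?(le_trans st h1)// subrr normr0 ltW.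
rewrite distrC; apply/ltW/hd.
  by rewrite le_min s0 (le_trans t0 h1)/= ge_min sT.
apply: le_lt_trans hn; rewrite !ler0_norm ?subr_le0//; last by rewrite le_min h1 ltW.
by rewrite !opprB lerD2r ge_min lexx orbT.
Qed.

Lemma cvgL2_stopped f (tn : nat -> R) t : pathL2 f -> 0 <= t <= T ->
  (forall n, t <= tn n <= T) -> tn n @[n --> \oo] --> t ->
  cvgL2 (fun n => stopped (tn n) f) (stopped t f).
Proof.
move=> hf /[dup] tT /andP[t0 tT'] tnT ct.
have TT : 0 <= T <= T by rewrite T0 lexx.
rewrite /cvgL2; have e n : ip (fun s => stopped (tn n) f s - stopped t f s)
    (fun s => stopped (tn n) f s - stopped t f s) T = ip f f (tn n) - ip f f t.
  have /andP[h1 h2] := tnT n; have h0 := le_trans t0 h1.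
  have p1 := pathL2_stopped (tn n) hf; have p2 := pathL2_stopped t hf.
  have p3 := pathL2B p1 p2.
  rewrite ipBl// !ipBr// !ip_stopped2 ?le_min ?t0 ?h0//.
  rewrite !minxx (min_r h1) (min_l h1) (min_l h2) (min_l tT'); ring.
under eq_fun do rewrite e; rewrite -(subrr (ip f f t)); apply: cvgB; last exact: cvg_cst.
apply: within_cvg => //; first exact: ip_continuous.
by move=> n; have /andP[h1 ->] := tnT n; rewrite (le_trans t0 h1).
Qed.

Lemma cvgL2_ext fn gn f g : (forall n s, 0 <= s <= T -> fn n s = gn n s) ->
  (forall s, 0 <= s <= T -> f s = g s) -> cvgL2 fn f -> cvgL2 gn g.
Proof.
move=> h1 h2; rewrite /cvgL2; suff -> : (fun n => ip (fun s => fn n s - f s) (fun s => fn n s - f s) T) = (fun n => ip (fun s => gn n s - g s) (fun s => gn n s - g s) T) by [].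
by apply/funext => n; apply: rint_ext => // s hs; rewrite h1// h2.
Qed.

Lemma cvgL2D fn gn f g : (forall n, pathL2 (fn n)) -> pathL2 f -> (forall n, pathL2 (gn n)) ->
  pathL2 g -> cvgL2 fn f -> cvgL2 gn g -> cvgL2 (fun n s => fn n s + gn n s) (fun s => f s + g s).
Proof.
move=> hfn hf hgn hg cf cg.
apply: (@squeeze_cvgr _ _ _ _ (cst 0) (fun n => 2 * ip (fun s => fn n s - f s) (fun s => fn n s - f s) T +
   2 * ip (fun s => gn n s - g s) (fun s => gn n s - g s) T)).
- apply: nearW => n; rewrite ip_ge0//=.
  apply: le_trans (ip_addsq (pathL2B (hfn n) hf) (pathL2B (hgn n) hg)).
  by rewrite le_eqVlt; apply/orP; left; apply/eqP/rint_ext => // s _; rewrite opprD addrACA.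
- exact: cvg_cst.
- rewrite (_ : 0 = 2 * 0 + 2 * 0 :> R); last ring.
  by apply: cvgD; apply: cvgM => //; exact: cvg_cst.
Qed.

Lemma cvgL2Z a fn f : (forall n, pathL2 (fn n)) -> pathL2 f -> cvgL2 fn f ->
  cvgL2 (fun n s => a *: fn n s) (fun s => a *: f s).
Proof.
move=> hfn hf cf; have TT : 0 <= T <= T by rewrite T0 lexx.
rewrite /cvgL2 (_ : (fun n => _) = fun n => a ^+ 2 * ip (fun s => fn n s - f s) (fun s => fn n s - f s) T).
  by rewrite -(mulr0 (a ^+ 2)); apply: cvgM => //; exact: cvg_cst.
apply/funext => n; rewrite -rintZ//; last exact: pathL2_dot (pathL2B (hfn n) hf) (pathL2B (hfn n) hf).
by apply: rint_ext => // s _; rewrite -scalerBr dotvZl dotvZr mulrA.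
Qed.

Lemma ip_cvg fn f gn g : (forall n, pathL2 (fn n)) -> pathL2 f -> (forall n, pathL2 (gn n)) ->
  pathL2 g -> cvgL2 fn f -> cvgL2 gn g -> unif (fun n => ip (fn n) (gn n)) (ip f g).
Proof.
move=> hfn hf hgn hg cf cg e e0.
set M := ip f f T + ip g g T + 1.
have TT : T <= T by [].
have M0 : 0 < M by rewrite ltr_wpDl// addr_ge0// ip_ge0.
have d0 : 0 < e / M by rewrite divr_gt0.
(* The bound [e / M * e / 16] pays for the weight [4 * M / e] in Young's inequality for the two
   cross terms; each of the three terms below is then at most [e / 4]. *)
have eta0 : 0 < Num.min 1 (Num.min (e / 4) (e / M * e / 16)).
  by rewrite !lt_min ltr01 !divr_gt0//= mulr_gt0.
set eta := Num.min _ _ in eta0.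
near=> n => t tT.
have hF := pathL2B (hfn n) hf; have hG := pathL2B (hgn n) hg.
have bF : ip (fun s => fn n s - f s) (fun s => fn n s - f s) T <= eta.
  have : `|0 - ip (fun s => fn n s - f s) (fun s => fn n s - f s) T| <= eta.
    by near: n; move/cvgrPdist_le : cf; exact.
  by rewrite sub0r normrN; apply: le_trans; exact: ler_norm.
have bG : ip (fun s => gn n s - g s) (fun s => gn n s - g s) T <= eta.
  have : `|0 - ip (fun s => gn n s - g s) (fun s => gn n s - g s) T| <= eta.
    by near: n; move/cvgrPdist_le : cg; exact.
  by rewrite sub0r normrN; apply: le_trans; exact: ler_norm.
have -> : ip (fn n) (gn n) t - ip f g t =
    ip (fun s => fn n s - f s) (fun s => gn n s - g s) t +
    (ip (fun s => fn n s - f s) g t + ip (fun s => gn n s - g s) f t).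
  by rewrite !(ipBl, ipBr)// (ipC (gn n) f) (ipC g f); ring.
have h1 := ip_young ltr01 tT hF hG.
have h2 := ip_young (divr_gt0 (mulr_gt0 (ltr0n _ 4) M0) e0) tT hF hg.
have h3 := ip_young (divr_gt0 (mulr_gt0 (ltr0n _ 4) M0) e0) tT hG hf.
rewrite invr1 !mul1r in h1.
rewrite !invf_div in h2 h3.
apply: (le_trans (ler_normD _ _)); apply: (le_trans (lerD (lexx _) (ler_normD _ _))).
have [e1 [e2 e3]] : eta <= 1 /\ eta <= e / 4 /\ eta <= e / M * e / 16.
  by rewrite /eta !ge_min !lexx !orbT.
have k1 : 4 * M / e * eta <= e / 4.
  apply: (le_trans (ler_wpM2l _ e3)); first by rewrite divr_ge0 ?mulr_ge0 ?ltW.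
  rewrite le_eqVlt; apply/orP; left; apply/eqP; field.
  by rewrite !gt_eqF.
have k2 x : 0 <= x -> x <= M -> e / (4 * M) * x <= e / 4.
  move=> x0 xM; apply: (@le_trans _ _ (e / (4 * M) * M)).
    by apply: ler_wpM2l => //; rewrite divr_ge0 ?mulr_ge0 ?ltW.
  by rewrite le_eqVlt; apply/orP; left; apply/eqP; field; rewrite gt_eqF.
have ff := ip_ge0 f TT; have gg := ip_ge0 g TT.
have fM : ip f f T <= M by rewrite /M; lra.
have gM : ip g g T <= M by rewrite /M; lra.
have k0 : 0 <= 4 * M / e by rewrite divr_ge0 ?mulr_ge0 ?ltW.
have := ler_wpM2l k0 bF; have := ler_wpM2l k0 bG.
have := k2 _ ff fM; have := k2 _ gg gM.
move: k1 h1 h2 h3; set c1 := 4 * M / e; set c2 := e / (4 * M).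
by lra.
Unshelve. all: end_near.
Qed.

Lemma pathL2P f : (forall i, measurable_fun `[0, T] (fun s => f s i 0)) ->
  (\int[leb]_(t in `[0%R, T]) (enorm (f t) ^+ 2)%:E < +oo)%E -> pathL2 f.
Proof.
move=> mf h; split=> //; apply/integrableP; split.
  by apply/measurable_EFinP; exact: measurable_dotv.
apply: le_lt_trans h; apply: ge0_le_integral => //.
- apply: measurableT_comp => //; apply/measurable_EFinP; exact: measurable_dotv.
- apply/measurable_EFinP; rewrite (funext (fun s => enormK (f s))); exact: measurable_dotv.
- by move=> s _ /=; rewrite enormK ger0_norm ?dotv_ge0.
Qed.

Lemma ip_EFin f : pathL2 f ->
  (\int[leb]_(t in `[0%R, T]) (enorm (f t) ^+ 2)%:E = (ip f f T)%:E)%E.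
Proof.
move=> [mf h]; rewrite /ip /rint /Rintegral fineK; last exact: integrable_fin_num.
by apply: eq_integral => s _; rewrite enormK.
Qed.

End path.

(* Quadratic variation of the integral of f. *)
Notation qv f t := (ip f f t).

(** Induction along a sorted list that contains [pts]: between neighbours there is no point of
    [pts], so each step applies. With the end points of a simple process as [pts], it reduces a mean
    at [T] to one at 0. *)
Lemma path_invariant {R : realDomainType} {V} (F : R -> V) (pts : seq R) (T : R) :
  (forall u v, 0 <= u -> u <= v -> v <= T -> (forall e, e \in pts -> e <= u \/ v <= e) ->
    F v = F u) ->
  forall (l : seq R) u, path <=%R u l -> 0 <= u -> (forall e, e \in l -> e <= T) ->
    (forall e, e \in pts -> e <= u \/ e \in l) -> F (last u l) = F u.
Proof.
move=> step; elim=> [//|v l ih] u /= /andP[uv pv] u0 lT hl.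
have vl e : e \in l -> v <= e.
  by move: pv; rewrite (path_sortedE le_trans) => /andP[/allP + _]; exact.
rewrite ih.
- apply: step => //; first by apply: lT; rewrite inE eqxx.
  move=> e /hl[|]; first by left.
  by rewrite inE => /orP[/eqP ->|/vl]; right.
- exact: pv.
- exact: le_trans uv.
- by move=> e el; apply: lT; rewrite inE el orbT.
- move=> e /hl[eu|]; first by left; exact: le_trans uv.
  by rewrite inE => /orP[/eqP ->|]; [left|right].
Qed.

Lemma cvg_expR_seq {R : realType} (u : nat -> R) (l : R) :
  u n @[n --> \oo] --> l -> expR (u n) @[n --> \oo] --> expR l.
Proof. by move=> h; apply: continuous_cvg h; exact: continuous_expR. Qed.

(** * First indices and hitting times *)

Section first_index.

(** Takes the default value [N] when no index below [N] satisfies [p]. *)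
Definition first_index (p : nat -> bool) N := find p (iota 0 N).

Lemma first_index_le p N : (first_index p N <= N)%N.
Proof. by rewrite -{2}(size_iota 0 N); exact: find_size. Qed.

Lemma first_index_before p N j : (j < first_index p N)%N -> ~~ p j.
Proof.
move=> h; have := before_find 0%N h; rewrite nth_iota ?add0n; first by move=> ->.
exact: leq_trans (first_index_le p N).
Qed.

Lemma first_index_at p N : (first_index p N < N)%N -> p (first_index p N).
Proof.
move=> h; have hp : has p (iota 0 N) by rewrite has_find size_iota.
by have := nth_find 0%N hp; rewrite nth_iota.
Qed.

Lemma first_indexE p N k : (first_index p N = k) <->
  ((k < N)%N && p k \/ k = N) /\ (forall j, (j < k)%N -> ~~ p j).
Proof.
split=> [<-|[h1 h2]].
  split; last exact: first_index_before.
  have := first_index_le p N; rewrite leq_eqVlt => /orP[/eqP|h]; first by right.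
  by left; rewrite h first_index_at.
have [h|h|//] := ltngtP (first_index p N) k.
  have hN : (first_index p N < N)%N.
    by apply: leq_trans h _; case: h1 => [/andP[/ltnW]|->].
  by have := h2 _ h; rewrite first_index_at.
case: h1 => [/andP[_ pk]|kN]; first by have := first_index_before h; rewrite pk.
by move: h; rewrite kN ltnNge first_index_le.
Qed.

End first_index.

Section hitting.
Context {R : realType}.
Variable T : R.
Hypothesis T0 : 0 <= T.

(** Adding [T] keeps the set nonempty and gives the value [T] when the level is never reached. *)
Definition hitting (a : R) (x : R -> R) : R :=
  inf ([set t | 0 <= t <= T /\ a <= x t] `|` [set T]).

Let S (a : R) (x : R -> R) := [set t | 0 <= t <= T /\ a <= x t] `|` [set T].

Let S_inf (a : R) (x : R -> R) : has_inf (S a x).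
Proof. by split; [exists T; right|exists 0 => t [[/andP[] //]|->]]. Qed.

Lemma hitting_itv a (x : R -> R) : 0 <= hitting a x <= T.
Proof.
apply/andP; split.
  apply: lb_le_inf; first by exists T; right.
  by move=> t [[/andP[] //]|->].
by apply: ge_inf; [exact: (S_inf a x).2|right].
Qed.

Lemma hitting_le a (x : R -> R) (t : R) : 0 <= t <= T -> a <= x t -> hitting a x <= t.
Proof. by move=> tT at_; apply: ge_inf; [exact: (S_inf a x).2|left]. Qed.

Lemma before_hitting a (x : R -> R) (t : R) : 0 <= t -> t < hitting a x -> x t < a.
Proof.
move=> t0 th; rewrite ltNge; apply/negP => h.
have /andP[_ hT] := hitting_itv a x.
by move: (th); rewrite ltNge hitting_le// t0 (le_trans (ltW th)).
Qed.

Lemma hitting_ge a (x : R -> R) : {within `[0, T], continuous x} ->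
  (exists2 t, 0 <= t <= T & a <= x t) -> a <= x (hitting a x).
Proof.
move=> /within_itvP cx [t tT at_]; rewrite leNgt; apply/negP => h.
have hT := hitting_itv a x.
have e0 : 0 < a - x (hitting a x) by rewrite subr_gt0.
have [d d0 hd] := cx _ hT _ e0.
have [s Ss sd] := inf_adherent d0 (S_inf a x).
have hs : hitting a x <= s by apply: ge_inf => //; exact: (S_inf a x).2.
have key (r : R) : 0 <= r <= T -> hitting a x <= r -> r < hitting a x + d -> x r < a.
  move=> rT hr rd; have := hd r rT; rewrite distrC ger0_norm ?subr_ge0// ltrBlDl => /(_ rd).
  by rewrite ltr_distl => /andP[]; lra.
case: Ss => [[sT as_]|sT]; first by have := key _ sT hs sd; rewrite ltNge as_.
have := key t tT (hitting_le tT at_); rewrite [x t < a]ltNge at_ => k; suff : false by [].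
by apply: k; apply: le_lt_trans sd; rewrite sT; case/andP: tT.
Qed.

Lemma hitting_at a (x : R -> R) : {within `[0, T], continuous x} ->
  hitting a x < T -> a <= x (hitting a x).
Proof.
move=> cx hT; apply: hitting_ge => //; apply: contrapT => h.
suff : T <= hitting a x by rewrite leNgt hT.
apply: lb_le_inf; first by exists T; right.
by move=> t [[tT at_]|->//]; exfalso; apply: h; exists t.
Qed.

Lemma hitting_last a (x : R -> R) : (forall t, 0 <= t <= T -> x t < a) -> hitting a x = T.
Proof.
move=> h; apply/eqP; rewrite eq_le; have /andP[_ ->] := hitting_itv a x => /=.
apply: lb_le_inf; first by exists T; right.
by move=> t [[tT]|->//]; rewrite leNgt h.
Qed.

Lemma le_hitting a (x : R -> R) (t : R) : {within `[0, T], continuous x} -> x 0 <= a ->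
  0 <= t <= hitting a x -> x t <= a.
Proof.
move=> cx x0 /andP[t0]; rewrite le_eqVlt => /predU1P[->|th]; last exact/ltW/before_hitting.
have hT := hitting_itv a x; have /andP[h0 h1] := hT.
rewrite leNgt; apply/negP => h.
have hp : 0 < hitting a x.
  by rewrite lt_neqAle h0 andbT; apply/eqP => e; move: h; rewrite -e ltNge x0.
have e0 : 0 < x (hitting a x) - a by rewrite subr_gt0.
have /within_itvP/(_ _ hT _ e0)[d d0 hd] := cx.
(* A nonnegative time just before the hitting time, within the modulus [d]: there [x] is below [a],
   yet by continuity above [a]. *)
pose s := Num.max (hitting a x / 2) (hitting a x - d / 2).
have s0 : 0 <= s by rewrite le_max divr_ge0.
have sh : s < hitting a x by rewrite gt_max; apply/andP; split; lra.
have := hd s; rewrite s0 (le_trans (ltW sh) h1) => /(_ isT).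
rewrite ger0_norm ?subr_ge0 ?(ltW sh)// => k.
have : hitting a x - d / 2 <= s by rewrite le_max lexx orbT.
move=> k2; have {k} := k _; rewrite ltr_distl => k.
have /andP[k1 _] := k ltac:(lra).
by have := before_hitting s0 sh; rewrite ltNge => /negP; apply; lra.
Qed.

Lemma within_continuous_stopped (x : R -> R) (t : R) : 0 <= t <= T ->
  {within `[0, T], continuous x} -> {within `[0, T], continuous (fun s => x (Num.min s t))}.
Proof.
move=> /andP[t0 tT] /within_itvP cx; apply/within_itvP => s /andP[s0 sT] e e0.
have [|d d0 hd] := cx (Num.min s t) _ e e0.
  by rewrite le_min s0 t0 ge_min sT.
exists d => // r /andP[r0 rT] rd; apply: hd; first by rewrite le_min r0 t0 ge_min rT.
apply: le_lt_trans rd; rewrite /Num.min.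
case: ltP => h1; case: ltP => h2; rewrite ?subrr ?normr0//.
- by rewrite !ler0_norm; lra.
- by rewrite !ger0_norm; lra.
Qed.

(** The case [t = T] is left out: the hitting time is at most [T] even if the level is never
    reached. *)
Lemma hitting_leP a (x : R -> R) (t : R) : {within `[0, T], continuous x} ->
  0 <= t < T -> hitting a x <= t <-> exists2 s, 0 <= s <= t & a <= x s.
Proof.
move=> cx /andP[t0 tT]; have /andP[h0 _] := hitting_itv a x; split=> [ht|[s /andP[s0 st] as_]].
  exists (hitting a x); first by rewrite h0.
  by apply: hitting_at => //; exact: le_lt_trans tT.
by apply: (le_trans _ st); apply: hitting_le => //; rewrite s0 (le_trans st)// ltW.
Qed.

End hitting.

(** * Projection on a closed cone *)

Section cone.
Context {R : realType} {n : nat}.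
Implicit Types (K : set 'cV[R]_n) (u v z : 'cV[R]_n).

(* Closedness is stated with approximating points, which is what the image of a
   closed cone under an injective linear map satisfies most directly. *)
Definition approx_closed_cone K : Prop :=
  [/\ K 0, forall u v, K u -> K v -> K (u + v),
      forall (a : R) u, 0 < a -> K u -> K (a *: u) &
      forall z, (forall e : R, 0 < e -> exists2 u, K u & dotv (z - u) (z - u) < e) -> K z].

Lemma dist_set_le K z u : K u -> dist_set K z <= enorm (z - u).
Proof.
move=> Ku; apply: ge_inf; last by exists u.
by exists 0 => _ [v _ <-]; exact: enorm_ge0.
Qed.

Lemma dist_set_ge0 K z u : K u -> 0 <= dist_set K z.
Proof.
move=> Ku; apply: lb_le_inf; first by exists (enorm (z - u)), u.
by move=> _ [v _ <-]; exact: enorm_ge0.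
Qed.

Lemma dist_set_adherent K z u (e : R) : K u -> 0 < e ->
  exists2 v, K v & enorm (z - v) < dist_set K z + e.
Proof.
move=> Ku e0; have [|_ [v Kv <-] h] := @inf_adherent _ [set enorm (z - k) | k in K] _ e0.
- split; first by exists (enorm (z - u)), u.
  by exists 0 => _ [v _ <-]; exact: enorm_ge0.
by exists v.
Qed.

Lemma dotv_cvg (x : nat -> 'cV[R]_n) u z : (forall i, x k i 0 @[k --> \oo] --> u i 0) ->
  dotv (z - x k) (z - x k) @[k --> \oo] --> dotv (z - u) (z - u).
Proof.
move=> h; rewrite (funext (fun k => dotvE (z - x k) (z - x k))) dotvE.
apply: cvg_sumr => i.
have c : (z - x k) i 0 @[k --> \oo] --> (z - u) i 0.
  rewrite (funext (fun k => mxE _ _ i 0)) !mxE.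
  have -> : (fun k => z i 0 + (- x k) i 0) = (fun k => z i 0 - x k i 0).
    by apply/funext => k; rewrite mxE.
  by apply: cvgB => //; exact: cvg_cst.
exact: cvgM.
Qed.

Lemma cauchy_coord_cvg (x : nat -> 'cV[R]_n) (e : nat -> R) :
  e k @[k --> \oo] --> 0 ->
  (forall j k, (j <= k)%N -> dotv (x j - x k) (x j - x k) <= e j) ->
  exists u, forall i, x k i 0 @[k --> \oo] --> u i 0.
Proof.
move=> ce h; exists (\col_i lim (x k i 0 @[k --> \oo])) => i; rewrite mxE.
apply: cauchy_cvg; apply: cauchy_exP => d d0.
have /cvgr_lt/(_ _ (exprn_gt0 2 d0))[N _ hN] := ce.
exists (x N i 0); exists N => // k /= Nk; rewrite /ball/=.
have := le_lt_trans (le_trans (dotv_coord _ i) (h N k Nk)) (hN N (leqnn N)).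
have -> : (x N - x k) i 0 = x N i 0 - x k i 0 by rewrite !mxE.
by move=> h1; rewrite -(@ltr_pXn2r _ 2) ?nnegrE ?(ltW d0)// real_normK ?num_real.
Qed.

Section projection.
Variable K : set 'cV[R]_n.
Hypothesis hK : approx_closed_cone K.
Variable z : 'cV[R]_n.

(** A minimising sequence is Cauchy by the parallelogram identity, since midpoints stay in the cone;
    with slack [1 / (k + 1)] in the k-th term, the squared distance of two terms is at most four
    times the larger slack. *)
Lemma proj_exists : exists u, K u /\ enorm (z - u) = dist_set K z.
Proof.
have [K0 KD KZ Kcl] := hK; set d := dist_set K z.
have d0 : 0 <= d by exact: dist_set_ge0 K0.
have ch (k : nat) : exists v, K v /\ dotv (z - v) (z - v) < d ^+ 2 + k.+1%:R^-1.
  have q0 : 0 < k.+1%:R^-1 :> R by rewrite invr_gt0.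
  (* For [m <= 1] one has [(d + m) ^+ 2 <= d ^+ 2 + m * (2 * d + 1)], which dictates the
     denominator. *)
  pose e := k.+1%:R^-1 / (2 * d + 1 : R).
  have D0 : 0 < 2 * d + 1 by lra.
  have e0 : 0 < Num.min e 1 by rewrite lt_min ltr01 divr_gt0.
  have [v Kv hv] := dist_set_adherent z K0 e0; exists v; split=> //.
  rewrite -enormK; have h1 : Num.min e 1 <= 1 by rewrite ge_min lexx orbT.
  have h2 : Num.min e 1 <= e by rewrite ge_min lexx.
  have h3 : e * (2 * d + 1) = k.+1%:R^-1 by rewrite divfK// gt_eqF.
  have := enorm_ge0 (z - v); rewrite -/d in hv; move: hv h1 h2 h3 e0.
  move: (enorm _) (k.+1%:R^-1) (e) (Num.min e 1) => x q e' m hv h1 h2 h3 e0 x0.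
  have : x ^+ 2 < (d + m) ^+ 2 by rewrite ltr_pXn2r ?nnegrE//; lra.
  nra.
pose x k := projT1 (cid (ch k)).
have Kx k : K (x k) by rewrite /x; case: cid => ? [].
have hx k : dotv (z - x k) (z - x k) < d ^+ 2 + k.+1%:R^-1 by rewrite /x; case: cid => ? [].
have ge v : K v -> d ^+ 2 <= dotv (z - v) (z - v).
  by move=> Kv; rewrite -enormK ler_pXn2r ?nnegrE ?enorm_ge0// dist_set_le.
have [|j k jk|u hu] := @cauchy_coord_cvg x (fun k => 4 * k.+1%:R^-1).
- by rewrite -(mulr0 4); apply: cvgMr; exact: cvg_harmonic.
- have Kh : K (2^-1 *: (x j + x k)) by apply: KZ => //; exact: KD.
  have := ge _ Kh; have := hx j; have := hx k.
  have : k.+1%:R^-1 <= j.+1%:R^-1 :> R by rewrite lef_pV2 ?posrE// ler_nat.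
  move: (k.+1%:R^-1) (j.+1%:R^-1) => a b.
  rewrite !(dotvBl, dotvBr, dotvZl, dotvZr, dotvDl, dotvDr) (dotvC (x j) z) (dotvC (x k) z) (dotvC (x k) (x j)).
  by lra.
exists u.
have c := @dotv_cvg x u z hu.
have Ku : K u.
  apply: Kcl => e e0; have := @dotv_cvg x u u hu; rewrite subrr dotv0l.
  by move=> /cvgr_lt/(_ _ e0)[N _ hN]; exists (x N) => //; exact: hN (leqnn N).
split=> //; apply/eqP; rewrite eq_le dist_set_le// andbT.
rewrite -(ler_pXn2r (ltn0Sn 1)) ?nnegrE ?enorm_ge0// enormK.
have c2 : d ^+ 2 + k.+1%:R^-1 @[k --> \oo] --> d ^+ 2.
  by rewrite -[X in _ --> X]addr0; apply: cvgD; [exact: cvg_cst|exact: cvg_harmonic].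
rewrite -(cvg_lim _ c)// -(cvg_lim _ c2)//; apply: ler_lim.
- by apply/cvg_ex; exists (dotv (z - u) (z - u)).
- by apply/cvg_ex; exists (d ^+ 2).
by apply: nearW => k; exact/ltW.
Qed.

Lemma proj_setP : K (proj_set K z) /\ enorm (z - proj_set K z) = dist_set K z.
Proof. exact: (xgetPex 0 proj_exists). Qed.

Lemma proj_min v : K v -> dotv (z - proj_set K z) (z - proj_set K z) <= dotv (z - v) (z - v).
Proof.
move=> Kv; have [_ h] := proj_setP.
by rewrite -!enormK ler_pXn2r ?nnegrE ?enorm_ge0// h dist_set_le.
Qed.

Lemma proj_polar v : K v -> dotv (z - proj_set K z) v <= 0.
Proof.
have [K0 KD KZ Kcl] := hK; move=> Kv; have [Kp _] := proj_setP.
rewrite leNgt; apply/negP => h.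
have vv := dotv_ge0 v.
(* Near the minimiser in [a] of the squared distance from [z] to [p + a v]; the [+ 1] keeps the
   denominator positive. *)
pose a := dotv (z - proj_set K z) v / (dotv v v + 1).
have a0 : 0 < a by rewrite divr_gt0// ltr_wpDl.
have e : a * (dotv v v + 1) = dotv (z - proj_set K z) v by rewrite divfK// gt_eqF// ltr_wpDl.
have := proj_min (KD _ _ Kp (KZ _ _ a0 Kv)).
rewrite opprD addrA !(dotvBl _ (a *: v)) !(dotvBr _ (a *: v)) !(dotvZl, dotvZr) (dotvC v).
by move: h e a0 vv; move: (dotv (z - _) v) (dotv (z - _) (z - _)) (dotv v v) (a) => x y q c; nra.
Qed.

Lemma proj_orthogonal : dotv (z - proj_set K z) (proj_set K z) = 0.
Proof.
have [K0 KD KZ Kcl] := hK; have [Kp _] := proj_setP.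
apply/eqP; rewrite eq_le proj_polar//= leNgt; apply/negP => h.
set p := proj_set K z in Kp h *; have pp := dotv_ge0 p.
pose q := - dotv (z - p) p.
have q0 : 0 < q by rewrite oppr_gt0.
(* If the inner product were negative, shrinking the projection by the factor [1 - a], which stays
   in the cone, would bring it closer to [z]. *)
pose a := q / (dotv p p + q + 1).
have D0 : 0 < dotv p p + q + 1 by lra.
have a0 : 0 < a by rewrite divr_gt0.
have e : a * (dotv p p + q + 1) = q by rewrite divfK// gt_eqF.
have a1 : 0 < 1 - a by rewrite subr_gt0 ltr_pdivrMr// mul1r; lra.
have := proj_min (KZ _ _ a1 Kp).
rewrite scalerBl scale1r opprB addrCA addrC !(dotvDl _ (a *: p)) !(dotvDr _ (a *: p)) !(dotvZl, dotvZr) (dotvC p).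
have qE : dotv (z - p) p = - q by rewrite opprK.
rewrite -/p qE.
move: e a0 q0 pp; move: (dotv (z - p) (z - p)) (dotv p p) (q) (a) => y r s c e c0 s0 r0.
have cr : c * r <= s by have := mulr_ge0 (ltW c0) (ltW s0); lra.
have : 0 < c * (2 * s - c * r) by rewrite mulr_gt0//; lra.
by lra.
Qed.

End projection.

(* With n = z - Proj z one has z.n = |n|^2 and k.n <= 0 on K, so the square distance
   of z + d to K lies between its linearisation at z and the latter plus |d|^2. *)
Lemma dist_set_sqr K z d : approx_closed_cone K ->
  dotv (z - proj_set K z) (z - proj_set K z) + 2 * dotv (z - proj_set K z) d <=
    dist_set K (z + d) ^+ 2 <=
  dotv (z - proj_set K z) (z - proj_set K z) + 2 * dotv (z - proj_set K z) d + dotv d d.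
Proof.
move=> hK.
have lin1 (x y w v t : R) : t = x + y - w -> w <= 0 -> 2 * t <= v + x -> x + 2 * y <= v by lra.
have lin2 (x y v : R) : x + y + (y + v) = x + 2 * y + v by ring.
set p := proj_set K z; have [Kp _] := proj_setP hK z; have [Kq eq] := proj_setP hK (z + d).
have hpo := proj_orthogonal hK z; have hpp := proj_polar hK z Kq.
rewrite -/p in Kp hpo hpp; set q := proj_set K (z + d) in Kq eq hpp.
apply/andP; split.
  have key (a b : 'cV[R]_n) : 2 * dotv b a <= dotv a a + dotv b b.
    by have := dotv_ge0 (a - b); rewrite dotvBl !dotvBr (dotvC a b); lra.
  rewrite -eq enormK.
  have e : dotv (z - p) (z + d - q) = dotv (z - p) (z - p) + dotv (z - p) d - dotv (z - p) q.
    rewrite -[dotv (z - p) (z - p)]addr0 -hpo -!dotvDr -dotvBr; congr dotv.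
    by rewrite subrK.
  exact: lin1 e hpp (key _ _).
apply: (@le_trans _ _ (enorm (z + d - p) ^+ 2)).
  by rewrite ler_pXn2r ?nnegrE ?enorm_ge0 ?dist_set_le//; exact: dist_set_ge0 Kp.
by rewrite enormK addrAC (dotvDl _ d) (dotvDr (z - p)) (dotvDr (z - p) d) (dotvC d) lin2.
Qed.

(** One inequality, used for [a] and for [a^-1]. This homogeneity is what relates the drivers of
    different risk aversions. *)
Lemma dist_set_scale K z (a : R) : approx_closed_cone K -> 0 < a ->
  dist_set K (a *: z) ^+ 2 = a ^+ 2 * dist_set K z ^+ 2.
Proof.
move=> hK; have le (c : R) v : 0 < c -> dist_set K (c *: v) ^+ 2 <= c ^+ 2 * dist_set K v ^+ 2.
  move=> c0; have [K0 _ KZ _] := hK; have [Kp <-] := proj_setP hK v.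
  have h := dist_set_le (c *: v) (KZ _ _ c0 Kp).
  apply: (@le_trans _ _ (enorm (c *: v - c *: proj_set K v) ^+ 2)).
    by rewrite ler_pXn2r ?nnegrE ?enorm_ge0//; exact: dist_set_ge0 K0.
  by rewrite -scalerBr !enormK dotvZl dotvZr mulrA -expr2.
move=> a0; apply/eqP; rewrite eq_le le//=.
have ai : 0 < a^-1 by rewrite invr_gt0.
have := le _ (a *: z) ai; rewrite scalerA mulVf ?gt_eqF// scale1r exprVn.
by rewrite -ler_pdivrMl ?invr_gt0 ?exprn_gt0// invrK.
Qed.

End cone.

(** * Linear images of closed cones *)

Section linear_image.
Context {R : realType} {d n : nat}.
Implicit Types (C : set 'cV[R]_d) (s : 'M[R]_(d, n)).

Lemma closed_cV_approx C (c : 'cV[R]_d) : closed C ->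
  (forall e : R, 0 < e -> exists2 c', C c' & forall i, `|c i 0 - c' i 0| < e) -> C c.
Proof.
move=> cl h; apply: cl => A /nbhs_ballP[e /= e0 hA].
have [c' Cc' hc'] := h e e0; exists c'; split=> //; apply: hA.
by split=> // i j; rewrite ord1; exact: hc'.
Qed.

Lemma convex_cone_add C (c c' : 'cV[R]_d) : closed_convex_cone C -> C c -> C c' -> C (c + c').
Proof.
move=> [_ cC zC] Cc Cc'.
have h0 : 0 <= (2^-1 : R) by rewrite invr_ge0.
have h1 : (2^-1 : R) <= 1 by rewrite invf_le1// ler1n.
have := cC c c' (Itv01 h0 h1) (mem_set Cc) (mem_set Cc'); rewrite inE => h.
have := zC 2 _ (ltr0Sn _ 1) h.
rewrite (_ : 2 *: _ = c + c')//.
have -> : conv (Itv01 h0 h1) (c : convex_lmodType 'cV[R]_d) c' = 2^-1 *: c + (1 - 2^-1) *: c' by [].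
by rewrite scalerDr !scalerA mulrBr mulr1 divff// (_ : 2 - 1 = 1 :> R) ?scale1r//; lra.
Qed.

Lemma mulmx_coord_le p q (s : 'M[R]_(p, q)) : exists2 K : R, 0 < K &
  forall (u : 'cV[R]_q) i, `|(s *m u) i 0| <= K * enorm u.
Proof.
exists (\sum_i \sum_j `|s i j| + 1).
  by rewrite ltr_wpDl// sumr_ge0// => i _; rewrite sumr_ge0.
move=> u i; rewrite mxE; apply: (le_trans (ler_norm_sum _ _ _)).
apply: (@le_trans _ _ (\sum_j `|s i j| * enorm u)).
  apply: ler_sum => j _; rewrite normrM; apply: ler_wpM2l => //.
  rewrite -(ler_pXn2r (ltn0Sn 1)) ?nnegrE ?enorm_ge0// enormK real_normK ?num_real//.
  exact: dotv_coord.
rewrite -mulr_suml; apply: ler_wpM2r; first exact: enorm_ge0.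
rewrite [X in _ <= X + _](bigD1 i)//= -addrA lerDl addr_ge0// sumr_ge0// => k _.
by rewrite sumr_ge0.
Qed.

(** [M] is a left inverse of [s^T], so preimages of approximating points converge to [M *m z], which
    lies in [C]; [A = 1 - s^T M] vanishes on images, hence on [z], and [z] is the image of
    [M *m z]. *)
Lemma image_approx_closed_cone C s : closed_convex_cone C -> C 0 ->
  s *m s^T \in unitmx -> approx_closed_cone [set s^T *m p | p in C].
Proof.
move=> hC C0 us; have [cl _ zC] := hC; split.
- by exists 0 => //; rewrite mulmx0.
- move=> _ _ [p Cp <-] [q Cq <-]; exists (p + q); last by rewrite mulmxDr.
  exact: convex_cone_add.
- by move=> a _ a0 [p Cp <-]; exists (a *: p); rewrite ?scalemxAr//; exact: zC.
move=> z hz; pose M := invmx (s *m s^T) *m s.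
have MK p : M *m (s^T *m p) = p by rewrite /M -mulmxA (mulmxA s) mulmxA mulVmx// mul1mx.
have [K1 K10 hK1] := mulmx_coord_le M.
have hz' e : 0 < e -> exists2 p, C p & enorm (z - s^T *m p) < e.
  move=> e0; have [_ [p Cp <-] h] := hz (e ^+ 2) (exprn_gt0 _ e0).
  exists p => //; rewrite -(@ltr_pXn2r _ 2) ?nnegrE ?enorm_ge0 ?(ltW e0)//.
  by rewrite enormK.
exists (M *m z).
  apply: closed_cV_approx => // e e0; have [p Cp hp] := hz' _ (divr_gt0 e0 K10).
  exists p => // i; rewrite -[p in X in _ - X]MK.
  have -> : (M *m z) i 0 - (M *m (s^T *m p)) i 0 = (M *m (z - s^T *m p)) i 0.
    by rewrite mulmxBr !mxE.
  by apply: (le_lt_trans (hK1 _ i)); rewrite mulrC -ltr_pdivlMr.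
pose A := 1%:M - s^T *m M; have [K2 K20 hK2] := mulmx_coord_le A.
suff A0 : A *m z = 0.
  by move: A0; rewrite mulmxBl mul1mx -mulmxA => /eqP; rewrite subr_eq0 => /eqP/esym.
apply/matrixP => i j; rewrite ord1 [in RHS]mxE.
apply/eqP; rewrite -normr_le0; apply/ler_addgt0Pr => e e0; rewrite add0r.
have [p Cp hp] := hz' _ (divr_gt0 e0 K20).
have -> : A *m z = A *m (z - s^T *m p).
  have Ap : A *m (s^T *m p) = 0 by rewrite /A mulmxBl mul1mx -mulmxA MK subrr.
  by rewrite mulmxBr Ap subr0.
by apply: (le_trans (hK2 _ i)); rewrite mulrC -ler_pdivlMr// ltW.
Qed.

(** A countable family dense in [C]: one point of [C] for each rational vector and mesh, and 0 if
    [C] has none within the mesh. It turns the distance to the constraint set into a countable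
    infimum, whence its predictability. *)
Definition rational_point (C : set 'cV[R]_d) (qn : {ffun 'I_d -> rat} * nat) : 'cV[R]_d :=
  xget 0 [set c | C c /\ forall i, `|(ratr (qn.1 i) : R) - c i 0| < qn.2.+1%:R^-1].

Lemma rational_point_in C qn : C 0 -> C (rational_point C qn).
Proof.
by move=> C0; rewrite /rational_point; case: xgetP => // c _ [].
Qed.

Lemma rational_point_dense C (c : 'cV[R]_d) (e : R) : C c -> 0 < e ->
  exists qn, forall i, `|c i 0 - rational_point C qn i 0| < e.
Proof.
move=> Cc e0; have e2 : 0 < e / 2 by rewrite divr_gt0.
have [n0 _ /(_ _ (leqnn _)) hn] := near_infty_natSinv_lt (PosNum e2).
have hq i : exists q : rat, `|(ratr q : R) - c i 0| < n0.+1%:R^-1.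
  have n1 : 0 < n0.+1%:R^-1 :> R by rewrite invr_gt0.
  have lt : c i 0 - n0.+1%:R^-1 < c i 0 + n0.+1%:R^-1 by rewrite ltrD2l gtrN.
  have [q] := rat_in_itvoo lt; rewrite in_itv/= => hq; exists q.
  by rewrite ltr_distl.
pose q := [ffun i => projT1 (cid (hq i))].
exists (q, n0) => i.
have hc : C c /\ forall i, `|(ratr (q i) : R) - c i 0| < n0.+1%:R^-1.
  by split=> // k; rewrite ffunE; case: cid.
have [_ /(_ i) h1] := xgetPex 0 (ex_intro _ c hc : exists c, [set c | C c /\ forall i, `|(ratr ((q, n0).1 i) : R) - c i 0| < (q, n0).2.+1%:R^-1] c).
have h2 := hc.2 i; move: hn h1 h2; rewrite -/(rational_point C (q, n0)) /=.
move: (rational_point _ _ i 0) (ratr (q i) : R) (c i 0) (n0.+1%:R^-1) => x y z u hn.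
by rewrite !ltr_distl => /andP[? ?] /andP[? ?]; apply/andP; split; lra.
Qed.

Lemma dist_set_image_dense C s (z : 'cV[R]_n) (e : R) : closed_convex_cone C -> C 0 ->
  s *m s^T \in unitmx -> 0 < e ->
  exists qn, dotv (z - s^T *m rational_point C qn) (z - s^T *m rational_point C qn) <
    dist_set [set s^T *m p | p in C] z ^+ 2 + e.
Proof.
move=> hC C0 us e0; have hK := image_approx_closed_cone hC C0 us.
have [[p Cp pE]] := proj_setP hK z; rewrite -pE => <-; rewrite enormK.
have h (k : nat) : exists qn, forall i, `|p i 0 - rational_point C qn i 0| < k.+1%:R^-1.
  by apply: rational_point_dense => //; rewrite invr_gt0.
pose x k := rational_point C (projT1 (cid (h k))).
have hx k i : `|p i 0 - x k i 0| < k.+1%:R^-1 by rewrite /x; case: cid.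
have cx i : x k i 0 @[k --> \oo] --> p i 0.
  apply/cvgrPdist_le => d0 d00; have [n0 _ hn] := near_infty_natSinv_lt (PosNum d00).
  exists n0 => // k nk; apply: (le_trans (ltW (hx k i))); exact: (ltW (hn k nk)).
have cs i : (s^T *m x k) i 0 @[k --> \oo] --> (s^T *m p) i 0.
  rewrite (funext (fun k => mxE _ _ i 0)) mxE; apply: cvg_sumr => j.
  by apply: cvgM; [exact: cvg_cst|exact: cx].
have := @dotv_cvg R n (fun k => s^T *m x k) (s^T *m p) z cs.
have lt : dotv (z - s^T *m p) (z - s^T *m p) < dotv (z - s^T *m p) (z - s^T *m p) + e by rewrite ltrDl.
by move=> /cvgr_lt/(_ _ lt)[N _ /(_ N (leqnn N)) hN]; exists (projT1 (cid (h N))).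
Qed.

End linear_image.

Section running_min.
Context {R : realType}.

Fixpoint running_min (g : nat -> R) n : R :=
  if n is k.+1 then Num.min (running_min g k) (g n) else g 0%N.

Lemma running_min_cvg (g : nat -> R) (l : R) : (forall i, l <= g i) ->
  (forall e : R, 0 < e -> exists i, g i < l + e) -> running_min g n @[n --> \oo] --> l.
Proof.
move=> lg h; apply/cvgrPdist_le => e e0; have [i hi] := h e e0.
have ge n : l <= running_min g n by elim: n => //= n ih; rewrite le_min ih lg.
have le n : (i <= n)%N -> running_min g n <= g i.
  elim: n => [|n ih]; first by rewrite leqn0 => /eqP ->.
  by rewrite leq_eqVlt => /predU1P[->|/ih k] /=; rewrite ge_min ?lexx ?orbT// k.
exists i => // n /= i_n; rewrite distrC ger0_norm ?subr_ge0//.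
by rewrite lerBlDl (le_trans (le n i_n))// ltW.
Qed.

End running_min.

(** * Exponential integrability *)

Section exponential_bounds.
Context {R : realType}.

Lemma expR_young (s d : R) : 1 < s -> 0 < d -> exists2 K : R, 0 < K &
  forall x : R, expR x <= K + d * expR (s * x).
Proof.
(* Beyond [x0] one has [1 <= d * expR ((s - 1) * x)]. *)
move=> s1 d0; pose x0 := Num.max 0 (- ln d / (s - 1)).
exists (expR x0); first exact: expR_gt0.
move=> x; have [xx|xx] := leP x x0.
  by apply: (@le_trans _ _ (expR x0)); rewrite ?ler_expR// lerDl mulr_ge0 ?expR_ge0 ?ltW.
apply: (@le_trans _ _ (d * expR (s * x))); last by rewrite lerDr expR_ge0.
rewrite -{1}[d]lnK ?posrE// -expRD ler_expR.
have : - ln d / (s - 1) <= x by apply: le_trans (ltW xx); rewrite le_max lexx orbT.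
by rewrite ler_pdivrMr ?subr_gt0//; lra.
Qed.

(** Replaces Hoelder's inequality for a density [expR x] with a moment of order [1 + e]. The
    exponent [2 * (1 + e) / e] of the other factor is twice the conjugate one, which leaves room for
    an arbitrarily small [d]. *)
Lemma expR_add_young (e d : R) : 0 < e -> 0 < d -> exists2 K : R, 0 < K &
  forall x u : R, expR (x + u) <= K + d * (expR ((1 + e) * x) + expR (2 * (1 + e) / e * u)).
Proof.
move=> e0 d0; set p := 2 * (1 + e) / e.
have e1 : 0 < 1 + e by lra.
have e2 : 0 < 1 + e / 2 by lra.
have p0 : 0 < p by rewrite divr_gt0// mulr_gt0.
have s1 : 1 < (1 + e) / (1 + e / 2) by rewrite ltr_pdivlMr// mul1r; lra.
have [K K0 hK] := expR_young s1 d0; exists (K + 1); first by rewrite ltr_wpDl// ltW.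
move=> x u; have h1 := expR_ge0 ((1 + e) * x); have h2 := expR_ge0 (p * u).
have ep : e * p = 2 * (1 + e) by rewrite /p mulrC divfK// gt_eqF.
pose M := Num.max ((1 + e) * x) (p * u).
have m1 : (1 + e) * x <= M by rewrite le_max lexx.
have m2 : p * u <= M by rewrite le_max lexx orbT.
have [M0|M0] := lerP 0 M; last first.
  apply: (@le_trans _ _ 1); last first.
    have : 0 <= d * (expR ((1 + e) * x) + expR (p * u)).
      by apply: mulr_ge0; [exact: ltW|exact: addr_ge0].
    by move: (d * _) => S; lra.
  rewrite -expR0 ler_expR; nra.
have MM : expR M <= expR ((1 + e) * x) + expR (p * u).
  by rewrite /M /Num.max; case: ifP => _; rewrite ?lerDl ?lerDr.
(* The sum of the bounds [x <= M / (1 + e)] and [u <= M * e / (2 * (1 + e))]. *)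
pose y := M * ((1 + e / 2) / (1 + e)).
have xy : x + u <= y.
  rewrite /y mulrA ler_pdivlMr//.
  have : e * ((1 + e) * u) * 2 = e * (p * u) * e by rewrite [e * (p * u)]mulrA ep; ring.
  nra.
apply: (@le_trans _ _ (expR y)); first by rewrite ler_expR.
apply: (le_trans (hK y)).
have -> : (1 + e) / (1 + e / 2) * y = M.
  rewrite /y; field; lra.
rewrite -addrA lerD2l; apply: (@le_trans _ _ (d * (expR ((1 + e) * x) + expR (p * u)))).
  by rewrite ler_pM2l.
by rewrite lerDr.
Qed.

Lemma expR_amgm (x y : R) : expR ((x + y) / 2) <= 2^-1 * (expR x + expR y).
Proof.
rewrite (_ : expR x = expR (x / 2) ^+ 2); last by rewrite expr2 -expRD; congr expR; lra.
rewrite (_ : expR y = expR (y / 2) ^+ 2); last by rewrite expr2 -expRD; congr expR; lra.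
rewrite (_ : (x + y) / 2 = x / 2 + y / 2); last lra.
by rewrite expRD; have := sqr_ge0 (expR (x / 2) - expR (y / 2)); nra.
Qed.

End exponential_bounds.

Section weighted_limits.
Context {disp : measure_display} {Omega : measurableType disp} {R : realType}.
Variable P : probability Omega R.
Implicit Types (L U X : nat -> Omega -> R).

(** The form in which limits are taken later: [expR (L n)] is a stopped density, and [X n] is
    dominated by a variable with bounded moments of the order that [expR_add_young] pairs with
    it. *)
Lemma weighted_vitali (e k M : R) L U X (Y : Omega -> R) : 0 < e -> 0 <= k ->
  (forall n, measurable_fun setT (L n)) -> (forall n, measurable_fun setT (X n)) ->
  measurable_fun setT Y ->
  (forall n, L1 P (fun w => expR ((1 + e) * L n w)) /\ Ex P (fun w => expR ((1 + e) * L n w)) <= 2) ->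
  (forall n, L1 P (fun w => expR (2 * (1 + e) / e * U n w)) /\
     Ex P (fun w => expR (2 * (1 + e) / e * U n w)) <= M) ->
  (forall n, {ae P, forall w, `|X n w| <= k * expR (U n w)}) ->
  {ae P, forall w, expR (L n w) * X n w @[n --> \oo] --> Y w} ->
  [/\ L1 P Y, forall n, L1 P (fun w => expR (L n w) * X n w) &
      Ex P (fun w => expR (L n w) * X n w) @[n --> \oo] --> Ex P Y].
Proof.
move=> e0 k0 mL mX mY hL hU XU cY.
pose Z n w := expR ((1 + e) * L n w) + expR (2 * (1 + e) / e * U n w).
have iZ n : L1 P (Z n) by apply: L1D; [exact: (hL n).1|exact: (hU n).1].
have Z0 n w : 0 <= Z n w by rewrite addr_ge0 ?expR_ge0.
have ZE n : Ex P (Z n) <= 2 + M.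
  by rewrite ExD; [apply: lerD; [exact: (hL n).2|exact: (hU n).2]|exact: (hL n).1|exact: (hU n).1].
have mW n : measurable_fun setT (fun w => expR (L n w) * X n w).
  by apply: measurable_funM => //; exact: measurableT_comp.
have UI (d : R) : 0 < d -> exists K : R, forall n, {ae P, forall w, `|expR (L n w) * X n w| <= K + d * Z n w}.
  move=> d0; have dk : 0 < d / (k + 1) by rewrite divr_gt0// ltr_wpDl.
  have [K K0 hK] := expR_add_young e0 dk; exists (k * K) => n.
  apply: filterS (XU n) => w h; rewrite normrM ger0_norm ?expR_ge0//.
  apply: (@le_trans _ _ (k * expR (L n w + U n w))).
    by rewrite expRD mulrCA ler_wpM2l ?expR_ge0.
  apply: (@le_trans _ _ (k * (K + d / (k + 1) * Z n w))); first by rewrite ler_wpM2l.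
  rewrite mulrDr lerD2l mulrA; apply: ler_wpM2r => //.
  by rewrite mulrA [k * d]mulrC -mulrA ler_piMr ?ltW// ltr_pdivrMr ?ltr_wpDl// mul1r ltrDl.
have [iY iW c] := vitali mW mY cY iZ Z0 ZE UI.
by split=> //; exact: cvg_Ex.
Qed.

(** Only the negative parts of [X n] are dominated. They converge in mean by [weighted_vitali], and
    Fatou's lemma handles the positive parts. It is meant for wealth processes of which only the
    losses are controlled. *)
Lemma fatou_upper (e k M x : R) L U X (Y : Omega -> R) : 0 < e -> 0 <= k ->
  (forall n, measurable_fun setT (L n)) -> (forall n, measurable_fun setT (X n)) ->
  measurable_fun setT Y ->
  (forall n, L1 P (fun w => expR ((1 + e) * L n w)) /\ Ex P (fun w => expR ((1 + e) * L n w)) <= 2) ->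
  (forall n, L1 P (fun w => expR (2 * (1 + e) / e * U n w)) /\
     Ex P (fun w => expR (2 * (1 + e) / e * U n w)) <= M) ->
  (forall n, {ae P, forall w, Num.max (- X n w) 0 <= k * expR (U n w)}) ->
  {ae P, forall w, expR (L n w) * X n w @[n --> \oo] --> Y w} ->
  (forall n, L1 P (fun w => expR (L n w) * X n w)) ->
  (forall n, Ex P (fun w => expR (L n w) * X n w) <= x) ->
  L1 P Y /\ Ex P Y <= x.
Proof.
move=> e0 k0 mL mX mY hL hU XU cY iX EX.
have mneg (f : Omega -> R) : measurable_fun setT f -> measurable_fun setT (fun w => Num.max (- f w) 0).
  by move=> mf; apply: measurable_maxr => //; exact: measurableT_comp.
have mpos (f : Omega -> R) : measurable_fun setT f -> measurable_fun setT (fun w => Num.max (f w) 0).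
  by move=> mf; apply: measurable_maxr.
have me (y : R) : Num.max y 0 = (y + `|y|) * 2^-1.
  by have [y0|y0] := lerP 0 y; rewrite ?(max_l y0) ?(max_r (ltW y0)) ?(ger0_norm y0) ?(ltr0_norm y0); lra.
have cmax (u : nat -> R) (l : R) : u n @[n --> \oo] --> l -> Num.max (u n) 0 @[n --> \oo] --> Num.max l 0.
  move=> h; rewrite (funext (fun n => me (u n))) me; apply: cvgMl; apply: cvgD => //.
  exact: cvg_norm.
have maxM (a y : R) : Num.max (expR a * y) 0 = expR a * Num.max y 0.
  by rewrite -{1}[0](mulr0 (expR a)) maxr_pMr ?expR_ge0.
have [iYn iXn cn] := @weighted_vitali e k M L U (fun n w => Num.max (- X n w) 0)
  (fun w => Num.max (- Y w) 0) e0 k0 mL (fun n => mneg _ (mX n)) (mneg _ mY) hL hU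
  ltac:(move=> n; apply: filterS (XU n) => w; rewrite ger0_norm// le_max lexx orbT//)
  ltac:(apply: filterS cY => w /(@cvgN _ _ _ _ _ _)/cmax; under eq_fun do rewrite -mulrN maxM; by []).
pose Xp n w := expR (L n w) * Num.max (X n w) 0.
have XpE n w : Xp n w = expR (L n w) * X n w + expR (L n w) * Num.max (- X n w) 0.
  by rewrite -mulrDr; congr (_ * _); rewrite !me normrN; lra.
have iXp n : L1 P (Xp n) by rewrite (funext (XpE n)); exact: L1D.
have bd (d : R) : 0 < d -> L1 P (fun w => Num.max (Y w) 0) /\
    Ex P (fun w => Num.max (Y w) 0) <= x + Ex P (fun w => Num.max (- Y w) 0) + d.
  move=> d0; have lt : Ex P (fun w => Num.max (- Y w) 0) < Ex P (fun w => Num.max (- Y w) 0) + d by rewrite ltrDl.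
  have /cvgr_lt/(_ _ lt)[N _ hN] := cn.
  apply: (@fatou_Ex _ _ _ P (fun n => Xp (N + n)%N)) => //.
  - exact: mpos.
  - by move=> n w; rewrite mulr_ge0 ?expR_ge0// le_max lexx orbT.
  - apply: filterS cY => w /cmax h; rewrite (_ : (fun n => _) = fun n => Num.max (expR (L (n + N)%N w) * X (n + N)%N w) 0).
      by rewrite (cvg_shiftn N (fun n => Num.max (expR (L n w) * X n w) 0)).
    by apply/funext => n; rewrite maxM addnC.
  - move=> n; rewrite (funext (XpE _)) ExD//; have := EX (N + n)%N.
    by have := hN (N + n)%N (leq_addr _ _); move=> /=; lra.
have iYp : L1 P (fun w => Num.max (Y w) 0) by exact: (bd 1 ltr01).1.
have YE w : Y w = Num.max (Y w) 0 - Num.max (- Y w) 0.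
  by rewrite !me normrN; lra.
have iY : L1 P Y by rewrite (funext YE); exact: L1B.
split=> //; rewrite (funext YE) ExB// lerBlDr; apply/ler_addgt0Pr => d d0.
exact: (bd d d0).2.
Qed.

End weighted_limits.

(** * Densities and uniform integrability *)

Section change_of_measure.
Context {disp : measure_display} {Omega : measurableType disp} {R : realType}.
Variables (P Q : probability Omega R) (L : Omega -> R).
Hypothesis mL : measurable_fun setT L.
Hypothesis hQ : forall A, measurable A -> Q A = (\int[P]_(w in A) (expR (L w))%:E)%E.

Lemma change_integral (f : Omega -> R) : measurable_fun setT f -> (forall w, 0 <= f w) ->
  (\int[Q]_w (f w)%:E = \int[P]_w (expR (L w) * f w)%:E)%E.
Proof.
move=> mf f0.
have mE : measurable_fun setT (fun w => expR (L w)) by exact: measurableT_comp.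
have := @integral_transfer _ _ _ _ R P Q id (fun w => expR (L w)) 1 (@measurable_id _ _ setT) mE (fun w => expR_ge0 _) ler01 _ f mf f0.
rewrite mul1e => <-; first by apply: eq_integral => w _; rewrite mulrC.
move=> U mU; rewrite mul1e; apply/esym/(etrans (hQ mU)).
rewrite [LHS]integral_mkcond; apply: eq_integral => w _.
by rewrite patchE indicE; case: ifP => _; rewrite ?mul1r ?mul0r.
Qed.

Lemma change_L1 X : measurable_fun setT X -> L1 Q X <-> L1 P (fun w => expR (L w) * X w).
Proof.
move=> mX; have mE : measurable_fun setT (fun w => expR (L w)) by exact: measurableT_comp.
have e : (\int[Q]_w `|(X w)%:E| = \int[P]_w `|(expR (L w) * X w)%:E|)%E.
  have := @change_integral (fun w => `|X w|) _ (fun w => normr_ge0 _).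
  move=> ->; last exact: measurableT_comp.
  by apply: eq_integral => w _; rewrite /= normrM (ger0_norm (expR_ge0 _)).
by split=> /integrableP[_ h]; apply/integrableP; split; rewrite ?e// -?e//;
  apply/measurable_EFinP => //; exact: measurable_funM.
Qed.

Lemma change_Ex X : L1 P (fun w => expR (L w) * X w) -> measurable_fun setT X ->
  Ex Q X = Ex P (fun w => expR (L w) * X w).
Proof.
move=> iX mX; have iQ := (change_L1 mX).2 iX.
have E0 (f : Omega -> R) : measurable_fun setT f -> (forall w, 0 <= f w) ->
    Ex Q f = Ex P (fun w => expR (L w) * f w).
  by move=> mf f0; rewrite /Ex /Rintegral change_integral.
have XE w : X w = `|X w| - (`|X w| - X w) by rewrite opprB addrC subrK.
have mN : measurable_fun setT (fun w => `|X w|) by exact: measurableT_comp.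
have iN := L1_norm iQ; have iD := L1B iN iQ.
have mD := L1_meas iD.
rewrite (funext XE) ExB// E0// E0//; last by move=> w; rewrite subr_ge0 ler_norm.
rewrite -ExB; [|exact/change_L1|exact/change_L1].
by congr Ex; apply/funext => w; rewrite -mulrBr -XE.
Qed.

Lemma change_ae (A : set Omega) : {ae P, forall w, A w} <-> {ae Q, forall w, A w}.
Proof.
have mE : measurable_fun setT (fun w => expR (L w)) by exact: measurableT_comp.
split=> -[N [mN N0 h]]; exists N; split=> //.
  by rewrite hQ// null_set_integral//; apply: measurable_funTS; exact/measurable_EFinP.
have : {ae P, forall w, N w -> (expR (L w))%:E = 0%E}.
  have [+ _] := ae_eq_integral_abs P mN (measurable_funTS ((measurable_EFinP _ _).2 mE)).
  apply; rewrite -[RHS]N0 hQ//; apply: eq_integral => w _.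
  by rewrite gee0_abs// lee_fin expR_ge0.
move=> [N' [mN' N'0 h']]; apply: measure_negligible => //; exists N'; split=> // w Nw.
by apply: h' => /= k; have := expR_gt0 (L w); move: (k Nw) => [->]; rewrite ltxx.
Qed.

End change_of_measure.

Section exponential_mean.
Context {disp : measure_display} {Omega : measurableType disp} {R : realType}.
Variable Q : probability Omega R.

Lemma expR_quadratic_le (y : R) : expR y <= 1 + y + y ^+ 2 * expR `|y|.
Proof.
have [y0|y0] := lerP 0 y.
  have h := expR_ge1Dx (- y); rewrite expRN in h.
  have e0 := expR_gt0 y; rewrite ger0_norm// expr2.
  have h1 : expR y <= 1 + y * expR y.
    have := ler_wpM2r (ltW e0) h; rewrite mulVf ?gt_eqF//; lra.
  by apply: (le_trans h1); have := ler_wpM2l y0 h1; rewrite mulrDr mulr1 mulrA; lra.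
have h := expR_ge1Dx (- y); have e0 := expR_gt0 y; have e1 := expR_gt0 (- y).
have ee : expR y * expR (- y) = 1 by rewrite -expRD subrr expR0.
rewrite ltr0_norm//.
have h1 : expR y * (1 - y) <= 1 by rewrite -[leRHS]ee ler_pM2l.
have h2 : expR y <= 1 + y + y ^+ 2.
  have d0 : 0 < 1 - y by lra.
  rewrite -(ler_pM2r d0); apply: (le_trans h1).
  have : 0 <= - y * y ^+ 2 by rewrite mulr_ge0 ?sqr_ge0// oppr_ge0 ltW.
  by rewrite expr2; nra.
apply: (le_trans h2); rewrite lerD2l ler_peMr ?sqr_ge0//.
by apply: le_trans h; lra.
Qed.

(** The origin of the rate [K alpha]: the bound [expR y <= 1 + y + y ^+ 2 * expR |y|] at
    [y = a * F], where [a <= 1] and [F ^+ 2 <= 4 * expR |F|]. *)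
Lemma exp_mean_le (F : Omega -> R) (a : R) : 0 < a -> a <= 1 -> measurable_fun setT F ->
  L1 Q F -> L1 Q (fun w => expR (2 * `|F w|)) -> L1 Q (fun w => expR (a * F w)) ->
  Ex Q (fun w => expR (a * F w)) <= expR (a * Ex Q F + a ^+ 2 * (4 * Ex Q (fun w => expR (2 * `|F w|)))).
Proof.
move=> a0 a1 mF iF i2 iE.
apply: le_trans (expR_ge1Dx _).
have iG : L1 Q (fun w => 1 + (a * F w + a ^+ 2 * (4 * expR (2 * `|F w|)))).
  by apply: L1D; [exact: L1_cst|apply: L1D; [exact: L1Z|apply: L1Z; exact: L1Z]].
apply: (le_trans (Ex_le iE iG _)).
  apply: aeW => w; apply: (le_trans (expR_quadratic_le _)); rewrite -addrA !lerD2l exprMn -mulrA.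
  apply: ler_wpM2l; first exact: sqr_ge0.
  rewrite (_ : 2 * `|F w| = `|F w| + `|F w|) ?expRD ?mulrA; last lra.
  apply: ler_pM; rewrite ?sqr_ge0 ?expR_ge0//.
    rewrite -real_normK ?num_real//; have := expR_ge1Dx (`|F w| / 2); have := normr_ge0 (F w).
    rewrite (_ : expR `|F w| = expR (`|F w| / 2) ^+ 2); last by rewrite expr2 -expRD; congr expR; lra.
    by move: `|F w| (expR _) => x y x0 h; rewrite !expr2; nra.
  by rewrite ler_expR normrM (ger0_norm (ltW a0)) ler_piMl.
rewrite ExD ?Ex_cst ?ExD ?ExZ//; [exact: L1Z|exact: L1Z|by apply: L1Z; exact: L1Z|exact: L1_cst|].
by apply: L1D; [exact: L1Z|apply: L1Z; exact: L1Z].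
Qed.

End exponential_mean.

Section partition.
Context {disp : measure_display} {Omega : measurableType disp} {R : realType}.
Variable Q : probability Omega R.

Lemma integral_indic_Ex (A : set Omega) (X : Omega -> R) : measurable A -> L1 Q X ->
  L1 Q (fun w => \1_A w * X w) /\ (\int[Q]_(w in A) (X w)%:E = (Ex Q (fun w => \1_A w * X w))%:E)%E.
Proof.
move=> mA iX; have i : L1 Q (fun w => \1_A w * X w).
  apply: (L1_le _ _ (L1_norm iX)).
    by apply: measurable_funM; [exact: measurable_indic|exact: (L1_meas iX)].
  apply: aeW => w; rewrite normrM ler_piMl// indicE; case: (_ \in _) => /=; rewrite ?normr1//.
  by rewrite normr0.
split=> //; rewrite (EFin_Ex i) integral_mkcond; apply: eq_integral => w _.
by rewrite patchE indicE; case: ifP => _; rewrite ?mul1r ?mul0r.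
Qed.

Lemma measurable_partition (f : Omega -> nat) (X : nat -> Omega -> R) :
  (forall j, measurable [set w | f w = j]) -> (forall j, measurable_fun setT (X j)) ->
  measurable_fun setT (fun w => X (f w) w).
Proof.
move=> mf mX _ V mV; rewrite setTI.
rewrite (_ : _ @^-1` V = \bigcup_j ([set w | f w = j] `&` (X j @^-1` V))).
  by apply: bigcupT_measurable => j; apply: measurableI => //; rewrite -[X in measurable X]setTI; exact: mX.
by apply/seteqP; split=> [w /= h|w [j _ [/= <-]]//]; exists (f w).
Qed.

(** Integrability of [X] is part of the conclusion: the bounds on the first [n] pieces add up, and
    Fatou's lemma passes to the limit. *)
Lemma Ex_le_partition (f : Omega -> nat) (X Z : Omega -> R) :
  (forall j, measurable [set w | f w = j]) -> measurable_fun setT X ->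
  (forall w, 0 <= X w) -> (forall w, 0 <= Z w) -> L1 Q Z ->
  (forall j, L1 Q (fun w => \1_[set w | f w = j] w * X w) /\
    Ex Q (fun w => \1_[set w | f w = j] w * X w) <= Ex Q (fun w => \1_[set w | f w = j] w * Z w)) ->
  L1 Q X /\ Ex Q X <= Ex Q Z.
Proof.
move=> mf mX X0 Z0 iZ h.
have E j w : \1_[set w | f w = j] w = (f w == j)%:R :> R.
  by rewrite indicE; case: eqVneq => [e|/eqP e]; [rewrite mem_set|rewrite memNset].
have S n w : (f w < n.+1)%N%:R = (f w < n)%N%:R + \1_[set w | f w = n] w :> R.
  by rewrite E ltnS leq_eqVlt; case: eqVneq => [->|_] /=; rewrite ?ltnn ?add0r ?addr0.
have part n : [/\ L1 Q (fun w => (f w < n)%N%:R * X w), L1 Q (fun w => (f w < n)%N%:R * Z w) &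
    Ex Q (fun w => (f w < n)%N%:R * X w) <= Ex Q (fun w => (f w < n)%N%:R * Z w)].
  elim: n => [|n [i1 i2 le]].
    have z (V : Omega -> R) : (fun w => (f w < 0)%N%:R * V w) = fun=> 0 by apply/funext => w; rewrite mul0r.
    by rewrite !z; split=> //; exact: L1_cst.
  have [i3 le3] := h n; have i4 := (integral_indic_Ex (mf n) iZ).1.
  have D (V : Omega -> R) : (fun w => (f w < n.+1)%N%:R * V w) =
      fun w => (f w < n)%N%:R * V w + \1_[set w | f w = n] w * V w.
    by apply/funext => w; rewrite S mulrDl.
  by rewrite !D; split; [exact: L1D|exact: L1D|rewrite !ExD//; exact: lerD].
apply: (@fatou_Ex _ _ _ Q (fun n w => (f w < n)%N%:R * X w)) => //.
- by move=> n; have [] := part n.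
- by move=> n w; rewrite mulr_ge0.
- apply: aeW => w; apply: cvg_near_cst; exists (f w).+1 => // n /= fn.
  by rewrite fn mul1r.
- move=> n; have [_ i le] := part n; apply: (le_trans le); apply: Ex_le => //.
  by apply: aeW => w; case: (_ < _)%N; rewrite ?mul1r ?mul0r.
Qed.

End partition.

Section uniform_integrability.
Context {disp : measure_display} {Omega : measurableType disp} {R : realType}.
Variable P : probability Omega R.

(** The integral of a nonnegative function is a supremum over simple functions below it, hence
    monotone without measurability. This matters for suprema over time and for tail events of
    arbitrary families. *)
Lemma integral_le_nonmeasurable (f g : Omega -> \bar R) : (forall w, 0 <= f w)%E ->
  (forall w, f w <= g w)%E -> (\int[P]_w f w <= \int[P]_w g w)%E.
Proof.
move=> f0 fg; rewrite !ge0_integralTE//; last by move=> w; exact: le_trans (f0 w) (fg w).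
by apply: le_ereal_sup => _ [h hf <-]; exists h => // w; exact: le_trans (hf w) (fg w).
Qed.

Lemma truncated_Ex (X : Omega -> R) (c e : R) : measurable_fun setT X -> (forall w, 0 <= X w) ->
  (\int[P]_(w in [set w | (c < `|X w|)%R]) `|X w|%:E <= e%:E)%E -> 0 <= c ->
  L1 P X /\ Ex P X <= Ex P (fun w => Num.min (X w) c) + e.
Proof.
move=> mX X0 tail c0; pose A := [set w | c < `|X w|].
have mA : measurable A.
  rewrite (_ : A = X @^-1` `]c, +oo[); last first.
    by apply/seteqP; split=> w /=; rewrite /A /= in_itv/= andbT ger0_norm.
  by rewrite -[X in measurable X]setTI; apply: mX => //; exact: measurable_itv.
have mI : measurable_fun setT (fun w => \1_A w * X w) by apply: measurable_funM => //; exact: measurable_indic.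
have I0 w : 0 <= \1_A w * X w by rewrite mulr_ge0// indicE.
have iE : (\int[P]_w (\1_A w * X w)%:E <= e%:E)%E.
  apply: le_trans tail; rewrite [leRHS]integral_mkcond; apply: ge0_le_integral => //.
  - by move=> w _; rewrite lee_fin.
  - exact/measurable_EFinP.
  - by apply/(measurable_restrictT _ mA)/measurable_funTS/measurable_EFinP; exact: measurableT_comp.
  - by move=> w _; rewrite patchE indicE; case: ifP => _; rewrite ?mul1r ?mul0r// lee_fin ger0_norm.
have i1 : L1 P (fun w => \1_A w * X w).
  apply/integrableP; split; first exact/measurable_EFinP.
  under eq_integral => w _ do rewrite gee0_abs ?lee_fin//.
  exact: le_lt_trans iE (ltry _).
have i2 : L1 P (fun w => Num.min (X w) c).
  apply: (@L1_bounded _ _ _ _ _ c); first exact: measurable_minr.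
  by apply: aeW => w; rewrite ger0_norm ?le_min ?X0// ge_min lexx orbT.
have le w : X w <= Num.min (X w) c + \1_A w * X w.
  rewrite indicE; have [/set_mem/= h|] := boolP (w \in A).
    by rewrite mul1r lerDr le_min X0.
  by move/negP => h; rewrite mul0r addr0 min_l// leNgt; apply/negP => k; apply: h; rewrite inE /A/= ger0_norm.
have iX : L1 P X by apply: (L1_le mX _ (L1D i2 i1)); apply: aeW => w; rewrite ger0_norm.
split=> //; apply: (le_trans (Ex_le iX (L1D i2 i1) (aeW _ le))).
by rewrite ExD// lerD2l -lee_fin (EFin_Ex i1).
Qed.

(** Truncation at [c] costs at most [e], uniformly in [n], and the truncated variables converge
    boundedly. Integrability of each [Xn n] comes from the same tail bound, so it may be assumed in
    the last hypothesis. *)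
Lemma uniformly_integrable_ge (family : set (Omega -> R)) (Xn : nat -> Omega -> R) (X : Omega -> R) (v : R) :
  uniformly_integrable P family -> (forall n, family (Xn n)) -> family X ->
  (forall n, measurable_fun setT (Xn n)) -> measurable_fun setT X ->
  (forall n w, 0 <= Xn n w) -> (forall w, 0 <= X w) ->
  {ae P, forall w, Xn n w @[n --> \oo] --> X w} ->
  (forall n, L1 P (Xn n) -> v <= Ex P (Xn n)) -> L1 P X /\ v <= Ex P X.
Proof.
move=> ui fn fX mn mX n0 X0 cX vn.
have tail e : 0 < e -> exists c : R, 0 <= c /\ forall Z, family Z ->
    (\int[P]_(w in [set w | (c < `|Z w|)%R]) `|Z w|%:E <= e%:E)%E.
  move=> e0; have [c hc] := ui e e0; exists `|c|; split=> // Z fZ; apply: le_trans (hc Z fZ).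
  rewrite [leLHS]integral_mkcond [leRHS]integral_mkcond; apply: integral_le_nonmeasurable => w.
    by rewrite patchE; case: ifP => _ //; rewrite lee_fin.
  rewrite !patchE; case: ifPn => [/set_mem/= h|_]; last by case: ifP => _ //; rewrite lee_fin.
  by rewrite mem_set//=; exact: le_lt_trans (ler_norm c) h.
have [c1 [c10 h1]] := tail 1 ltr01.
have iX : L1 P X by exact: (truncated_Ex mX X0 (h1 _ fX) c10).1.
split=> //; apply/ler_addgt0Pr => e e0; have [c [c0 h]] := tail e e0.
have mmin (Z : Omega -> R) : measurable_fun setT Z -> measurable_fun setT (fun w => Num.min (Z w) c).
  by move=> mZ; exact: measurable_minr.
have cmin : {ae P, forall w, Num.min (Xn n w) c @[n --> \oo] --> Num.min (X w) c}.
  apply: filterS cX => w cw.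
  have me (y : R) : Num.min y c = 2^-1 * (y + c - `|y - c|).
    by case: (lerP y c) => h'; lra.
  rewrite me (funext (fun n => me (Xn n w))); apply: cvgMr; apply: cvgB.
    by apply: cvgD => //; exact: cvg_cst.
  by apply: cvg_norm; apply: cvgB => //; exact: cvg_cst.
have im (Z : Omega -> R) : measurable_fun setT Z -> (forall w, 0 <= Z w) -> L1 P (fun w => Num.min (Z w) c).
  move=> mZ Z0; apply: (@L1_bounded _ _ _ _ _ c); first exact: mmin.
  by apply: aeW => w; rewrite ger0_norm ?le_min ?Z0// ge_min lexx orbT.
have UI (d : R) : 0 < d -> exists K : R, forall n, {ae P, forall w, `|Num.min (Xn n w) c| <= K + d * (fun=> 0 : R) w}.
  move=> _; exists c => n; apply: aeW => w; rewrite mulr0 addr0 ger0_norm ?le_min ?n0//.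
  by rewrite ge_min lexx orbT.
have E0 (n : nat) : Ex P (fun=> 0) <= 0 by rewrite Ex_cst.
have [i3 i4 c4] := @vitali _ _ _ P _ (fun _ _ => 0) _ 0 (fun n => mmin _ (mn n)) (mmin _ mX) cmin
  (fun=> L1_cst P 0) (fun _ _ => lexx _) E0 UI.
have cE := cvg_Ex i3 i4 c4.
apply: (@le_trans _ _ (Ex P (fun w => Num.min (X w) c) + e)); last first.
  by rewrite lerD2r; apply: Ex_le => //; apply: aeW => w; rewrite ge_min lexx.
rewrite -lerBlDr -(cvg_lim _ cE)//; apply: limr_ge; first by apply/cvg_ex; eexists; exact: cE.
apply: nearW => n; rewrite lerBlDr; have [i1 h2] := truncated_Ex (mn n) (n0 n) (h _ (fn n)) c0.
exact: le_trans (vn n i1) h2.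
Qed.

(* de la Vallee-Poussin: domination up to arbitrarily small multiples of
   variables with bounded means. *)
Lemma dominated_uniformly_integrable (family : set (Omega -> R)) (M : R) :
  (forall d : R, 0 < d -> exists2 K : R, 0 <= K & forall X, family X -> measurable_fun setT X /\
     exists Z : Omega -> R, [/\ L1 P Z, Ex P Z <= M, forall w, 0 <= Z w &
       {ae P, forall w, `|X w| <= K + d * Z w}]) ->
  uniformly_integrable P family.
Proof.
move=> h e e0; have M0 : 0 < 2 * (`|M| + 1) by rewrite mulr_gt0// ltr_wpDl.
have d0 : 0 < e / (2 * (`|M| + 1)) by rewrite divr_gt0.
have [K K0 hK] := h _ d0; exists (2 * K) => X /hK[mX [Z [iZ EZ Z0 XZ]]].
set d := e / _ in d0 XZ.
pose A := [set w | 2 * K < `|X w|].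
have mN : measurable_fun setT (fun w => `|X w|) by exact: measurableT_comp.
have mA : measurable A.
  rewrite (_ : A = (fun w => `|X w|) @^-1` `]2 * K, +oo[); last first.
    by apply/seteqP; split=> w /=; rewrite /A /= in_itv/= andbT.
  by rewrite -[X in measurable X]setTI; apply: mN => //; exact: measurable_itv.
have iX : L1 P (fun w => `|X w|).
  apply: (L1_le mN _ (L1D (L1_cst P K) (L1Z d iZ))).
  by apply: filterS XZ => w; rewrite normr_id.
have [iA ->] := integral_indic_Ex mA iX; rewrite lee_fin.
apply: (@le_trans _ _ (Ex P (fun w => 2 * d * Z w))).
  apply: Ex_le => //; first exact: L1Z.
  apply: filterS XZ => w k; have dZ : 0 <= d * Z w by rewrite mulr_ge0 ?Z0// ltW.
  rewrite indicE; have [/set_mem/= l|_] := boolP (w \in A); rewrite ?mul1r ?mul0r -mulrA.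
    by move: l; rewrite /A/=; lra.
  by rewrite mulr_ge0.
rewrite ExZ//; apply: (@le_trans _ _ (2 * d * (`|M| + 1))).
  rewrite ler_pM2l ?mulr_gt0//; apply: (le_trans EZ); apply: (le_trans (ler_norm M)).
  by rewrite lerDl.
have <- : d * (2 * (`|M| + 1)) = e by rewrite /d divfK// gt_eqF.
by rewrite le_eqVlt; apply/orP; left; apply/eqP; ring.
Qed.

End uniform_integrability.

(** Dominates a density times its own logarithm: the wealth of the optimal hedge differs from minus
    the log-density by at most [2 * c]. *)
Lemma expR_linear_young (R : realType) (e c : R) : 0 < e -> 0 < c -> forall k : R, 0 < k ->
  exists K : R, forall l : R, expR l * (2 * c + `|l|) <= K + k * expR ((1 + e) * l).
Proof.
move=> e0 c0 k k0; have e1 : 0 < 1 + e / 2 by rewrite addr_gt0 ?divr_gt0.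
have s1 : 1 < (1 + e) / (1 + e / 2) by rewrite ltr_pdivlMr// mul1r; lra.
have p1 : 0 < 2 / e by rewrite divr_gt0.
pose q := 2 * c + 2 / e.
have q0 : 0 < q by rewrite addr_gt0// mulr_gt0.
have [K K0 hK] := expR_young s1 (divr_gt0 k0 q0).
exists (2 * c + 1 + q * K) => l.
have e2 : (1 + e) / (1 + e / 2) * ((1 + e / 2) * l) = (1 + e) * l.
  by rewrite mulrA divfK// gt_eqF.
have h1 := hK ((1 + e / 2) * l); rewrite e2 in h1.
apply: (@le_trans _ _ (2 * c + 1 + q * expR ((1 + e / 2) * l))); last first.
  have := ler_wpM2l (ltW q0) h1; rewrite mulrDr mulrA (mulrC q (k / q)) divfK ?gt_eqF//.
  by move: (q * K) (k * _) (q * _) => *; lra.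
have x0 := expR_gt0 l; have [l0|l0] := lerP 0 l.
  rewrite ger0_norm//.
  rewrite (mulrDl 1 (e / 2) l) mul1r expRD (mulrCA q); have y0 := expR_ge1Dx (e / 2 * l).
  have h : 2 * c + l <= q * expR (e / 2 * l).
    have e3 : 2 / e * (e / 2 * l) = l by field; rewrite gt_eqF.
    have h2 := ler_wpM2l (ltW q0) y0; apply: le_trans h2.
    have -> : q * (1 + e / 2 * l) = q + 2 * c * (e / 2 * l) + l by rewrite mulrDr mulr1 {2}/q mulrDl e3 addrA.
    have : 0 <= 2 * c * (e / 2 * l) by rewrite !mulr_ge0// ?ltW// divr_gt0.
    by move: (2 * c * _) => z; rewrite /q; lra.
  apply: (le_trans (ler_wpM2l (ltW x0) h)); rewrite lerDr; lra.
rewrite (ltr0_norm l0).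
have l1 : expR l <= 1 by rewrite -expR0 ler_expR ltW.
have h2 : expR l * - l <= 1.
  have := expR_ge1Dx (- l); rewrite expRN => h.
  have : expR l * (1 - l) <= 1 by rewrite -ler_pdivlMl// mulr1.
  by rewrite mulrDr mulr1; lra.
have : 0 <= q * expR ((1 + e / 2) * l) by rewrite mulr_ge0 ?expR_ge0// ltW.
have : expR l * (2 * c) <= 2 * c by rewrite ler_piMl// mulr_ge0// ltW.
by rewrite mulrDr; move: (expR l * - l) (expR l * (2 * c)) (q * _) h2 => *; lra.
Qed.

(** * Measurable limits of paths *)

Section limsup_path.
Context {R : realType}.

(** A choice of limit defined for every sequence. Unlike a limit redefined on a null set of paths,
    it keeps limits of predictable processes predictable. *)
Definition limsup_path (u : nat -> R) : R := fine (limn_esup (EFin \o u)).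

Lemma limsup_pathE (u : nat -> R) (l : R) : u n @[n --> \oo] --> l -> limsup_path u = l.
Proof.
move=> /cvgE h; rewrite /limsup_path is_cvg_limn_esupE; last by apply/cvg_ex; exists l%:E.
by rewrite (cvg_lim _ h).
Qed.

Lemma measurable_limsup_path d (U : measurableType d) (E : set U) (g : nat -> U -> R) :
  measurable E -> (forall n, measurable_fun E (g n)) -> measurable_fun E (fun x => limsup_path (g ^~ x)).
Proof.
move=> mE mg; apply: measurableT_comp => //.
by apply: measurable_fun_limn_esup => // n; exact/measurable_EFinP.
Qed.

End limsup_path.

Section path_limit.
Context {R : realType} {m : nat}.
Variable T : R.
Local Notation leb := (@lebesgue_measure R).
Variable f : nat -> R -> 'cV[R]_m.
Hypothesis hf : forall n, pathL2 T (f n).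

Definition limsup_mx (t : R) : 'cV[R]_m := \col_i limsup_path (fun n => f n t i 0).

Let D n t := f n t - f n.+1 t.
Let u n t : \bar R := (4 ^+ n * dotv (D n t) (D n t))%:E.
Let S t : \bar R := (\sum_(n <oo) u n t)%E.
Variable M : R.
Hypothesis SM : forall n, \sum_(j < n) 4 ^+ j * qv (D j) T <= M.

Let u0 n t : (0 <= u n t)%E.
Proof. by rewrite lee_fin mulr_ge0 ?exprn_ge0 ?dotv_ge0. Qed.

Let uS n t : (u n t <= S t)%E.
Proof.
rewrite /S; apply: le_trans (nneseries_lim_ge n.+1 (fun k _ _ => u0 k t)).
rewrite big_nat_recr//= leeDr// sume_ge0//.
Qed.

Let mu n : measurable_fun (`[0, T] : set (measurableTypeR R)) (u n).
Proof.
apply/measurable_EFinP; apply: measurable_funM => //.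
by apply: measurable_dotv => i; exact: (pathL2B (hf n) (hf n.+1)).1.
Qed.

Let mS : measurable_fun (`[0, T] : set (measurableTypeR R)) S.
Proof. by apply: ge0_emeasurable_sum => // k t _ _; exact: u0. Qed.

Let S0 t : (0 <= S t)%E. Proof. exact: nneseries_ge0. Qed.

Let SI : (\int[leb]_(t in `[0%R, T]) S t <= M%:E)%E.
Proof.
rewrite integral_nneseries//; apply: lime_le; first by apply: is_cvg_nneseries => n _ _; apply: integral_ge0.
apply: nearW => n; rewrite big_mkord; apply: (@le_trans _ _ (\sum_(j < n) (4 ^+ j * qv (D j) T)%:E)%E); last first.
  by rewrite sumEFin lee_fin.
apply: lee_sum => j _; have p := pathL2B (hf j) (hf j.+1).
rewrite EFinM -(ip_EFin p) -ge0_integralZl_EFin ?exprn_ge0//.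
- by rewrite le_eqVlt; apply/orP; left; apply/eqP; apply: eq_integral => t _; rewrite enormK.
- by move=> t _; rewrite lee_fin sqr_ge0.
- apply/measurable_EFinP; rewrite (funext (fun s => enormK _)); apply: measurable_dotv; exact: p.1.
Qed.

(** Solves the recursion of the telescoping argument: [2 * 4^-1 ^+ j + 2 * err j.+1 = err j]. *)
Let err (j : nat) : R := 4 * 4^-1 ^+ j.

Let close (s : R) t j p : S t = s%:E -> dotv (f j t - f (j + p)%N t) (f j t - f (j + p)%N t) <= err j * s.
Proof.
move=> St; have s0 : 0 <= s by rewrite -lee_fin -St.
have step i : dotv (D i t) (D i t) <= 4^-1 ^+ i * s.
  have := uS i t; rewrite St lee_fin => h.
  by rewrite -(ler_pM2l (exprn_gt0 i (ltr0n R 4))) mulrA -exprMn mulfV ?pnatr_eq0// expr1n mul1r.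
elim: p j => [|p ih] j; first by rewrite addn0 subrr dotv0l mulr_ge0// mulr_ge0// exprn_ge0.
rewrite addnS -addSn (_ : f j t - _ = D j t + (f j.+1 t - f (j.+1 + p)%N t)); last by rewrite /D addrA subrK.
apply: (le_trans (dotv_addsq _ _)); have := ih j.+1; have := step j.
rewrite /err exprS; move: (dotv _ _) (dotv _ _) (4^-1 ^+ j) => x1 x2 q; lra.
Qed.

(** Where [S t] is finite the sequence is Cauchy at the rate [err], since the weights [4 ^+ n]
    absorb the factor 2 of each splitting of a square; where it is infinite there is nothing to
    prove. Integrating the bound yields convergence in [L^2]. *)
Lemma limsup_mx_bound t j :
  ((dotv (f j t - limsup_mx t) (f j t - limsup_mx t))%:E <= (err j)%:E * S t)%E.
Proof.
have ej : 0 < err j by rewrite mulr_gt0// exprn_gt0.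
case E : (S t) => [s| |]; last by have := S0 t; rewrite E.
  rewrite -EFinM lee_fin.
  have ce : (err k * s) @[k --> \oo] --> 0.
    rewrite -[X in _ --> X](mul0r s); apply: cvgMl; rewrite -[X in _ --> X](mulr0 4); apply: cvgMr.
    by apply: cvg_expr; rewrite ger0_norm// invf_lt1// ltr1n.
  have [l hl] : exists l : 'cV[R]_m, forall i, f k t i 0 @[k --> \oo] --> l i 0.
    apply: (cauchy_coord_cvg ce) => i k ik; rewrite -(subnKC ik); exact: close.
  have -> : limsup_mx t = l.
    by apply/matrixP => i o; rewrite !ord1 mxE (limsup_pathE (hl i)).
  have h : dotv (f j t - f k t) (f j t - f k t) @[k --> \oo] --> dotv (f j t - l) (f j t - l) by exact: dotv_cvg.
  rewrite -(cvg_lim _ h)//.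
  apply: limr_le; first by apply/cvg_ex; eexists; exact: h.
  exists j => // k /= jk; rewrite -(subnKC jk); exact: close.
by rewrite gt0_muley ?lte_fin// leey.
Qed.

Let mlim i : measurable_fun `[0, T] (fun t => limsup_mx t i 0).
Proof.
rewrite (_ : (fun t => _) = fun t => limsup_path (fun n => f n t i 0)); last by apply/funext => t; rewrite mxE.
by apply: measurable_limsup_path => // n; exact: (hf n).1.
Qed.

Let iS : leb.-integrable `[0, T] S.
Proof.
apply/integrableP; split=> //; under eq_integral => t _ do rewrite gee0_abs//.
exact: le_lt_trans SI (ltry _).
Qed.

Let pdiff j : pathL2 T (fun t => f j t - limsup_mx t).
Proof.
have mi i : measurable_fun `[0, T] (fun t => (f j t - limsup_mx t) i 0).
  rewrite (_ : (fun t => _) = fun t => f j t i 0 - limsup_mx t i 0); last by apply/funext => t; rewrite !mxE.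
  by apply: measurable_funB => //; exact: (hf j).1.
split=> //; apply: (le_integrable _ _ _ (integrableZl _ (err j) iS)) => //.
  by apply/measurable_EFinP; exact: measurable_dotv.
move=> t _; rewrite /= ger0_norm ?dotv_ge0//; apply: (le_trans (limsup_mx_bound t j)).
by rewrite gee0_abs// mule_ge0// lee_fin mulr_ge0// exprn_ge0.
Qed.

Lemma pathL2_limsup : pathL2 T limsup_mx.
Proof.
rewrite (_ : limsup_mx = fun t => f 0%N t - (f 0%N t - limsup_mx t)); first exact: pathL2B.
by apply/funext => t; rewrite opprB addrC subrK.
Qed.

Lemma cvgL2_limsup : cvgL2 T f limsup_mx.
Proof.
have ej j : 0 <= err j by rewrite mulr_ge0// exprn_ge0.
have le j : qv (fun t => f j t - limsup_mx t) T <= err j * M.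
  rewrite -lee_fin -(ip_EFin (pdiff j)) EFinM; apply: (@le_trans _ _ ((err j)%:E * \int[leb]_(t in `[0%R, T]) S t)%E).
    rewrite -ge0_integralZl_EFin//; apply: ge0_le_integral => //.
    - by move=> t _; rewrite lee_fin sqr_ge0.
    - by apply/measurable_EFinP; rewrite (funext (fun s => enormK _)); apply: measurable_dotv; exact: (pdiff j).1.
    - exact: measurable_funeM.
    - by move=> t _; rewrite enormK; exact: limsup_mx_bound.
  by apply: lee_wpmul2l; rewrite ?lee_fin.
apply: (@squeeze_cvgr _ _ _ _ (cst 0) (fun j => err j * M)).
- by apply: nearW => j; rewrite le andbT; exact: (@ip_ge0 R T).
- exact: cvg_cst.
- rewrite -[X in _ --> X](mul0r M); apply: cvgMl; rewrite -[X in _ --> X](mulr0 4); apply: cvgMr.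
  by apply: cvg_expr; rewrite ger0_norm// invf_lt1// ltr1n.
Qed.

End path_limit.

Section real_sequences.
Context {R : realType}.

Lemma geometric_cvg (y : nat -> R) (n0 : nat) :
  (forall n, (n0 <= n)%N -> `|y n - y n.+1| <= 2 * 2^-1 ^+ n) ->
  exists2 l, y n @[n --> \oo] --> l & forall n, (n0 <= n)%N -> `|y n - l| <= 4 * 2^-1 ^+ n.
Proof.
move=> h.
have close n p : (n0 <= n)%N -> `|y n - y (n + p)%N| <= 4 * 2^-1 ^+ n.
  elim: p n => [|p ih] n nn; first by rewrite addn0 subrr normr0 mulr_ge0// exprn_ge0.
  have -> : y n - y (n + p.+1)%N = (y n - y n.+1) + (y n.+1 - y (n.+1 + p)%N) by rewrite addnS -addSn addrA subrK.
  apply: (le_trans (ler_normD _ _)); have := h n nn; have := ih n.+1 (leqW nn).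
  by rewrite exprS; move: (2^-1 ^+ n) `|_| `|_| => q x1 x2; lra.
have c0 : (4 * 2^-1 ^+ n : R) @[n --> \oo] --> 0.
  rewrite -[X in _ --> X](mulr0 4); apply: cvgMr.
  by apply: cvg_expr; rewrite ger0_norm// invf_lt1// ltr1n.
have : cvgn y.
  apply: cauchy_cvg; apply: cauchy_exP => d d0.
  have /cvgr_lt/(_ _ d0)[N _ hN] := c0.
  exists (y (maxn N n0)); exists (maxn N n0) => // k /= Nk; rewrite /ball/= -(subnKC Nk).
  by apply: le_lt_trans (close _ _ (leq_maxr _ _)) (hN _ _); exact: leq_maxl.
move=> /cvg_ex[l hl]; exists l => // n nn.
have hc : `|y n - y k| @[k --> \oo] --> `|y n - l| by apply: cvg_norm; apply: cvgB => //; exact: cvg_cst.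
rewrite -(cvg_lim _ hc)//; apply: limr_le; first by apply/cvg_ex; eexists; exact: hc.
by exists n => // k /= nk; rewrite -(subnKC nk); exact: close.
Qed.

Lemma geometric_sum_bounded (u : nat -> R) (n0 : nat) : (forall n, 0 <= u n) ->
  (forall n, (n0 <= n)%N -> u n <= 2^-1 ^+ n) -> exists M, forall n, \sum_(j < n) u j <= M.
Proof.
move=> u0 h; exists (\sum_(j < n0) u j + 2) => n.
suff: \sum_(j < n) u j <= \sum_(j < n0) u j + 2 * (1 - 2^-1 ^+ n).
  by move/le_trans; apply; rewrite lerD2l ler_piMr// lerBlDr lerDl exprn_ge0.
elim: n => [|n ih].
  by rewrite big_ord0 expr0 subrr mulr0 addr0 sumr_ge0.
have e0 k : 0 <= 2^-1 ^+ k :> R by rewrite exprn_ge0.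
have e1 : 2^-1 ^+ n.+1 <= 1 :> R by rewrite exprn_ile1// invf_le1// ler1n.
have [nn|nn] := leqP n0 n.
  by rewrite big_ord_recr/=; have := h n nn; move: ih (e0 n); rewrite exprS; move: (2^-1 ^+ n) (\sum_(_ < _) _) (\sum_(_ < _) _) => q s1 s2; lra.
apply: (@le_trans _ _ (\sum_(j < n0) u j)); last by rewrite lerDl mulr_ge0// subr_ge0.
rewrite -(subnKC nn) big_split_ord/= lerDl; exact: sumr_ge0.
Qed.

End real_sequences.

(** * The Brownian filtration *)

Record brownian_setting {disp} {Omega : measurableType disp} {R : realType}
    (P : probability Omega R) (T : R) {m} (B : R -> Omega -> 'cV[R]_m) : Prop :=
  BrownianSetting {
    setting_complete : measure_is_complete P;
    setting_T : 0 < T;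
    setting_B : brownian_motion P T B }.

Section brownian.
Context {disp : measure_display} {Omega : measurableType disp} {R : realType}.
Context {P : probability Omega R} {T : R} {m : nat} {B : R -> Omega -> 'cV[R]_m}.
Variable bs : brownian_setting P T B.
Local Notation Fil := (filtration P B).
Local Notation mat := (measurable_at P B).
Local Notation prd := (predictable P T B).
Local Notation prdmx := (predictable_mx P T B).
Local Notation stop := (stopping_time P T B).
Let cP : measure_is_complete P := setting_complete bs.
Let bm : brownian_motion P T B := setting_B bs.
Let T0 : 0 <= T. Proof. exact/ltW/(setting_T bs). Qed.
Let TT : 0 <= T <= T. Proof. by rewrite T0 lexx. Qed.
Let T00 : 0 <= (0 : R) <= T. Proof. by rewrite T0 lexx. Qed.

Section filtration.

(** The augmented past as a measurable type, from which closure properties of events and functions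
    are inherited. *)
Definition past_type (t : R) := g_sigma_algebraType
  (sets_of_past B t `|` [set N | P.-negligible N]).
Local Notation FT := past_type.

Lemma filtration_mono s t : s <= t -> Fil s `<=` Fil t.
Proof.
move=> st; apply: sub_sigma_algebra2 => A [[r [i [U [/andP[r0 rs] mU AE]]]]|N]; [left|by right].
by exists r, i, U; split=> //; rewrite r0 (le_trans rs).
Qed.

Lemma filtration_measurable t A : t <= T -> Fil t A -> measurable A.
Proof.
move=> tT; apply: (@smallest_sub _ _ _ measurable).
  split=> //; [move=> A'; rewrite setTD; exact: measurableC|exact: bigcupT_measurable].
move=> A' [[s [i [U [/andP[s0 st] mU ->]]]]|]; last exact: cP.
case: bm => mB _ _ _.
have := mB s i; rewrite s0 (le_trans st tT) => /(_ isT measurableT U mU).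
by rewrite setTI.
Qed.

Lemma filtrationC t A : Fil t A -> Fil t (~` A).
Proof. exact: (@measurableC _ (FT t)). Qed.

Lemma filtrationI t A A' : Fil t A -> Fil t A' -> Fil t (A `&` A').
Proof. exact: (@measurableI _ (FT t)). Qed.

Lemma filtrationU t A A' : Fil t A -> Fil t A' -> Fil t (A `|` A').
Proof. exact: (@measurableU _ (FT t)). Qed.

Lemma filtrationT t : Fil t setT.
Proof. exact: (@measurableT _ (FT t)). Qed.

Lemma filtration_bigcup t (A : nat -> set Omega) :
  (forall n, Fil t (A n)) -> Fil t (\bigcup_n A n).
Proof. by move=> h; apply: (@bigcupT_measurable _ (FT t)). Qed.

Lemma filtration_bigcap t (A : nat -> set Omega) :
  (forall n, Fil t (A n)) -> Fil t (\bigcap_n A n).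
Proof. by move=> h; apply: (@bigcapT_measurable _ (FT t)). Qed.

Lemma filtration_negligible t N : P.-negligible N -> Fil t N.
Proof. by move=> h; apply: sub_sigma_algebra; right. Qed.

Lemma filtration_ae t A A' : Fil t A -> {ae P, forall w, A w <-> A' w} -> Fil t A'.
Proof.
move=> FA [N [mN N0 h]].
have FN : Fil t N by apply: filtration_negligible; exists N; split.
rewrite (_ : A' = (A `&` ~` N) `|` (A' `&` N)).
  apply: filtrationU; first by apply: filtrationI => //; exact: filtrationC.
  by apply: filtration_negligible; exists N; split=> // w [].
have k w : ~ N w -> (A w <-> A' w).
  by move=> Nw; apply: contrapT => h'; apply: Nw; exact: h.
apply/seteqP; split=> w /=; last by case=> -[] // Aw /k[h1 _]; exact: h1.
by have [Nw|Nw] := pselect (N w); [right|left; split=> //; apply/(k _ Nw)].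
Qed.

Lemma matP t X : mat t X <-> measurable_fun setT (X : FT t -> measurableTypeR R).
Proof.
split; first by move=> h _ U mU; rewrite setTI; exact: h.
by move=> h U mU; have := h measurableT U mU; rewrite setTI.
Qed.

Lemma mat_mono s t X : s <= t -> mat s X -> mat t X.
Proof. by move=> st h U mU; apply: (filtration_mono st); exact: h. Qed.

Lemma mat_meas t X : t <= T -> mat t X -> measurable_fun setT X.
Proof.
move=> tT h _ U mU; rewrite setTI; apply: (filtration_measurable tT); exact: h.
Qed.

Lemma mat_ae t X Y : mat t X -> {ae P, forall w, X w = Y w} -> mat t Y.
Proof.
move=> hX XY U mU; apply: (filtration_ae (hX U mU)).
by apply: filterS XY => w e; rewrite /= e.
Qed.

Lemma mat_cst t (c : R) : mat t (fun=> c).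
Proof. by apply/matP; exact: measurable_cst. Qed.

Lemma mat_comp t X (f : R -> R) : measurable_fun setT f -> mat t X ->
  mat t (fun w => f (X w)).
Proof. by move=> mf /matP h; apply/matP; exact: (measurableT_comp mf h). Qed.

Lemma matD t X Y : mat t X -> mat t Y -> mat t (fun w => X w + Y w).
Proof. by move=> /matP h1 /matP h2; apply/matP; exact: measurable_funD. Qed.

Lemma matB t X Y : mat t X -> mat t Y -> mat t (fun w => X w - Y w).
Proof. by move=> /matP h1 /matP h2; apply/matP; exact: measurable_funB. Qed.

Lemma matM t X Y : mat t X -> mat t Y -> mat t (fun w => X w * Y w).
Proof. by move=> /matP h1 /matP h2; apply/matP; exact: measurable_funM. Qed.

Lemma mat_min t X Y : mat t X -> mat t Y -> mat t (fun w => Num.min (X w) (Y w)).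
Proof. by move=> /matP h1 /matP h2; apply/matP; exact: measurable_minr. Qed.

Lemma mat_sum t I (s : seq I) (X : I -> Omega -> R) :
  (forall i, mat t (X i)) -> mat t (fun w => \sum_(i <- s) X i w).
Proof.
move=> h; elim: s => [|i s ih].
  by under eq_fun do rewrite big_nil; exact: mat_cst.
by under eq_fun do rewrite big_cons; exact: matD.
Qed.

Lemma mat_indic t A : Fil t A -> mat t (\1_A).
Proof. by move=> FA; apply/matP; exact: (@measurable_indic _ (FT t)). Qed.

Lemma mat_le t X (a : R) : mat t X -> Fil t [set w | X w <= a].
Proof. by move=> /(_ `]-oo, a]%classic (measurable_itv _)); apply. Qed.

Lemma mat_ge t X (a : R) : mat t X -> Fil t [set w | a <= X w].
Proof.
move=> /(_ `[a, +oo[%classic (measurable_itv _)).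
by move/filtration_ae; apply; apply: aeW => w /=; rewrite in_itv/= andbT.
Qed.

Lemma mat_lt t X Y : mat t X -> mat t Y -> Fil t [set w | X w < Y w].
Proof.
move=> hX hY; have := mat_le 0 (matB hY hX) => /filtrationC.
move/filtration_ae; apply; apply: aeW => w /=; rewrite subr_le0.
by split=> [/negP|h]; [rewrite -ltNge|apply/negP; rewrite -ltNge].
Qed.

(** The null set where convergence fails belongs to the filtration at every time, so the sequence
    can be set to 0 there. *)
Lemma mat_cvg t (X : nat -> Omega -> R) (Y : Omega -> R) : (forall n, mat t (X n)) ->
  {ae P, forall w, X n w @[n --> \oo] --> Y w} -> mat t Y.
Proof.
move=> hX [N [mN N0 h]].
have FN : Fil t (~` N) by apply: filtrationC; apply: filtration_negligible; exists N; split.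
have iN := mat_indic FN.
apply: (@mat_ae _ (fun w => \1_(~` N) w * Y w)); last first.
  exists N; split=> // w /= h'; apply: contrapT => Nw; apply: h'.
  by rewrite indicE mem_set// mul1r.
apply/matP; apply: (@measurable_fun_cvg _ (FT t) _ _ (fun n w => \1_(~` N) w * X n w)).
  by move=> n; apply/matP; exact: matM.
move=> w _; rewrite indicE; have [Nw|Nw] := pselect ((~` N) w).
  rewrite mem_set//=; under eq_fun do rewrite mul1r; rewrite mul1r.
  by apply: contrapT => h'; apply: Nw; exact: h.
by rewrite memNset//=; under eq_fun do rewrite mul0r; rewrite mul0r; exact: cvg_cst.
Qed.

Lemma ae_cvg_measurable (X : nat -> Omega -> R) (Y : Omega -> R) :
  (forall n, measurable_fun setT (X n)) ->
  {ae P, forall w, X n w @[n --> \oo] --> Y w} -> measurable_fun setT Y.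
Proof.
move=> hX [N [mN N0 h]].
have iN : measurable_fun setT (\1_(~` N) : Omega -> R).
  by apply: measurable_indic; exact: measurableC.
apply: (@ae_measurable _ _ _ P (fun w => \1_(~` N) w * Y w)) => //; last first.
  exists N; split=> // w /= h'; apply: contrapT => Nw; apply: h'.
  by rewrite indicE mem_set// mul1r.
apply: (@measurable_fun_cvg _ _ _ _ (fun n w => \1_(~` N) w * X n w)).
  by move=> n; exact: measurable_funM.
move=> w _; rewrite indicE; have [Nw|Nw] := pselect ((~` N) w).
  rewrite mem_set//=; under eq_fun do rewrite mul1r; rewrite mul1r.
  by apply: contrapT => h'; apply: Nw; exact: h.
by rewrite memNset//=; under eq_fun do rewrite mul0r; rewrite mul0r; exact: cvg_cst.
Qed.

Lemma measure_ae_eq A A' : measurable A -> measurable A' ->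
  {ae P, forall w, A w <-> A' w} -> P A = P A'.
Proof.
move=> mA mA' h; rewrite -[A]setIT -[A']setIT -!integral_indic//.
apply: ae_eq_integral => //; [exact/measurable_EFinP|exact/measurable_EFinP|].
apply: filterS h => w [h1 h2] _; rewrite !indicE.
have [Aw|Aw] := pselect (A w); first by rewrite !mem_set//; exact: h1.
by rewrite !memNset// => /h2.
Qed.

(** The generators at time 0 are events about [B 0], which is 0 almost surely, and null sets. *)
Lemma filtration0_trivial A : Fil 0 A -> P A = 0%E \/ P A = 1%E.
Proof.
pose D : set (set Omega) := [set A | measurable A /\ (P A = 0%E \/ P A = 1%E)].
suff /[apply] : Fil 0 `<=` D by case.
have DC X : D X -> D (~` X).
  move=> [mX hX]; split; first exact: measurableC.
  by rewrite probability_setC//; case: hX => ->; [right|left]; rewrite ?sube0 ?subee.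
apply: smallest_sub.
  split; first by split => //; left; exact: measure0.
  - by move=> A' /DC; rewrite setTD.
  - move=> F DF; split; first by apply: bigcupT_measurable => n; case: (DF n).
    have [[n Fn1]|h] := pselect (exists n, P (F n) = 1%E).
      have mF : measurable (\bigcup_k F k).
        by apply: bigcupT_measurable => k; case: (DF k).
      right; apply/eqP; rewrite eq_le probability_le1//=.
      by rewrite -Fn1 le_measure ?inE//; [case: (DF n)|exact: bigcup_sup].
    left; apply: measure_negligible.
      by apply: bigcupT_measurable => n; case: (DF n).
    apply: negligible_bigcup => k; apply/negligibleP; case: (DF k) => // mF [//|F1].
    by exfalso; apply: h; exists k.
move=> A' [[s [i [U [/andP[s0 s0'] mU AE]]]]|]; last first.
  by move=> N; split; [exact: cP|left; apply: measure_negligible => //; exact: cP].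
have {s0 s0'} s0 : s = 0 by apply/eqP; rewrite eq_le s0 s0'.
have mA : measurable A'.
  apply: (@filtration_measurable 0); first exact: T0.
  by apply: sub_sigma_algebra; left; exists s, i, U; split=> //; rewrite s0 lexx.
split=> //; case: bm => _ B0 _ _.
have [U0|U0] := pselect (U 0).
  right; have : P (~` A') = 0%E.
    apply: measure_negligible; first exact: measurableC.
    apply: negligibleS B0 => w; rewrite AE s0 => h /= h'; apply: h => /=.
    by rewrite h' mxE.
  by move=> h; rewrite -[A']setCK probability_setC ?h ?sube0//; exact: measurableC.
left; apply: measure_negligible => //.
apply: negligibleS B0 => w; rewrite AE s0 /= => h /= h'; apply: U0.
by move: h; rewrite h' mxE.
Qed.

Lemma mat0_const X : mat 0 X -> L1 P X -> {ae P, forall w, X w = Ex P X}.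
Proof.
move=> mX iX; set c := Ex P X.
have F1 : Fil 0 [set w | X w < c] by apply: mat_lt => //; exact: mat_cst.
have F2 : Fil 0 [set w | c < X w] by apply: mat_lt => //; exact: mat_cst.
have m1 := filtration_measurable T0 F1; have m2 := filtration_measurable T0 F2.
have eqc (Y : Omega -> R) : L1 P Y -> Ex P Y = 0 -> {ae P, forall w, 0 < Y w} -> False.
  move=> iY EY hY.
  have hY0 : {ae P, forall w, Y w = 0}.
    by apply: (Ex_eq0 iY _ EY); apply: filterS hY => w /ltW.
  have : {ae P, forall w, False}.
    by apply: filterS2 hY hY0 => w + e; rewrite e ltxx.
  move=> [N [mN N0]]; rewrite setC0 subTset => NT.
  by move: N0; rewrite NT probability_setT => /eqP; rewrite onee_eq0.
have full A : measurable A -> P A = 1%E -> {ae P, forall w, A w}.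
  move=> mA A1; exists (~` A); split=> //; first exact: measurableC.
  by rewrite probability_setC// A1 subee.
have i1 := L1B (L1_cst P c) iX; have i2 := L1B iX (L1_cst P c).
case: (filtration0_trivial F1) => h1; last first.
  exfalso; apply: (eqc _ i1); first by rewrite ExB ?Ex_cst ?subrr//; exact: L1_cst.
  by apply: filterS (full _ m1 h1) => w /=; rewrite subr_gt0.
case: (filtration0_trivial F2) => h2; last first.
  exfalso; apply: (eqc _ i2); first by rewrite ExB ?Ex_cst ?subrr//; exact: L1_cst.
  by apply: filterS (full _ m2 h2) => w /=; rewrite subr_gt0.
exists ([set w | X w < c] `|` [set w | c < X w]); split.
- exact: measurableU.
- by apply: measure_negligible; [exact: measurableU|apply: negligibleU; exact/negligibleP].
by move=> w /= /eqP; rewrite neq_lt => /orP[|]; [left|right].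
Qed.

(** [brownian_motion] speaks of the raw past. Every event of the augmented past agrees with one of
    the raw past up to a null set. *)
Lemma brownian_increment_indep s t A (U : 'I_m -> set R) :
  0 <= s -> s < t -> t <= T -> Fil s A ->
  (forall i, @measurable _ (measurableTypeR R) (U i)) ->
  P (A `&` [set w | forall i, U i (B t w i 0 - B s w i 0)]) =
  (P A * \prod_i normal_prob 0 (Num.sqrt (t - s)) (U i))%E.
Proof.
move=> s0 st tT FA mU.
pose past A := <<s sets_of_past B s >> A.
have mpast A' : past A' -> Fil s A'.
  by apply: sub_sigma_algebra2 => ? ?; left.
have sT : s <= T by rewrite (le_trans _ tT)// ltW.
have [A' pA [N [mN N0 hN]]] : exists2 A', past A' & {ae P, forall w, A w <-> A' w}.
  move: A FA; apply: smallest_sub.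
    split.
    - by exists set0; [exact: sigma_algebra0|exact: aeW].
    - move=> A [A' pA h]; exists (~` A'); first by exact: sigma_algebraC.
      by apply: filterS h => w h'; rewrite setTD /=; split; apply: contra_not => /h'.
    - move=> F hF.
      pose G n := projT1 (cid2 (hF n)).
      exists (\bigcup_n G n).
        by apply: sigma_algebra_bigcup => n; rewrite /G; case: cid2.
      have : {ae P, forall w, forall n, F n w <-> G n w}.
        by apply: ae_foralln => n; rewrite /G; case: cid2.
      by apply: filterS => w h; split=> -[n _ /h ?]; exists n.
  move=> A [pA|NA]; first by exists A; [exact: sub_sigma_algebra|exact: aeW].
  exists set0; first exact: sigma_algebra0.
  by apply: negligibleS NA => w /= h; apply: contrapT => h'; apply: h; split.
set V := [set w | _].
have mV : measurable V.
  rewrite (_ : V = \bigcap_(i in [set: 'I_m]) [set w | U i (B t w i 0 - B s w i 0)]).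
    apply: fin_bigcap_measurable => [|i _]; first exact: finite_finset.
    have [mB _ _ _] := bm.
    have : measurable_fun setT (fun w => B t w i 0 - B s w i 0).
      by apply: measurable_funB; apply: mB; rewrite ?(le_trans s0 (ltW st)) ?s0 ?tT ?sT.
    by move=> /(_ measurableT _ (mU i)); rewrite setTI.
  by apply/seteqP; split=> w /= h i; [move=> _; exact: h|exact: h].
have mA := filtration_measurable sT FA.
have mA' := filtration_measurable sT (mpast _ pA).
have eqP X : measurable X -> P (A `&` X) = P (A' `&` X).
  move=> mX; apply: measure_ae_eq; [exact: measurableI|exact: measurableI|].
  by exists N; split=> // w /= h; apply: hN => /= h'; apply: h; split=> -[/h'].
rewrite eqP//; have -> : P A = P A' by rewrite -[A]setIT -[A' in RHS]setIT eqP.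
by case: bm => _ _ _; exact.
Qed.

Definition predictable_generators : set (set (R * Omega)) :=
  [set [set 0] `*` A | A in Fil 0] `|`
  [set D | exists s t A, [/\ 0 <= s, s <= t, t <= T, Fil s A &
                             D = `]s, t] `*` A]].
Definition predictable_type := g_sigma_algebraType predictable_generators.
Local Notation PT := predictable_type.
Local Notation DT := (`[0, T]%classic `*` [set: Omega]).

Lemma predictable_domain : <<s predictable_generators >> DT.
Proof.
rewrite (_ : DT = ([set 0] `*` setT) `|` (`]0, T]%classic `*` setT)).
  apply: (@measurableU _ PT); apply: sub_sigma_algebra.
    by left; exists setT => //; exact: filtrationT.
  right; exists 0, T, setT; split=> //; exact: filtrationT.
apply/seteqP; split=> -[t w] /=; rewrite !in_itv/=.
  move=> [/andP[]]; rewrite le_eqVlt => /predU1P[<-|t0] tT _; [left|right] => //.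
  by rewrite t0.
case=> -[] //; first by move=> ->; rewrite lexx T0.
by move=> /andP[/ltW -> ->].
Qed.

(** [predictable_sets] is a sigma-algebra on [[0, T]] times the outcomes; it is the trace of one on
    the whole product, where the calculus of measurable functions applies. *)
Lemma predictableP X : prd X <->
  measurable_fun (DT : set PT) (fun q : PT => X q.1 q.2 : measurableTypeR R).
Proof.
have sD := predictable_domain.
split=> h.
  move=> _ U mU.
  suff : predictable_sets P T B `<=` <<s predictable_generators >>.
    by apply; exact: h.
  apply: smallest_sub; last exact: sub_sigma_algebra.
  split; first exact: sigma_algebra0.
  - by move=> A hA; exact: (@measurableD _ PT).
  - by move=> F; exact: sigma_algebra_bigcup.
move=> U mU; have := h sD U mU.
have k E : <<s predictable_generators >> E -> predictable_sets P T B (DT `&` E).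
  apply: (@smallest_sub _ _ _ (fun E => predictable_sets P T B (DT `&` E))).
    split; first by rewrite setI0; exact: sigma_algebra0.
    - move=> A hA; have := sigma_algebraCD hA; rewrite setTD.
      by congr (predictable_sets P T B _); apply/seteqP; split=> q /=; tauto.
    - by move=> F hF; rewrite setI_bigcupr; exact: sigma_algebra_bigcup.
  move=> A GA; rewrite (_ : DT `&` A = A); first exact: sub_sigma_algebra.
  apply/setIidPr => -[t w].
  case: GA => [[A' _ <-] [/= -> _]|[s [u [A' [s0 su uT _ ->]]]] [/= + _]].
    by split=> //; rewrite /= in_itv/= lexx T0.
  rewrite !in_itv/= => /andP[st tu]; split=> //=.
  by rewrite (le_trans s0 (ltW st)) (le_trans tu uT).
by move/k; rewrite setIA setIid.
Qed.

(** Progressive measurability: cut at time [t], a generator is empty or a product of a time set and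
    an event known at [t]. *)
Lemma predictable_joint t X : 0 <= t <= T -> prd X ->
  measurable_fun (`[0, t]%classic `*` setT : set (measurableTypeR R * FT t))
    (fun q => X q.1 q.2 : measurableTypeR R).
Proof.
move=> /andP[t0 tT] /predictableP hX.
have mD : measurable (`[0, t]%classic `*` setT : set (measurableTypeR R * FT t)).
  by apply: measurableX => //; exact: measurable_itv.
have k (E : set PT) : measurable E ->
    measurable ((`[0, t]%classic `*` setT) `&` E : set (measurableTypeR R * FT t)).
  apply: (@smallest_sub _ _ _ (fun E : set PT =>
    measurable ((`[0, t]%classic `*` setT) `&` E : set (measurableTypeR R * FT t)))).
    split; first by rewrite setI0; exact: measurable0.
    - move=> A hA; have := measurableD mD hA.
      by congr (measurable _); apply/seteqP; split=> q /=; tauto.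
    - by move=> F hF; rewrite setI_bigcupr; exact: bigcupT_measurable.
  move=> A GA.
  case: GA => [[A' FA' <-]|[s [u [A' [s0 su uT FA' ->]]]]].
    rewrite -setXI setTI; apply: measurableX.
      by apply: measurableI; [exact: measurable_itv|exact: measurable_set1].
    exact: (filtration_mono t0 FA').
  rewrite -setXI setTI; have [st|ts] := leP s t.
    apply: measurableX; first by apply: measurableI; exact: measurable_itv.
    exact: (filtration_mono st FA').
  rewrite (_ : _ `&` _ = set0) ?set0X; first exact: measurable0.
  apply/seteqP; split=> // r [] /=; rewrite !in_itv/= => /andP[_ rt] /andP[sr _].
  by have := lt_le_trans (lt_trans ts sr) rt; rewrite ltxx.
move=> _ U mU.
have := k _ (hX predictable_domain U mU); congr (measurable _).
apply/seteqP; split=> -[r w] /=; first by move=> [? []].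
move=> [[rt _] h]; split=> //; split=> //; split=> //.
by move: rt; rewrite /= !in_itv/= => /andP[-> /le_trans ->].
Qed.

Lemma predictable_joint_meas X : prd X ->
  measurable_fun (DT : set (measurableTypeR R * Omega))
    (fun q => X q.1 q.2 : measurableTypeR R).
Proof.
move=> hX.
have h := predictable_joint TT hX.
have mD : measurable (DT : set (measurableTypeR R * FT T)).
  by apply: measurableX => //; exact: measurable_itv.
have k (E : set (measurableTypeR R * FT T)) : measurable E ->
    measurable (E : set (measurableTypeR R * Omega)).
  rewrite {1}measurable_prod_measurableType.
  apply: (@smallest_sub _ _ _ (fun E => measurable (E : set (measurableTypeR R * Omega)))).
    split; [exact: measurable0|by move=> A mA; rewrite setTD; exact: measurableC|].
    by move=> F mF; exact: bigcupT_measurable.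
  move=> A [A1 mA1 [A2 mA2 <-]]; apply: measurableX => //.
  exact: (@filtration_measurable T).
by move=> _ U mU; apply: k; exact: h.
Qed.

Lemma predictable_section X w : prd X ->
  measurable_fun `[0, T] (fun t => X t w).
Proof.
move=> hX; have h := predictable_joint_meas hX.
have h1 : measurable_fun (`[0, T] : set (measurableTypeR R))
    (fun t : measurableTypeR R => (t, w)).
  by apply: measurable_funTS; exact: measurable_pair2.
have := measurable_comp _ _ h h1; apply.
- by apply: measurableX => //; exact: measurable_itv.
- by move=> _ [t tT <-].
Qed.

Lemma predictable_mat t X : 0 <= t <= T -> prd X -> mat t (X t).
Proof.
move=> tT hX; apply/matP; have h := predictable_joint tT hX.
have h1 : measurable_fun setT (fun w : FT t => (t, w) : measurableTypeR R * FT t).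
  exact: measurable_pair1.
have := measurable_comp _ _ h h1; apply.
- by apply: measurableX => //; exact: measurable_itv.
- by move=> _ [w _ <-]; split=> //=; rewrite in_itv/= lexx; case/andP: tT => ->.
Qed.

Lemma predictable_integral_mat t X : 0 <= t <= T -> prd X ->
  (forall s w, 0 <= X s w) ->
  measurable_fun setT (fun w : FT t => \int[lebesgue_measure]_(s in `[0%R, t]) (X s w)%:E)%E.
Proof.
move=> tT hX X0; have h := predictable_joint tT hX.
set D := (_ `*` _) in h.
have mD : measurable D by apply: measurableX => //; exact: measurable_itv.
pose f (q : measurableTypeR R * FT t) : \bar R := ((EFin \o (fun q => X q.1 q.2)) \_ D) q.
have mf : measurable_fun setT f.
  by apply/(measurable_restrictT _ mD); exact/measurable_EFinP.
have f0 q : (0 <= f q)%E.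
  by rewrite /f patchE; case: ifP => // _; rewrite lee_fin.
have := @measurable_fun_fubini_tonelli_G _ _ _ _ _ lebesgue_measure f mf f0.
congr (measurable_fun _ _); apply/funext => w; rewrite /fubini_G [RHS]integral_mkcond.
apply: eq_integral => s _; rewrite /f !patchE.
suff -> : ((s, w) \in D) = (s \in `[0%R, t]%classic) by [].
by apply/idP/idP; rewrite !inE; [case|split].
Qed.

Lemma predictableD X Y : prd X -> prd Y -> prd (fun t w => X t w + Y t w).
Proof. by move=> /predictableP h1 /predictableP h2; apply/predictableP; exact: measurable_funD. Qed.

Lemma predictableB X Y : prd X -> prd Y -> prd (fun t w => X t w - Y t w).
Proof. by move=> /predictableP h1 /predictableP h2; apply/predictableP; exact: measurable_funB. Qed.

Lemma predictableM X Y : prd X -> prd Y -> prd (fun t w => X t w * Y t w).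
Proof. by move=> /predictableP h1 /predictableP h2; apply/predictableP; exact: measurable_funM. Qed.

Lemma predictable_cst c : prd (fun _ _ => c).
Proof. by apply/predictableP; exact: measurable_cst. Qed.

Lemma predictable_comp f X : measurable_fun setT f -> prd X -> prd (fun t w => f (X t w)).
Proof. by move=> mf /predictableP h; apply/predictableP; exact: (measurableT_comp mf h). Qed.

Lemma predictable_sum I (s : seq I) (X : I -> R -> Omega -> R) :
  (forall i, prd (X i)) -> prd (fun t w => \sum_(i <- s) X i t w).
Proof.
move=> h; elim: s => [|i s ih].
  rewrite (_ : (fun _ _ => _) = (fun _ _ => 0)); first exact: predictable_cst.
  by apply/funext => t; apply/funext => w; rewrite big_nil.
rewrite (_ : (fun _ _ => _) = (fun t w => X i t w + \sum_(i <- s) X i t w)).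
  exact: predictableD.
by apply/funext => t; apply/funext => w; rewrite big_cons.
Qed.

Lemma predictable_ext X Y : (forall t w, 0 <= t <= T -> X t w = Y t w) -> prd X -> prd Y.
Proof.
move=> XY hX U mU; have := hX U mU; congr (predictable_sets P T B _).
by apply/seteqP; split=> -[t w] [[h _] /= Uw]; split=> //=; move: h Uw; rewrite /= in_itv/= => /XY ->.
Qed.

Lemma predictable_itv s t A : 0 <= s -> s <= t -> t <= T -> Fil s A ->
  prd (fun r w => \1_(`]s, t]%classic `*` A) (r, w)).
Proof.
move=> s0 st tT FA; apply/predictableP.
rewrite (_ : (fun q : PT => _) = indic (`]s, t]%classic `*` A)); last first.
  by apply/funext => -[].
apply: measurable_funTS; apply: measurable_indic.
by apply: sub_sigma_algebra; right; exists s, t, A.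
Qed.

Lemma predictable_lim (X : nat -> R -> Omega -> R) Y : (forall n, prd (X n)) ->
  (forall t w, 0 <= t <= T -> X n t w @[n --> \oo] --> Y t w) -> prd Y.
Proof.
move=> hX h; apply/predictableP.
apply: (@measurable_fun_cvg _ PT _ _ (fun n q => X n q.1 q.2)).
  by move=> n; apply/predictableP.
by move=> -[t w] [/= tT _]; apply: h; move: tT; rewrite in_itv.
Qed.

End filtration.

Arguments mat_cst t c _ _ : clear implicits.

(** * Exponentials of Brownian increments *)

Section brownian_increment.

Lemma brownian_meas t i : 0 <= t <= T -> measurable_fun setT (fun w => B t w i 0).
Proof. by case: (setting_B bs) => h _ _ _; exact: h. Qed.

Lemma brownian_mat s t i : 0 <= s <= t -> mat t (fun w => B s w i 0).
Proof.
move=> st U mU; apply: sub_sigma_algebra; left.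
by exists s, i, U; split.
Qed.

Section increment.
Variables s t : R.
Hypotheses (s0 : 0 <= s) (st : s < t) (tT : t <= T).
Let N := (normal_prob 0 (Num.sqrt (t - s)) : probability (measurableTypeR R) R).
Let D i w := B t w i 0 - B s w i 0.

Let mD i : measurable_fun setT (D i).
Proof.
apply: measurable_funB; apply: brownian_meas.
  by rewrite tT (le_trans s0)// ltW.
by rewrite s0 (le_trans _ tT)// ltW.
Qed.

Lemma increment_integral A (g : 'I_m -> R -> R) : Fil s A ->
  (forall i, measurable_fun setT (g i)) -> (forall i x, 0 <= g i x) ->
  (forall i, (\int[N]_x (g i x)%:E < +oo)%E) ->
  (\int[P]_w (\1_A w * \prod_i g i (D i w))%:E =
   P A * \prod_i \int[N]_x (g i x)%:E)%E.
Proof.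
move=> FA mg g0 gfin.
have mA : measurable A by apply: (filtration_measurable _ FA); rewrite (le_trans _ tT)// ltW.
(* The first [k] functions are arbitrary, the others indicators. Each step of the induction uses
   [integral_transfer] to turn one more indicator into an arbitrary function. *)
suff main k : forall h : 'I_m -> R -> R,
    (forall i : 'I_m, (i < k)%N -> h i = g i) ->
    (forall i : 'I_m, (k <= i)%N -> exists2 U, @measurable _ (measurableTypeR R) U & h i = \1_U) ->
    (\int[P]_w (\1_A w * \prod_i h i (D i w))%:E =
     P A * \prod_i \int[N]_x (h i x)%:E)%E.
  apply: (main m) => // i; by rewrite leqNgt ltn_ord.
elim: k => [|k ih] h h1 h2.
  pose U i := projT1 (cid2 (h2 i (leq0n i))).
  have mU i : @measurable _ (measurableTypeR R) (U i) by rewrite /U; case: cid2.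
  have hU i : h i = \1_(U i) by rewrite /U; case: cid2.
  pose E := A `&` [set w | forall i, U i (B t w i 0 - B s w i 0)].
  have -> : (P A * \prod_i \int[N]_x (h i x)%:E)%E = P E.
    rewrite /E (brownian_increment_indep s0 st tT FA mU); congr (_ * _)%E.
    by apply: eq_bigr => i _; rewrite hU integral_indic// setIT.
  have -> : (fun w => (\1_A w * \prod_i h i (D i w))%:E) = (fun w => (\1_E w)%:E).
    apply/funext => w; congr EFin; rewrite !indicE.
    have [Ew|Ew] := pselect (E w).
      rewrite !mem_set//; last by case: Ew.
      by rewrite big1 ?mulr1// => i _; rewrite hU indicE mem_set//; case: Ew.
    rewrite [w \in E]memNset//.
    have [Aw|Aw] := pselect (A w); last by rewrite memNset// mul0r.
    have /existsNP[i hi] : ~ (forall i, U i (D i w)) by move=> h'; apply: Ew.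
    have hi0 : h i (D i w) = 0 by rewrite hU indicE memNset.
    by rewrite (bigD1 i)//= hi0 mul0r mulr0.
  rewrite integral_indic ?setIT//.
  apply: measurableI => //.
  rewrite (_ : [set w | _] = \bigcap_(i in [set: 'I_m]) [set w | U i (D i w)]).
    apply: fin_bigcap_measurable => [|i _]; first exact: finite_finset.
    by have := mD i measurableT (mU i); rewrite setTI.
  by apply/seteqP; split=> w /= h' i; [move=> _; exact: h'|exact: h'].
have [km|mk] := ltnP k m; last first.
  apply: ih => i; [by move=> ik; apply: h1; exact: ltnW|].
  by rewrite leqNgt (leq_trans (ltn_ord i) mk).
pose j := Ordinal km.
have h0 i x : 0 <= h i x.
  have [ik|ki] := ltnP i k.+1; first by rewrite h1.
  by have [U _ ->] := h2 i ki.
have mh i : measurable_fun setT (h i).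
  have [ik|ki] := ltnP i k.+1; first by rewrite h1.
  by have [U mU ->] := h2 i ki; exact: (@measurable_indic _ (measurableTypeR R)).
have hfin i : (\int[N]_x (h i x)%:E \is a fin_num)%E.
  rewrite ge0_fin_numE; last by apply: integral_ge0 => x _; rewrite lee_fin.
  have [ik|ki] := ltnP i k.+1; first by rewrite h1//; exact: gfin.
  have [U mU ->] := h2 i ki; rewrite integral_indic// setIT.
  by apply: (le_lt_trans (probability_le1 _ mU)); exact: ltry.
pose c := fine (P A * \prod_(i | i != j) \int[N]_x (h i x)%:E)%E.
have cfin : (P A * \prod_(i | i != j) \int[N]_x (h i x)%:E)%E \is a fin_num.
  by rewrite fin_numM ?fin_num_measure// prode_fin_num.
have c0 : 0 <= c.
  apply: fine_ge0; apply: mule_ge0 => //; apply: prode_ge0 => i _.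
  by apply: integral_ge0 => x _; rewrite lee_fin.
have mW : measurable_fun setT (fun w => \1_A w * \prod_(i | i != j) h i (D i w)).
  apply: measurable_funM; first exact: measurable_indic.
  under eq_fun do rewrite -big_filter.
  by apply: measurable_prod => i _; exact: measurableT_comp.
have := @integral_transfer _ _ Omega (measurableTypeR R) R P N (D j)
  (fun w => \1_A w * \prod_(i | i != j) h i (D i w)) c (mD j) mW _ c0 _ (h j) (mh j) (h0 j).
rewrite /c fineK// => H.
rewrite [RHS](_ : _ = (P A * \prod_(i | i != j) \int[N]_x (h i x)%:E) * \int[N]_x (h j x)%:E)%E; last first.
  by rewrite (bigD1 j)//= [in RHS]muleC muleCA.
rewrite -H.
- by apply: eq_integral => w _; rewrite (bigD1 j)//= mulrCA.
- by move=> w; rewrite mulr_ge0//; apply: prodr_ge0.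
move=> U mU.
pose h' i := if i == j then (\1_U : R -> R) else h i.
transitivity (\int[P]_w (\1_A w * \prod_i h' i (D i w))%:E)%E.
  apply: eq_integral => w _; rewrite [in RHS](bigD1 j)//= {1}/h' eqxx mulrCA.
  by congr (_ * (_ * _))%:E; apply: eq_bigr => i /negbTE; rewrite /h' => ->.
rewrite ih; last 2 first.
- move=> i ik; rewrite /h' -(h1 i (ltnW ik)); case: eqP => // ij.
  by move: ik; rewrite ij /= ltnn.
- move=> i ki; rewrite /h'; case: eqP => [_|/eqP ij]; first by exists U.
  apply: h2; rewrite ltn_neqAle ki andbT eq_sym.
  by apply: contra ij => /eqP e; apply/eqP/val_inj.
rewrite (bigD1 j)//= {1}/h' eqxx integral_indic// setIT [in LHS]muleCA muleC; congr (_ * _ * _)%E.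
by apply: eq_bigr => i /negbTE; rewrite /h' => ->.
Qed.

End increment.
End brownian_increment.

Section increment_exp.

Variables s t : R.
Hypotheses (s0 : 0 <= s) (st : s < t) (tT : t <= T).
Let D w := B t w - B s w.
Let ee (c : 'cV[R]_m) w := expR (dotv c (D w) - (t - s) * dotv c c / 2).
Let sT : s <= T. Proof. by rewrite (le_trans _ tT)// ltW. Qed.
Let tT' : 0 <= t <= T. Proof. by rewrite tT (le_trans s0)// ltW. Qed.

Let mD i : measurable_fun setT (fun w => D w i 0).
Proof.
rewrite (_ : (fun w => _) = fun w => B t w i 0 - B s w i 0).
  by apply: measurable_funB; apply: (brownian_meas); rewrite ?s0.
by apply/funext => w; rewrite !mxE.
Qed.

Let mdot (xi : Omega -> 'cV[R]_m) : (forall i, measurable_fun setT (fun w => xi w i 0)) ->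
  measurable_fun setT (fun w => dotv (xi w) (D w)).
Proof.
move=> h; under eq_fun do rewrite dotvE.
by apply: measurable_sum => i; exact: measurable_funM.
Qed.

Let mee (xi : Omega -> 'cV[R]_m) : (forall i, measurable_fun setT (fun w => xi w i 0)) ->
  measurable_fun setT (fun w => ee (xi w) w).
Proof.
move=> h; apply: measurableT_comp => //; apply: measurable_funB; first exact: mdot.
apply: measurable_funM => //; apply: measurable_funM => //.
under eq_fun do rewrite dotvE.
by apply: measurable_sum => i; exact: measurable_funM.
Qed.

Lemma filtration_integral (X Z : Omega -> R) : measurable_fun setT X -> (forall w, 0 <= X w) ->
  (forall A, Fil s A -> (\int[P]_w (\1_A w * X w)%:E = P A)%E) ->
  mat s Z -> (forall w, 0 <= Z w) -> (\int[P]_w (Z w * X w)%:E = \int[P]_w (Z w)%:E)%E.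
Proof.
move=> mX X0 h mZ Z0; have mZ' := mat_meas sT mZ.
pose mphi := isMeasurableFun.Build _ _ Omega (measurableTypeR R) Z mZ'.
pose phi : {mfun Omega >-> measurableTypeR R} := HB.pack Z mphi.
have HU U : @measurable _ (measurableTypeR R) U ->
    (\int[P]_w (\1_U (Z w) * X w)%:E = 1%:E * pushforward P phi U)%E.
  by move=> mU; rewrite mul1e /pushforward -h//; exact: mZ.
have mmax : measurable_fun setT (fun x : measurableTypeR R => Num.max x 0).
  exact: measurable_maxr.
have max0 x : 0 <= Num.max x 0 :> R by rewrite le_max lexx orbT.
have k := @integral_transfer _ _ Omega (measurableTypeR R) R P (pushforward P phi) Z
  X 1 mZ' mX X0 ler01 HU _ mmax max0.
(* The transferred function must be nonnegative on the whole line, hence the positive part. *)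
transitivity (\int[P]_w (Num.max (Z w) 0 * X w)%:E)%E.
  by apply: eq_integral => w _; rewrite max_l.
rewrite k mul1e ge0_integral_pushforward//=.
- by rewrite preimage_setT; apply: eq_integral => w _; rewrite max_l.
- by apply/measurable_EFinP.
- by move=> y _; rewrite lee_fin.
Qed.

Lemma increment_exp_cst (c : 'cV[R]_m) (Z : Omega -> R) : mat s Z ->
  (forall w, 0 <= Z w) ->
  (\int[P]_w (Z w * ee c w)%:E = \int[P]_w (Z w)%:E)%E.
Proof.
apply: filtration_integral => [|w|]; [|exact: expR_ge0|].
  by apply: (@mee (fun=> c)) => i; exact: measurable_cst.
move=> A FA; have mA := filtration_measurable sT FA.
have sd : Num.sqrt (t - s) ^+ 2 = t - s by rewrite sqr_sqrtr// subr_ge0 ltW.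
have sd0 : 0 < Num.sqrt (t - s) by rewrite sqrtr_gt0 subr_gt0.
have I i : (\int[normal_prob 0 (Num.sqrt (t - s))]_x (expR (c i 0 * x - (t - s) * c i 0 ^+ 2 / 2))%:E = 1)%E.
  under eq_integral do rewrite expRD mulrC EFinM.
  rewrite ge0_integralZl_EFin//.
  - rewrite normal_mgf// -EFinM -expRD sd -[RHS]/(1%:E) -(expR0 R); congr (expR _)%:E.
    rewrite expR0; field.
  - by [].
  - by apply/measurable_EFinP; apply: measurableT_comp => //; exact: measurable_funM.
have := @increment_integral s t s0 st tT A
  (fun i x => expR (c i 0 * x - (t - s) * c i 0 ^+ 2 / 2)) FA.
rewrite (eq_bigr (fun=> 1%E)) => [|i _]; last by rewrite I.
rewrite big1// mule1 => <-//.
- apply: eq_integral => w _; rewrite -expR_sum; congr (_ * expR _)%:E.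
  rewrite sumrB dotvE; congr (_ - _); first by apply: eq_bigr => i _; rewrite !mxE.
  by rewrite dotvE mulr_sumr mulr_suml; apply: eq_bigr => i _; rewrite expr2.
- by move=> i; apply: measurableT_comp => //; apply: measurable_funB.
- by move=> i; rewrite I ltry.
Qed.

(* A bounded xi is the uniform limit of processes with finitely many values. *)
Lemma increment_exp (xi : Omega -> 'cV[R]_m) (K : R) (Z : Omega -> R) :
  mat s Z -> (forall w, 0 <= Z w) ->
  (forall i, mat s (fun w => xi w i 0)) -> (forall w i, `|xi w i 0| <= K) ->
  (\int[P]_w (Z w * ee (xi w) w)%:E = \int[P]_w (Z w)%:E)%E.
Proof.
move=> mZ Z0 mxi xiK.
apply: filtration_integral => // [|w|A FA]; [|exact: expR_ge0|].
  by apply: mee => i; exact: (mat_meas sT).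
have -> : P A = (\int[P]_w (\1_A w)%:E)%E by rewrite integral_indic ?setIT//; exact: (filtration_measurable sT FA).
have Z01 w : 0 <= (\1_A w : R) <= 1 by rewrite indicE; case: (_ \in _); rewrite ?lexx ?ler01.
move: (\1_A : Omega -> R) (mat_indic FA : mat s (\1_A)) Z01 => {mZ Z0}Z mZ Z01; pose M : R := 1.
have Z0 w : 0 <= Z w by case/andP: (Z01 w).
have ZM w : Z w <= M by case/andP: (Z01 w).
have K0 : 0 <= `|K| by [].
pose L : R := `|K|.
have xiL w i : `|xi w i 0| <= L by apply: (le_trans (xiK w i)); exact: ler_norm.
have mZ' := mat_meas sT mZ.
have iZ : L1 P Z.
  by apply: (L1_bounded (K := M)) => //; apply: aeW => w; rewrite ger0_norm.
(* Rounds down to a grid of mesh [1 / (n + 1)]; the shift by [L] makes the argument of the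
   truncation nonnegative. *)
pose q n (x : R) : nat := Num.truncn ((x + L) * n.+1%:R).
pose xn n w : 'cV[R]_m := \col_i ((q n (xi w i 0))%:R / n.+1%:R - L).
have qx n w i : 0 <= xi w i 0 - xn n w i 0 <= n.+1%:R^-1.
  have h0 : 0 <= (xi w i 0 + L) * n.+1%:R.
    rewrite mulr_ge0// -lerBlDr sub0r; have := xiL w i; by rewrite ler_norml => /andP[].
  have /andP[h1 h2] := truncn_itv h0.
  rewrite mxE /q; have n0 : 0 < n.+1%:R :> R by [].
  apply/andP; split.
    by rewrite subr_ge0 lerBlDr ler_pdivrMr.
  move: h2; rewrite -ltr_pdivlMr// -natr1 mulrDl mul1r.
  by move: n.+1%:R^-1 => a; lra.
have mxn n i : mat s (fun w => xn n w i 0).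
  rewrite (_ : (fun w => _) = fun w => (fun x => (q n x)%:R / n.+1%:R - L) (xi w i 0)).
    suff h : measurable_fun setT (fun x : R => (q n x)%:R / n.+1%:R - L) by exact: (mat_comp h (mxi i)).
    apply: measurable_funB => //; apply: measurable_funM => //.
    have -> : (fun x => (q n x)%:R : R) = (fun x => (Num.truncn x)%:R) \o (fun x => (x + L) * n.+1%:R) by [].
    apply: measurableT_comp; last by apply: measurable_funM => //; exact: measurable_funD.
    apply: nondecreasing_measurable => //.
    by move=> x y xy; rewrite ler_nat Num.Theory.le_truncn.
  by apply/funext => w; rewrite mxE.
have xnL n w i : `|xn n w i 0| <= L + 1.
  have := qx n w i; have := xiL w i; rewrite !ler_norml.
  have : n.+1%:R^-1 <= 1 :> R by rewrite invf_le1// ler1n.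
  by move: n.+1%:R^-1 => a ? /andP[? ?] /andP[? ?]; apply/andP; split; lra.
have step n Z' : mat s Z' -> (forall w, 0 <= Z' w) ->
  forall a, (\int[P]_w (Z' w * ee (a *: xn n w) w)%:E = \int[P]_w (Z' w)%:E)%E.
  move=> mZ1 Z10 a.
  pose V := {ffun 'I_m -> 'I_(Num.truncn ((L + L) * n.+1%:R)).+1}.
  pose J w : V := [ffun i => inord (q n (xi w i 0))].
  pose val (v : V) : 'cV[R]_m := \col_i ((v i)%:R / n.+1%:R - L).
  have Jx w : xn n w = val (J w).
    apply/matrixP => i j; rewrite !mxE ffunE inordK//.
    rewrite ltnS le_truncn// ler_wpM2r// lerD2r.
    by have := xiL w i; rewrite ler_norml => /andP[].
  have FJ v : Fil s [set w | J w = v].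
    rewrite (_ : [set w | _] = \bigcap_(i in [set: 'I_m]) [set w | xn n w i 0 = val v i 0]).
      apply: (@fin_bigcap_measurable _ (past_type s)) => [|i _]; first exact: finite_finset.
      by have := mxn n i [set val v i 0] (measurable_set1 _).
    apply/seteqP; split=> w /=; first by move=> <- i _; rewrite /= Jx.
    move=> h; apply/ffunP => i; have /= := h i I; rewrite Jx !mxE => /addIr.
    have n0 : n.+1%:R^-1 != 0 :> R by rewrite invr_eq0 pnatr_eq0.
    by move=> /(mulIf n0) /eqP; rewrite eqr_nat => /eqP /val_inj.
  have dec (g : Omega -> 'cV[R]_m -> R) w :
      Z' w * g w (xn n w) = \sum_(v : V) (\1_[set w | J w = v] w * Z' w) * g w (val v).
    rewrite (bigD1 (J w))//= indicE mem_set// mul1r Jx big1 ?addr0// => v vJ.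
    by rewrite indicE memNset ?mul0r//= => e; move: vJ; rewrite e eqxx.
  under eq_integral do rewrite (dec (fun w x => ee (a *: x) w)) -sumEFin.
  rewrite ge0_integral_sum//; last 2 first.
  - move=> v; apply/measurable_EFinP; apply: measurable_funM.
      by apply: measurable_funM; [apply: measurable_indic; exact: (filtration_measurable sT)|exact: (mat_meas sT)].
    by apply: (@mee (fun=> a *: val v)) => i; exact: measurable_cst.
  - by move=> v w _; rewrite lee_fin !mulr_ge0// expR_ge0.
  have mv v : mat s (fun w => \1_[set w | J w = v] w * Z' w).
    by apply: matM => //; exact: mat_indic.
  under eq_bigr => v _.
    rewrite increment_exp_cst//; last by move=> w; rewrite mulr_ge0.
    over.
  rewrite -ge0_integral_sum//; last 2 first.
  - by move=> v; apply/measurable_EFinP; exact: (mat_meas sT).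
  - by move=> v w _; rewrite lee_fin mulr_ge0.
  apply: eq_integral => w _; rewrite sumEFin; congr EFin.
  rewrite -[RHS]mulr1 (dec (fun _ _ => 1)).
  by apply: eq_bigr => v _; rewrite mulr1.
have dot_bd n w : dotv (xn n w) (xn n w) <= m%:R * (L + 1) ^+ 2.
  rewrite dotvE; apply: (@le_trans _ _ (\sum_(i < m) (L + 1) ^+ 2)).
    apply: ler_sum => i _; rewrite -expr2 -real_normK ?num_real//.
    by rewrite lerXn2r ?nnegrE ?addr_ge0.
  by rewrite sumr_const card_ord -[leLHS]mulr_natl.
have ts0 : 0 <= t - s by rewrite subr_ge0 ltW.
pose Q := expR ((t - s) * (m%:R * (L + 1) ^+ 2)).
have mX n : measurable_fun setT (fun w => Z w * ee (xn n w) w).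
  by apply: measurable_funM => //; apply: mee => i; exact: (mat_meas sT).
have mX2 n : measurable_fun setT (fun w => ee (2 *: xn n w) w).
  apply: mee => i; under eq_fun do rewrite mxE.
  by apply: measurable_funM => //; exact: (mat_meas sT).
have mXl : measurable_fun setT (fun w => Z w * ee (xi w) w).
  by apply: measurable_funM => //; apply: mee => i; exact: (mat_meas sT).
have i2 n : L1 P (fun w => ee (2 *: xn n w) w) /\ Ex P (fun w => ee (2 *: xn n w) w) = 1.
  have m1 : mat s (fun=> 1) by exact: mat_cst.
  have h := step n _ m1 (fun=> ler01) 2.
  rewrite -[RHS](EFin_Ex (L1_cst P 1)) Ex_cst in h.
  have i : L1 P (fun w => ee (2 *: xn n w) w).
    apply/integrableP; split; first exact/measurable_EFinP.
    apply: (@le_lt_trans _ _ 1%E); last exact: ltry.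
    rewrite -h le_eqVlt; apply/orP; left; apply/eqP; apply: eq_integral => w _.
    by rewrite mul1r /= ger0_norm// expR_ge0.
  split=> //; have /esym : (1%:E = (Ex P (fun w => ee (2 *: xn n w) w))%:E)%E.
    by rewrite EFin_Ex// -h; apply: eq_integral => w _; rewrite mul1r.
  by case.
(* The exponential for [2 *: xn] also has mean 1, so the squares have bounded means; this gives
   uniform integrability. *)
have XX n w : (Z w * ee (xn n w) w) ^+ 2 <= M ^+ 2 * Q * ee (2 *: xn n w) w.
  rewrite exprMn -mulrA; apply: ler_pM; rewrite ?sqr_ge0//.
    by rewrite lerXn2r ?nnegrE// (le_trans (Z0 w) (ZM w)).
  rewrite /ee /Q -expRM_natl -expRD ler_expR !dotvZl dotvZr.
  have := ler_wpM2l ts0 (dot_bd n w); lra.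
have cX w : Z w * ee (xn n w) w @[n --> \oo] --> Z w * ee (xi w) w.
  have cxi i : xn n w i 0 @[n --> \oo] --> xi w i 0.
    apply/cvgrPdist_le => e e0; near=> n.
    have /andP[h1 h2] := qx n w i; rewrite ger0_norm// (le_trans h2)//.
    by apply/ltW; near: n; exact: (near_infty_natSinv_lt (PosNum e0)).
  apply: cvgM; first exact: cvg_cst.
  apply: (@continuous_cvg _ _ _ _ _ _ expR); first exact: continuous_expR.
  under eq_fun do rewrite !dotvE; rewrite !dotvE.
  apply: cvgB.
    by apply: cvg_sumr => i; apply: cvgM => //; exact: cvg_cst.
  apply: cvgM; last exact: cvg_cst.
  apply: cvgM; first exact: cvg_cst.
  by apply: cvg_sumr => i; exact: cvgM.
pose Z2 n w : R := M ^+ 2 * Q * ee (2 *: xn n w) w.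
have iZ2 n : L1 P (Z2 n) := L1Z _ (i2 n).1.
have Z20 n w : 0 <= Z2 n w.
  by apply: mulr_ge0; [apply: mulr_ge0; [exact: sqr_ge0|exact: expR_ge0]|exact: expR_ge0].
have Z2E n : Ex P (Z2 n) <= M ^+ 2 * Q.
  by rewrite ExZ ?(i2 n).2 ?mulr1//; exact: (i2 n).1.
have UI d : 0 < d -> exists K : R, forall n,
    {ae P, forall w, `|Z w * ee (xn n w) w| <= K + d * Z2 n w}.
  move=> d0; exists d^-1 => n; apply: aeW => w.
  rewrite ger0_norm ?mulr_ge0 ?expR_ge0//.
  apply: (le_trans (ler_invD_sq _ d0)); rewrite lerD2l ler_wpM2l ?(ltW d0)//.
have [iX iXn cE] := vitali mX mXl (aeW P cX) iZ2 Z20 Z2E UI.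
have := cvg_Ex iX iXn cE.
have h n : Ex P (fun w => Z w * ee (xn n w) w) = Ex P Z.
  have := step n Z mZ Z0 1; under eq_integral do rewrite scale1r.
  by rewrite /Ex /Rintegral => ->.
under eq_fun do rewrite h.
move=> H; rewrite -(EFin_Ex iX) -(EFin_Ex iZ); congr EFin.
by rewrite -(cvg_lim _ H)// lim_cst.
Unshelve. all: end_near.
Qed.

End increment_exp.

(** * The Ito integral *)

Section simple.
Local Notation leb := (@lebesgue_measure R).
Local Notation adapted := (sp_adapted P T B).

Lemma predictable_dotv (G N : R -> Omega -> 'cV[R]_m) : prdmx G -> prdmx N ->
  prd (fun t w => dotv (G t w) (N t w)).
Proof.
move=> hG hN; apply: (@predictable_ext (fun t w => \sum_i G t w i 0 * N t w i 0)).
  by move=> t w _; rewrite dotvE.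
by apply: (predictable_sum) => i; exact: (predictableM).
Qed.

Lemma predictable_rint_mat (t : R) X : 0 <= t <= T -> prd X -> mat t (fun w => rint (X ^~ w) t).
Proof.
move=> tT hX; apply/matP.
have h1 : prd (fun s w => Num.max (X s w) 0).
  by apply: (@predictable_comp (fun x => Num.max x 0)) => //; exact: measurable_maxr.
have h2 : prd (fun s w => Num.max (- X s w) 0).
  apply: (@predictable_comp (fun x => Num.max (- x) 0)) => //.
  by apply: measurable_maxr => //; exact: measurableT_comp.
have n1 (Z : R -> Omega -> R) s w : 0 <= Num.max (Z s w) 0 by rewrite le_max lexx orbT.
have k1 := predictable_integral_mat tT h1 (n1 _).
have k2 := predictable_integral_mat tT h2 (n1 (fun s w => - X s w)).
have k : measurable_fun setT (fun w : past_type t =>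
    (\int[leb]_(s in `[0%R, t]) (Num.max (X s w) 0)%:E -
     \int[leb]_(s in `[0%R, t]) (Num.max (- X s w) 0)%:E)%E).
  exact: emeasurable_funB.
have := measurableT_comp (fine_measurable (@measurableT _ (\bar R))) k.
congr (measurable_fun _ _); apply/funext => w; rewrite /= /rint /Rintegral; congr fine.
rewrite [RHS]integralE; congr (_ - _)%E; apply: eq_integral => s _.
  by rewrite funeposE /= EFin_max.
by rewrite funenegE /= EFin_max.
Qed.

Lemma predictable_step (s e : R) (xi : Omega -> R) : 0 <= s -> s <= e -> e <= T -> mat s xi ->
  prd (fun t w => if s < t <= e then xi w else 0).
Proof.
move=> s0 se eT mxi; apply/predictableP => mD U mU.
have FU := mxi U mU.
have mI A : Fil s A -> measurable (`]s, e]%classic `*` A : set (predictable_type)).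
  by move=> FA; apply: sub_sigma_algebra; right; exists s, e, A.
rewrite (_ : _ `&` _ = (`]s, e]%classic `*` (xi @^-1` U)) `|`
   ((`[0, T]%classic `*` setT) `&` ~` (`]s, e]%classic `*` setT) `&` [set q | U 0])).
  apply: measurableU; first exact: mI.
  apply: measurableI.
    by apply: measurableI => //; apply: measurableC; apply: mI; exact: filtrationT.
  have [U0|U0] := pselect (U 0).
    by rewrite (_ : [set q | _] = setT)//; apply/seteqP; split.
  by rewrite (_ : [set q | _] = set0)//; apply/seteqP; split.
apply/seteqP; split=> -[t w] /=; rewrite !in_itv/=.
  by case: ifP => te [[tT _] h]; [left|right; split=> //; split=> //; case; rewrite ?te].
case=> [[te h]|[[[tT _] h] U0]].
  rewrite te; split=> //; split=> //; move/andP : te => [st te].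
  by rewrite (le_trans s0 (ltW st)) (le_trans te eT).
by split=> //; case: ifP => // te; exfalso; apply: h; rewrite te.
Qed.

Lemma sp_predictable S : adapted S -> prdmx (sp_value S).
Proof.
move=> aS i j; rewrite ord1.
apply: (@predictable_ext (fun t w => \sum_(k < sp_card S)
   (if sp_start k < t <= sp_end k then sp_coef k w i 0 else 0))).
  move=> t w _; rewrite /sp_value summxE; apply: eq_bigr => k _.
  by case: ifP; rewrite ?mxE.
apply: (predictable_sum) => k; have [s0 se eT mc _] := aS k.
exact: (predictable_step s0 se eT (mc i)).
Qed.

Lemma sp_bounded S : adapted S -> exists K, forall t w, dotv (sp_value S t w) (sp_value S t w) <= K.
Proof.
move=> aS.
have h k : exists K, forall w i, `|sp_coef (s := S) k w i 0| <= K by have [] := aS k.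
pose K k := projT1 (cid (h k)).
have hK k w i : `|sp_coef (s := S) k w i 0| <= K k by rewrite /K; case: cid.
pose L := \sum_(k < sp_card S) `|K k|.
exists (\sum_(i < m) L ^+ 2) => t w; rewrite dotvE; apply: ler_sum => i _.
rewrite -expr2 -real_normK ?num_real// lerXn2r ?nnegrE ?sumr_ge0//.
rewrite /sp_value summxE; apply: (le_trans (ler_norm_sum _ _ _)).
apply: ler_sum => k _; case: ifP => _; last by rewrite mxE normr0.
exact: (le_trans (hK k w i) (ler_norm _)).
Qed.

Lemma sp_pathL2 S w : adapted S -> pathL2 T (sp_value S ^~ w).
Proof.
move=> aS; have [K hK] := sp_bounded aS.
apply: (@pathL2_bounded _ _ _ _ K) => [i|s _]; last exact: hK.
exact: (predictable_section w (sp_predictable aS i 0)).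
Qed.

Definition sp_cat (S1 S2 : @simple_process disp Omega R m) := @SimpleProcess disp Omega R m (sp_card S1 + sp_card S2)
  (fun k => match fintype.split k with inl i => @sp_start _ _ _ _ S1 i | inr i => @sp_start _ _ _ _ S2 i end)
  (fun k => match fintype.split k with inl i => @sp_end _ _ _ _ S1 i | inr i => @sp_end _ _ _ _ S2 i end)
  (fun k => match fintype.split k with inl i => @sp_coef _ _ _ _ S1 i | inr i => @sp_coef _ _ _ _ S2 i end).

Lemma sp_cat_adapted S1 S2 : adapted S1 -> adapted S2 -> adapted (sp_cat S1 S2).
Proof. by move=> h1 h2 k /=; case: fintype.split => i; [exact: h1|exact: h2]. Qed.

Lemma sp_cat_value S1 S2 t w : sp_value (sp_cat S1 S2) t w = sp_value S1 t w + sp_value S2 t w.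
Proof.
rewrite /sp_value/= big_split_ord/=; congr (_ + _); apply: eq_bigr => k _.
  by rewrite (unsplitK (inl k)).
by rewrite (unsplitK (inr k)).
Qed.

Lemma sp_cat_integral S1 S2 t w :
  sp_integral B (sp_cat S1 S2) t w = sp_integral B S1 t w + sp_integral B S2 t w.
Proof.
rewrite /sp_integral/= big_split_ord/=; congr (_ + _); apply: eq_bigr => k _.
  by rewrite (unsplitK (inl k)).
by rewrite (unsplitK (inr k)).
Qed.

Definition sp_scale (a : R) (S : @simple_process disp Omega R m) := @SimpleProcess disp Omega R m (sp_card S)
  (@sp_start _ _ _ _ S) (@sp_end _ _ _ _ S) (fun k w => a *: sp_coef k w).

Lemma sp_scale_adapted (a : R) S : adapted S -> adapted (sp_scale a S).
Proof.
move=> h k /=; have [s0 se eT mc [K hK]] := h k; split=> //.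
  move=> i; rewrite (_ : (fun w => _) = fun w => a * @sp_coef _ _ _ _ S k w i 0).
    exact: (matM (mat_cst _ _) (mc i)).
  by apply/funext => w; rewrite mxE.
by exists (`|a| * K) => w i; rewrite mxE normrM ler_wpM2l.
Qed.

Lemma sp_scale_value (a : R) S (t : R) w : sp_value (sp_scale a S) t w = a *: sp_value S t w.
Proof.
by rewrite /sp_value scaler_sumr; apply: eq_bigr => k _ /=; case: ifP; rewrite ?scaler0.
Qed.

Lemma sp_scale_integral (a : R) S (t : R) w :
  sp_integral B (sp_scale a S) t w = a * sp_integral B S t w.
Proof. by rewrite /sp_integral mulr_sumr; apply: eq_bigr => k _ /=; rewrite dotvZl. Qed.

(** The part of [S] after time [r] on the event [A]. Subtracting it stops [S] at [r] on [A], and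
    finitely many such subtractions stop [S] at a random time with finitely many values. *)
Definition sp_restart (r : R) (A : set Omega) (S : @simple_process disp Omega R m) :=
  @SimpleProcess disp Omega R m (sp_card S)
    (fun k => Num.max (@sp_start _ _ _ _ S k) r) (fun k => Num.max (@sp_end _ _ _ _ S k) r)
    (fun k w => \1_A w *: sp_coef k w).

Lemma sp_restart_adapted (r : R) A S : 0 <= r <= T -> Fil r A -> adapted S ->
  adapted (sp_restart r A S).
Proof.
move=> /andP[r0 rT] FA aS k /=; have [s0 se eT mc [K hK]] := aS k; split.
- by rewrite le_max s0.
- by rewrite ge_max !le_max se lexx orbT.
- by rewrite ge_max eT.
- move=> i; rewrite (_ : (fun w => _) = fun w => \1_A w * @sp_coef _ _ _ _ S k w i 0).
    have h : r <= Num.max (@sp_start _ _ _ _ S k) r by rewrite le_max lexx orbT.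

    have h' : @sp_start _ _ _ _ S k <= Num.max (@sp_start _ _ _ _ S k) r by rewrite le_max lexx.
    exact: (matM (mat_mono h (mat_indic FA)) (mat_mono h' (mc i))).
  by apply/funext => w; rewrite mxE.
exists K => w i; rewrite mxE normrM indicE.
by case: (w \in A); rewrite ?normr1 ?mul1r// normr0 mul0r (le_trans _ (hK w i)).
Qed.

Lemma sp_restart_value (r : R) A S (t : R) w : sp_value (sp_restart r A S) t w =
  (if r < t then \1_A w else 0) *: sp_value S t w.
Proof.
rewrite /sp_value scaler_sumr; apply: eq_bigr => k _ /=.
rewrite gt_max le_max; case: (ltP r t) => [rt|tr]; last by rewrite andbF scale0r.
by rewrite andbT orbF; case: ifP; rewrite ?scaler0.
Qed.

Lemma sp_restart_integral (r : R) A S (t : R) w : sp_integral B (sp_restart r A S) t w =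
  \1_A w * (sp_integral B S t w - sp_integral B S (Num.min t r) w).
Proof.
rewrite /sp_integral -sumrB mulr_sumr; apply: eq_bigr => k _ /=.
rewrite dotvZl -dotvBr; congr (_ * dotv _ _).
have key e : B (Num.min (Num.max e r) t) w = B (Num.min e t) w -
    B (Num.min e (Num.min t r)) w + B (Num.min t r) w.
  have [er|re] := leP r e.
    by rewrite (min_r (y := Num.min t r)) ?subrK// ge_min er orbT.
  by rewrite [Num.min e (Num.min t r)]minCA (min_l (ltW re)) minC subrr add0r minC.
rewrite !key; apply/matrixP => i j; rewrite !mxE; ring.
Qed.

Fixpoint sp_stop (g : nat -> R) (A : nat -> set Omega) (S : @simple_process disp Omega R m) n :=
  if n is k.+1 then sp_cat (sp_stop g A S k) (sp_scale (-1) (sp_restart (g k) (A k) S)) else S.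

Lemma sp_stop_adapted g A S n : (forall k, 0 <= g k <= T) -> (forall k, Fil (g k) (A k)) ->
  adapted S -> adapted (sp_stop g A S n).
Proof.
move=> hg hA hS; elim: n => //= k ih; apply: sp_cat_adapted => //.
by apply: sp_scale_adapted; exact: sp_restart_adapted.
Qed.

Section stop_at_index.
Variables (g : nat -> R) (J : Omega -> nat) (n : nat).
Let A k := [set w | J w = k].
Hypothesis Jn : forall w, (J w < n)%N.

Lemma sp_stop_sum (x : nat -> R) w :
  \sum_(k < n) \1_(A k) w * x k = x (J w).
Proof.
rewrite (bigD1 (Ordinal (Jn w)))//= indicE mem_set// mul1r big1 ?addr0// => k kJ.
rewrite indicE memNset ?mul0r//= => e; move/eqP : kJ; apply.
exact/val_inj.
Qed.

Lemma sp_stop_value S (t : R) w : sp_value (sp_stop g A S n) t w =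
  stopped (g (J w)) (sp_value S ^~ w) t.
Proof.
have -> : sp_value (sp_stop g A S n) t w =
    (1 - \sum_(k < n) \1_(A k) w * (if g k < t then 1 else 0)) *: sp_value S t w.
  clear Jn; elim: n => /= [|k ih]; first by rewrite big_ord0 subr0 scale1r.
  rewrite sp_cat_value ih sp_scale_value sp_restart_value big_ord_recr/=.
  rewrite scaleN1r -scaleNr -scalerDl; congr (_ *: _).
  by case: ifP => _; rewrite ?mulr1 ?mulr0; ring.
rewrite (sp_stop_sum (fun k => if g k < t then 1 else 0)) /stopped.
by case: (ltP (g (J w)) t) => _; rewrite ?subrr ?scale0r ?subr0 ?scale1r.
Qed.

Lemma sp_stop_integral S (t : R) w : sp_integral B (sp_stop g A S n) t w =
  sp_integral B S (Num.min t (g (J w))) w.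
Proof.
have -> : sp_integral B (sp_stop g A S n) t w = sp_integral B S t w -
   \sum_(k < n) \1_(A k) w * (sp_integral B S t w - sp_integral B S (Num.min t (g k)) w).
  clear Jn; elim: n => /= [|k ih]; first by rewrite big_ord0 subr0.
  rewrite sp_cat_integral ih sp_scale_integral sp_restart_integral big_ord_recr/=; ring.
rewrite (sp_stop_sum (fun k => sp_integral B S t w - sp_integral B S (Num.min t (g k)) w)).
by rewrite subKr.
Qed.

End stop_at_index.

Lemma sp_integral0 S w : adapted S -> sp_integral B S 0 w = 0.
Proof.
move=> aS; rewrite /sp_integral big1// => k _; have [s0 se eT _ _] := aS k.
by rewrite !min_r ?subrr ?dotv0r// (le_trans s0 se).
Qed.

Lemma sp_integral_mat S (t : R) : 0 <= t <= T -> adapted S -> mat t (sp_integral B S t).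
Proof.
move=> /andP[t0 tT] aS.
have mB s i : 0 <= s <= t -> mat t (fun w => B s w i 0) by exact: brownian_mat.
apply: mat_sum => k; have [s0 se eT mc _] := aS k.
have [ts|st] := leP t (sp_start k).
  rewrite !min_r ?(le_trans ts se)//; rewrite (_ : (fun w => _) = fun=> 0); first exact: mat_cst.
  by apply/funext => w; rewrite subrr dotv0r.
rewrite (_ : (fun w => _) = fun w => \sum_i sp_coef k w i 0 *
   (B (Num.min (sp_end k) t) w i 0 - B (sp_start k) w i 0)); last first.
  by apply/funext => w; rewrite dotvE; apply: eq_bigr => i _; rewrite !mxE.
apply: mat_sum => i; apply: matM; first exact: (mat_mono (ltW st) (mc i)).
apply: matB; apply: mB; last by rewrite s0 ltW.
by rewrite ge_min lexx orbT le_min t0 (le_trans s0 se).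
Qed.

Lemma sp_integral_continuous S : adapted S ->
  {ae P, forall w, {within `[0, T], continuous (fun t => sp_integral B S t w)}}.
Proof.
move=> aS; have [_ _ cB _] := setting_B bs.
apply: filterS cB => w hB; rewrite /sp_integral.
have c0 c : {within `[0, T], continuous (fun _ : R => c : R)}.
  by move=> t; exact: cvg_cst.
have cm e : 0 <= e <= T -> forall i, {within `[0, T], continuous (fun t => B (Num.min e t) w i 0)}.
  by move=> eT i; apply: within_continuous_ext (within_continuous_stopped eT (hB i)) => t _; rewrite minC.
apply: within_continuous_sum => k; have [s0 se eT _ _] := aS k.
apply: (@within_continuous_ext _ _ (fun t => \sum_i sp_coef k w i 0 *
   (B (Num.min (sp_end k) t) w i 0 - B (Num.min (sp_start k) t) w i 0))).
  by move=> t _; rewrite dotvE; apply: eq_bigr => i _; rewrite !mxE.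
apply: within_continuous_sum => i; apply: within_continuousZ; apply: within_continuousB.
  by apply: cm; rewrite eT (le_trans s0 se).
by apply: cm; rewrite s0 (le_trans se eT).
Qed.

Section exponential.
Variable S : @simple_process disp Omega R m.
Hypothesis aS : adapted S.
Let X t w := expR (sp_integral B S t w - qv (sp_value S ^~ w) t / 2).
Let F t := (\int[P]_w (X t w)%:E)%E.

Let pS w := sp_pathL2 w aS.

Lemma sp_exp_mat (t : R) : 0 <= t <= T -> mat t (X t).
Proof.
move=> tT; have pp := sp_predictable aS.
apply: (@mat_comp _ (fun w => sp_integral B S t w - qv (sp_value S ^~ w) t / 2) expR) => //.
apply: matB; first exact: sp_integral_mat.
under eq_fun do rewrite mulrC; apply: matM; first exact: mat_cst.
by apply: predictable_rint_mat => //; exact: predictable_dotv.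
Qed.

(** Between points of the partition the integrand is constant in time and known at [u], so passing
    from [u] to [v] multiplies [X u] by the exponential of a Gaussian increment with conditional
    mean 1. *)
Let stepF (u v : R) : 0 <= u -> u <= v -> v <= T ->
  (forall k : 'I_(sp_card S), sp_start k <= u \/ v <= sp_start k) ->
  (forall k : 'I_(sp_card S), sp_end k <= u \/ v <= sp_end k) -> F v = F u.
Proof.
move=> u0; rewrite le_eqVlt => /predU1P[->//|uv] vT hs he.
have uT : 0 <= u <= T by rewrite u0 (le_trans (ltW uv)).
have vT' : 0 <= v <= T by rewrite vT (le_trans u0 (ltW uv)).
have [K hK] : exists K, forall w i, `|sp_value S v w i 0| <= K.
  have [K hK] := sp_bounded aS; exists (K + 1) => w i.
  have h1 := hK v w; have h2 := dotv_coord (sp_value S v w) i.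
  have := sqr_ge0 (`|sp_value S v w i 0| - 1); rewrite -real_normK ?num_real// in h2.
  have := normr_ge0 (sp_value S v w i 0); nra.
have mS i : mat u (fun w => sp_value S v w i 0).
  rewrite (_ : (fun w => _) = fun w => \sum_(k < sp_card S)
     (if sp_start k < v <= sp_end k then sp_coef k w i 0 else 0)); last first.
    apply/funext => w; rewrite /sp_value summxE; apply: eq_bigr => k _.
    by case: ifP; rewrite ?mxE.
  apply: mat_sum => k; have [s0 se eT mc _] := aS k.
  have [/andP[sv _]|_] := boolP (sp_start k < v <= sp_end k); last exact: mat_cst.
  case: (hs k) => su; first exact: (mat_mono su).
  by move: sv; rewrite ltNge su.
have := increment_exp u0 uv vT (sp_exp_mat uT) (fun w => expR_ge0 _) mS hK.
rewrite /F => <-; apply: eq_integral => w _; congr EFin; rewrite /X -expRD; congr expR.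
have -> : sp_integral B S v w = sp_integral B S u w + dotv (sp_value S v w) (B v w - B u w).
  rewrite /sp_integral /sp_value !dotvE.
  transitivity (\sum_(k < sp_card S) (dotv (sp_coef k w)
      (B (Num.min (sp_end k) u) w - B (Num.min (sp_start k) u) w) +
      dotv (if sp_start k < v <= sp_end k then sp_coef k w else 0) (B v w - B u w))).
    apply: eq_bigr => k _; have [s0 se eT mc _] := aS k.
    case: (hs k) => h1.
      have sv : sp_start k <= v by rewrite (le_trans h1 (ltW uv)).
      rewrite (le_lt_trans h1 uv)/= (min_l h1) (min_l sv).
      case: (he k) => h2.
        rewrite leNgt (le_lt_trans h2 uv)/= dotv0l addr0 (min_l h2) min_l//.
        by rewrite (le_trans h2 (ltW uv)).
      rewrite h2 (min_r h2) (min_r (le_trans (ltW uv) h2)) -dotvDr; congr dotv.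
      by apply/matrixP => i j; rewrite !mxE; ring.
    have vs := le_trans (ltW uv) h1.
    rewrite ltNge h1/= dotv0l addr0 (min_r h1) (min_r vs).
    by rewrite !min_r ?subrr ?dotv0r ?(le_trans vs)// (le_trans h1).
  rewrite big_split/=; congr (_ + _).
  under eq_bigr do rewrite dotvE; rewrite exchange_big/=; apply: eq_bigr => i _.
  by rewrite summxE mulr_suml.
have -> : qv (sp_value S ^~ w) v = qv (sp_value S ^~ w) u +
    (v - u) * dotv (sp_value S v w) (sp_value S v w).
  have [_ hS] := pS w; apply/eqP; rewrite addrC -subr_eq; apply/eqP.
  rewrite /ip (@rint_incr R T) ?(ltW uv)//.
  rewrite (@eq_Rintegral _ _ _ _ _ (fun=> dotv (sp_value S v w) (sp_value S v w))); last first.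
    move=> r; rewrite inE /= in_itv/= => /andP[ur rv].
    suff -> : sp_value S r w = sp_value S v w by [].
    apply: eq_bigr => k _; have [s0 se eT mc _] := aS k; congr (if _ then _ else _).
    case: (hs k) => h1; last first.
      by rewrite (ltNge _ r) (le_trans rv h1) (ltNge _ v) h1.
    rewrite (le_lt_trans h1 ur) (le_lt_trans h1 uv)/=.
    case: (he k) => h2; last by rewrite h2 (le_trans rv h2).
    by rewrite !leNgt (le_lt_trans h2 ur) (le_lt_trans h2 uv).
  rewrite Rintegral_cst// mulrC; congr (_ * _).
  by rewrite /= lebesgue_measure_itv/= lte_fin uv -EFinB.
by ring.
Qed.

Lemma sp_exp_mean1 : L1 P (X T) /\ Ex P (X T) = 1.
Proof.
pose pts := [seq sp_start k | k <- enum 'I_(sp_card S)] ++ [seq sp_end k | k <- enum 'I_(sp_card S)].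
have ptsT e : e \in pts -> 0 <= e <= T.
  rewrite mem_cat => /orP[] /mapP[k _ ->]; have [s0 se eT _ _] := aS k.
    by rewrite s0 (le_trans se).
  by rewrite eT (le_trans s0).
have sin k : sp_start (s := S) k \in pts by rewrite mem_cat map_f ?mem_enum.
have ein k : sp_end (s := S) k \in pts by rewrite mem_cat map_f ?mem_enum ?orbT.
have stp u v : 0 <= u -> u <= v -> v <= T -> (forall e, e \in pts -> e <= u \/ v <= e) ->
    F v = F u.
  by move=> u0 uv vT h; apply: stepF => // k; exact: h.
have main := path_invariant stp.
pose l := rcons (sort <=%R pts) T.
have FT : F T = F 0.
  suff <- : F (last 0 l) = F 0 by rewrite /l last_rcons.
  apply: main.
  - rewrite /l rcons_path; apply/andP; split.
      rewrite (path_sortedE le_trans) sort_sorted ?andbT; last exact: le_total.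
      by apply/allP => e; rewrite mem_sort => /ptsT/andP[].
    have := mem_last 0 (sort <=%R pts); rewrite inE => /orP[/eqP ->//|].
    by rewrite mem_sort => /ptsT/andP[].
  - by [].
  - by move=> e; rewrite mem_rcons inE mem_sort => /orP[/eqP ->//|/ptsT/andP[]].
  - by move=> e ep; right; rewrite mem_rcons inE mem_sort ep orbT.
have F0 : F 0 = 1%E.
  rewrite -[RHS](congr1 EFin (Ex_cst P 1)) (EFin_Ex (L1_cst P 1)); apply: eq_integral => w _.
  by congr EFin; rewrite /X (sp_integral0 w aS) /ip rint0 mul0r subr0 expR0.
apply: L1_Ex_eq.
- by have := sp_exp_mat TT; move: (X T) => Y; exact: (mat_meas).
- by move=> w; exact: expR_ge0.
- exact: (etrans FT F0).
Qed.

End exponential.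

End simple.

Section events.

Lemma ae_eventually_cvg0 (A : nat -> set Omega) : (forall n, measurable (A n)) ->
  {ae P, forall w, \forall n \near \oo, ~ A n w} -> P (A n) @[n --> \oo] --> 0%E.
Proof.
move=> mA h.
have e n : P (A n) = (Ex P (\1_(A n)))%:E.
  by rewrite EFin_Ex ?integral_indic ?setIT//; exact: integrable_indic.
under eq_fun do rewrite e; apply: cvgE; apply: (@bounded_cvg_Ex _ _ _ _ _ 1).
- by move=> n; exact: measurable_indic.
- by move=> n w; rewrite indicE; case: (w \in A n); rewrite lexx ler01.
apply: filterS h => w h; apply: cvg_near_cst; apply: filterS h => n h.
by rewrite indicE memNset.
Qed.

Lemma ae_measurable_set (A A' : set Omega) : measurable A ->
  {ae P, forall w, A w <-> A' w} -> measurable A'.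
Proof.
move=> mA [N [mN N0 h]].
have k w : ~ N w -> (A w <-> A' w).
  by move=> Nw; apply: contrapT => h'; apply: Nw; exact: h.
rewrite (_ : A' = (A `&` ~` N) `|` (A' `&` N)).
  apply: measurableU; first by apply: measurableI => //; exact: measurableC.
  by apply: cP; exists N; split=> // w [].
apply/seteqP; split=> w /=; last by case=> -[] // Aw /k[h1 _]; exact: h1.
by have [Nw|Nw] := pselect (N w); [right|left; split=> //; apply/(k _ Nw)].
Qed.

Definition ae_continuous (x : R -> Omega -> R) : Prop :=
  {ae P, forall w, {within `[0, T], continuous (x ^~ w)}}.

Lemma rational_near (x : R -> R) (e t : R) : {within `[0, T], continuous x} ->
  0 <= t <= T -> e < x t -> exists2 q : rat, 0 <= (ratr q : R) <= T & e < x (ratr q : R).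
Proof.
move=> /within_itvP h tT et; have xe : 0 < x t - e by rewrite subr_gt0.
have [d d0 hd] := h t tT _ xe.
case/andP: tT => t0 tT.
have lt : Num.max 0 (t - d) < Num.min T (t + d).
  by rewrite lt_min !gt_max (setting_T bs)/=; apply/and3P; split; lra.
have [q] := rat_in_itvoo lt.
rewrite in_itv/= gt_max lt_min => /andP[/andP[q0 qd] /andP[qT dq]].
have qT' : 0 <= (ratr q : R) <= T by rewrite !ltW.
exists q => //; have h1 : `|t - ratr q| < d by rewrite ltr_distl; apply/andP; split; lra.
have := hd _ qT' h1; rewrite ltr_distl => /andP[]; lra.
Qed.

(** Along a continuous path a strict excess is already seen at a rational time; completeness takes
    care of the exceptional paths. *)
Lemma exceed_measurable (x : R -> Omega -> R) (e : R) :
  (forall t, 0 <= t <= T -> measurable_fun setT (x t)) -> ae_continuous x ->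
  measurable [set w | exists2 t, 0 <= t <= T & e < x t w].
Proof.
move=> mx cx.
pose A : set Omega := \bigcup_(q : rat) [set w | 0 <= (ratr q : R) <= T /\ e < x (ratr q : R) w].
have mA : measurable A.
  apply: bigcupT_measurable_rat => q.
  have [qT|qT] := boolP (0 <= (ratr q : R) <= T); last first.
    by rewrite (_ : [set w | _] = set0)//; apply/seteqP; split=> w //= -[].
  rewrite (_ : [set w | _] = x (ratr q) @^-1` `]e, +oo[).
    by rewrite -[X in measurable X]setTI; apply: mx => //; exact: measurable_itv.
  by apply/seteqP; split=> w /=; rewrite in_itv/= andbT; [case|split].
apply: ae_measurable_set mA _; apply: filterS cx => w cw; split.
  by move=> [q _ [qT h]]; exists (ratr q).
by move=> [t tT /(rational_near cw tT)[q qT h]]; exists q.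
Qed.

Lemma eventually_choice (A : nat -> set Omega) (e : R) : 0 < e ->
  P (A n) @[n --> \oo] --> 0%E -> \forall n \near \oo, (P (A n) <= e%:E)%E.
Proof.
move=> e0 /fine_cvgP[fin /cvgrPdist_le/(_ e e0) h].
apply: filterS2 fin h => n fin; rewrite sub0r normrN -[in X in _ -> X](fineK fin) lee_fin.
by apply: le_trans; exact: ler_norm.
Qed.

End events.

Local Notation aecont := ae_continuous.

Section ito.
Local Notation leb := (@lebesgue_measure R).
Local Notation adapted := (sp_adapted P T B).
Local Notation sproc := (@simple_process disp Omega R m).
Implicit Types (H : R -> Omega -> 'cV[R]_m) (I : R -> Omega -> R) (S : nat -> sproc).

Definition ito_approx S H I w : Prop :=
  cvgL2 T (fun n => sp_value (S n) ^~ w) (H ^~ w) /\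
  unif T (fun n => sp_integral B (S n) ^~ w) (I ^~ w).

(* Almost sure form of ito_integral, along a subsequence. *)
Definition ito H I : Prop :=
  [/\ prdmx H, {ae P, forall w, pathL2 T (H ^~ w)} &
      exists2 S : nat -> sproc, (forall n, adapted (S n)) &
        {ae P, forall w, ito_approx S H I w}].

Lemma predictable_section_mx H w i : prdmx H -> measurable_fun `[0, T] (fun s => H s w i 0).
Proof. by move=> hH; exact: (predictable_section w (hH i 0)). Qed.

Lemma square_integrable_path H : prdmx H -> square_integrable P T H ->
  {ae P, forall w, pathL2 T (H ^~ w)}.
Proof.
move=> hH; apply: filterS => w h; apply: pathL2P => // i.
exact: predictable_section_mx.
Qed.

Lemma path_square_integrable H : {ae P, forall w, pathL2 T (H ^~ w)} ->
  square_integrable P T H.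
Proof. by apply: filterS => w h; rewrite ip_EFin// ltry. Qed.

Lemma ito_mat H I t : 0 <= t <= T -> ito H I -> mat t (I t).
Proof.
move=> tT [_ _ [S aS h]].
apply: (mat_cvg (X := fun n => sp_integral B (S n) t)).
  by move=> n; exact: (sp_integral_mat tT (aS n)).
by apply: filterS h => w [_ /(unif_cvg tT)].
Qed.

Lemma ito_meas H I t : 0 <= t <= T -> ito H I -> measurable_fun setT (I t).
Proof. by move=> tT h; apply: (mat_meas _ (ito_mat tT h)); case/andP: tT. Qed.

Lemma ito_continuous H I : ito H I -> aecont I.
Proof.
move=> [_ _ [S aS h]].
have : {ae P, forall w, forall n, {within `[0, T], continuous (sp_integral B (S n) ^~ w)}}.
  by apply: ae_foralln => n; exact: sp_integral_continuous.
by apply: filterS2 h => w [_ h] c; exact: (unif_within_continuous c h).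
Qed.

Lemma ito_at0 H I : ito H I -> {ae P, forall w, I 0 w = 0}.
Proof.
move=> [_ _ [S aS h]]; apply: filterS h => w [_ h].
rewrite -(cvg_lim _ (unif_cvg T00 h))//.
under eq_fun do rewrite (sp_integral0 w (aS _)).
by rewrite lim_cst.
Qed.

Lemma ito_simple (S : sproc) : adapted S -> ito (sp_value S) (sp_integral B S).
Proof.
move=> aS; split.
- exact: sp_predictable.
- by apply: aeW => w; exact: (sp_pathL2).
exists (fun=> S) => //; apply: aeW => w; split; last first.
  by move=> e e0; apply: nearW => n t _; rewrite subrr normr0 ltW.
rewrite /cvgL2 (_ : (fun _ => _) = fun=> 0); first exact: cvg_cst.
apply/funext => n; rewrite /ip (@rint_ext _ T _ (fun=> 0)) ?rint_cst ?mul0r//.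
by move=> s _; rewrite subrr dotv0l.
Qed.

Lemma ito_ext H H' I I' : (forall t w, 0 <= t <= T -> H t w = H' t w) ->
  {ae P, forall w, forall t, 0 <= t <= T -> I t w = I' t w} -> ito H I -> ito H' I'.
Proof.
move=> HH II [pH hH [S aS h]]; split.
- by move=> i j; apply: predictable_ext (pH i j) => t w tT; rewrite HH.
- apply: filterS hH => w [mH iH]; split.
    move=> i; apply: eq_measurable_fun (mH i) => s; rewrite inE /= in_itv/= => hs.
    by rewrite HH.
  by apply: path_integrable_ext iH => s hs; rewrite HH.
exists S => //; apply: filterS2 II h => w II [h1 h2]; split.
  by apply: cvgL2_ext h1 => // s hs; rewrite HH.
move=> e e0; apply: filterS (h2 e e0) => n h t tT; rewrite -II//; exact: h.
Qed.

Lemma pathL2_ae_add H H' : {ae P, forall w, pathL2 T (H ^~ w)} ->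
  {ae P, forall w, pathL2 T (H' ^~ w)} -> {ae P, forall w, pathL2 T (fun t => H t w + H' t w)}.
Proof. by apply: filterS2 => w; exact: pathL2D. Qed.

Lemma ito_add H H' I I' : ito H I -> ito H' I' ->
  ito (fun t w => H t w + H' t w) (fun t w => I t w + I' t w).
Proof.
move=> [pH hH [S aS h]] [pH' hH' [S' aS' h']]; split.
- move=> i j; apply: predictable_ext (predictableD (pH i j) (pH' i j)) => t w _.
  by rewrite mxE.
- exact: pathL2_ae_add.
exists (fun n => sp_cat (S n) (S' n)); first by move=> n; exact: sp_cat_adapted.
near=> w; have [h1 h2] : ito_approx S H I w by near: w.
have [h1' h2'] : ito_approx S' H' I' w by near: w.
have p1 : pathL2 T (H ^~ w) by near: w.
have p2 : pathL2 T (H' ^~ w) by near: w.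
split.
  apply: cvgL2_ext (cvgL2D T0 (fun n => sp_pathL2 w (aS n)) p1 (fun n => sp_pathL2 w (aS' n)) p2 h1 h1') => //.
  by move=> n s _; rewrite sp_cat_value.
move=> e e0; have e2 : 0 < e / 2 by rewrite divr_gt0.
apply: filterS2 (h2 _ e2) (h2' _ e2) => n k k' t tT.
rewrite sp_cat_integral opprD addrACA (splitr e); apply: (le_trans (ler_normD _ _)).
by apply: lerD; [exact: k|exact: k'].
Unshelve. all: end_near.
Qed.

Lemma ito_scale (a : R) H I : ito H I -> ito (fun t w => a *: H t w) (fun t w => a * I t w).
Proof.
move=> [pH hH [S aS h]]; split.
- move=> i j; apply: predictable_ext (predictableM (predictable_cst a) (pH i j)) => t w _.
  by rewrite mxE.
- by apply: filterS hH => w; exact: pathL2Z.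
exists (fun n => sp_scale a (S n)); first by move=> n; exact: sp_scale_adapted.
apply: filterS2 hH h => w p [h1 h2]; split.
  apply: cvgL2_ext (cvgL2Z T0 a (fun n => sp_pathL2 w (aS n)) p h1) => //.
  by move=> n s _; rewrite sp_scale_value.
move=> e e0; have e2 : 0 < e / (`|a| + 1) by rewrite divr_gt0// ltr_wpDl.
apply: filterS (h2 _ e2) => n k t tT.
rewrite sp_scale_integral -mulrBr normrM.
have := k t tT; rewrite ler_pdivlMr ?ltr_wpDl// mulrC; apply: le_trans.
by rewrite ler_wpM2r// lerDl.
Qed.

Lemma ito_opp H I : ito H I -> ito (fun t w => - H t w) (fun t w => - I t w).
Proof.
move=> /(ito_scale (-1)); apply: ito_ext => [t w _|]; first by rewrite scaleN1r.
by apply: aeW => w t _; rewrite mulN1r.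
Qed.

Lemma ito_sub H H' I I' : ito H I -> ito H' I' ->
  ito (fun t w => H t w - H' t w) (fun t w => I t w - I' t w).
Proof. by move=> h /ito_opp; exact: ito_add. Qed.

Lemma ip_mat H H' t : 0 <= t <= T -> prdmx H -> prdmx H' ->
  mat t (fun w => ip (H ^~ w) (H' ^~ w) t).
Proof. by move=> tT h h'; apply: (predictable_rint_mat) => //; exact: (predictable_dotv). Qed.

Lemma ip_meas H H' t : 0 <= t <= T -> prdmx H -> prdmx H' ->
  measurable_fun setT (fun w => ip (H ^~ w) (H' ^~ w) t).
Proof. by move=> tT h h'; apply: (mat_meas _ (ip_mat tT h h')); case/andP: tT. Qed.

Lemma predictable_mxB H H' : prdmx H -> prdmx H' -> prdmx (fun t w => H t w - H' t w).
Proof.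
move=> h h' i j; apply: predictable_ext (predictableB (h i j) (h' i j)) => t w _.
by rewrite !mxE.
Qed.

Let bad1 (S : sproc) H (e : R) : set Omega :=
  [set w | e < qv (fun s => sp_value S s w - H s w) T].
Let bad2 (S : sproc) I (e : R) : set Omega :=
  [set w | exists2 t, 0 <= t <= T & e < `|sp_integral B S t w - I t w|].

Let bad1_measurable (S : sproc) H (e : R) : adapted S -> prdmx H -> measurable (bad1 S H e).
Proof.
move=> aS pH; have p := predictable_mxB (sp_predictable aS) pH.
have := ip_meas TT p p => /(_ measurableT `]e, +oo[%classic (measurable_itv _)).
by rewrite setTI; congr (measurable _); apply/seteqP; split=> w /=; rewrite in_itv/= andbT.
Qed.

Let bad2_measurable (S : sproc) H I (e : R) : adapted S -> ito H I -> measurable (bad2 S I e).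
Proof.
move=> aS h; apply: (exceed_measurable (x := fun t w => `|sp_integral B S t w - I t w|)).
  move=> t tT; apply: measurableT_comp => //; apply: measurable_funB; last exact: (ito_meas tT h).
  by apply: (mat_meas _ (sp_integral_mat tT aS)); case/andP: tT.
apply: filterS2 (sp_integral_continuous aS) (ito_continuous h) => w c1 c2.
have := within_continuousB c1 c2 => c t; apply: cvg_norm; exact: c.
Qed.

Let bad1_cvg S H I (e : R) : 0 < e -> (forall n, adapted (S n)) -> prdmx H ->
  {ae P, forall w, ito_approx S H I w} -> P (bad1 (S n) H e) @[n --> \oo] --> 0%E.
Proof.
move=> e0 aS pH h; apply: ae_eventually_cvg0 => [n|]; first exact: bad1_measurable.
apply: filterS h => w [/cvgrPdist_le/(_ e e0) h _]; apply: filterS h => n; rewrite sub0r normrN.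
by move=> h; apply/negP; rewrite /bad1 /= -leNgt (le_trans (ler_norm _)).
Qed.

Let bad2_cvg S H I (e : R) : 0 < e -> (forall n, adapted (S n)) -> ito H I ->
  {ae P, forall w, ito_approx S H I w} -> P (bad2 (S n) I e) @[n --> \oo] --> 0%E.
Proof.
move=> e0 aS hI h; apply: ae_eventually_cvg0 => [n|]; first exact: bad2_measurable hI.
apply: filterS h => w [_ /(_ e e0) h]; apply: filterS h => n h [t tT].
by rewrite ltNge h.
Qed.

Lemma ito_to H I : ito H I -> ito_integral P T B H I.
Proof.
move=> hI; have [pH hH [S aS h]] := hI; split=> //; first exact: path_square_integrable.
have [N [mN N0 hN]] := hH.
exists S; split=> // e e0; last first.
  exists (fun n => bad2 (S n) I e); split.
  - by move=> n; exact: bad2_measurable hI.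
  - by move=> n w.
  - exact: (bad2_cvg e0 aS hI h).
exists (fun n => bad1 (S n) H e `|` N); split.
- by move=> n; apply: measurableU => //; exact: bad1_measurable.
- move=> n w /= hw; have [Nw|Nw] := pselect (N w); [by right|left].
  have p : pathL2 T (H ^~ w) by apply: contrapT => k; apply: Nw; exact: hN.
  have p' := pathL2B (sp_pathL2 w (aS n)) p.
  by move: hw; rewrite ip_EFin// lte_fin.
rewrite (_ : (fun n => _) = fun n => P (bad1 (S n) H e)); first exact: bad1_cvg e0 aS pH h.
apply/funext => n; apply/measure_ae_eq; [|exact: bad1_measurable|].
  by apply: measurableU => //; exact: bad1_measurable.
exists N; split=> // w /= k; apply: contrapT => Nw; apply: k; split; last by left.
by case.
Qed.

(** Borel-Cantelli along a subsequence whose k-th term has error [2^-1 ^+ k] off an event of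
    probability at most [2^-1 ^+ k]. *)
Lemma ito_of H I : ito_integral P T B H I -> ito H I.
Proof.
move=> [pH sH [S [aS v1 v2]]]; have hH := square_integrable_path pH sH.
pose e k : R := 2^-1 ^+ k.
have e0 k : 0 < e k by rewrite exprn_gt0// invr_gt0.
have ch k : exists n, (exists2 N1, measurable N1 & (P N1 <= (e k)%:E)%E /\
    [set w | ((e k)%:E < \int[leb]_(t in `[0%R, T]) (enorm (sp_value (S n) t w - H t w) ^+ 2)%:E)%E] `<=` N1) /\
    (exists2 N2, measurable N2 & (P N2 <= (e k)%:E)%E /\
    [set w | exists2 t, 0 <= t <= T & e k < `|sp_integral B (S n) t w - I t w|] `<=` N2).
  have [N1 [mN1 h1 c1]] := v1 _ (e0 k); have [N2 [mN2 h2 c2]] := v2 _ (e0 k).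
  have [n [k1 k2]] := filter_ex (filterI (eventually_choice (e0 k) c1) (eventually_choice (e0 k) c2)).
  by exists n; split; [exists (N1 n)|exists (N2 n)].
pose n k := projT1 (cid (ch k)).
have hn1 k := (projT2 (cid (ch k))).1; have hn2 k := (projT2 (cid (ch k))).2.
pose N1 k := projT1 (cid2 (hn1 k)); pose N2 k := projT1 (cid2 (hn2 k)).
have mN1 k : measurable (N1 k) by rewrite /N1; case: cid2.
have mN2 k : measurable (N2 k) by rewrite /N2; case: cid2.
have pN1 k : (P (N1 k) <= (e k)%:E)%E by rewrite /N1; case: cid2 => ? ? [].
have pN2 k : (P (N2 k) <= (e k)%:E)%E by rewrite /N2; case: cid2 => ? ? [].
split=> //; exists (fun k => S (n k)) => //.
have ec : e k @[k --> \oo] --> 0.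
  by apply: cvg_expr; rewrite ger0_norm ?invr_ge0// invf_lt1// ltr1n.
near=> w.
have p : pathL2 T (H ^~ w) by near: w.
have b1 : \forall k \near \oo, ~ N1 k w by near: w; exact: (borel_cantelli_ae mN1 pN1).
have b2 : \forall k \near \oo, ~ N2 k w by near: w; exact: (borel_cantelli_ae mN2 pN2).
split.
  apply: (@squeeze_cvgr _ _ _ _ (cst 0) e) ec; last exact: cvg_cst.
  apply: filterS b1 => k hk; rewrite (@ip_ge0 R T)//= leNgt; apply/negP => h; apply: hk.
  rewrite /N1; case: cid2 => N' /= _ [_]; apply => /=.
  have p' := pathL2B (sp_pathL2 w (aS (n k))) p.
  by rewrite ip_EFin// lte_fin.
move=> d d0; move/cvgrPdist_le : ec => /(_ d d0) ec.
apply: filterS2 b2 ec => k hk; rewrite sub0r normrN (ger0_norm (ltW (e0 _))) => ekd t tT.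
rewrite leNgt; apply/negP => h; apply: hk.
rewrite /N2; case: cid2 => N' /= _ [_]; apply => /=; exists t => //.
exact: le_lt_trans h.
Unshelve. all: end_near.
Qed.

(** A diagonal sequence: [S k] is within [2^-1 ^+ k] of [Hk k], both for integrands and integrals,
    off an event of probability at most [2^-1 ^+ k]. *)
Lemma ito_lim (Hk : nat -> R -> Omega -> 'cV[R]_m) (Ik : nat -> R -> Omega -> R) H I :
  (forall k, ito (Hk k) (Ik k)) -> prdmx H -> {ae P, forall w, pathL2 T (H ^~ w)} ->
  {ae P, forall w, cvgL2 T (fun k => Hk k ^~ w) (H ^~ w) /\ unif T (fun k => Ik k ^~ w) (I ^~ w)} ->
  ito H I.
Proof.
move=> hk pH hH c.
pose e k : R := 2^-1 ^+ k.
have e0 k : 0 < e k by rewrite exprn_gt0// invr_gt0.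
have ch k : exists S : sproc, [/\ adapted S, (P (bad1 S (Hk k) (e k)) <= (e k)%:E)%E &
    (P (bad2 S (Ik k) (e k)) <= (e k)%:E)%E].
  have [p h [S aS hS]] := hk k.
  have c1 := bad1_cvg (e0 k) aS p hS; have c2 := bad2_cvg (e0 k) aS (hk k) hS.
  have [n [k1 k2]] := filter_ex (filterI (eventually_choice (e0 k) c1) (eventually_choice (e0 k) c2)).
  by exists (S n).
pose S k := projT1 (cid (ch k)).
have aS k : adapted (S k) by rewrite /S; case: cid => ? [].
have h1 k : (P (bad1 (S k) (Hk k) (e k)) <= (e k)%:E)%E by rewrite /S; case: cid => ? [].
have h2 k : (P (bad2 (S k) (Ik k) (e k)) <= (e k)%:E)%E by rewrite /S; case: cid => ? [].
have pk k : prdmx (Hk k) by case: (hk k).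
split=> //; exists S => //.
have ec : e k @[k --> \oo] --> 0.
  by apply: cvg_expr; rewrite ger0_norm ?invr_ge0// invf_lt1// ltr1n.
near=> w.
have p : pathL2 T (H ^~ w) by near: w.
have pk' : forall k, pathL2 T (Hk k ^~ w).
  by near: w; apply: ae_foralln => k; case: (hk k).
have [c1 c2] : cvgL2 T (fun k => Hk k ^~ w) (H ^~ w) /\ unif T (fun k => Ik k ^~ w) (I ^~ w) by near: w.
have b1 : \forall k \near \oo, ~ bad1 (S k) (Hk k) (e k) w.
  by near: w; apply: borel_cantelli_ae => // k; exact: bad1_measurable.
have b2 : \forall k \near \oo, ~ bad2 (S k) (Ik k) (e k) w.
  by near: w; apply: borel_cantelli_ae => // k; exact: bad2_measurable (hk k).
split.
  apply: (@squeeze_cvgr _ _ _ _ (cst 0) (fun k => 2 * e k + 2 * qv (fun s => Hk k s w - H s w) T)).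
  - apply: filterS b1 => k /negP; rewrite /bad1 /= -leNgt => hk'; rewrite (@ip_ge0 R T)//=.
    have q1 := pathL2B (sp_pathL2 w (aS k)) (pk' k); have q2 := pathL2B (pk' k) p.
    apply: (@le_trans _ _ (2 * qv (fun s => sp_value (S k) s w - Hk k s w) T +
       2 * qv (fun s => Hk k s w - H s w) T)); last by rewrite lerD2r ler_pM2l.
    apply: le_trans (ip_addsq T0 q1 q2).
    rewrite le_eqVlt; apply/orP; left; apply/eqP/(@rint_ext _ T) => // s _.
    by rewrite addrA subrK.
  - exact: cvg_cst.
  - rewrite (_ : 0 = 2 * 0 + 2 * 0 :> R); last ring.
    by apply: cvgD; apply: cvgM => //; exact: cvg_cst.
move=> d d0; have d2 : 0 < d / 2 by rewrite divr_gt0.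
move/cvgrPdist_le : ec => /(_ _ d2) ec.
apply: filterS3 b2 ec (c2 _ d2) => k hb; rewrite sub0r normrN (ger0_norm (ltW (e0 _))) => ek hc t tT.
have hb' : `|sp_integral B (S k) t w - Ik k t w| <= e k.
  by rewrite leNgt; apply/negP => h; apply: hb; exists t.
rewrite (_ : sp_integral B (S k) t w - I t w = (sp_integral B (S k) t w - Ik k t w) + (Ik k t w - I t w)); last ring.
rewrite (splitr d); apply: (le_trans (ler_normD _ _)); apply: lerD; last exact: hc.
exact: le_trans ek.
Unshelve. all: end_near.
Qed.

End ito.

(** * Stopping the Ito integral *)

Section ito_stop.
Local Notation adapted := (sp_adapted P T B).
Local Notation sproc := (@simple_process disp Omega R m).
Implicit Types (H : R -> Omega -> 'cV[R]_m) (I : R -> Omega -> R).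

Lemma filtration_first_index (p : nat -> Omega -> bool) (g : nat -> R) N k :
  {homo g : i j / (i <= j)%N >-> i <= j} -> (forall j, Fil (g j) [set w | p j w]) ->
  Fil (g k) [set w | first_index (p ^~ w) N = k].
Proof.
move=> hg hp.
have h1 : Fil (g k) [set w | forall j, (j < k)%N -> ~~ p j w].
  rewrite (_ : [set w | _] = \bigcap_j (if (j < k)%N then ~` [set w | p j w] else setT)).
    apply: filtration_bigcap => j; case: ifP => [jk|_]; last exact: filtrationT.
    by apply: filtrationC; apply: filtration_mono (hp j); apply: hg; exact: ltnW.
  apply/seteqP; split=> w /= h j; first by case: ifP => // /h /negP.
  by move=> jk; have := h j Logic.I; rewrite jk => /negP.
have h2 : Fil (g k) [set w | (k < N)%N && p k w \/ k = N].
  have [->|/eqP kN] := eqVneq k N.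
    by rewrite (_ : [set w | _] = setT); [exact: filtrationT|apply/seteqP; split=> // w _; right].
  case: (k < N)%N => /=.
    by rewrite (_ : [set w | _] = [set w | p k w]) //; apply/seteqP; split=> w /=; [case|left].
  rewrite (_ : [set w | _] = ~` setT); first by apply: filtrationC; exact: filtrationT.
  by apply/seteqP; split=> w /=; [case|move=> /(_ Logic.I)].
have := filtrationI h2 h1; congr (Fil _ _).
by apply/seteqP; split=> w /= /first_indexE.
Qed.

Definition grid N k : R := Num.min (T * (k%:R / N.+1%:R)) T.

Lemma grid_itv N k : 0 <= grid N k <= T.
Proof. by rewrite le_min T0 ge_min lexx orbT !andbT mulr_ge0// divr_ge0. Qed.

Lemma grid_homo N : {homo grid N : i j / (i <= j)%N >-> i <= j}.
Proof.
move=> i j ij; rewrite le_min !ge_min lexx orbT andbT ler_wpM2l//.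
by rewrite ler_wpM2r ?invr_ge0// ler_nat.
Qed.

Lemma grid0 N : grid N 0 = 0.
Proof. by rewrite /grid mul0r mulr0 min_l. Qed.

Lemma grid_last N : grid N N.+1 = T.
Proof. by rewrite /grid divff ?mulr1 ?minxx// pnatr_eq0. Qed.

Lemma grid_step N k : grid N k.+1 <= grid N k + T / N.+1%:R.
Proof.
rewrite -[k.+1]addn1 /grid natrD mulrDl mulrDr mul1r; set a := T * (k%:R / _).
have : 0 <= T / N.+1%:R by rewrite divr_ge0.
by move: (T / _) => b b0; rewrite /Num.min; case: ifP; case: ifP; rewrite ?lexx//; lra.
Qed.

(** Stops at the first grid point where the bracket exceeds [K]. At the previous point it was at
    most [K], and the mesh is so fine that one step adds at most 1. *)
Lemma sp_stop_ip (S : sproc) (K : R) : adapted S -> 0 <= K -> exists S' : sproc,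
  [/\ adapted S', forall w, qv (sp_value S' ^~ w) T <= K + 1 &
    forall w, qv (sp_value S ^~ w) T <= K ->
      sp_integral B S' T w = sp_integral B S T w /\
      qv (sp_value S' ^~ w) T = qv (sp_value S ^~ w) T].
Proof.
move=> aS K0; have [c hc] := sp_bounded aS.
(* With this [N], the bound [c] of the squared integrand times the mesh [T / (N + 1)] is below 1. *)
pose N := Num.truncn (Num.max c 0 * T); pose g := grid N.
pose A t w := qv (sp_value S ^~ w) t.
pose p k w := K < A (g k) w.
pose J w := first_index (p ^~ w) N.+1.
have pS w := sp_pathL2 w aS; have prS := sp_predictable aS.
have gT k : 0 <= g k <= T by exact: grid_itv.
have JN w : (J w < N.+2)%N by rewrite ltnS first_index_le.
have FJ k : Fil (g k) [set w | J w = k].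
  apply: filtration_first_index; first exact: grid_homo.
  by move=> j; apply: mat_lt; [exact: mat_cst|exact: (ip_mat (gT j) prS prS)].
have AJ w : A (g (J w)) w <= K + 1.
  case E : (J w) => [|k].
    by rewrite /g grid0 /A /ip rint0 addr_ge0.
  have hk : A (g k) w <= K.
    by have := @first_index_before (p ^~ w) N.+1 k; rewrite -/(J w) E leNgt; exact.
  apply: (@le_trans _ _ (A (g k) w + 1)); last by rewrite lerD2r.
  rewrite -lerBlDl /A /ip.
  have /andP[g0 g1] := gT k; have /andP[g0' g1'] := gT k.+1.
  have gg : g k <= g k.+1 by apply: grid_homo.
  have [_ iS] := pS w; rewrite (@rint_incr R T)//.
  apply: (@le_trans _ _ (\int[lebesgue_measure]_(r in `]g k, g k.+1]) Num.max c 0)).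
    apply: le_Rintegral => //.
    - by apply: (@path_integrableS R T).
    - apply: (@path_integrableS R T (fun=> Num.max c 0)) => //; exact: path_integrable_cst.
    - by move=> r _; rewrite le_max hc.
  rewrite Rintegral_cst//= lebesgue_measure_itv/= lte_fin.
  case: ifP => _ /=; last by rewrite mulr0.
  apply: (@le_trans _ _ (Num.max c 0 * (T / N.+1%:R))).
    by apply: ler_wpM2l; [rewrite le_max lexx orbT|rewrite lerBlDl grid_step].
  rewrite mulrA ler_pdivrMr ?ltr0n// mul1r ltW//.
  exact: Num.Theory.truncnS_gt.
exists (sp_stop g (fun k => [set w | J w = k]) S N.+2).
have ipE w : qv (sp_value (sp_stop g (fun k => [set w | J w = k]) S N.+2) ^~ w) T = A (g (J w)) w.
  rewrite (_ : sp_value _ ^~ w = stopped (g (J w)) (sp_value S ^~ w)).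
    have /andP[g0 g1] := gT (J w).
    by rewrite (ip_stopped2 g0 g0 TT (pS w) (pS w)) minxx min_l.
  by apply/funext => t; rewrite sp_stop_value.
split.
- exact: sp_stop_adapted.
- by move=> w; rewrite ipE.
move=> w hw; have JT : g (J w) = T.
  have /andP[g0 g1] := gT (J w).
  have := first_index_le (p ^~ w) N.+1; rewrite leq_eqVlt => /orP[/eqP h|h].
    by rewrite /g /J h grid_last.
  have := first_index_at h; rewrite -/(J w) /p ltNge => /negP[].
  by apply: le_trans hw; apply: (ip_nd (T := T)).
by rewrite ipE JT; split=> //; rewrite sp_stop_integral// JT minxx.
Qed.

(** The approximating simple integrals are stopped so that their brackets are uniformly bounded. The
    identity for twice the integrand then bounds the squares of the exponentials, and [vitali] gives
    the limit. *)
Lemma ito_exp H I K : ito H I -> {ae P, forall w, qv (H ^~ w) T <= K} ->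
  L1 P (fun w => expR (I T w - qv (H ^~ w) T / 2)) /\
  Ex P (fun w => expR (I T w - qv (H ^~ w) T / 2)) = 1.
Proof.
move=> hI hK; have [pH hH [S aS hS]] := hI.
(* Strictly above the bound of the limiting bracket, so that the brackets of the approximations are
   eventually below [K'] and stopping no longer alters them. *)
pose K' := Num.max K 0 + 1; have K0 : 0 <= K' by rewrite addr_ge0// le_max lexx orbT.
have ch n := sp_stop_ip (aS n) K0.
pose S' n := projT1 (cid (ch n)).
have aS' n : adapted (S' n) by rewrite /S'; case: cid => ? [].
have bS' n w : qv (sp_value (S' n) ^~ w) T <= K' + 1.
  by rewrite /S'; case: cid => ? [].
have eS' n w : qv (sp_value (S n) ^~ w) T <= K' ->
      sp_integral B (S' n) T w = sp_integral B (S n) T w /\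
      qv (sp_value (S' n) ^~ w) T = qv (sp_value (S n) ^~ w) T.
  by rewrite /S'; case: cid => S1 /= [_ _ h]; exact: h.
pose X n w := expR (sp_integral B (S' n) T w - qv (sp_value (S' n) ^~ w) T / 2).
pose Z n w := expR (K' + 1) * expR (sp_integral B (sp_scale 2 (S' n)) T w -
   qv (sp_value (sp_scale 2 (S' n)) ^~ w) T / 2).
have X1 n := sp_exp_mean1 (aS' n).
have Z1 n := sp_exp_mean1 (sp_scale_adapted (a := 2) (aS' n)).
have mX : measurable_fun setT (fun w => expR (I T w - qv (H ^~ w) T / 2)).
  apply: measurableT_comp => //; apply: measurable_funB; first exact: (ito_meas TT hI).
  by apply: measurable_funM => //; exact: (ip_meas TT pH pH).
have cX : {ae P, forall w, X n w @[n --> \oo] --> expR (I T w - qv (H ^~ w) T / 2)}.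
  apply: filterS3 hH hK hS => w pw kw [c1 c2].
  have pS n := sp_pathL2 w (aS n).
  have cip := unif_cvg TT (ip_cvg T0 pS pw pS pw c1 c1).
  have kk : qv (H ^~ w) T < K'.
    by apply: (le_lt_trans kw); rewrite /K' ltr_pwDr// le_max lexx.
  have ev : \forall n \near \oo, expR (sp_integral B (S n) T w - qv (sp_value (S n) ^~ w) T / 2) = X n w.
    move: (cip) => /cvgr_lt/(_ _ kk); apply: filterS => n /ltW/eS'[e1 e2].
    by rewrite /X e1 e2.
  apply: cvg_trans (near_eq_cvg ev) _; apply: cvg_expR_seq.
  by apply: cvgB; [exact: (unif_cvg TT c2)|apply: cvgMl].
have Z0 n w : 0 <= Z n w by rewrite mulr_ge0 ?expR_ge0.
have ZE n : Ex P (Z n) <= expR (K' + 1) by rewrite ExZ ?(Z1 n).2 ?mulr1//; exact: (Z1 n).1.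
have UI (d : R) : 0 < d -> exists K0 : R, forall n, {ae P, forall w, `|X n w| <= K0 + d * Z n w}.
  move=> d0; exists d^-1 => n; apply: aeW => w.
  rewrite ger0_norm ?expR_ge0//; apply: (le_trans (ler_invD_sq _ d0)).
  suff h : X n w ^+ 2 <= Z n w by apply: lerD; [exact: lexx|apply: ler_wpM2l h; exact: ltW].
  rewrite expr2 /X /Z -expRD -[leRHS]expRD ler_expR.
  rewrite sp_scale_integral (_ : sp_value (sp_scale 2 (S' n)) ^~ w = fun s => 2 *: sp_value (S' n) s w); last first.
    by apply/funext => s; rewrite sp_scale_value.
  have pS' := sp_pathL2 w (aS' n).
  rewrite (ipZl _ TT)//; last exact: pathL2Z.
  by rewrite (ipZr _ TT)//; have := bS' n w; move: (ip _ _ _) => q; lra.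
have [iX iXn cE] := vitali (fun n => L1_meas (X1 n).1) mX cX (fun n => L1Z _ (Z1 n).1) Z0 ZE UI.
split=> //; have := cvg_Ex iX iXn cE; rewrite (_ : (fun n => _) = fun=> 1).
  by move=> h; rewrite -(cvg_lim _ h)// lim_cst.
by apply/funext => n; exact: (X1 n).2.
Qed.

Lemma stopping_itv tau w : stop tau -> 0 <= tau w <= T.
Proof. by case=> h _. Qed.

Lemma stopping_cst (t : R) : 0 <= t <= T -> stop (fun=> t).
Proof.
move=> tT; split=> // s _; case: (leP t s) => _.
  by rewrite (_ : [set w | _] = setT); [exact: filtrationT|apply/seteqP; split].
rewrite (_ : [set w | _] = ~` setT); first by apply: filtrationC; exact: filtrationT.
by apply/seteqP; split=> w //= /(_ Logic.I).
Qed.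

Lemma stopping_min s t : stop s -> stop t -> stop (fun w => Num.min (s w) (t w)).
Proof.
move=> [hs fs] [ht ft]; split.
  move=> w; have /andP[a1 a2] := hs w; have /andP[b1 b2] := ht w.
  by rewrite le_min a1 b1 ge_min a2.
move=> u uT; have := filtrationU (fs u uT) (ft u uT); congr (Fil _ _).
by apply/seteqP; split=> w /=; rewrite ge_min => /orP.
Qed.

Lemma stopping_max s t : stop s -> stop t -> stop (fun w => Num.max (s w) (t w)).
Proof.
move=> [hs fs] [ht ft]; split.
  move=> w; have /andP[a1 a2] := hs w; have /andP[b1 b2] := ht w.
  by rewrite le_max a1 ge_max a2 b2.
move=> u uT; have := filtrationI (fs u uT) (ft u uT); congr (Fil _ _).
by apply/seteqP; split=> w /=; rewrite ge_max => /andP.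
Qed.

(** Comparing means at this stopping time and at [T] gives identities on the event [A], that is,
    statements on conditional expectations. *)
Definition restricted_time (t : R) (A : set Omega) w : R := if w \in A then t else T.

Lemma stopping_restricted (t : R) A : 0 <= t <= T -> Fil t A -> stop (restricted_time t A).
Proof.
move=> tT FA; split; first by move=> w; rewrite /restricted_time; case: ifP.
move=> u /andP[u0 uT]; have := uT; rewrite le_eqVlt => /predU1P[->|uT'].
  rewrite (_ : [set w | _] = setT); first exact: filtrationT.
  by apply/seteqP; split=> // w _; rewrite /= /restricted_time; case: ifP; case/andP: tT.
have [tu|ut] := leP t u.
  rewrite (_ : [set w | _] = A); first exact: (filtration_mono tu FA).
  apply/seteqP; split=> w /=; rewrite /restricted_time; last by move=> Aw; rewrite mem_set.
  by have [|] := boolP (w \in A); rewrite ?inE// leNgt uT'.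
rewrite (_ : [set w | _] = ~` setT); first by apply: filtrationC; exact: filtrationT.
apply/seteqP; split=> w /=; last by move=> /(_ Logic.I).
by rewrite /restricted_time; case: ifP; rewrite leNgt ?ut ?uT'.
Qed.

Section grid_above.
Variable tau : Omega -> R.
Hypothesis htau : stop tau.

Definition grid_index N w := first_index (fun k => tau w <= grid N k) N.+1.
Definition grid_above N w := grid N (grid_index N w).

Lemma grid_index_lt N w : (grid_index N w < N.+2)%N.
Proof. by rewrite ltnS first_index_le. Qed.

Lemma filtration_grid_index N k : Fil (grid N k) [set w | grid_index N w = k].
Proof.
apply: (@filtration_first_index (fun k w => tau w <= grid N k)); first exact: grid_homo.
by move=> j; apply: (proj2 htau); exact: grid_itv.
Qed.

Lemma le_grid_above N w : tau w <= grid_above N w.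
Proof.
have := first_index_le (fun k => tau w <= grid N k) N.+1; rewrite leq_eqVlt => /orP[/eqP h|h].
  by rewrite /grid_above /grid_index h grid_last; case/andP: (stopping_itv w htau).
exact: (first_index_at h).
Qed.

Lemma grid_above_le N w : grid_above N w <= tau w + T / N.+1%:R.
Proof.
have q0 : 0 <= T / N.+1%:R by rewrite divr_ge0.
have /andP[t0 tT] := stopping_itv w htau.
case E : (grid_index N w) => [|k].
  by rewrite /grid_above E grid0 addr_ge0.
rewrite /grid_above E; apply: (le_trans (grid_step _ _)); rewrite lerD2r.
have := @first_index_before (fun k => tau w <= grid N k) N.+1 k.
by rewrite -/(grid_index N w) E -ltNge ltnSn => /(_ isT) /ltW.
Qed.

Lemma grid_above_itv N w : tau w <= grid_above N w <= T.
Proof. by rewrite le_grid_above; case/andP: (grid_itv N (grid_index N w)). Qed.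

Lemma grid_above_cvg w : grid_above N w @[N --> \oo] --> tau w.
Proof.
apply: (@squeeze_cvgr _ _ _ _ (cst (tau w)) (fun N => tau w + T * N.+1%:R^-1)).
- by apply: nearW => N; rewrite le_grid_above grid_above_le.
- exact: cvg_cst.
rewrite -[X in _ --> X]addr0 -[X in _ --> _ + X](mulr0 T).
by apply: cvgD; [exact: cvg_cst|apply: cvgMr; exact: cvg_harmonic].
Qed.

Lemma predictable_after (s : R) A X : 0 <= s <= T -> Fil s A -> prd X ->
  prd (fun t w => \1_A w * (if s < t then X t w else 0)).
Proof.
move=> /andP[s0 sT] FA pX.
apply: predictable_ext (predictableM (predictable_itv s0 sT (lexx T) FA) pX) => t w /andP[_ tT].
rewrite !indicE; have [Aw|Aw] := boolP (w \in A).
  rewrite mul1r; case: ifP => st.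
    by rewrite mem_set ?mul1r//= in_itv/= st; rewrite inE in Aw.
  by rewrite memNset ?mul0r//= in_itv/= st => -[].
rewrite mul0r memNset ?mul0r//= => -[_ h]; move/negP: Aw; apply; exact: mem_set.
Qed.

Lemma predictable_grid_stopped N X : prd X -> prd (fun t w => stopped (grid_above N w) (X ^~ w) t).
Proof.
move=> pX; apply: (@predictable_ext (fun t w => X t w -
   \sum_(k < N.+2) \1_[set w | grid_index N w = k] w * (if grid N k < t then X t w else 0))).
  move=> t w _; have := sp_stop_sum (@grid_index_lt N) (fun k => if grid N k < t then X t w else 0).
  by move=> ->; rewrite /stopped /grid_above; case: ltP; rewrite ?subrr ?subr0.
apply: (predictableB) => //; apply: (predictable_sum) => k.
by apply: predictable_after => //; [exact: grid_itv|exact: filtration_grid_index].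
Qed.

Lemma predictable_stopped X : prd X -> prd (fun t w => stopped (tau w) (X ^~ w) t).
Proof.
move=> pX; apply: (@predictable_lim (fun N t w => stopped (grid_above N w) (X ^~ w) t)).
  by move=> N; exact: predictable_grid_stopped.
move=> t w tT; apply: cvg_near_cst; rewrite /stopped.
have [tt|tt] := leP t (tau w).
  by apply: nearW => N; rewrite (le_trans tt (le_grid_above N w)).
have /cvgr_lt/(_ _ tt) := @grid_above_cvg w.
by apply: filterS => N h; rewrite leNgt h.
Qed.

Lemma predictable_mx_stopped H : prdmx H -> prdmx (fun t w => stopped (tau w) (H ^~ w) t).
Proof.
move=> pH i j; apply: predictable_ext (predictable_stopped (pH i j)) => t w _.
by rewrite /stopped; case: ifP => //; rewrite mxE.
Qed.

(** At a time with finitely many grid values the stopped simple integrals are again integrals of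
    simple processes. The general case follows along grid times converging to [tau] from above. *)
Lemma ito_stop H I : ito H I ->
  ito (fun t w => stopped (tau w) (H ^~ w) t) (fun t w => I (Num.min t (tau w)) w).
Proof.
move=> hI; have [pH hH [S aS hS]] := hI; have cI := ito_continuous hI.
have tT w := stopping_itv w htau.
have step N : ito (fun t w => stopped (grid_above N w) (H ^~ w) t)
    (fun t w => I (Num.min t (grid_above N w)) w).
  pose St n := sp_stop (grid N) (fun k => [set w | grid_index N w = k]) (S n) N.+2.
  have aSt n : adapted (St n).
    apply: sp_stop_adapted => //; first exact: grid_itv.
    by move=> k; exact: filtration_grid_index.
  have lt := @grid_index_lt N.
  have gi w : 0 <= grid_above N w <= T by exact: grid_itv.
  apply: (ito_lim (Hk := fun n => sp_value (St n)) (Ik := fun n => sp_integral B (St n))).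
  - by move=> n; exact: (ito_simple).
  - move=> i j; apply: predictable_ext (predictable_grid_stopped N (pH i j)) => t w _.
    by rewrite /stopped; case: ifP => //; rewrite mxE.
  - by apply: filterS hH => w; exact: pathL2_stopped.
  apply: filterS2 hH hS => w pw [c1 c2]; split; last first.
    move=> e e0; apply: filterS (c2 e e0) => n h t /andP[t0 t1].
    rewrite sp_stop_integral//; apply: h.
    by have /andP[g0 g1] := gi w; rewrite le_min t0 g0 ge_min t1.
  apply: (@squeeze_cvgr _ _ _ _ (cst 0) (fun n => qv (fun s => sp_value (S n) s w - H s w) T)) c1; last exact: cvg_cst.
  apply: nearW => n; rewrite (@ip_ge0 R T)//=.
  have pS := pathL2B (sp_pathL2 w (aS n)) pw.
  rewrite (_ : (fun s => _ - stopped _ _ s) = stopped (grid_above N w) (fun s => sp_value (S n) s w - H s w)); last first.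
    by apply/funext => s; rewrite sp_stop_value// /stopped /grid_above; case: ifP; rewrite ?subr0.
  have /andP[g0 g1] := gi w.
  by rewrite (ip_stopped2 g0 g0 TT pS pS) minxx min_l//; apply: (ip_nd (T := T)).
apply: (ito_lim step).
- exact: predictable_mx_stopped.
- by apply: filterS hH => w; exact: pathL2_stopped.
apply: filterS2 hH cI => w pw cw; split.
  exact: (cvgL2_stopped T0 pw (tT w) (fun N => grid_above_itv N w) (grid_above_cvg (w:=w))).
exact: (unif_stopped cw (tT w) (fun N => grid_above_itv N w) (grid_above_cvg (w:=w))).
Qed.

End grid_above.

End ito_stop.

(** * Hitting times and localisation *)

Section stopping.

Definition adapted (X : R -> Omega -> R) : Prop := forall t, 0 <= t <= T -> mat t (X t).

(** For [t < T], the level is reached by [t] if and only if, for every [k], some rational time gives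
    a value above [a - 1 / (k + 1)]: a maximum exists by compactness. The rational times are cut at
    [t], so that only values known at [t] occur. *)
Lemma stopping_hitting (a : R) X : adapted X -> aecont X -> stop (fun w => hitting T a (X ^~ w)).
Proof.
move=> aX cX; split; first by move=> w; exact: hitting_itv.
move=> t /andP[t0]; rewrite le_eqVlt => /predU1P[->|tT].
  rewrite (_ : [set w | _] = setT); first exact: filtrationT.
  by apply/seteqP; split=> // w _ /=; have /andP[] := hitting_itv T0 a (X ^~ w).
have tT' : 0 <= t <= T by rewrite t0 ltW.
pose E (k : nat) (q : rat) := if 0 <= (ratr q : R) <= T
  then [set w | a - k.+1%:R^-1 < X (Num.min (ratr q) t) w] else ~` setT.
have FE : Fil t (\bigcap_k \bigcup_n (if unpickle n is Some q then E k q else ~` setT)).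
  apply: filtration_bigcap => k; apply: filtration_bigcup => n.
  have F0 : Fil t (~` setT) by apply: filtrationC; exact: filtrationT.
  case: (unpickle n) => [q|//]; rewrite /E; case: ifP => // /andP[q0 qT].
  apply: mat_lt; first exact: mat_cst.
  apply: (@mat_mono (Num.min (ratr q) t)); first by rewrite ge_min lexx orbT.
  by apply: aX; rewrite le_min q0 t0 ge_min qT.
apply: filtration_ae FE _; apply: filterS cX => w cw /=.
have cw' := within_continuous_stopped tT' cw.
rewrite (hitting_leP T0 a cw) ?t0//; split=> [h|[s /andP[s0 st] as_] k _].
  have [c cT hc] := EVT_max T0 cw'.
  exists (Num.min c t); move: cT; rewrite in_itv/= => /andP[c0 cT].
    by rewrite le_min c0 t0 ge_min lexx orbT.
  rewrite leNgt; apply/negP => h'; have e0 : 0 < a - X (Num.min c t) w by rewrite subr_gt0.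
  have [k _ /(_ k (leqnn k)) hk] := near_infty_natSinv_lt (PosNum e0).
  have [n _] := h k Logic.I; case: (unpickle n) => [q|/(_ Logic.I)//].
  rewrite /E; case: ifP => [qT|_ /(_ Logic.I)//] /=.
  have := hc (ratr q); rewrite in_itv/= qT => /(_ isT); move: hk => /=.
  by move: (k.+1%:R^-1) => u; lra.
have [||q qT hq] := @rational_near _ (a - k.+1%:R^-1) s cw'.
- by rewrite s0 (le_trans st (ltW tT)).
- by rewrite min_l// (lt_le_trans _ as_)// ltrBlDr ltrDl invr_gt0.
by exists (pickle q); [exact: Logic.I|rewrite pickleK /E qT; exact: hq].
Qed.

Lemma stopped_meas X tau : adapted X -> aecont X -> stop tau ->
  measurable_fun setT (fun w => X (tau w) w).
Proof.
move=> aX cX st.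
apply: (ae_cvg_measurable (X := fun N w => X (grid_above tau N w) w)); last first.
  apply: filterS cX => w cw; apply: (within_cvg cw (stopping_itv w st)); last exact: (grid_above_cvg st).
  by move=> n; exact: (grid_itv).
move=> N; pose J := grid_index tau N.
rewrite (_ : (fun w => _) = fun w => \sum_(k < N.+2) \1_[set w | J w = k] w * X (grid N k) w).
  apply: measurable_sum => k; apply: measurable_funM.
    apply: measurable_indic; have /andP[_ gT] := grid_itv N k.
    have FJ : filtration P B (grid N k) [set w | J w = k] by exact: (filtration_grid_index st).
    exact: (filtration_measurable gT FJ).
  by apply: (mat_meas _ (aX _ (grid_itv N k))); have /andP[] := grid_itv N k.
have Jn v : (J v < N.+2)%N by rewrite ltnS first_index_le.
by apply/funext => w; rewrite (sp_stop_sum Jn (fun k => X (grid N k) w)).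
Qed.

Lemma adapted_ito H I : ito H I -> adapted I.
Proof. by move=> h t tT; exact: (ito_mat tT h). Qed.

Lemma adapted_ip (H G : R -> Omega -> 'cV[R]_m) : prdmx H -> prdmx G -> adapted (fun t w => ip (H ^~ w) (G ^~ w) t).
Proof. by move=> h1 h2 t tT; exact: (ip_mat). Qed.

Lemma aecont_ip (H G : R -> Omega -> 'cV[R]_m) : {ae P, forall w, pathL2 T (H ^~ w)} ->
  {ae P, forall w, pathL2 T (G ^~ w)} -> aecont (fun t w => ip (H ^~ w) (G ^~ w) t).
Proof. by apply: filterS2 => w h1 h2; exact: ip_continuous. Qed.

Lemma adaptedD X Y : adapted X -> adapted Y -> adapted (fun t w => X t w + Y t w).
Proof. by move=> h1 h2 t tT; exact: matD (h1 t tT) (h2 t tT). Qed.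

Lemma adaptedZ (a : R) X : adapted X -> adapted (fun t w => a * X t w).
Proof. by move=> h1 t tT; exact: matM (mat_cst _ _) (h1 t tT). Qed.

Lemma adaptedB X Y : adapted X -> adapted Y -> adapted (fun t w => X t w - Y t w).
Proof. by move=> h1 h2 t tT; exact: matB (h1 t tT) (h2 t tT). Qed.

Lemma adapted_comp (f : R -> R) X : measurable_fun setT f -> adapted X -> adapted (fun t w => f (X t w)).
Proof. by move=> mf h1 t tT; exact: mat_comp mf (h1 t tT). Qed.

Lemma aecontD X Y : aecont X -> aecont Y -> aecont (fun t w => X t w + Y t w).
Proof. by apply: filterS2 => w; exact: within_continuousD. Qed.

Lemma aecontZ (a : R) X : aecont X -> aecont (fun t w => a * X t w).
Proof. by apply: filterS => w; exact: within_continuousZ. Qed.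

Lemma aecontB X Y : aecont X -> aecont Y -> aecont (fun t w => X t w - Y t w).
Proof. by apply: filterS2 => w; exact: within_continuousB. Qed.

Lemma aecont_comp (f : R -> R) X : continuous f -> aecont X -> aecont (fun t w => f (X t w)).
Proof. by move=> cf; apply: filterS => w cX t; apply: continuous_comp; [exact: cX|exact: cf]. Qed.

(** The times are eventually equal to [T], not merely convergent to it, so that localised quantities
    are eventually constant along almost every path. *)
Definition localizing (X : R -> Omega -> R) (rho : nat -> Omega -> R) : Prop :=
  [/\ forall n, stop (rho n),
      {ae P, forall w, forall n t, 0 <= t <= rho n w -> X t w <= n%:R} &
      {ae P, forall w, \forall n \near \oo, rho n w = T}].

Lemma localizing_hitting X : adapted X -> aecont X -> {ae P, forall w, X 0 w <= 0} ->
  localizing X (fun n w => hitting T n%:R (X ^~ w)).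
Proof.
move=> aX cX X0; split.
- by move=> n; exact: stopping_hitting.
- apply: filterS2 cX X0 => w cw X0 n t; apply: le_hitting => //.
  exact: le_trans X0 (ler0n _ _).
apply: filterS cX => w cw.
have [c _ hc] := EVT_max T0 cw.
near=> n; apply: hitting_last => // t tT.
apply: (le_lt_trans (hc t _)); first by rewrite in_itv.
near: n; exact: nbhs_infty_gtr.
Unshelve. all: end_near.
Qed.

End stopping.

(** * Change of measure *)

Section girsanov.

Definition doleans (N : R -> Omega -> 'cV[R]_m) (I : R -> Omega -> R) (t : R) w : R :=
  expR (I t w - qv (N ^~ w) t / 2).

(** The Girsanov transform of the integral [J] of [G]: what remains a local martingale under the
    density built from [N]. *)
Definition drifted (N G : R -> Omega -> 'cV[R]_m) (J : R -> Omega -> R) (t : R) w : R :=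
  J t w - ip (G ^~ w) (N ^~ w) t.

Lemma doleans_gt0 N I t w : 0 < doleans N I t w.
Proof. exact: expR_gt0. Qed.

Lemma ito_path H I : ito H I -> {ae P, forall w, pathL2 T (H ^~ w)}.
Proof. by case. Qed.

Lemma ito_prd H I : ito H I -> prdmx H.
Proof. by case. Qed.

Lemma doleans_adapted N I : ito N I -> adapted (doleans N I).
Proof.
move=> hN; apply: adapted_comp; first by apply: measurable_expR.
apply: adaptedB; first exact: adapted_ito hN.
have := adaptedZ 2^-1 (adapted_ip (ito_prd hN) (ito_prd hN)).
by under eq_fun do under eq_fun do rewrite mulrC.
Qed.

Lemma doleans_aecont N I : ito N I -> aecont (doleans N I).
Proof.
move=> hN; apply: aecont_comp; first exact: continuous_expR.
apply: aecontB; first exact: (ito_continuous hN).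
have := aecontZ 2^-1 (aecont_ip (ito_path hN) (ito_path hN)).
by under eq_fun do under eq_fun do rewrite mulrC.
Qed.

Lemma drifted_adapted N G J : prdmx N -> ito G J -> adapted (drifted N G J).
Proof.
move=> hN hG; apply: adaptedB; first exact: adapted_ito hG.
exact: (adapted_ip (ito_prd hG) hN).
Qed.

Lemma drifted_aecont N G J : {ae P, forall w, pathL2 T (N ^~ w)} -> ito G J ->
  aecont (drifted N G J).
Proof.
move=> hN hG; apply: aecontB; first exact: (ito_continuous hG).
exact: (aecont_ip (ito_path hG) hN).
Qed.

Section change_of_drift.
Variables (N G : R -> Omega -> 'cV[R]_m) (I J : R -> Omega -> R).
Hypotheses (hN : ito N I) (hG : ito G J).
Variables (rho sigma : Omega -> R) (K' K : R).
Hypotheses (hrho : stop rho) (hsigma : stop sigma).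
Hypothesis sigma_rho : forall w, sigma w <= rho w.
Hypothesis NK : {ae P, forall w, qv (N ^~ w) (rho w) <= K'}.
Hypothesis GK : {ae P, forall w, qv (G ^~ w) (sigma w) <= K}.

Let D w := doleans N I (rho w) w.
Let W w := drifted N G J (sigma w) w.
Let V w := qv (G ^~ w) (sigma w).

Lemma doleans_meas : measurable_fun setT D.
Proof.
by have := stopped_meas (doleans_adapted hN) (doleans_aecont hN) hrho.
Qed.

Lemma drifted_meas : measurable_fun setT W.
Proof.
by have := stopped_meas (drifted_adapted (ito_prd hN) hG) (drifted_aecont (ito_path hN) hG) hsigma.
Qed.

Lemma bracket_meas : measurable_fun setT V.
Proof.
have cV := aecont_ip (ito_path hG) (ito_path hG).
by have := stopped_meas (adapted_ip (ito_prd hG) (ito_prd hG)) cV hsigma.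
Qed.

Let mE (c e : R) : measurable_fun setT (fun w => D w * expR (c * W w - e * V w)).
Proof.
have mD := doleans_meas; have mW := drifted_meas; have mV := bracket_meas.
apply: measurable_funM => //; apply: measurableT_comp => //.
by apply: measurable_funB; apply: measurable_funM.
Qed.

(** The product is the exponential of one integral, with integrand [N] up to [rho] plus [c *: G] up
    to [sigma], to which [ito_exp] applies. The cross term of its bracket turns [J] into [drifted];
    it is evaluated at [sigma] because [sigma <= rho]. *)
Lemma girsanov_exp (c : R) :
  L1 P (fun w => D w * expR (c * W w - c ^+ 2 / 2 * V w)) /\
  Ex P (fun w => D w * expR (c * W w - c ^+ 2 / 2 * V w)) = 1.
Proof.
have h := ito_add (ito_stop hrho hN) (ito_scale c (ito_stop hsigma hG)).
have [rT sT] : (forall w, 0 <= rho w <= T) /\ (forall w, 0 <= sigma w <= T).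
  by split=> w; [exact: (stopping_itv w hrho)|exact: (stopping_itv w hsigma)].
have hb : {ae P, forall w,
    qv (fun t => stopped (rho w) (N ^~ w) t + c *: stopped (sigma w) (G ^~ w) t) T =
    qv (N ^~ w) (rho w) + 2 * c * ip (G ^~ w) (N ^~ w) (sigma w) + c ^+ 2 * V w}.
  apply: filterS2 (ito_path hN) (ito_path hG) => w pN pG.
  have /andP[r0 r1] := rT w; have /andP[s0 s1] := sT w; have sr := sigma_rho w.
  have qN := pathL2_stopped (rho w) pN; have qG := pathL2_stopped (sigma w) pG.
  have qc := pathL2Z c qG; have qs := pathL2D qN qc.
  rewrite (ipDl TT qN qc qs) (ipDr TT qN qc qN) (ipDr TT qN qc qc).
  rewrite (ipZl c TT qG qN) (ipZr c TT qN qG) (ipZl c TT qG qc) (ipZr c TT qG qG).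
  rewrite (ip_stopped2 r0 r0 TT pN pN) (ip_stopped2 r0 s0 TT pN pG).
  rewrite (ip_stopped2 s0 r0 TT pG pN) (ip_stopped2 s0 s0 TT pG pG) !minxx.
  rewrite (min_r sr) (min_l sr) (min_l r1) (min_l s1) (ipC (N ^~ w)) /V; ring.
have hK : {ae P, forall w,
    qv (fun t => stopped (rho w) (N ^~ w) t + c *: stopped (sigma w) (G ^~ w) t) T <= 2 * K' + 2 * (c ^+ 2 * K)}.
  apply: filterS2 (filterI NK GK) (filterI (ito_path hN) (ito_path hG)) => w [kN kG] [pN pG].
  have /andP[r0 r1] := rT w; have /andP[s0 s1] := sT w.
  have qN := pathL2_stopped (rho w) pN; have qG := pathL2_stopped (sigma w) pG.
  apply: (le_trans (ip_addsq T0 qN (pathL2Z c qG))).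
  rewrite (ipZl c TT qG (pathL2Z c qG)) (ipZr c TT qG qG).
  rewrite (ip_stopped2 r0 r0 TT pN pN) (ip_stopped2 s0 s0 TT pG pG) !minxx (min_l r1) (min_l s1).
  apply: lerD; apply: ler_wpM2l => //; rewrite mulrA -expr2; apply: ler_wpM2l => //; exact: sqr_ge0.
have [iX EX] := ito_exp h hK.
have e : {ae P, forall w, expR (I (Num.min T (rho w)) w + c * J (Num.min T (sigma w)) w -
    qv (fun t => stopped (rho w) (N ^~ w) t + c *: stopped (sigma w) (G ^~ w) t) T / 2) =
    D w * expR (c * W w - c ^+ 2 / 2 * V w)}.
  apply: filterS hb => w ->; rewrite /D /doleans -expRD; congr expR.
  have /andP[_ r1] := rT w; have /andP[_ s1] := sT w.
  by rewrite (min_r r1) (min_r s1) /W /drifted; lra.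
have mX := L1_meas iX; have mY := mE c (c ^+ 2 / 2).
by split; [exact: L1_ae mY e iX|rewrite -[RHS]EX; apply/esym; exact: Ex_ae mX mY e].
Qed.

Lemma doleans_mean1 : L1 P D /\ Ex P D = 1.
Proof.
have := girsanov_exp 0; rewrite (_ : (fun w => _) = D)//.
by apply/funext => w; rewrite expr0n /= !mul0r subrr expR0 mulr1.
Qed.

Lemma drifted_exp_bound (c : R) : L1 P (fun w => D w * expR (c * W w)) /\
  Ex P (fun w => D w * expR (c * W w)) <= expR (c ^+ 2 * K / 2).
Proof.
have [iX EX] := girsanov_exp c.
have mY : measurable_fun setT (fun w => D w * expR (c * W w)).
  have := mE c 0; rewrite (_ : (fun w => _) = fun w => D w * expR (c * W w))//.
  by apply/funext => w; rewrite mul0r subr0.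
have le : {ae P, forall w, D w * expR (c * W w) <=
    expR (c ^+ 2 * K / 2) * (D w * expR (c * W w - c ^+ 2 / 2 * V w))}.
  apply: filterS GK => w k; rewrite mulrCA; apply: ler_wpM2l; first exact/ltW/doleans_gt0.
  rewrite -expRD ler_expR; have : c ^+ 2 * V w <= c ^+ 2 * K by apply: ler_wpM2l => //; exact: sqr_ge0.
  by move: (c ^+ 2) (c * W w) => a b; rewrite /V; lra.
have iY : L1 P (fun w => D w * expR (c * W w)).
  apply: (L1_le mY) (L1Z (expR (c ^+ 2 * K / 2)) iX); apply: filterS le => w h.
  by rewrite [`|_|]ger0_norm; [exact: h|apply: mulr_ge0; [exact/ltW/doleans_gt0|exact: expR_ge0]].
split=> //; apply: (le_trans (Ex_le iY (L1Z _ iX) le)).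
by rewrite ExZ// EX mulr1.
Qed.

(** A first-order argument: [1 + x <= expR x] in [girsanov_exp] bounds [c * Ex (D W)] by a multiple
    of [c ^+ 2], for [c] of either sign. *)
Lemma drifted_mean0 : L1 P (fun w => D w * W w) /\ Ex P (fun w => D w * W w) = 0.
Proof.
have mD := doleans_meas; have mW := drifted_meas; have mV := bracket_meas.
have iDW : L1 P (fun w => D w * W w).
  have [i1 _] := drifted_exp_bound 1; have [i2 _] := drifted_exp_bound (-1).
  apply: (L1_le (measurable_funM mD mW)) (L1D i1 i2); apply: aeW => w.
  have D0 : 0 < D w by exact: doleans_gt0.
  rewrite normrM (ger0_norm (ltW D0)) -mulrDr ler_pM2l// mul1r mulN1r.
  have h1 := expR_ge1Dx (W w); have h2 := expR_ge1Dx (- W w).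
  have e1 := expR_ge0 (W w); have e2 := expR_ge0 (- W w).
  by case: (lerP 0 (W w)) => h; [rewrite ger0_norm|rewrite ltr0_norm]; lra.
have [iD ED] := doleans_mean1.
have iDV : L1 P (fun w => D w * V w).
  apply: (L1_le (measurable_funM mD mV)) (L1Z K iD); apply: filterS GK => w k.
  have D0 : 0 < D w by exact: doleans_gt0.
  have V0 : 0 <= V w by apply: (@ip_ge0 R T); have /andP[] := stopping_itv w hsigma.
  rewrite [`|_|]ger0_norm; last by apply: mulr_ge0 => //; exact: ltW.
  by rewrite [leRHS]mulrC; apply: ler_wpM2l => //; exact: ltW.
have le (c : R) : c * Ex P (fun w => D w * W w) <= c ^+ 2 / 2 * Ex P (fun w => D w * V w).
  have [iX EX] := girsanov_exp c; rewrite -subr_le0.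
  have : Ex P (fun w => D w + (c * (D w * W w) - c ^+ 2 / 2 * (D w * V w))) <= 1.
    rewrite -[leRHS]EX; apply: Ex_le => //.
      by apply: L1D => //; apply: L1B; exact: L1Z.
    apply: aeW => w; rewrite (_ : D w + _ = D w * (1 + (c * W w - c ^+ 2 / 2 * V w))); last ring.
    by apply: ler_wpM2l; [exact/ltW/doleans_gt0|exact: expR_ge1Dx].
  rewrite ExD//; last by apply: L1B; exact: L1Z.
  by rewrite ExB ?ExZ ?ED; try exact: L1Z; rewrite -?lerBrDl ?subrr.
split=> //; set x := Ex _ _ in le *; move: le; set y := Ex _ _ => le.
have y0 : 0 < `|y| + 1 by rewrite ltr_wpDl.
(* This value of [c] makes the quadratic term smaller than the linear one unless [x = 0]. *)
have := le (x / (`|y| + 1)); have : x / (`|y| + 1) * (`|y| + 1) = x by rewrite divfK// gt_eqF.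
move: (x / _) => q <-; rewrite expr2 => h.
have : q * q == 0.
  rewrite eq_le -expr2 sqr_ge0 andbT expr2.
  by have := sqr_ge0 q; rewrite expr2; have := ler_norm y; have := normr_ge0 y; nra.
by rewrite mulf_eq0 orbb => /eqP ->; rewrite mul0r.
Qed.

End change_of_drift.
End girsanov.

(** * Reverse Hoelder inequality *)

Section reverse_holder.

Variables (N G : R -> Omega -> 'cV[R]_m) (I J Y : R -> Omega -> R) (c : R).
Hypotheses (hN : ito N I) (hG : ito G J) (c0 : 0 < c).
Hypothesis Yc : {ae P, forall w, forall t, 0 <= t <= T -> `|Y t w| <= c}.
Hypothesis YE : {ae P, forall w, forall t, 0 <= t <= T ->
  drifted N G J t w = Y t w - Y 0 w - qv (N ^~ w) t / 2}.

Let A t w := qv (N ^~ w) t.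
(** The length of the slices of the bracket. Passing from one level to the next costs [b / 2], while
    the increment of [Y] is at most [2 * c]; the ratio [2 * c / (b / 2)] is one half. As [delta] is
    such that [expR (delta * b) = q] with [q < 2], the geometric series for the exponential moment
    converges. *)
Let b := 8 * c.
Let b0 : 0 < b. Proof. by rewrite mulr_gt0. Qed.
Let q : R := 5 / 4.
Let delta := ln q / b.
Let q1 : 1 < q. Proof. by rewrite /q; lra. Qed.
Let delta0 : 0 < delta. Proof. by rewrite divr_gt0// ln_gt0. Qed.

Section stopped.
Variables (zeta : Omega -> R) (K : R).
Hypothesis hz : stop zeta.
Hypothesis NK : {ae P, forall w, qv (N ^~ w) (zeta w) <= K}.
Hypothesis GK : {ae P, forall w, qv (G ^~ w) (zeta w) <= K}.

Let D w := doleans N I (zeta w) w.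
Let V w := A (zeta w) w.
Let level j w := Num.min (hitting T (j%:R * b) (A ^~ w)) (zeta w).
Let above j w : R := \1_[set w | j%:R * b <= V w] w.

Let zT w : 0 <= zeta w <= T. Proof. exact: (stopping_itv w hz). Qed.
Let D0 w : 0 < D w. Proof. exact: doleans_gt0. Qed.
Let sA j : stop (level j).
Proof.
apply: (stopping_min _ hz); apply: (stopping_hitting).
  exact: (adapted_ip (ito_prd hN) (ito_prd hN)).
exact: (aecont_ip (ito_path hN) (ito_path hN)).
Qed.
Let lz j w : level j w <= zeta w. Proof. by rewrite ge_min lexx orbT. Qed.
Let lT j w : 0 <= level j w <= T. Proof. exact: (stopping_itv w (sA j)). Qed.
Let mV : measurable_fun setT V := bracket_meas hN hz.
Let mD : measurable_fun setT D := doleans_meas hN hz.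
Let iD : L1 P D /\ Ex P D = 1.
Proof. exact: (doleans_mean1 hN hN hz hz (fun w => lexx _) NK NK). Qed.

Let mabove j : measurable_fun setT (above j).
Proof.
apply: measurable_indic; rewrite (_ : [set w | _] = V @^-1` `[j%:R * b, +oo[).
  by rewrite -[X in measurable X]setTI; apply: mV => //; exact: measurable_itv.
by apply/seteqP; split=> w /=; rewrite in_itv/= andbT.
Qed.

Let aboveE j w : above j w = if j%:R * b <= V w then 1 else 0.
Proof.
by rewrite /above indicE; case: ifP => h; [rewrite mem_set|rewrite memNset//= h].
Qed.

Let iabove j : L1 P (fun w => D w * above j w).
Proof.
apply: (L1_le (measurable_funM mD (mabove j)) _ iD.1); apply: aeW => w.
rewrite /= aboveE; have := ltW (D0 w); case: ifP => _ h; first by rewrite mulr1 ger0_norm.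
by rewrite mulr0 normr0.
Qed.

Let levelE : {ae P, forall w, forall j, A (level j w) w = Num.min (j%:R * b) (V w)}.
Proof.
apply: filterS (ito_path hN) => w pN j.
have cA := ip_continuous T0 pN pN; have jb : 0 <= j%:R * b by rewrite mulr_ge0// ltW.
have A0 : A 0 w <= j%:R * b by rewrite /A /ip rint0.
have /andP[z0 z1] := zT w; have /andP[h0 h1] := hitting_itv T0 (j%:R * b) (A ^~ w).
have nd s t : 0 <= s -> s <= t -> t <= T -> A s w <= A t w by move=> *; exact: (ip_nd (T := T)).
rewrite /level; have [hz'|zh] := leP (hitting T (j%:R * b) (A ^~ w)) (zeta w).
  have le : A (hitting T (j%:R * b) (A ^~ w)) w <= j%:R * b.
    by apply: (le_hitting T0 cA A0); rewrite h0 lexx.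
  have [hT|hT] := ltP (hitting T (j%:R * b) (A ^~ w)) T.
    have ge := hitting_at T0 cA hT.
    have e : A (hitting T (j%:R * b) (A ^~ w)) w = j%:R * b by apply/eqP; rewrite eq_le le.
    by rewrite e min_l// -{1}e; exact: nd.
  have e : zeta w = hitting T (j%:R * b) (A ^~ w).
    by apply/eqP; rewrite eq_le hz' (le_trans z1 hT).
  by rewrite /V e min_r.
rewrite min_r//; apply: (le_hitting T0 cA A0); rewrite z0; exact: ltW.
Qed.

(** If the bracket at [zeta] stays below level [j], both times equal [zeta] and the increment
    vanishes. *)
Let Ydiff : {ae P, forall w, forall j,
  Y (level j.+1 w) w - Y (level j w) w <= 2 * c * above j w}.
Proof.
apply: filterS2 (ito_path hN) Yc => w pN Yw j; rewrite aboveE; case: ifPn => [_|].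
  have := Yw _ (lT j.+1 w); have := Yw _ (lT j w).
  by rewrite !ler_norml => /andP[? ?] /andP[? ?]; lra.
rewrite -ltNge => h; have cA := ip_continuous T0 pN pN.
have key i : (j <= i)%N -> level i w = zeta w.
  move=> ji; apply: min_r; rewrite leNgt; apply/negP => h'.
  have /andP[h0 _] := hitting_itv T0 (i%:R * b) (A ^~ w); have /andP[z0 z1] := zT w.
  have ge := hitting_at T0 cA (lt_le_trans h' z1).
  have le : A (hitting T (i%:R * b) (A ^~ w)) w <= V w by exact: (ip_nd h0 (ltW h') z1 pN).
  have : j%:R * b <= i%:R * b by rewrite ler_pM2r// ler_nat.
  by move: (le_trans ge le); lra.
by rewrite !key// subrr mulr0.
Qed.

(** Under the density, the drifted integral has equal means at two consecutive levels, and by [YE]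
    its increment is that of [Y] minus half of that of the bracket. *)
Let above_half j : Ex P (fun w => D w * above j.+1 w) <= Ex P (fun w => D w * above j w) / 2.
Proof.
have lin (y1 y2 y0 m1 m2 a1 a2 : R) : y1 - y2 <= 2 * c * a1 -> b * a2 <= m1 - m2 ->
    y1 - y0 - m1 / 2 - (y2 - y0 - m2 / 2) <= 2 * c * a1 - b / 2 * a2.
  by move: b => b'; lra.
have lin2 (x y : R) : 0 <= 2 * c * x - b / 2 * y -> y <= x / 2.
  by move=> h; rewrite -(ler_pM2l c0); move: h; rewrite /b; lra.
have bG i : {ae P, forall w, qv (G ^~ w) (level i w) <= K}.
  apply: filterS2 GK (ito_path hG) => w h pG; apply: le_trans h.
  have /andP[l0 _] := lT i w; have /andP[_ z1] := zT w.
  exact: (ip_nd l0 (lz i w) z1 pG).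
have [i1 e1] := drifted_mean0 hN hG hz (sA j) (lz j) NK (bG j).
have [i2 e2] := drifted_mean0 hN hG hz (sA j.+1) (lz j.+1) NK (bG j.+1).
have : Ex P (fun w => D w * drifted N G J (level j.+1 w) w - D w * drifted N G J (level j w) w) = 0.
  by rewrite (ExB i2 i1) e1 e2 subrr.
have le : {ae P, forall w, D w * drifted N G J (level j.+1 w) w - D w * drifted N G J (level j w) w <=
    2 * c * (D w * above j w) - b / 2 * (D w * above j.+1 w)}.
  apply: filterS2 (filterI YE levelE) Ydiff => w [Ew lw] yd.
  rewrite (Ew _ (lT j.+1 w)) (Ew _ (lT j w)) -!/(A _ w) (lw j) (lw j.+1) -mulrBr.
  rewrite !(mulrCA _ (D w)) -mulrBr; apply: ler_wpM2l; first exact: ltW.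
  apply: (lin _ _ _ _ _ _ _ (yd j)).
  rewrite aboveE; have jb : j.+1%:R * b = j%:R * b + b by rewrite -natr1 mulrDl mul1r.
  case: ifPn => [h|_].
    have jl : j%:R * b <= j.+1%:R * b by rewrite jb lerDl ltW.
    by rewrite mulr1 (min_l h) (min_l (le_trans jl h)) jb addrAC subrr add0r.
  rewrite mulr0 subr_ge0 le_min !ge_min lexx orbT andbT jb.
  by rewrite lerDl ltW.
move=> e0; have := Ex_le (L1B i2 i1) (L1B (L1Z (2 * c) (iabove j)) (L1Z (b / 2) (iabove j.+1))) le.
rewrite e0 ExB; [|exact: L1Z|exact: L1Z].
by rewrite (ExZ _ (iabove j)) (ExZ _ (iabove j.+1)); exact: lin2.
Qed.

Let above_geometric j : Ex P (fun w => D w * above j w) <= 2^-1 ^+ j.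
Proof.
elim: j => [|j ih]; last by rewrite exprSr; apply: le_trans (above_half j) _; rewrite ler_pM2r// invr_gt0.
rewrite expr0 -[leRHS]iD.2; apply: Ex_le => //; first exact: iD.1.
apply: aeW => w; rewrite aboveE; case: ifP => _; rewrite ?mulr1 ?mulr0//; exact: ltW.
Qed.

Let Xj j w := D w * expR (delta * Num.min (j%:R * b) (V w)).

Let mXj j : measurable_fun setT (Xj j).
Proof.
apply: measurable_funM => //; apply: measurableT_comp => //; apply: measurable_funM => //.
exact: measurable_minr.
Qed.

Let V0 w : 0 <= V w. Proof. by apply: (@ip_ge0 R T); case/andP: (zT w). Qed.

Let iXj j : L1 P (Xj j).
Proof.
apply: (L1_le (mXj j) _ (L1Z (expR (delta * (j%:R * b))) iD.1)); apply: aeW => w.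
rewrite ger0_norm ?mulr_ge0 ?expR_ge0 ?(ltW (D0 w))// [leRHS]mulrC.
by rewrite ler_wpM2l ?(ltW (D0 w))// ler_expR ler_wpM2l ?(ltW delta0)// ge_min lexx.
Qed.

(** Passing level [j] adds at most [q ^+ j * (q - 1)] on a set of mass at most [2^-1 ^+ j], that is
    [(5 / 8) ^+ j / 4], with total [2 / 3]. *)
Let exp_level j : Ex P (Xj j) <= 1 + 2 / 3 * (1 - (5 / 8) ^+ j).
Proof.
elim: j => [|j ih].
  rewrite expr0 subrr mulr0 addr0 -[leRHS]iD.2; apply: Ex_le => //; first exact: iD.1.
  by apply: aeW => w; rewrite /Xj mul0r (min_l (V0 w)) mulr0 expR0 mulr1.
have qE (k : nat) : expR (delta * (k%:R * b)) = q ^+ k.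
  rewrite mulrCA /delta divfK ?gt_eqF// -[in RHS](@lnK _ q) ?posrE ?(lt_trans ltr01 q1)//.
  by rewrite -expRM_natl mulr_natl.
have le : {ae P, forall w, Xj j.+1 w <= Xj j w + q ^+ j * (q - 1) * (D w * above j w)}.
  apply: aeW => w; rewrite /Xj [X in _ + X]mulrCA -mulrDr; apply: ler_wpM2l; first exact: ltW.
  rewrite aboveE; have jb : j%:R * b <= j.+1%:R * b by rewrite ler_pM2r// ler_nat.
  case: ifPn => [h|]; last by rewrite -ltNge => h; rewrite mulr0 addr0 !min_r// ?(le_trans (ltW h)).
  rewrite mulr1 (min_l h) qE (_ : q ^+ j + _ = q ^+ j.+1); last by rewrite exprS; ring.
  by rewrite -qE ler_expR ler_wpM2l ?(ltW delta0)// ge_min lexx.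
apply: (le_trans (Ex_le (iXj _) (L1D (iXj j) (L1Z _ (iabove j))) le)).
rewrite ExD//; last exact: L1Z.
rewrite ExZ//; have h := above_geometric j.
have k : q ^+ j * (q - 1) * Ex P (fun w => D w * above j w) <= 4^-1 * (5 / 8) ^+ j.
  apply: (@le_trans _ _ (q ^+ j * (q - 1) * 2^-1 ^+ j)).
    by apply: ler_wpM2l => //; rewrite mulr_ge0 ?exprn_ge0 ?subr_ge0 ?(ltW q1)// (le_trans ler01 (ltW q1)).
  rewrite mulrAC -exprMn (_ : q / 2 = 5 / 8) /q; last lra.
  by rewrite mulrC (_ : 5 / 4 - 1 = 4^-1 :> R)//; lra.
move: ih k; rewrite exprS; move: ((5 / 8) ^+ j) (q ^+ j * _ * _) (Ex P _) => x y z; lra.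
Qed.

Lemma doleans_bracket_exp : L1 P (fun w => D w * expR (delta * V w)) /\
  Ex P (fun w => D w * expR (delta * V w)) <= 2.
Proof.
pose j := (Num.truncn (K / b)).+1.
have e : {ae P, forall w, Xj j w = D w * expR (delta * V w)}.
  apply: filterS NK => w h; rewrite /Xj min_r//; apply: (le_trans h).
  by rewrite -ler_pdivrMr// ltW// Num.Theory.truncnS_gt.
have mX : measurable_fun setT (fun w => D w * expR (delta * V w)).
  by apply: measurable_funM => //; apply: measurableT_comp => //; exact: measurable_funM.
split; first exact: L1_ae mX e (iXj j).
rewrite -(Ex_ae (mXj j) mX e); apply: (le_trans (exp_level j)).
have : 0 <= (5 / 8 : R) ^+ j by rewrite exprn_ge0// divr_ge0.
by move: (_ ^+ j) => x; lra.
Qed.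

(** Arithmetic-geometric mean of two variables: the density times the exponential of [2 * e] times
    the drifted integral of [N], with mean 1, and the density times [expR (delta * V)], with mean at
    most 2. Comparing coefficients of [V] gives the condition on [e]. *)
Lemma doleans_power_stopped (e : R) : 0 < e -> e + 2 * e ^+ 2 <= delta ->
  L1 P (fun w => expR ((1 + e) * (I (zeta w) w - V w / 2))) /\
  Ex P (fun w => expR ((1 + e) * (I (zeta w) w - V w / 2))) <= 2.
Proof.
move=> e0 ed; have [i1 E1] := doleans_bracket_exp.
have [i2 E2] := girsanov_exp hN hN hz hz (fun w => lexx _) NK NK (2 * e).
have mI : measurable_fun setT (fun w => I (zeta w) w).
  exact: (stopped_meas (adapted_ito hN) (ito_continuous hN) hz).
have mX : measurable_fun setT (fun w => expR ((1 + e) * (I (zeta w) w - V w / 2))).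
  apply: measurableT_comp => //; apply: measurable_funM => //; apply: measurable_funB => //.
  exact: measurable_funM.
have le : {ae P, forall w, expR ((1 + e) * (I (zeta w) w - V w / 2)) <=
    2^-1 * (D w * expR (2 * e * drifted N N I (zeta w) w - (2 * e) ^+ 2 / 2 * V w) + D w * expR (delta * V w))}.
  apply: aeW => w; rewrite /D /doleans -!expRD; apply: le_trans (expR_amgm _ _).
  rewrite ler_expR /drifted -/(A (zeta w) w) -/(V w).
  have := ler_wpM2r (V0 w) ed; move: (V w) (I (zeta w) w) => v x.
  by rewrite exprMn; lra.
have iS := L1Z 2^-1 (L1D i2 i1).
have iX : L1 P (fun w => expR ((1 + e) * (I (zeta w) w - V w / 2))).
  by apply: (L1_le mX _ iS); apply: filterS le => w h; rewrite ger0_norm ?expR_ge0.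
split=> //; apply: (le_trans (Ex_le iX iS le)).
by rewrite ExZ ?ExD ?E2//; [lra|exact: L1D].
Qed.

End stopped.

(** Neither [e] nor the bound 2 depends on the bounds of the brackets, so Fatou's lemma removes the
    localisation. *)
Lemma doleans_power : exists2 e : R, 0 < e & forall tau, stop tau ->
  L1 P (fun w => expR ((1 + e) * (I (tau w) w - A (tau w) w / 2))) /\
  Ex P (fun w => expR ((1 + e) * (I (tau w) w - A (tau w) w / 2))) <= 2.
Proof.
pose e := Num.min 1 (delta / 3).
have e0 : 0 < e by rewrite lt_min ltr01 divr_gt0.
have ed : e + 2 * e ^+ 2 <= delta.
  have h1 : e <= 1 by rewrite ge_min lexx.
  have h2 : e <= delta / 3 by rewrite ge_min lexx orbT.
  by rewrite expr2; nra.
exists e => // tau htau.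
pose X t w := qv (N ^~ w) t + qv (G ^~ w) t.
pose rho (n : nat) w := hitting T n%:R (X ^~ w).
have [srho bX eX] : localizing X rho.
  apply: (localizing_hitting).
  - exact: adaptedD (adapted_ip (ito_prd hN) (ito_prd hN)) (adapted_ip (ito_prd hG) (ito_prd hG)).
  - exact: aecontD (aecont_ip (ito_path hN) (ito_path hN)) (aecont_ip (ito_path hG) (ito_path hG)).
  - by apply: aeW => w; rewrite /X /ip !rint0 addr0.
pose z n w := Num.min (tau w) (rho n w).
have sz n : stop (z n) by exact: stopping_min.
have zT n w : 0 <= z n w <= T by exact: (stopping_itv w (sz n)).
have bN n : {ae P, forall w, qv (N ^~ w) (z n w) <= n%:R} /\ {ae P, forall w, qv (G ^~ w) (z n w) <= n%:R}.
  have h : {ae P, forall w, X (z n w) w <= n%:R}.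
    by apply: filterS bX => w; apply; have /andP[-> _] := zT n w; rewrite ge_min lexx orbT.
  split; apply: filterS h => w; apply: le_trans; rewrite /X ?lerDl ?lerDr.
    by apply: (@ip_ge0 R T); case/andP: (zT n w).
  by apply: (@ip_ge0 R T); case/andP: (zT n w).
have hz n := doleans_power_stopped (sz n) (bN n).1 (bN n).2 e0 ed.
apply: (@fatou_Ex _ _ _ P (fun n w => expR ((1 + e) * (I (z n w) w - A (z n w) w / 2)))).
- by move=> n; exact: (hz n).1.
- have mI := stopped_meas (adapted_ito hN) (ito_continuous hN) htau.
  have mA : measurable_fun setT (fun w => A (tau w) w) by exact: (bracket_meas hN htau).
  apply: measurableT_comp => //; apply: measurable_funM => //; apply: measurable_funB => //.
  exact: measurable_funM.
- by move=> n w; exact: expR_ge0.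
- apply: filterS eX => w h; apply: cvg_near_cst; apply: filterS h => n h.
  by rewrite /z h min_l//; case/andP: (stopping_itv w htau).
- by move=> n; exact: (hz n).2.
Qed.

End reverse_holder.

(** * Expectations under a tilted measure *)

Section tilted.

(** Common to the two measures in play: for [QZ] the moment bound is the reverse Hoelder inequality,
    for [Qtheta] it follows from the boundedness of [theta]. The bound holds at all stopping times,
    so that the density can be localised. *)
Record tilting (N : R -> Omega -> 'cV[R]_m) (J : R -> Omega -> R) (e : R)
    (Q : probability Omega R) : Prop := Tilting {
  tilting_ito : ito N J;
  tilting_gt0 : 0 < e;
  tilting_power : forall tau, stop tau ->
    L1 P (fun w => expR ((1 + e) * (J (tau w) w - qv (N ^~ w) (tau w) / 2))) /\
    Ex P (fun w => expR ((1 + e) * (J (tau w) w - qv (N ^~ w) (tau w) / 2))) <= 2;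
  tilting_density : forall A, measurable A ->
    Q A = (\int[P]_(w in A) (expR (J T w - qv (N ^~ w) T / 2))%:E)%E }.

Variables (N : R -> Omega -> 'cV[R]_m) (J : R -> Omega -> R) (e : R) (Q : probability Omega R).
Hypothesis ts : tilting N J e Q.
Let L t w := J t w - qv (N ^~ w) t / 2.
Let hN : ito N J := tilting_ito ts.
Let e0 : 0 < e := tilting_gt0 ts.
Let power tau : stop tau -> L1 P (fun w => expR ((1 + e) * L (tau w) w)) /\
  Ex P (fun w => expR ((1 + e) * L (tau w) w)) <= 2.
Proof. exact: tilting_power ts tau. Qed.
Let hQ A : measurable A -> Q A = (\int[P]_(w in A) (expR (L T w))%:E)%E.
Proof. exact: tilting_density ts A. Qed.

Lemma log_doleans_meas tau : stop tau -> measurable_fun setT (fun w => L (tau w) w).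
Proof.
move=> st; apply: measurable_funB.
  exact: (stopped_meas (adapted_ito hN) (ito_continuous hN) st).
by apply: measurable_funM => //; exact: (bracket_meas hN st).
Qed.

Let mL : measurable_fun setT (L T).
Proof. exact: (log_doleans_meas (stopping_cst TT)). Qed.

Lemma tilted_ae (A : set Omega) : {ae P, forall w, A w} <-> {ae Q, forall w, A w}.
Proof. exact: change_ae mL hQ A. Qed.

Lemma tilted_L1 X : L1 P (fun w => expR (L T w) * X w) -> measurable_fun setT X ->
  L1 Q X /\ Ex Q X = Ex P (fun w => expR (L T w) * X w).
Proof. by move=> iX mX; split; [exact/(change_L1 mL hQ mX)|exact: (change_Ex mL hQ iX mX)]. Qed.

Lemma tilted_vitali (k M : R) (U X : nat -> Omega -> R) (Y : Omega -> R) : 0 <= k ->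
  (forall n, measurable_fun setT (X n)) -> measurable_fun setT Y ->
  (forall n, L1 P (fun w => expR (2 * (1 + e) / e * U n w)) /\
     Ex P (fun w => expR (2 * (1 + e) / e * U n w)) <= M) ->
  (forall n, {ae P, forall w, `|X n w| <= k * expR (U n w)}) ->
  {ae P, forall w, X n w @[n --> \oo] --> Y w} ->
  [/\ L1 Q Y, forall n, L1 Q (X n) & Ex Q (X n) @[n --> \oo] --> Ex Q Y].
Proof.
move=> k0 mX mY hU XU cX.
have pw (n : nat) := power (stopping_cst TT).
have cD : {ae P, forall w, expR (L T w) * X n w @[n --> \oo] --> expR (L T w) * Y w}.
  by apply: filterS cX => w h; apply: cvgMr.
have mD : measurable_fun setT (fun w => expR (L T w) * Y w).
  by apply: measurable_funM => //; exact: measurableT_comp.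
have [iY iX c] := weighted_vitali e0 k0 (fun n => mL) mX mD pw hU XU cD.
have [iY' ->] := tilted_L1 iY mY.
have iX' n := tilted_L1 (iX n) (mX n).
by split=> // [n|]; [exact: (iX' n).1|rewrite (funext (fun n => (iX' n).2))].
Qed.

Lemma tilted_L1_exp (k : R) (U X : Omega -> R) : 0 <= k -> measurable_fun setT X ->
  L1 P (fun w => expR (2 * (1 + e) / e * U w)) ->
  {ae P, forall w, `|X w| <= k * expR (U w)} -> L1 Q X.
Proof.
move=> k0 mX hU XU.
by have [] := @tilted_vitali k _ (fun=> U) (fun=> X) X k0 (fun=> mX) mX (fun=> conj hU (lexx _))
  (fun=> XU) (aeW _ (fun w => cvg_cst _)).
Qed.

Section at_stopping.
Variables (G : R -> Omega -> 'cV[R]_m) (I : R -> Omega -> R) (s : Omega -> R) (K : R).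
Hypotheses (hG : ito G I) (hs : stop s).
Hypothesis NK : {ae P, forall w, qv (N ^~ w) (s w) <= K}.
Hypothesis GK : {ae P, forall w, qv (G ^~ w) (s w) <= K}.

Let W w := drifted N G I (s w) w.
Let V w := qv (G ^~ w) (s w).
Let A t w := qv (N ^~ w) t.
Let hit (n : nat) w := hitting T n%:R (A ^~ w).
(** The time at which the density is stopped: never before [s], as [girsanov_exp] requires of an
    integral stopped at [s], and eventually [T]. *)
Let rho n w := Num.max (hit n w) (s w).

Let hloc : localizing A hit.
Proof.
apply: (localizing_hitting (adapted_ip (ito_prd hN) (ito_prd hN)) (aecont_ip (ito_path hN) (ito_path hN))).
by apply: aeW => w; rewrite /A /ip rint0.
Qed.

Let srho n : stop (rho n).
Proof. by apply: stopping_max hs; case: hloc. Qed.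

Let srl n w : s w <= rho n w. Proof. by rewrite le_max lexx orbT. Qed.

Let rhoN n : {ae P, forall w, qv (N ^~ w) (rho n w) <= Num.max n%:R K}.
Proof.
have [sh bh _] := hloc; apply: filterS2 bh NK => w h1 h2; rewrite le_max /rho.
have /andP[h0 _] := stopping_itv w (sh n).
by rewrite /Num.max; case: ifP => _; rewrite ?h2 ?orbT// (h1 n)// h0 lexx.
Qed.

Let rho_eventually : {ae P, forall w, \forall n \near \oo, rho n w = T}.
Proof.
have [_ _ h] := hloc; apply: filterS h => w; apply: filterS => n h.
by rewrite /rho h max_l//; case/andP: (stopping_itv w hs).
Qed.

(* The mean under the density stopped at rho n passes to the limit when |F| is dominated
   by exponentials of W, whose means under these densities are bounded. *)
Lemma tilted_limit (F : Omega -> R) (k c v : R) : measurable_fun setT F -> 0 <= k ->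
  (forall w, `|F w| <= k * (expR (c * W w) + expR (- c * W w))) ->
  (forall n, Ex P (fun w => expR (L (rho n w) w) * F w) = v) -> L1 Q F /\ Ex Q F = v.
Proof.
move=> mF k0 Fk EF.
have lin (x y K1 q u v' : R) : x <= K1 + q * u -> y <= K1 + q * v' -> x + y <= 2 * K1 + q * (u + v').
  by rewrite mulrDr; lra.
pose Z n w := expR ((1 + e) * L (rho n w) w) +
  (expR (L (rho n w) w) * expR (2 * c * W w) + expR (L (rho n w) w) * expR (- (2 * c) * W w)).
have b1 n := drifted_exp_bound hN hG (srho n) hs (srl n) (rhoN n) GK (2 * c).
have b2 n := drifted_exp_bound hN hG (srho n) hs (srl n) (rhoN n) GK (- (2 * c)).
have iZ n : L1 P (Z n).
  by apply: L1D; [exact: (power (srho n)).1|apply: L1D; [exact: (b1 n).1|exact: (b2 n).1]].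
have Z0 n w : 0 <= Z n w by rewrite !addr_ge0 ?mulr_ge0 ?expR_ge0.
have ZE n : Ex P (Z n) <= 2 + (expR ((2 * c) ^+ 2 * K / 2) + expR ((- (2 * c)) ^+ 2 * K / 2)).
  rewrite ExD; [|exact: (power (srho n)).1|by apply: L1D; [exact: (b1 n).1|exact: (b2 n).1]].
  rewrite ExD; [|exact: (b1 n).1|exact: (b2 n).1].
  by apply: lerD; [exact: (power (srho n)).2|apply: lerD; [exact: (b1 n).2|exact: (b2 n).2]].
have mX n : measurable_fun setT (fun w => expR (L (rho n w) w) * F w).
  by apply: measurable_funM => //; apply: measurableT_comp => //; exact: log_doleans_meas.
have mY : measurable_fun setT (fun w => expR (L T w) * F w).
  by apply: measurable_funM => //; exact: measurableT_comp.
have cX : {ae P, forall w, expR (L (rho n w) w) * F w @[n --> \oo] --> expR (L T w) * F w}.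
  by apply: filterS rho_eventually => w h; apply: cvg_near_cst; apply: filterS h => n ->.
have UI (d : R) : 0 < d -> exists K0 : R, forall n, {ae P, forall w, `|expR (L (rho n w) w) * F w| <= K0 + d * Z n w}.
  (* Young's inequality twice: on the exponentials of [W], whose exponent doubles, and on the
     density, whose exponent becomes [1 + e]. *)
  move=> d0; have d1 : 0 < d / (k + 1) by rewrite divr_gt0// ltr_wpDl.
  have [K1 K10 hK1] := expR_young (ltr1n R 2) d1.
  have d2 : 0 < d / (2 * k * K1 + 1) by rewrite divr_gt0// ltr_wpDl// !mulr_ge0// ltW.
  have s1 : 1 < 1 + e by rewrite ltrDl.
  have [K2 K20 hK2] := expR_young s1 d2.
  exists (2 * k * K1 * K2) => n; apply: aeW => w; rewrite normrM ger0_norm ?expR_ge0//.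
  set l := L (rho n w) w; have l0 := expR_ge0 l.
  have h1 := hK1 (c * W w); have h2 := hK1 (- c * W w); have h3 := hK2 l.
  rewrite !(mulrA 2) mulrN in h1 h2.
  have F1 := Fk w.
  apply: (@le_trans _ _ (expR l * (k * (2 * K1 + d / (k + 1) * (expR (2 * c * W w) + expR (- (2 * c) * W w)))))).
    apply: ler_wpM2l => //; apply: (le_trans F1); apply: ler_wpM2l => //.
    exact: (lin _ _ _ _ _ _ h1 h2).
  have p0 : 0 <= expR l * (expR (2 * c * W w) + expR (- (2 * c) * W w)) by rewrite mulr_ge0// addr_ge0 ?expR_ge0.
  have kd : k * (d / (k + 1)) <= d by rewrite mulrCA ler_piMr ?ltW// ltr_pdivrMr ?ltr_wpDl// mul1r ltrDl.
  have kd2 : 2 * k * K1 * (d / (2 * k * K1 + 1)) <= d.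
    have q0 : 0 <= 2 * k * K1 by rewrite !mulr_ge0// ltW.
    by rewrite mulrCA ler_piMr ?ltW// ltr_pdivrMr ?ltr_wpDl// mul1r ltrDl.
  have s2 : 2 * k * K1 * expR l <= 2 * k * K1 * K2 + d * expR ((1 + e) * l).
    apply: (@le_trans _ _ (2 * k * K1 * (K2 + d / (2 * k * K1 + 1) * expR ((1 + e) * l)))).
      by apply: ler_wpM2l => //; rewrite !mulr_ge0// ltW.
    by rewrite mulrDr lerD2l mulrA; apply: ler_wpM2r; rewrite ?expR_ge0.
  rewrite (_ : _ * _ = 2 * k * K1 * expR l + k * (d / (k + 1)) * (expR l * (expR (2 * c * W w) + expR (- (2 * c) * W w)))); last ring.
  apply: (le_trans (lerD s2 (ler_wpM2r p0 kd))); rewrite /Z -/l le_eqVlt; apply/orP; left; apply/eqP; ring.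
have [iY iX cE] := vitali mX mY cX iZ Z0 ZE UI.
have [iQ ->] := tilted_L1 iY mF; split=> //.
have := cvg_Ex iY iX cE; rewrite (funext EF) => h.
by rewrite -(cvg_lim _ h)// lim_cst.
Qed.

Lemma tilted_drift_mean0 : L1 Q W /\ Ex Q W = 0.
Proof.
apply: (@tilted_limit W 1 1 0) => //; first exact: (drifted_meas hN hG hs).
  move=> w; rewrite mul1r mul1r mulN1r; have h1 := expR_ge1Dx (W w); have h2 := expR_ge1Dx (- W w).
  have e1 := expR_ge0 (W w); have e2 := expR_ge0 (- W w).
  by case: (lerP 0 (W w)) => h; [rewrite ger0_norm|rewrite ltr0_norm]; lra.
by move=> n; exact: (drifted_mean0 hN hG (srho n) hs (srl n) (rhoN n) GK).2.
Qed.

Lemma tilted_exp (c : R) : L1 Q (fun w => expR (c * W w - c ^+ 2 / 2 * V w)) /\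
  Ex Q (fun w => expR (c * W w - c ^+ 2 / 2 * V w)) = 1.
Proof.
have V0 w : 0 <= V w by apply: (@ip_ge0 R T); case/andP: (stopping_itv w hs).
apply: (@tilted_limit _ 1 c 1) => //.
- have mW := drifted_meas hN hG hs; have mV := bracket_meas hG hs.
  apply: measurableT_comp => //; apply: measurable_funB; apply: measurable_funM => //.
- move=> w; rewrite ger0_norm ?expR_ge0// mul1r.
  apply: (@le_trans _ _ (expR (c * W w))); last by rewrite lerDl expR_ge0.
  by rewrite ler_expR gerBl mulr_ge0// divr_ge0// sqr_ge0.
by move=> n; exact: (girsanov_exp hN hG (srho n) hs (srl n) (rhoN n) GK c).2.
Qed.

End at_stopping.

Definition exp_bounded (U : R -> Omega -> R) : Prop := forall p : R, 1 <= p ->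
  exists M : R, forall tau, stop tau ->
    L1 P (fun w => expR (p * U (tau w) w)) /\ Ex P (fun w => expR (p * U (tau w) w)) <= M.

Lemma stopped_continuous_cvg (X : R -> Omega -> R) (taun : nat -> Omega -> R) (tau : Omega -> R) :
  {ae P, forall w, \forall n \near \oo, taun n w = tau w} ->
  {ae P, forall w, X (taun n w) w @[n --> \oo] --> X (tau w) w}.
Proof. by apply: filterS => w h; apply: cvg_near_cst; apply: filterS h => n ->. Qed.

Lemma tilting_exponent_ge1 : 1 <= 2 * (1 + e) / e.
Proof. by rewrite ler_pdivlMr// mul1r; move: e0; lra. Qed.

Lemma tilted_stopping_cvg (U X : R -> Omega -> R) (k : R) (taun : nat -> Omega -> R) (tau : Omega -> R) :
  exp_bounded U -> adapted X -> aecont X -> 0 <= k ->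
  {ae P, forall w, forall t, 0 <= t <= T -> `|X t w| <= k * expR (U t w)} ->
  (forall n, stop (taun n)) -> stop tau ->
  {ae P, forall w, \forall n \near \oo, taun n w = tau w} ->
  [/\ L1 Q (fun w => X (tau w) w), forall n, L1 Q (fun w => X (taun n w) w) &
      Ex Q (fun w => X (taun n w) w) @[n --> \oo] --> Ex Q (fun w => X (tau w) w)].
Proof.
move=> eU aX cX k0 Xk sn st ev; have [M hM] := eU _ tilting_exponent_ge1.
apply: (@tilted_vitali k M (fun n w => U (taun n w) w) (fun n w => X (taun n w) w)) => //.
- by move=> n; exact: (stopped_meas aX cX (sn n)).
- exact: (stopped_meas aX cX st).
- by move=> n; exact: hM.
- by move=> n; apply: filterS Xk => w; apply; exact: (stopping_itv w (sn n)).
- exact: stopped_continuous_cvg.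
Qed.

Lemma tilted_stopping_L1 (U X : R -> Omega -> R) (k : R) (tau : Omega -> R) :
  exp_bounded U -> adapted X -> aecont X -> 0 <= k ->
  {ae P, forall w, forall t, 0 <= t <= T -> `|X t w| <= k * expR (U t w)} ->
  stop tau -> L1 Q (fun w => X (tau w) w).
Proof.
move=> eU aX cX k0 Xk st.
have ev : {ae P, forall w, \forall n \near \oo, (fun _ : nat => tau) n w = tau w}.
  by apply: aeW => w; near=> n.
by have [] := tilted_stopping_cvg eU aX cX k0 Xk (fun=> st) st ev.
Unshelve. all: end_near.
Qed.

End tilted.

(** * Martingales with a small drift *)

Section perturbation.

Variables (N : R -> Omega -> 'cV[R]_m) (J : R -> Omega -> R) (e : R) (Q : probability Omega R).
Hypothesis ts : tilting N J e Q.
Variables (h : R -> Omega -> 'cV[R]_m) (Ih X U : R -> Omega -> R) (a k : R).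

(** [pert_mono] and [pert_quad] describe the increasing process [X 0 + drifted - X]: it is monotone,
    and dominated by [a / 2] times the bracket. [U] serves to dominate [X] and [expR (a * X)] at
    stopping times. *)
Record perturbed : Prop := Perturbed {
  pert_ito : ito h Ih;
  pert_adapted : adapted X;
  pert_cont : aecont X;
  pert_gt0 : 0 < a;
  pert_k : 0 <= k;
  pert_U : exp_bounded U;
  pert_bound : {ae P, forall w, forall t, 0 <= t <= T -> `|X t w| <= k * expR (U t w)};
  pert_exp_bound : {ae P, forall w, forall t, 0 <= t <= T -> expR (a * X t w) <= k * expR (U t w)};
  pert_mono : {ae P, forall w, forall s t, 0 <= s -> s <= t -> t <= T ->
    X t w - drifted N h Ih t w <= X s w - drifted N h Ih s w};
  pert_quad : {ae P, forall w, forall t, 0 <= t <= T ->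
    X 0 w + drifted N h Ih t w - X t w <= a / 2 * qv (h ^~ w) t} }.

Hypothesis hp : perturbed.
Let hh := pert_ito hp.
Let aX := pert_adapted hp.
Let cX := pert_cont hp.
Let a0 := pert_gt0 hp.
Let hN := tilting_ito ts.
Let W t w := drifted N h Ih t w.
Let V t w := qv (h ^~ w) t.
Let A t w := qv (N ^~ w) t + V t w.
Let rho (n : nat) w := hitting T n%:R (A ^~ w).

Lemma drifted_at0 : {ae P, forall w, W 0 w = 0}.
Proof. by apply: filterS (ito_at0 hh) => w h0; rewrite /W /drifted h0 /ip rint0 subrr. Qed.

Let locA : localizing A rho.
Proof.
apply: (localizing_hitting).
- exact: adaptedD (adapted_ip (ito_prd hN) (ito_prd hN)) (adapted_ip (ito_prd hh) (ito_prd hh)).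
- exact: aecontD (aecont_ip (ito_path hN) (ito_path hN)) (aecont_ip (ito_path hh) (ito_path hh)).
- by apply: aeW => w; rewrite /A /V /ip !rint0 addr0.
Qed.

Section at_stopping_time.
Variable kappa : Omega -> R.
Hypothesis hk : stop kappa.
Let s n w := Num.min (kappa w) (rho n w).

Let ss n : stop (s n).
Proof. by apply: stopping_min => //; case: locA. Qed.

Let sT n w : 0 <= s n w <= T. Proof. exact: (stopping_itv w (ss n)). Qed.

Let kT w : 0 <= kappa w <= T. Proof. exact: (stopping_itv w hk). Qed.

Let sbound n : {ae P, forall w, qv (N ^~ w) (s n w) <= n%:R} /\ {ae P, forall w, V (s n w) w <= n%:R}.
Proof.
have [_ bA _] := locA.
have b : {ae P, forall w, A (s n w) w <= n%:R}.
  by apply: filterS bA => w; apply; have /andP[-> _] := sT n w; rewrite ge_min lexx orbT.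
split; apply: filterS b => w; apply: le_trans; rewrite /A /V ?lerDl ?lerDr.
  by apply: (@ip_ge0 R T); case/andP: (sT n w).
by apply: (@ip_ge0 R T); case/andP: (sT n w).
Qed.

Let s_eventually : {ae P, forall w, \forall n \near \oo, s n w = kappa w}.
Proof.
have [_ _ ev] := locA; apply: filterS ev => w; apply: filterS => n E.
by rewrite /s E min_l//; case/andP: (kT w).
Qed.

Let meanW n : L1 Q (fun w => W (s n w) w) /\ Ex Q (fun w => W (s n w) w) = 0.
Proof. exact: (tilted_drift_mean0 ts hh (ss n) (sbound n).1 (sbound n).2). Qed.

Let D t w := X 0 w + W t w - X t w.

Let D_nd : {ae Q, forall w, (forall t, 0 <= t <= T -> 0 <= D t w) /\
  forall u t, 0 <= u -> u <= t -> t <= T -> D u w <= D t w}.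
Proof.
apply/(tilted_ae ts); apply: filterS2 (pert_mono hp) drifted_at0 => w mono W0.
have nd u t : 0 <= u -> u <= t -> t <= T -> D u w <= D t w.
  by move=> u0 ut tT; have := mono u t u0 ut tT; rewrite /D -!/(W _ _); lra.
split=> // t /andP[t0 tT]; have := nd 0 t (lexx _) t0 tT.
by rewrite /D W0; lra.
Qed.

Lemma pert_L1 : L1 Q (fun w => X (kappa w) w).
Proof. exact: (tilted_stopping_L1 ts (pert_U hp) aX cX (pert_k hp) (pert_bound hp) hk). Qed.

Let cX' : L1 Q (X 0) /\ [/\ L1 Q (fun w => X (kappa w) w), forall n, L1 Q (fun w => X (s n w) w) &
      Ex Q (fun w => X (s n w) w) @[n --> \oo] --> Ex Q (fun w => X (kappa w) w)].
Proof.
split; last exact: (tilted_stopping_cvg ts (pert_U hp) aX cX (pert_k hp) (pert_bound hp) ss hk s_eventually).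
by apply: (tilted_stopping_L1 ts (pert_U hp) aX cX (pert_k hp) (pert_bound hp) (stopping_cst (t := 0) _)).
Qed.

Let mD : measurable_fun setT (fun w => D (kappa w) w).
Proof.
have [i0 [i1 _ _]] := cX'; apply: measurable_funB; last exact: (L1_meas i1).
by apply: measurable_funD; [exact: (L1_meas i0)|exact: (drifted_meas hN hh hk)].
Qed.

Let iDs n : L1 Q (fun w => D (s n w) w) /\
  Ex Q (fun w => D (s n w) w) = Ex Q (X 0) - Ex Q (fun w => X (s n w) w).
Proof.
have [i0 [_ i1 _]] := cX'; have [iW eW] := meanW n.
split; first by apply: L1B (i1 n); exact: L1D.
by rewrite (ExB (L1D i0 iW) (i1 n)) (ExD i0 iW) eW addr0.
Qed.

(** At localised times the integral has mean 0, so the mean of the increasing process is a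
    difference of means of [X]. These converge by domination; Fatou's lemma gives one inequality and
    monotonicity the other. *)
Lemma pert_drift : L1 Q (fun w => D (kappa w) w) /\
  Ex Q (fun w => D (kappa w) w) = Ex Q (X 0) - Ex Q (fun w => X (kappa w) w).
Proof.
have [i0 [i1 isn cE]] := cX'.
set c := Ex Q (X 0) - _.
have cc : Ex Q (fun w => D (s n w) w) @[n --> \oo] --> c.
  by rewrite (funext (fun n => (iDs n).2)); apply: cvgB => //; exact: cvg_cst.
have mN : measurable_fun setT (fun w => `|D (kappa w) w|) by exact: measurableT_comp.
have bd (d : R) : 0 < d -> L1 Q (fun w => `|D (kappa w) w|) /\ Ex Q (fun w => `|D (kappa w) w|) <= c + d.
  move=> d0; have lt : c < c + d by rewrite ltrDl.
  have [n0 _ hn0] := cvgr_lt _ cc _ lt.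
  apply: (@fatou_Ex _ _ _ Q (fun n w => `|D (s (n0 + n)%N w) w|)) => //.
  - by move=> n; apply: L1_norm; exact: (iDs _).1.
  - apply/(tilted_ae ts); apply: filterS s_eventually => w ev.
    apply: cvg_near_cst; have [n1 _ h1] := ev; exists n1 => // n n1n /=.
    by rewrite h1//=; apply: leq_trans n1n _; rewrite leq_addl.
  - move=> n; have <- : Ex Q (fun w => D (s (n0 + n)%N w) w) = Ex Q (fun w => `|D (s (n0 + n)%N w) w|).
      apply: Ex_ae; [exact: (L1_meas (iDs _).1)|exact: (L1_meas (L1_norm (iDs _).1))|].
      by apply: filterS D_nd => w [pos _]; rewrite ger0_norm// pos.
    by apply/ltW/hn0; rewrite /= leq_addr.
have iD : L1 Q (fun w => D (kappa w) w).
  by apply: (L1_le mD _ (bd 1 ltr01).1); apply: aeW => w /=.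
split=> //; apply/eqP; rewrite eq_le; apply/andP; split.
  apply/ler_addgt0Pr => d d0; apply: le_trans (bd d d0).2.
  by apply: Ex_le => //; [exact: L1_norm|apply: aeW => w; exact: ler_norm].
rewrite -(cvg_lim _ cc)//; apply: limr_le; first by apply/cvg_ex; exists c.
apply: nearW => n; apply: Ex_le => //; first exact: (iDs n).1.
apply: filterS D_nd => w [_ nd]; have /andP[u0 _] := sT n w; have /andP[_ u1] := kT w.
by apply: nd => //; rewrite ge_min lexx.
Qed.

Lemma pert_mean0 : L1 Q (fun w => W (kappa w) w) /\ Ex Q (fun w => W (kappa w) w) = 0.
Proof.
have [i0 [i1 _ _]] := cX'; have [iD eD] := pert_drift.
have -> : (fun w => W (kappa w) w) = (fun w => D (kappa w) w - X 0 w + X (kappa w) w).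
  by apply/funext => w; rewrite /D; ring.
split; first by apply: L1D => //; exact: L1B.
by rewrite (ExD (L1B iD i0) i1) (ExB iD i0) eD; ring.
Qed.

(** At localised times [a * X] is at least [a * c] plus the exponent of a stochastic exponential of
    mean 1, by [pert_quad]; the limit is dominated by [U]. *)
Lemma pert_exp (c : R) : {ae P, forall w, X 0 w = c} ->
  L1 Q (fun w => expR (a * X (kappa w) w)) /\ expR (a * c) <= Ex Q (fun w => expR (a * X (kappa w) w)).
Proof.
move=> Xc.
have aE : adapted (fun t w => expR (a * X t w)).
  apply: (adapted_comp (f := fun x => expR (a * x))) aX.
  by apply: measurableT_comp => //; exact: measurable_funM.
have cE : aecont (fun t w => expR (a * X t w)).
  apply: (aecont_comp (f := fun x => expR (a * x))) cX => x.
  by apply: continuous_comp; [apply: cvgMr|exact: continuous_expR].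
have bE : {ae P, forall w, forall t, 0 <= t <= T -> `|expR (a * X t w)| <= k * expR (U t w)}.
  by apply: filterS (pert_exp_bound hp) => w b t tT; rewrite ger0_norm ?expR_ge0//; exact: b.
have [iE isn cc] := tilted_stopping_cvg ts (pert_U hp) aE cE (pert_k hp) bE ss hk s_eventually.
split=> //; rewrite -(cvg_lim _ cc)//; apply: limr_ge; first by apply/cvg_ex; eexists; exact: cc.
apply: nearW => n; have [i1 e1] := tilted_exp ts hh (ss n) (sbound n).1 (sbound n).2 a.
rewrite -[leLHS]mulr1 -e1 -(ExZ _ i1); apply: (Ex_le (L1Z _ i1) (isn n)).
apply/(tilted_ae ts); apply: filterS2 Xc (pert_quad hp) => w Xw q.
rewrite -expRD ler_expR; have := ler_wpM2l (ltW a0) (q _ (sT n w)).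
rewrite Xw -!/(W _ _) -!/(V _ _) expr2; move: (V _ _) (W _ _) (X _ _) => v w' x; lra.
Qed.

End at_stopping_time.

(* W at the time equal to t on E and to T elsewhere has mean 0. *)
Lemma pert_conditional (t : R) (E : set Omega) : 0 <= t <= T -> filtration P B t E ->
  0 <= Ex Q (fun w => \1_E w * (X t w - X T w)) <= Ex Q (X 0) - Ex Q (X T).
Proof.
move=> tT FE; have /andP[t0 tT'] := tT.
have lin1 (xT xt x0 wT wt : R) : xT - wT <= xt - wt -> xt - wt <= x0 - 0 -> xT - wT <= x0 - 0 ->
  0 <= wT - wt + (xt - xT) <= x0 + wT - xT by move=> h1 h2 h3; apply/andP; split; lra.
have lin2 (xT xt x0 wT wt : R) : xT - wT <= xt - wt -> xt - wt <= x0 - 0 -> xT - wT <= x0 - 0 ->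
  0 <= (0 : R) <= x0 + wT - xT by move=> h1 h2 h3; rewrite lexx; lra.
have [iWT eT] := pert_mean0 (stopping_cst TT).
have [iWk ek] := pert_mean0 (stopping_restricted tT FE).
have [iDT eDT] := pert_drift (stopping_cst TT).
have iXt := pert_L1 (stopping_cst tT); have iXT := pert_L1 (stopping_cst TT).
have mE := filtration_measurable tT' FE.
have iI : L1 Q (fun w => \1_E w * (X t w - X T w)).
  apply: (L1_le _ _ (L1_norm (L1B iXt iXT))).
    by apply: measurable_funM; [exact: measurable_indic|exact: (L1_meas (L1B iXt iXT))].
  apply: aeW => w; rewrite normrM ler_piMl// indicE; case: (_ \in _) => /=; rewrite ?normr1//.
  by rewrite normr0.
pose Z w := W T w - W (restricted_time t E w) w + \1_E w * (X t w - X T w).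
have iZ : L1 Q Z by apply: L1D => //; exact: L1B.
have eZ : Ex Q (fun w => \1_E w * (X t w - X T w)) = Ex Q Z.
  by rewrite (ExD (L1B iWT iWk) iI) (ExB iWT iWk) eT ek subrr add0r.
have Zb : {ae P, forall w, 0 <= Z w <= X 0 w + W T w - X T w}.
  apply: filterS2 (pert_mono hp) drifted_at0 => w mono W0.
  have := mono 0 T (lexx _) T0 (lexx _); have := mono 0 t (lexx _) t0 tT'.
  have := mono t T t0 tT' (lexx _); rewrite /Z /restricted_time indicE -!/(W _ _) W0.
  case: (w \in E) => /=; rewrite ?mul1r ?mul0r ?subrr ?addr0; move: (X T w) (X t w) (X 0 w) (W T w) (W t w).
    exact: lin1.
  exact: lin2.
rewrite eZ; apply/andP; split.
  by apply: Ex_ae_ge0 => //; apply/(tilted_ae ts); apply: filterS Zb => w /andP[].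
rewrite -eDT; apply: Ex_le => //.
by apply/(tilted_ae ts); apply: filterS Zb => w /andP[].
Qed.

Lemma pert_start : {ae P, forall w, X 0 w = Ex Q (X 0)}.
Proof.
have h0 := stopping_cst T00; have [M hM] := pert_U hp (lexx 1).
have mX : measurable_at P B 0 (X 0) by exact: aX.
have m0 : measurable_fun setT (X 0) by exact: (mat_meas T0 mX).
have iX : L1 P (X 0).
  apply: (L1_le m0 _ (L1Z k (hM _ h0).1)); apply: filterS (pert_bound hp) => w b.
  by rewrite mul1r; exact: b.
have X0 := mat0_const mX iX.
have -> : Ex Q (X 0) = Ex P (X 0).
  rewrite -[RHS](Ex_cst Q); apply: (Ex_ae m0 (@measurable_cst _ _ _ _ setT (Ex P (X 0)))).
  exact/(tilted_ae ts).
exact: X0.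
Qed.

Variable F : Omega -> R.
Hypotheses (XF : {ae P, forall w, X T w = F w}) (mF : measurable_fun setT F).
Hypotheses (iF2 : L1 Q (fun w => expR (2 * `|F w|))) (a1 : a <= 1).

Lemma pert_terminal_L1 : L1 Q F.
Proof.
apply: (L1_ae mF _ (pert_L1 (stopping_cst TT))); exact/(tilted_ae ts).
Qed.

Lemma pert_terminal_Ex : Ex Q (X T) = Ex Q F.
Proof.
apply: Ex_ae mF _; first exact: (L1_meas (pert_L1 (stopping_cst TT))).
exact/(tilted_ae ts).
Qed.

(** The lower bound is the nonnegative mean of the increasing process. For the upper one, [pert_exp]
    at [T] meets [exp_mean_le], and the logarithms are divided by [a]. *)
Lemma pert_gap : 0 <= Ex Q (X 0) - Ex Q F <= a * (4 * Ex Q (fun w => expR (2 * `|F w|))).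
Proof.
have iF := pert_terminal_L1.
have lin (x y z : R) : a * x <= a * y + a ^+ 2 * z -> x - y <= a * z.
  by move=> hxyz; rewrite -(ler_pM2l a0) mulrBr; move: hxyz; rewrite expr2; lra.
apply/andP; split.
  have FT : filtration P B T setT by exact: filtrationT.
  have /andP[h1 h2] := pert_conditional TT FT.
  by rewrite -pert_terminal_Ex; exact: le_trans h1 h2.
have [iE le] := pert_exp (stopping_cst TT) pert_start.
have mE : measurable_fun setT (fun w => expR (a * F w)).
  by apply: measurableT_comp => //; exact: measurable_funM.
have E : {ae Q, forall w, expR (a * X T w) = expR (a * F w)}.
  by apply/(tilted_ae ts); apply: filterS XF => w ->.
have iE' := L1_ae mE E iE.
rewrite (Ex_ae (L1_meas iE) mE E) in le.
have := le_trans le (exp_mean_le a0 a1 mF iF iF2 iE'); rewrite ler_expR.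
exact: lin.
Qed.

End perturbation.

(** * Predictability of matrix operations and of constraints *)

Section predictable_matrices.

Lemma predictable_prod I (s : seq I) (X : I -> R -> Omega -> R) :
  (forall i, prd (X i)) -> prd (fun t w => \prod_(i <- s) X i t w).
Proof.
move=> h; elim: s => [|i s ih].
  by apply: (predictable_ext _ (predictable_cst 1)) => t w _; rewrite big_nil.
by apply: (predictable_ext _ (predictableM (h i) ih)) => t w _; rewrite big_cons.
Qed.

Lemma predictable_mulmx p q r (X : R -> Omega -> 'M[R]_(p, q)) (Y : R -> Omega -> 'M[R]_(q, r)) :
  prdmx X -> prdmx Y -> prdmx (fun t w => X t w *m Y t w).
Proof.
move=> hX hY i j; apply: (predictable_ext (X := fun t w => \sum_k X t w i k * Y t w k j)).
  by move=> t w _; rewrite mxE.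
by apply: (predictable_sum) => k; exact: (predictableM).
Qed.

Lemma predictable_tr p q (X : R -> Omega -> 'M[R]_(p, q)) : prdmx X -> prdmx (fun t w => (X t w)^T).
Proof. by move=> hX i j; apply: (predictable_ext _ (hX j i)) => t w _; rewrite mxE. Qed.

Lemma predictable_det n (X : R -> Omega -> 'M[R]_n) : prdmx X -> prd (fun t w => \det (X t w)).
Proof.
move=> hX; apply: (predictable_sum) => s; apply: (predictableM); first exact: predictable_cst.
by apply: predictable_prod => i; exact: hX.
Qed.

(** Uses [x^-1 = x * expR (- ln (x ^+ 2))], which also holds at 0, where both sides are 0. *)
Lemma predictable_inv (X : R -> Omega -> R) : prd X -> prd (fun t w => (X t w)^-1).
Proof.
move=> hX; apply: (predictable_ext (X := fun t w => X t w * expR (- ln (X t w ^+ 2)))).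
  move=> t w _; have [->|x0] := eqVneq (X t w) 0; first by rewrite mul0r invr0.
  by rewrite expRN lnK ?posrE ?exprn_even_gt0// expr2 invfM mulrA mulfV ?mul1r.
apply: (predictableM) => //.
apply: (predictable_comp (f := fun x => expR (- ln (x ^+ 2)))) => //.
apply: measurableT_comp => //; apply: measurableT_comp => //.
by apply: measurableT_comp => //; exact: exprn_measurable.
Qed.

Lemma predictable_invmx n (X : R -> Omega -> 'M[R]_n) :
  (forall t w, 0 <= t <= T -> X t w \in unitmx) -> prdmx X -> prdmx (fun t w => invmx (X t w)).
Proof.
move=> uX hX i j; apply: (predictable_ext
  (X := fun t w => (\det (X t w))^-1 * ((-1) ^+ (j + i) * \det (row' j (col' i (X t w)))))).
  by move=> t w tT; rewrite /invmx (uX t w tT) !mxE.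
apply: (predictableM); first exact: predictable_inv (predictable_det hX).
apply: (predictableM); first exact: predictable_cst.
by apply: predictable_det => i' j'; apply: (predictable_ext _ (hX (lift j i') (lift i j'))) => t w _; rewrite !mxE.
Qed.

(** Tonelli's theorem exchanges the quantifiers: strategies satisfy the constraint almost surely at
    each fixed time, whereas the integral along a path needs it at almost every time. *)
Lemma ae_rint_le0 (g : R -> Omega -> R) : prd g ->
  (forall t, 0 <= t <= T -> {ae P, forall w, g t w <= 0}) ->
  {ae P, forall w, path_integrable T (g ^~ w)} ->
  {ae P, forall w, forall t, 0 <= t <= T -> rint (g ^~ w) t <= 0}.
Proof.
move=> pg g0 ig.
pose G t w := Num.max (g t w) 0.
have pG : prd G by apply: (predictable_comp (f := fun x => Num.max x 0)) pg; exact: measurable_maxr.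
have jG := predictable_joint_meas pG.
pose mu := @lebesgue_measure R.
have mD : measurable (`[0, T]%classic `*` [set: Omega] : set (measurableTypeR R * Omega)).
  by apply: measurableX => //; exact: measurable_itv.
pose f (q : measurableTypeR R * Omega) := ((EFin \o (fun q : measurableTypeR R * Omega => G q.1 q.2)) \_ (`[0, T]%classic `*` [set: Omega])) q.
have mf : measurable_fun setT f.
  by apply/(measurable_restrictT _ mD); exact/measurable_EFinP.
have f0 q : (0 <= f q)%E.
  by rewrite /f patchE; case: ifP => //= _; rewrite lee_fin le_max lexx orbT.
have fE t w : f (t, w) = if t \in `[0, T]%classic then (G t w)%:E else 0%E.
  rewrite /f patchE; case: ifPn => h; case: ifPn => h' //.
    by move: h h'; rewrite inE => -[/= h _] /negP[]; rewrite inE.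
  by move: h' h; rewrite inE => h' /negP[]; rewrite inE.
have z : (\int[P]_w \int[mu]_t f (t, w) = 0)%E.
  rewrite -(fubini_tonelli (m1 := mu) (m2 := P) f mf f0).
  apply: integral0_eq => t _; have [h|h] := boolP (t \in `[0, T]%classic); last first.
    by apply: integral0_eq => w _; rewrite fE (negbTE h).
  under eq_integral => w _ do rewrite fE h.
  rewrite (ae_eq_integral (cst 0%E)) ?integral0//.
    move: h; rewrite inE/= in_itv/= => h; apply/measurable_EFinP.
    exact: (mat_meas (andP h).2 (predictable_mat h pG)).
  move: h; rewrite inE/= in_itv/= => h; apply: filterS (g0 t h) => w gw _ /=.
  by rewrite /G max_r.
have mI : measurable_fun setT (fun w => \int[mu]_t f (t, w))%E.
  exact: (measurable_fun_fubini_tonelli_G (m1 := mu) f mf f0).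
have I0 w : (0 <= \int[mu]_t f (t, w))%E by exact: integral_ge0.
have : {ae P, forall w, setT w -> (\int[mu]_t f (t, w) = 0)%E}.
  apply/(ae_eq_integral_abs P measurableT mI).
  by rewrite -[RHS]z; apply: eq_integral => w _; rewrite gee0_abs.
apply: filterS2 ig => w iw zw t tT.
have iG : path_integrable T (G ^~ w).
  apply: (path_integrable_le (g := fun s => `|g s w|)).
  - exact: (predictable_section w pG).
  - move=> s sT; rewrite /G; case: (lerP (g s w) 0) => h; first by rewrite normr0.
    by rewrite ger0_norm ?ler_norm// ltW.
  - exact: (integrable_abse iw).
have e : (\int[mu]_(t in `[0%R, T]) (G t w)%:E = 0)%E.
  rewrite -[RHS](zw Logic.I) integral_mkcond; apply: eq_integral => s _.
  by rewrite fE patchE.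
apply: (le_trans (rint_le tT iw iG _)); first by move=> s _; rewrite le_max lexx.
have GT : rint (G ^~ w) T = 0.
  by rewrite /rint /Rintegral e.
rewrite -[leRHS]GT; have /andP[t0 tT'] := tT; apply: rint_nd iG _ => // s _.
by rewrite le_max lexx orbT.
Qed.

End predictable_matrices.

(** * Exponentials of a martingale at stopping times *)

Section martingale_exponential.
Variables (Q : probability Omega R) (X : R -> Omega -> R) (c : R).
Hypothesis hX : martingale P T B Q X.
Hypothesis cX : ae_continuous X.
Hypothesis PQ : forall A : set Omega, {ae P, forall w, A w} -> {ae Q, forall w, A w}.
Let U t w := Num.max (- c * X t w) 0.
Hypothesis iT : L1 Q (fun w => expR (U T w)).

Let U0 t w : 0 <= U t w. Proof. by rewrite le_max lexx orbT. Qed.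

Let aX t : 0 <= t <= T -> measurable_at P B t (X t).
Proof. by have [h _ _] := hX; exact: h. Qed.

Let aU t : 0 <= t <= T -> measurable_at P B t (U t).
Proof.
move=> tT; apply: (mat_comp (f := fun x => Num.max (- c * x) 0)) (aX tT).
by apply: measurable_maxr => //; exact: measurable_funM.
Qed.

Let mE t : 0 <= t <= T -> measurable_fun setT (fun w => expR (U t w)).
Proof. by move=> tT; apply: measurableT_comp => //; exact: (mat_meas (andP tT).2 (aU tT)). Qed.

Lemma martingale_set (t : R) (A : set Omega) : 0 <= t <= T -> Fil t A ->
  Ex Q (fun w => \1_A w * X t w) = Ex Q (fun w => \1_A w * X T w).
Proof.
move=> tT FA; have /andP[t0 tT'] := tT; have [_ i h] := hX.
have mA := filtration_measurable tT' FA.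
have [_ e1] := integral_indic_Ex mA (i t tT); have [_ e2] := integral_indic_Ex mA (i T TT).
by have := h t T A t0 tT' (lexx T) FA; rewrite e1 e2 => -[].
Qed.

(* Jensen's inequality, up to a factor e: on the event j <= U t < j + 1 use the
   tangent of exp at j. *)
Lemma martingale_exp_le (t : R) (A : set Omega) : 0 <= t <= T -> Fil t A ->
  L1 Q (fun w => \1_A w * expR (U t w)) /\
  Ex Q (fun w => \1_A w * expR (U t w)) <= Ex Q (fun w => \1_A w * (expR 1 * expR (U T w))).
Proof.
move=> tT FA; have /andP[t0 tT'] := tT; have [_ iX _] := hX.
have mA := filtration_measurable tT' FA.
have iZ : L1 Q (fun w => \1_A w * (expR 1 * expR (U T w))) := (integral_indic_Ex mA (L1Z _ iT)).1.
pose f w := Num.truncn (U t w).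
have fP w : (f w)%:R <= U t w < (f w).+1%:R by exact: truncn_itv.
have Ff j : Fil t [set w | f w = j].
  rewrite (_ : [set w | _] = [set w | j%:R <= U t w] `&` ~` [set w | j.+1%:R <= U t w]).
    by apply: filtrationI; [|apply: filtrationC]; apply: mat_ge; exact: aU.
  apply/seteqP; split=> [w <-|w [/= h1 /negP]].
    by have /andP[h1 h2] := fP w; split=> //=; apply/negP; rewrite -ltNge.
  by rewrite -ltNge => h2; apply/eqP; rewrite /f truncn_eq ?h1.
apply: (Ex_le_partition (f := f)) => //.
- by move=> j; exact: (filtration_measurable tT' (Ff j)).
- by apply: measurable_funM; [exact: measurable_indic|exact: mE].
move=> j; pose D := [set w | f w = j] `&` A.
have FD : Fil t D by exact: filtrationI.
have mD := filtration_measurable tT' FD.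
have DE (V : Omega -> R) : (fun w => \1_[set w | f w = j] w * (\1_A w * V w)) = fun w => \1_D w * V w.
  by apply/funext => w; rewrite /D indicI mulrA.
rewrite !DE.
have Db w : \1_D w * expR (U t w) <= expR (1 + j%:R) * \1_D w.
  rewrite indicE; have [/set_mem[/= fj _]|_] := boolP (w \in D); last by rewrite mul0r mulr0.
  by rewrite mul1r mulr1 ler_expR; have /andP[_ h] := fP w; rewrite ltW// -(natrD _ 1%N) -fj.
have i1 : L1 Q (fun w => expR (1 + j%:R) * \1_D w).
  apply: L1Z; apply: (@L1_bounded _ _ _ _ _ 1); first exact: measurable_indic.
  by apply: aeW => w; rewrite indicE; case: (_ \in _); rewrite ?normr1 ?normr0.
have i2 : L1 Q (fun w => \1_D w * expR (U t w)).
  apply: (L1_le _ _ i1).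
    by apply: measurable_funM; [exact: measurable_indic|exact: mE].
  by apply: aeW => w; rewrite ger0_norm ?Db// mulr_ge0 ?expR_ge0// indicE.
split=> //.
have [i3 _] := integral_indic_Ex mD (L1Z (expR 1) iT).
apply: (@le_trans _ _ (Ex Q (fun w => expR (1 + j%:R) * \1_D w))); first by apply: Ex_le => //; exact: aeW.
(* For [j = 0] the event may contain points where [- c * X t] is negative and the tangent argument
   fails; there [expR (U t) <= expR 1] is enough. *)
have [j0|j0] := posnP j.
  apply: Ex_le => //; apply: aeW => w; rewrite j0 addr0 mulrC ler_wpM2l ?indicE//.
  by rewrite ler_peMr ?expR_ge0// -[leLHS]expR0 ler_expR.
have [i4 _] := integral_indic_Ex mD (iX T TT); have [i5 _] := integral_indic_Ex mD (iX t tT).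
have i1' : L1 Q (\1_D : Omega -> R).
  have := L1Z (expR (- (1 + j%:R))) i1; rewrite (_ : (fun w => _) = (\1_D : Omega -> R))//.
  by apply/funext => w; rewrite mulrA -expRD addNr expR0 mul1r.
have pos : 0 <= Ex Q (fun w => - c * (\1_D w * X t w) - j%:R * \1_D w).
  apply: Ex_ge0 => w; rewrite indicE; have [/set_mem[/= fj _]|_] := boolP (w \in D); last first.
    by rewrite !(mul0r, mulr0) subrr.
  rewrite mul1r mulr1 subr_ge0; have /andP[h _] := fP w; rewrite fj in h.
  by move: h; rewrite /U le_max => /orP[//|]; rewrite lern0 => /eqP j0'; rewrite j0' in j0.
rewrite ExB in pos; [|exact: L1Z|exact: L1Z].
rewrite (ExZ _ i5) (martingale_set tT FD) -(ExZ _ i4) -ExB in pos; [|exact: L1Z|exact: L1Z].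
apply: (@le_trans _ _ (Ex Q (fun w => expR (1 + j%:R) * \1_D w +
    expR (1 + j%:R) * (- c * (\1_D w * X T w) - j%:R * \1_D w)))).
  rewrite ExD//; last by apply: L1Z; apply: L1B; exact: L1Z.
  rewrite lerDl ExZ; last by apply: L1B; exact: L1Z.
  by rewrite mulr_ge0 ?expR_ge0.
apply: Ex_le => //; first by apply: L1D => //; apply: L1Z; apply: L1B; exact: L1Z.
apply: aeW => w; rewrite indicE; case: (_ \in _) => /=; last by rewrite !(mul0r, mulr0, subr0, addr0).
rewrite !mul1r !mulr1 -[X in X + _]mulr1 -mulrDr expRD -mulrA ler_pM2l ?expR_gt0//.
apply: (@le_trans _ _ (expR j%:R * expR (U T w - j%:R))); last by rewrite -expRD addrC subrK.
rewrite ler_pM2l ?expR_gt0//; apply: le_trans (expR_ge1Dx _); rewrite lerD2l lerD2r.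
by rewrite /U le_max lexx.
Qed.

(** Optional stopping: split according to the value of a grid time above [tau], apply the bound at
    each fixed time, and let the mesh tend to 0 with Fatou's lemma. *)
Lemma martingale_exp_stopped tau : stop tau ->
  L1 Q (fun w => expR (U (tau w) w)) /\
  Ex Q (fun w => expR (U (tau w) w)) <= expR 1 * Ex Q (fun w => expR (U T w)).
Proof.
move=> st; pose ga n w := grid_above tau n w.
have gE n w : ga n w = grid n (grid_index tau n w) by [].
have Fk n k : Fil (grid n k) [set w | grid_index tau n w = k].
  exact: (filtration_grid_index st).
have gI n k : 0 <= grid n k <= T by exact: (grid_itv).
have mk n k : measurable [set w | grid_index tau n w = k].
  exact: (filtration_measurable (andP (gI n k)).2 (Fk n k)).
have iZ : L1 Q (fun w => expR 1 * expR (U T w)) by exact: L1Z.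
have meas n : measurable_fun setT (fun w => expR (U (ga n w) w)).
  apply: (measurable_partition (f := grid_index tau n) (X := fun k w => expR (U (grid n k) w))) => // k.
  exact: mE.
have step n : L1 Q (fun w => expR (U (ga n w) w)) /\ Ex Q (fun w => expR (U (ga n w) w)) <= Ex Q (fun w => expR 1 * expR (U T w)).
  apply: (Ex_le_partition (f := grid_index tau n)) => //.
  move=> k; rewrite (_ : (fun w => _ * expR (U (ga n w) w)) =
      fun w => \1_[set w | grid_index tau n w = k] w * expR (U (grid n k) w)).
    exact: martingale_exp_le.
  apply/funext => w; rewrite indicE; have [/set_mem/= e|_] := boolP (w \in _); last by rewrite !mul0r.
  by rewrite gE e.
rewrite -ExZ//.
apply: (@fatou_Ex _ _ _ Q (fun n w => expR (U (ga n w) w))) => //.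
- by move=> n; exact: (step n).1.
- apply: measurableT_comp => //; apply: measurable_maxr => //; apply: measurable_funM => //.
  exact: (stopped_meas aX cX st).
- apply: PQ; apply: filterS cX => w cw; apply: cvg_expR_seq.
  have me (y : R) : Num.max y 0 = 2^-1 * (y + `|y|).
    by case: (lerP 0 y) => h; [rewrite ger0_norm|rewrite ltr0_norm]; lra.
  have cx : X (ga n w) w @[n --> \oo] --> X (tau w) w.
    by apply: (within_cvg cw (stopping_itv w st) (fun n => gI n _)); exact: (grid_above_cvg st).
  rewrite /U me (_ : (fun n => _) = fun n => 2^-1 * (- c * X (ga n w) w + `|- c * X (ga n w) w|)).
    by apply: cvgMr; apply: cvgD; [apply: cvgMr|apply: cvg_norm; apply: cvgMr].
  by apply/funext => n; rewrite me.
- by move=> n; exact: (step n).2.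
Qed.

End martingale_exponential.

(** * Densities with bounded bracket *)

Section tilting_instances.

Lemma exponential_ito (N : R -> Omega -> 'cV[R]_m) (Q : probability Omega R) :
  exponential_measure P T B N Q -> exists2 J, ito N J & forall A, measurable A ->
    Q A = (\int[P]_(w in A) (expR (J T w - qv (N ^~ w) T / 2))%:E)%E.
Proof.
move=> [J hJ hQ]; exists J => [|A mA]; first exact: ito_of.
rewrite hQ//; apply: eq_integral => w _; congr (expR (_ - _))%:E.
rewrite mulrC; congr (_ * _); rewrite /ip /rint; congr Rintegral.
by apply/funext => t; rewrite enormK.
Qed.

Section bounded_tilting.
Variables (N : R -> Omega -> 'cV[R]_m) (J : R -> Omega -> R) (K : R).
Hypotheses (hN : ito N J) (NK : {ae P, forall w, qv (N ^~ w) T <= K}).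

Let bracket_le tau : stop tau -> {ae P, forall w, qv (N ^~ w) (tau w) <= K}.
Proof.
move=> st; apply: filterS2 NK (ito_path hN) => w k pN; apply: le_trans k.
by have /andP[t0 t1] := stopping_itv w st; exact: (ip_nd t0 t1 (lexx T) pN).
Qed.

(** A power of the exponential is the exponential of [c] times the integral, with mean 1, times
    [expR ((c ^+ 2 - c) / 2 * V)], which is bounded. *)
Lemma bounded_doleans_power (c : R) tau : stop tau ->
  L1 P (fun w => expR (c * (J (tau w) w - qv (N ^~ w) (tau w) / 2))) /\
  Ex P (fun w => expR (c * (J (tau w) w - qv (N ^~ w) (tau w) / 2))) <= expR (`|c ^+ 2 - c| / 2 * K).
Proof.
move=> st; have hs := ito_scale c (ito_stop st hN).
have lin (q c' v j n : R) : (q - c') * v <= n * v -> n * v <= n * K ->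
  c' * (j - v / 2) <= n / 2 * K + (c' * j - q * v / 2) by rewrite mulrBl mulrBr; lra.
pose V w := qv (N ^~ w) (tau w).
have bE : {ae P, forall w, qv (fun t => c *: stopped (tau w) (N ^~ w) t) T = c ^+ 2 * V w}.
  apply: filterS (ito_path hN) => w pN; have pS := pathL2_stopped (tau w) pN.
  have /andP[t0 t1] := stopping_itv w st.
  rewrite (ipZl c TT pS (pathL2Z c pS)) (ipZr c TT pS pS) mulrA -expr2.
  by rewrite (ip_stopped2 t0 t0 TT pN pN) minxx min_l.
have hb : {ae P, forall w, qv (fun t => c *: stopped (tau w) (N ^~ w) t) T <= c ^+ 2 * K}.
  by apply: filterS2 bE (bracket_le st) => w -> k; rewrite ler_wpM2l ?sqr_ge0.
have [iX EX] := ito_exp hs hb.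
have mY : measurable_fun setT (fun w => expR (c * (J (tau w) w - V w / 2))).
  apply: measurableT_comp => //; apply: measurable_funM => //; apply: measurable_funB.
    exact: (stopped_meas (adapted_ito hN) (ito_continuous hN) st).
  by apply: measurable_funM => //; exact: (bracket_meas hN st).
have le : {ae P, forall w, expR (c * (J (tau w) w - V w / 2)) <= expR (`|c ^+ 2 - c| / 2 * K) *
    expR (c * J (Num.min T (tau w)) w - qv (fun t => c *: stopped (tau w) (N ^~ w) t) T / 2)}.
  apply: filterS2 bE (bracket_le st) => w -> k; rewrite -expRD ler_expR.
  have /andP[t0 t1] := stopping_itv w st; rewrite min_r//.
  have V0 : 0 <= V w by exact: (@ip_ge0 R T).
  have h1 : (c ^+ 2 - c) * V w <= `|c ^+ 2 - c| * V w by rewrite ler_wpM2r// ler_norm.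
  have h2 : `|c ^+ 2 - c| * V w <= `|c ^+ 2 - c| * K by rewrite ler_wpM2l.
  move: h1 h2; exact: lin.
have iY : L1 P (fun w => expR (c * (J (tau w) w - V w / 2))).
  apply: (L1_le mY _ (L1Z (expR (`|c ^+ 2 - c| / 2 * K)) iX)).
  by apply: filterS le => w h; rewrite ger0_norm ?expR_ge0.
by split=> //; apply: (le_trans (Ex_le iY (L1Z _ iX) le)); rewrite ExZ// EX mulr1.
Qed.

Lemma bounded_tilting (Q : probability Omega R) : (forall A, measurable A ->
    Q A = (\int[P]_(w in A) (expR (J T w - qv (N ^~ w) T / 2))%:E)%E) ->
  exists e, tilting N J e Q.
Proof.
(* Makes [e * (1 + e) / 2 * |K|] at most one half, and [expR 2^-1 <= 2]. *)
move=> hQ; pose e := Num.min 1 (2^-1 / (`|K| + 1)).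
have k0 : 0 < `|K| + 1 by rewrite ltr_wpDl.
have e0 : 0 < e by rewrite lt_min ltr01 divr_gt0.
exists e; split=> // tau st; have [i le] := bounded_doleans_power (1 + e) st.
split=> //; apply: (le_trans le).
have e1 : e <= 1 by rewrite ge_min lexx.
have e2 : e * (`|K| + 1) <= 2^-1 by rewrite -ler_pdivlMr// ge_min lexx orbT.
have eE : (1 + e) ^+ 2 - (1 + e) = e * (1 + e) by rewrite expr2; ring.
rewrite eE ger0_norm; last by rewrite mulr_ge0 ?addr_ge0// ltW.
apply: (@le_trans _ _ (expR 2^-1)).
  rewrite ler_expR; apply: (@le_trans _ _ (e * (1 + e) / 2 * `|K|)).
    by rewrite ler_wpM2l ?ler_norm// divr_ge0// mulr_ge0 ?addr_ge0 ?(ltW e0).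
  have n0 := normr_ge0 K; have : e * `|K| <= 2^-1 by rewrite mulrDr mulr1 in e2; lra.
  have u0 : 0 <= e * `|K| by rewrite mulr_ge0// ltW.
  by rewrite -mulrA mulrAC -mulrA; move: (e * `|K|) u0 => u; nra.
have h := expR_ge1Dx (- 2^-1 : R); rewrite expRN in h.
have p := expR_gt0 (2^-1 : R); have : expR 2^-1 * (1 + - 2^-1) <= 1 :> R by rewrite -ler_pdivlMl// mulr1.
by lra.
Qed.

End bounded_tilting.
End tilting_instances.

(** * Maximal inequality and control of brackets *)

Section small_increments.
Variables (N : R -> Omega -> 'cV[R]_m) (J : R -> Omega -> R) (e : R) (Q : probability Omega R).
Hypothesis ts : tilting N J e Q.
Let hN := tilting_ito ts.

Lemma measurable_ge (X : Omega -> R) (c : R) : measurable_fun setT X -> measurable [set w | c <= X w].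
Proof.
move=> mX; rewrite (_ : [set w | _] = X @^-1` `[c, +oo[).
  by rewrite -[X in measurable X]setTI; apply: mX => //; exact: measurable_itv.
by apply/seteqP; split=> w /=; rewrite in_itv/= andbT.
Qed.

(** Doob's inequality: [D] at the hitting time plus [|D T|] is nonnegative, at least [eps] where the
    level is reached, and its mean is that of [|D T|], since [D] has mean 0 at every stopping
    time. *)
Lemma one_sided_maximal (D : R -> Omega -> R) (eps eta : R) : adapted D -> aecont D ->
  (forall kappa, stop kappa -> L1 Q (fun w => D (kappa w) w) /\ Ex Q (fun w => D (kappa w) w) = 0) ->
  0 < eps -> Ex Q (fun w => `|D T w|) <= eta -> exists A, [/\ measurable A,
    (Q A <= (eta / eps)%:E)%E & {ae P, forall w, ~ A w -> hitting T eps (D ^~ w) = T /\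
      forall t, 0 <= t <= T -> D t w <= eps}].
Proof.
move=> aD cD mean0 eps0 Eeta; pose kappa w := hitting T eps (D ^~ w).
have sk : stop kappa by exact: (stopping_hitting _ aD cD).
have [ik ek] := mean0 _ sk; have [iT _] := mean0 _ (stopping_cst TT).
have mA := measurable_ge eps (L1_meas ik).
have off : {ae P, forall w, ~ (eps <= D (kappa w) w) -> hitting T eps (D ^~ w) = T /\
    forall t, 0 <= t <= T -> D t w <= eps}.
  apply: filterS cD => w cw nA.
  have lt t : 0 <= t <= T -> D t w < eps.
    by move=> tT; rewrite ltNge; apply/negP => h; apply: nA; apply: (hitting_ge T0 cw); exists t.
  by split=> [|t tT]; [exact: hitting_last|exact/ltW/lt].
exists [set w | eps <= D (kappa w) w]; split=> //.
have iX := L1D ik (L1_norm iT).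
have X0 : {ae Q, forall w, 0 <= D (kappa w) w + `|D T w|}.
  apply/(tilted_ae ts); apply: filterS off => w h.
  have [k|k] := pselect (eps <= D (kappa w) w).
    by rewrite addr_ge0// (le_trans (ltW eps0) k).
  rewrite /kappa (h k).1; have := ler_norm (- D T w); rewrite normrN; lra.
have XA : {ae Q, forall w, [set w | eps <= D (kappa w) w] w -> eps <= D (kappa w) w + `|D T w|}.
  by apply: aeW => w /= h; apply: (le_trans h); rewrite lerDl.
apply: (le_trans (Ex_markov eps0 iX mA X0 XA)); rewrite lee_fin ler_pM2r ?invr_gt0//.
by rewrite (ExD ik (L1_norm iT)) ek add0r.
Qed.

Variables (G : R -> Omega -> 'cV[R]_m) (I : R -> Omega -> R).
Hypothesis hG : ito G I.
Let D t w := drifted N G I t w.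
Let V t w := qv (G ^~ w) t.

Lemma drifted_zero : {ae P, forall w, D 0 w = 0}.
Proof. by apply: filterS (ito_at0 hG) => w h0; rewrite /D /drifted h0 /ip rint0 subrr. Qed.

Let A t w := qv (N ^~ w) t + V t w.

(** The exponential of [lam * D - lam ^+ 2 / 2 * V] has mean 1; replacing [D] by its upper bound
    [eps] leaves a lower bound for the Laplace transform of the bracket. As [lam >= 0], a one-sided
    bound on [D] suffices. *)
Lemma tilted_bracket_exp (kappa : Omega -> R) (lam eps : R) : stop kappa -> 0 <= lam ->
  {ae P, forall w, forall t, 0 <= t <= kappa w -> D t w <= eps} ->
  1 <= expR (lam * eps) * Ex Q (fun w => expR (- (lam ^+ 2 / 2 * V (kappa w) w))).
Proof.
move=> sk lam0 De.
pose rho (n : nat) w := hitting T n%:R (A ^~ w).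
have [srho bA ev] : localizing A rho.
  apply: (localizing_hitting).
  - exact: adaptedD (adapted_ip (ito_prd hN) (ito_prd hN)) (adapted_ip (ito_prd hG) (ito_prd hG)).
  - exact: aecontD (aecont_ip (ito_path hN) (ito_path hN)) (aecont_ip (ito_path hG) (ito_path hG)).
  - by apply: aeW => w; rewrite /A /V /ip !rint0 addr0.
pose s n w := Num.min (kappa w) (rho n w).
have ss n : stop (s n) by exact: stopping_min.
have sT n w : 0 <= s n w <= T by exact: (stopping_itv w (ss n)).
have bd n : {ae P, forall w, qv (N ^~ w) (s n w) <= n%:R} /\ {ae P, forall w, V (s n w) w <= n%:R}.
  have h : {ae P, forall w, A (s n w) w <= n%:R}.
    by apply: filterS bA => w; apply; have /andP[-> _] := sT n w; rewrite ge_min lexx orbT.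
  split; apply: filterS h => w; apply: le_trans; rewrite /A /V ?lerDl ?lerDr.
    by apply: (@ip_ge0 R T); case/andP: (sT n w).
  by apply: (@ip_ge0 R T); case/andP: (sT n w).
pose X n w := expR (- (lam ^+ 2 / 2 * V (s n w) w)).
have X01 (t : R) w : t <= T -> 0 <= expR (- (lam ^+ 2 / 2 * V t w)) <= 1.
  move=> tT; rewrite expR_ge0 -[leRHS]expR0 ler_expR oppr_le0 mulr_ge0 ?divr_ge0 ?sqr_ge0//.
  exact: (@ip_ge0 R T).
have mX tau : stop tau -> measurable_fun setT (fun w => expR (- (lam ^+ 2 / 2 * V (tau w) w))).
  move=> st; apply: measurableT_comp => //; apply: measurableT_comp => //; apply: measurable_funM => //.
  exact: (bracket_meas hG st).
have iX n : L1 Q (X n).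
  apply: (@L1_bounded _ _ _ _ _ 1); first exact: mX.
  by apply: aeW => w; have /andP[h1 h2] := X01 _ w (andP (sT n w)).2; rewrite ger0_norm.
have cX : {ae Q, forall w, X n w @[n --> \oo] --> expR (- (lam ^+ 2 / 2 * V (kappa w) w))}.
  apply/(tilted_ae ts); apply: (@stopped_continuous_cvg (fun t w => expR (- (lam ^+ 2 / 2 * V t w))) s kappa).
  apply: filterS ev => w; apply: filterS => n h; rewrite /s h min_l//.
  by case/andP: (stopping_itv w sk).
have UI (d : R) : 0 < d -> exists K : R, forall n, {ae Q, forall w, `|X n w| <= K + d * (fun=> 0 : R) w}.
  move=> _; exists 1 => n; apply: aeW => w; have /andP[h1 h2] := X01 _ w (andP (sT n w)).2.
  by rewrite mulr0 addr0 ger0_norm.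
have E0 (n : nat) : Ex Q (fun=> 0) <= 0 by rewrite Ex_cst.
have [i1 i2 c1] := @vitali _ _ _ Q _ (fun _ _ => 0) _ 0 (fun n => mX _ (ss n)) (mX _ sk) cX
  (fun=> L1_cst Q 0) (fun _ _ => lexx _) E0 UI.
have cE : expR (lam * eps) * Ex Q (X n) @[n --> \oo] --> expR (lam * eps) * Ex Q (fun w => expR (- (lam ^+ 2 / 2 * V (kappa w) w))).
  by apply: cvgMr; exact: (cvg_Ex i1 i2 c1).
rewrite -(cvg_lim _ cE)//; apply: limr_ge; first by apply/cvg_ex; eexists; exact: cE.
apply: nearW => n; have [iE E1] := tilted_exp ts hG (ss n) (bd n).1 (bd n).2 lam.
rewrite -[leLHS]E1 -(ExZ _ (i2 n)); apply: (Ex_le iE (L1Z _ (i2 n))).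
apply/(tilted_ae ts); apply: filterS De => w h; rewrite -expRD ler_expR lerD2r.
by apply: ler_wpM2l => //; apply: h; have /andP[-> _] := sT n w; rewrite ge_min lexx.
Qed.

(** Starts from the [L^1] norm of the terminal value alone. Two one-sided maximal inequalities bound
    the path. The Laplace transform of the bracket is then at least [1 - lam * eps], whereas a
    bracket above [v] makes the exponential at most one half; Markov's inequality gives the factor
    2. *)
Lemma small_increment (eps eta lam v : R) :
  (forall kappa, stop kappa -> L1 Q (fun w => D (kappa w) w) /\ Ex Q (fun w => D (kappa w) w) = 0) ->
  0 < eps -> Ex Q (fun w => `|D T w|) <= eta -> 0 <= lam -> 1 <= lam ^+ 2 / 2 * v ->
  exists A, [/\ measurable A, (Q A <= (2 * (eta / eps) + 2 * (lam * eps))%:E)%E &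
    {ae P, forall w, ~ A w -> (forall t, 0 <= t <= T -> `|D t w| <= eps) /\ V T w <= v}].
Proof.
move=> mean0 eps0 Eeta lam0 lv.
have aD : adapted D by exact: (drifted_adapted (ito_prd hN) hG).
have cD : aecont D by exact: (drifted_aecont (ito_path hN) hG).
have [A1 [mA1 q1 h1]] := one_sided_maximal aD cD mean0 eps0 Eeta.
have [A2 [mA2 q2 h2]] : exists A, [/\ measurable A, (Q A <= (eta / eps)%:E)%E &
    {ae P, forall w, ~ A w -> hitting T eps ((fun t w => -1 * D t w) ^~ w) = T /\
      forall t, 0 <= t <= T -> -1 * D t w <= eps}].
  apply: one_sided_maximal => //; [exact: adaptedZ|exact: aecontZ| |].
    move=> kappa sk; have [i0 E0] := mean0 _ sk; split; first exact: L1Z.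
    by rewrite ExZ// E0 mulr0.
  by rewrite (_ : (fun w => _) = fun w => `|D T w|)//; apply/funext => w; rewrite mulN1r normrN.
pose kappa w := hitting T eps (D ^~ w).
have sk : stop kappa by exact: (stopping_hitting _ aD cD).
have De : {ae P, forall w, forall t, 0 <= t <= kappa w -> D t w <= eps}.
  apply: filterS2 cD drifted_zero => w cw D0 t tk.
  by apply: (le_hitting T0 cw _ tk); rewrite D0 ltW.
have le1 := tilted_bracket_exp sk lam0 De.
pose X w := expR (- (lam ^+ 2 / 2 * V (kappa w) w)).
have mV : measurable_fun setT (fun w => V (kappa w) w) := bracket_meas hG sk.
have mX : measurable_fun setT X.
  by apply: measurableT_comp => //; apply: measurableT_comp => //; exact: measurable_funM.
have X1 w : X w <= 1.
  rewrite -[leRHS]expR0 ler_expR oppr_le0 mulr_ge0 ?divr_ge0 ?sqr_ge0//.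
  by apply: (@ip_ge0 R T); case/andP: (stopping_itv w sk).
have iX : L1 Q X.
  apply: (@L1_bounded _ _ _ _ _ 1) => //; apply: aeW => w; rewrite ger0_norm ?expR_ge0//.
have i1X := L1B (L1_cst Q 1) iX.
have half : expR (-1) <= 2^-1 :> R.
  rewrite expRN lef_pV2 ?posrE ?expR_gt0//; have := expR_ge1Dx (1 : R); lra.
pose A3 := [set w | v <= V (kappa w) w].
have mA3 : measurable A3 by exact: measurable_ge.
have q3 : (Q A3 <= (2 * (lam * eps))%:E)%E.
  have mk : {ae Q, forall w, A3 w -> 2^-1 <= 1 - X w}.
    apply: aeW => w; rewrite /A3/= => vV.
    have : X w <= expR (-1).
      rewrite ler_expR lerN2; apply: (le_trans lv); apply: ler_wpM2l => //.
      by rewrite divr_ge0// sqr_ge0.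
    by lra.
  have pos : {ae Q, forall w, 0 <= 1 - X w} by apply: aeW => w; rewrite subr_ge0.
  apply: (le_trans (Ex_markov _ i1X mA3 pos mk)); first by rewrite invr_gt0.
  rewrite lee_fin invrK mulrC ler_pM2l// (ExB (L1_cst Q 1) iX) Ex_cst.
  have h := expR_ge1Dx (- (lam * eps)); rewrite expRN in h.
  have := ler_wpM2l (ltW (expR_gt0 (- (lam * eps)))) le1.
  by rewrite mulr1 mulrA -expRD addNr expR0 mul1r -/X expRN; lra.
exists (A1 `|` A2 `|` A3); split; first by do 2 apply: measurableU => //.
  have U (E F : set Omega) : measurable E -> measurable F -> (Q (E `|` F) <= Q E + Q F)%E.
    by move=> mE mF; exact: measureU2.
  apply: (le_trans (U _ _ (measurableU _ _ mA1 mA2) mA3)).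
  rewrite EFinD; apply: leeD => //; apply: (le_trans (U _ _ mA1 mA2)).
  by rewrite mulr_natl mulr2n EFinD; exact: leeD.
apply: filterS2 h1 h2 => w k1 k2 nA.
have [n1 n2] : ~ A1 w /\ ~ A2 w by split=> h; apply: nA; left; [left|right].
have [kT d1] := k1 n1; have [_ d2] := k2 n2; split=> [t tT|].
  by have := d1 t tT; have := d2 t tT; rewrite ler_norml mulN1r => h h'; apply/andP; split; lra.
have n3 : ~ (v <= V (kappa w) w) by move=> h; apply: nA; right.
by move/negP: n3; rewrite -ltNge /kappa kT => /ltW.
Qed.

End small_increments.

(** * The linear equation *)

Section limit.
Variables (N : R -> Omega -> 'cV[R]_m) (J : R -> Omega -> R) (e : R) (Q : probability Omega R).
Hypothesis ts : tilting N J e Q.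
Let hN := tilting_ito ts.
Variables (h : nat -> R -> Omega -> 'cV[R]_m) (Ih X U : nat -> R -> Omega -> R) (a k : nat -> R).
Hypothesis hp : forall n, perturbed N (h n) (Ih n) (X n) (U n) (a n) (k n).
Hypothesis pX : forall n, predictable P T B (X n).
Variable F : Omega -> R.
Hypotheses (mF : measurable_fun setT F) (XF : forall n, {ae P, forall w, X n T w = F w}).
Let q : R := 2^-1.
Let EF := Ex Q F.
Let x n := Ex Q (X n 0).
(** Of the four powers of [q ^+ n], three go into the bound on the path and one is left for the
    probability that Borel-Cantelli has to sum; 256 keeps that probability below [q ^+ n]. *)
Let delta (n : nat) : R := (q ^+ n) ^+ 4 / 256.
Hypothesis gap_le : forall n, 0 <= x n - EF <= delta n.
Let W n t w := drifted N (h n) (Ih n) t w.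
Let D n t w := X n 0 w + W n t w - X n t w.
Let hh n := pert_ito (hp n).

Let q0 n : 0 < q ^+ n. Proof. by rewrite exprn_gt0// invr_gt0. Qed.
Let q1 n : q ^+ n <= 1. Proof. by rewrite exprn_ile1 ?invr_ge0// invf_le1// ler1n. Qed.

Let delta_nd n : delta n.+1 <= delta n.
Proof.
rewrite /delta ler_pM2r ?invr_gt0// lerXn2r ?nnegrE ?(ltW (q0 _))// exprS ler_piMl ?(ltW (q0 _))//.
by rewrite invf_le1// ler1n.
Qed.

Let delta_small n : delta n <= q ^+ n / 4.
Proof.
have h4 : (q ^+ n) ^+ 4 <= q ^+ n by rewrite exprS ler_piMr ?(ltW (q0 n))// exprn_ile1 ?(ltW (q0 n)).
by have := q0 n; rewrite /delta; move: h4; move: ((q ^+ n) ^+ 4) (q ^+ n) => u v; lra.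
Qed.

Let iF : L1 Q F := pert_terminal_L1 ts (hp 0%N) (XF 0%N) mF.

Let EXT n : Ex Q (X n T) = EF.
Proof. exact: (pert_terminal_Ex ts (hp n) (XF n) mF). Qed.

Let x_cst : {ae P, forall w, forall n, X n 0 w = x n}.
Proof. by apply: ae_foralln => n; exact: (pert_start ts (hp n)). Qed.

Let D_nd : {ae P, forall w, forall n, (forall t, 0 <= t <= T -> 0 <= D n t w <= D n T w)}.
Proof.
apply: ae_foralln => n; apply: filterS2 (pert_mono (hp n)) (drifted_at0 (hp n)) => w mono W0 t /andP[t0 tT].
have := mono t T t0 tT (lexx T); have := mono 0 t (lexx 0) t0 tT.
rewrite /D /W W0; move: (drifted _ _ _ _ _) (drifted _ _ _ _ _) => u v h1 h2.
by apply/andP; split; lra.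
Qed.

Let iDT n : L1 Q (D n T) /\ Ex Q (D n T) <= delta n.
Proof.
have [i E] := pert_drift ts (hp n) (stopping_cst TT); split=> //.
rewrite [Ex Q (D n T)]E EXT; by have /andP[] := gap_le n.
Qed.

Let G n t w := h n t w - h n.+1 t w.
Let IG n t w := Ih n t w - Ih n.+1 t w.
Let hG n : ito (G n) (IG n) := ito_sub (hh n) (hh n.+1).

Let incrE n : {ae P, forall w, forall t, 0 <= t <= T -> drifted N (G n) (IG n) t w = W n t w - W n.+1 t w}.
Proof.
apply: filterS3 (ito_path (hh n)) (ito_path (hh n.+1)) (ito_path hN) => w p1 p2 p3 t tT.
by rewrite /W /drifted /G (ipBl tT p1 p2 p3) /IG; move: (ip _ _ _) (ip _ _ _) => u v; ring.
Qed.

Let incr_mean0 n kappa : stop kappa -> L1 Q (fun w => drifted N (G n) (IG n) (kappa w) w) /\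
  Ex Q (fun w => drifted N (G n) (IG n) (kappa w) w) = 0.
Proof.
move=> sk; have [i1 e1] := pert_mean0 ts (hp n) sk; have [i2 e2] := pert_mean0 ts (hp n.+1) sk.
have mk := drifted_meas hN (hG n) sk.
have E : {ae Q, forall w, W n (kappa w) w - W n.+1 (kappa w) w = drifted N (G n) (IG n) (kappa w) w}.
  by apply/(tilted_ae ts); apply: filterS (incrE n) => w E; rewrite (E _ (stopping_itv w sk)).
have i := L1B i1 i2; split; first exact: (L1_ae mk E i).
by rewrite -(Ex_ae (L1_meas i) mk E) (ExB i1 i2) e1 e2 subrr.
Qed.

(** Both processes end at [F], so the two martingale parts differ at [T] by two nonnegative
    variables with means at most [delta n] and by a constant of that size. *)
Let incr_L1 n : Ex Q (fun w => `|drifted N (G n) (IG n) T w|) <= 4 * delta n.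
Proof.
have [iD ED] := iDT n; have [iD' ED'] := iDT n.+1.
have [i _] := incr_mean0 n (stopping_cst TT).
have iS := L1D (L1D iD iD') (L1_cst Q `|x n - x n.+1|).
have lin (w1 w2 x1 x2 f : R) : 0 <= x1 + w1 - f -> 0 <= x2 + w2 - f ->
    `|w1 - w2| <= x1 + w1 - f + (x2 + w2 - f) + `|x1 - x2|.
  move=> h1 h2; have := ler_norm (x1 - x2); have := ler_norm (- (x1 - x2)); rewrite normrN.
  by move: `|x1 - x2| => y h3 h4; rewrite ler_norml; apply/andP; split; lra.
apply: (le_trans (Ex_le (L1_norm i) iS _)).
  apply/(tilted_ae ts); apply: filterS2 (filterI x_cst D_nd) (filterI (incrE n) (filterI (XF n) (XF n.+1))).
  move=> w [xc nd] [E [F1 F2]]; rewrite (E T TT) /D F1 F2 !xc; apply: lin.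
    by have /andP[h1 _] := nd n T TT; move: h1; rewrite /D F1 xc.
  by have /andP[h1 _] := nd n.+1 T TT; move: h1; rewrite /D F2 xc.
rewrite (ExD (L1D iD iD') (L1_cst Q _)) (ExD iD iD') Ex_cst.
have := gap_le n; have := gap_le n.+1; have := delta_nd n.
move=> h1 /andP[h2 h3] /andP[h4 h5].
have : `|x n - x n.+1| <= delta n by rewrite ler_norml; apply/andP; split; lra.
move: ED ED'; move: (Ex Q _) (Ex Q _) => u v; lra.
Qed.

Definition good_increments w n : Prop :=
  [/\ forall t, 0 <= t <= T -> `|W n t w - W n.+1 t w| <= q ^+ n / 16,
      qv (G n ^~ w) T <= (q ^+ n) ^+ 4 & D n T w <= q ^+ n].

Lemma good_eventually : {ae P, forall w, exists n0, forall n, (n0 <= n)%N -> good_increments w n}.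
Proof.
have bad n : exists A, [/\ measurable A, (Q A <= (q ^+ n)%:E)%E & {ae P, forall w, ~ A w -> good_increments w n}].
  pose p := q ^+ n; have p0 : 0 < p := q0 n; have p1 : p <= 1 := q1 n.
  (* The three parts of the exceptional event then have measure at most [p / 2], [p / 4] and
     [p ^+ 3 / 256], and [lam ^+ 2 / 2 * p ^+ 4 = 2]. *)
  pose eps := p ^+ 3 / 16; pose lam := 2 / p ^+ 2.
  have eps0 : 0 < eps by rewrite divr_gt0// exprn_gt0.
  have lam0 : 0 <= lam by rewrite divr_ge0// exprn_ge0// ltW.
  have pn : p != 0 by rewrite gt_eqF.
  have lv : 1 <= lam ^+ 2 / 2 * p ^+ 4.
    by rewrite (_ : lam ^+ 2 / 2 * p ^+ 4 = 2) ?ler1n// /lam; field.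
  have [A [mA QA hA]] := small_increment ts (hG n) (incr_mean0 n) eps0 (incr_L1 n) lam0 lv.
  pose A' := [set w | p <= D n T w].
  have [iD ED] := iDT n; have mA' : measurable A' := measurable_ge p (L1_meas iD).
  have QA' : (Q A' <= (delta n / p)%:E)%E.
    have D0 : {ae Q, forall w, 0 <= D n T w}.
      by apply/(tilted_ae ts); apply: filterS D_nd => w nd; have /andP[] := nd n T TT.
    apply: (le_trans (Ex_markov p0 iD mA' D0 (aeW _ (fun w h => h)))).
    by rewrite lee_fin ler_pM2r ?invr_gt0.
  exists (A `|` A'); split; first exact: measurableU.
    apply: (le_trans (measureU2 _ mA mA')); apply: (le_trans (leeD QA QA')).
    rewrite -EFinD lee_fin -/p.
    have -> : 2 * (4 * delta n / eps) + 2 * (lam * eps) + delta n / p = 3 / 4 * p + p ^+ 3 / 256.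
      by rewrite /delta -/p /eps /lam; field.
    have : p ^+ 3 <= p by rewrite exprS ler_piMr ?(ltW p0)// exprn_ile1// ltW.
    by move: (p ^+ 3) => c; lra.
  apply: filterS2 hA (incrE n) => w hw E nA; have [h1 h2] : (forall t, 0 <= t <= T -> `|drifted N (G n) (IG n) t w| <= eps) /\
      qv (G n ^~ w) T <= p ^+ 4 by apply: hw => h'; apply: nA; left.
  split=> // [t tT|].
    rewrite -(E t tT); apply: (le_trans (h1 t tT)); rewrite -/p /eps.
    have : p ^+ 3 <= p by rewrite exprS ler_piMr ?(ltW p0)// exprn_ile1// ltW.
    by move: (p ^+ 3) => c; lra.
  by rewrite leNgt; apply/negP => /ltW h'; apply: nA; right.
have [A hA] := choice bad.
have : {ae Q, forall w, \forall n \near \oo, ~ A n w}.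
  by apply: borel_cantelli_ae => n; [case: (hA n)|case: (hA n)].
move=> /(tilted_ae ts) ev.
have all : {ae P, forall w, forall n, ~ A n w -> good_increments w n}.
  by apply: ae_foralln => n; case: (hA n).
by apply: filterS2 ev all => w [n0 _ h1] h2; exists n0 => n nn; apply: h2; exact: h1.
Qed.

Definition limit_process t w : R := limsup_path (fun n => X n t w).
Definition limit_integrand t w : 'cV[R]_m := limsup_mx (fun n s => h n s w) t.
(** Read off from the linear equation that the limit should solve; that it is the integral of the
    limiting integrand is [limit_itoP]. *)
Definition limit_ito t w : R := limit_process t w - EF + ip (limit_integrand ^~ w) (N ^~ w) t.
Let C0 := limit_process.
Let H0 := limit_integrand.

Let predictable_limsup (V : nat -> R -> Omega -> R) : (forall n, predictable P T B (V n)) ->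
  predictable P T B (fun t w => limsup_path (fun n => V n t w)).
Proof.
move=> pV; apply/predictableP.
have := @measurable_limsup_path R _ (predictable_type) _ (fun n z => V n z.1 z.2).
apply.
  exact: predictable_domain.
by move=> n; apply/predictableP; exact: pV.
Qed.

Lemma limit_predictable : predictable P T B C0.
Proof. exact: predictable_limsup. Qed.

Lemma limit_integrand_predictable : predictable_mx P T B H0.
Proof.
move=> i j; apply: (predictable_ext (X := fun t w => limsup_path (fun n => h n t w i 0))).
  by move=> t w _; rewrite ord1 mxE.
by apply: predictable_limsup => n; exact: (ito_prd (hh n)).
Qed.

Lemma limit_paths : {ae P, forall w, exists n0, forall n, (n0 <= n)%N ->
  D n T w <= q ^+ n /\ forall t, 0 <= t <= T -> `|X n t w - C0 t w| <= 4 * q ^+ n}.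
Proof.
have lin (x1 x2 w1 w2 d1 d2 c1 c2 c : R) : x1 - x2 <= c / 4 -> x2 - x1 <= c / 4 -> `|w1 - w2| <= c / 16 ->
    0 <= x1 + w1 - c1 <= d1 -> 0 <= x2 + w2 - c2 <= d2 -> d1 <= c -> d2 <= c -> `|c1 - c2| <= 2 * c.
  rewrite !ler_norml => h1 h2 /andP[h3 h4] /andP[h5 h6] /andP[h7 h8] h9 h10.
  by apply/andP; split; lra.
have dq n : x n - x n.+1 <= q ^+ n / 4 /\ x n.+1 - x n <= q ^+ n / 4.
  have /andP[h1 h2] := gap_le n; have /andP[h3 h4] := gap_le n.+1; have h5 := delta_nd n.
  have h6 := delta_small n.
  by split; lra.
apply: filterS3 good_eventually x_cst D_nd => w [n0 good] xc nd; exists n0 => n nn.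
have [_ _ Dn] := good n nn; split=> // t tT.
have [l hl bl] : exists2 l, X n t w @[n --> \oo] --> l & forall n, (n0 <= n)%N -> `|X n t w - l| <= 4 * q ^+ n.
  apply: geometric_cvg => j jj; have [hW _ hD] := good j jj; have [_ _ hD'] := good j.+1 (leqW jj).
  have [d1 d2] := dq j; have := nd j t tT; have := nd j.+1 t tT; rewrite /D !xc => n2 n1.
  apply: (lin _ _ _ _ _ _ _ _ _ d1 d2 (hW t tT) n1 n2); first by move: hD; rewrite /D xc.
  move: hD'; rewrite /D xc exprS => hD'; apply: (le_trans hD').
  by rewrite ler_piMl ?(ltW (q0 j))// invf_le1// ler1n.
by rewrite /C0 /limit_process (limsup_pathE hl); exact: bl.
Qed.

Let small (d : R) : 0 < d -> \forall n \near \oo, 4 * q ^+ n <= d.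
Proof.
move=> d0; have c0 : (4 * q ^+ n : R) @[n --> \oo] --> 0.
  rewrite -[X in _ --> X](mulr0 4); apply: cvgMr.
  by apply: cvg_expr; rewrite /q ger0_norm// invf_lt1// ltr1n.
exact: (cvgr_le _ c0 _ d0).
Qed.

Let limit_unif : {ae P, forall w, unif T (fun n => X n ^~ w) (C0 ^~ w) /\
  forall d : R, 0 < d -> \forall n \near \oo, D n T w <= d}.
Proof.
apply: filterS limit_paths => w [n0 hw]; split=> d d0; have [n1 _ h1] := small d0;
  exists (maxn n0 n1) => // n /=; rewrite geq_max => /andP[nn nn1]; have [hD hX] := hw n nn.
  by move=> t tT; exact: le_trans (hX t tT) (h1 n nn1).
by apply: (le_trans hD); apply: le_trans (h1 n nn1); rewrite ler_peMl ?(ltW (q0 n))// ler1n.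
Qed.

Lemma limit_continuous : aecont C0.
Proof.
have cX : {ae P, forall w, forall n, {within `[0, T], continuous (X n ^~ w)}}.
  by apply: ae_foralln => n; exact: (pert_cont (hp n)).
by apply: filterS2 cX limit_unif => w c [u _]; exact: unif_within_continuous c u.
Qed.

Lemma limit_terminal : {ae P, forall w, C0 T w = F w}.
Proof.
have XF' : {ae P, forall w, forall n, X n T w = F w} by apply: ae_foralln.
apply: filterS2 XF' limit_unif => w E [u _]; rewrite /C0 /limit_process (limsup_pathE (l := F w))//.
by rewrite (funext (fun n => E n)); exact: cvg_cst.
Qed.

Let x_cvg : x n @[n --> \oo] --> EF.
Proof.
apply/cvgrPdist_le => d d0; apply: filterS (small d0) => n hn; rewrite distrC.
have /andP[h1 h2] := gap_le n; rewrite ger0_norm//; apply: (le_trans h2); apply: le_trans hn.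
by have := q0 n; have := delta_small n; move: (q ^+ n) (delta n) => u v; lra.
Qed.

Lemma limit_initial : {ae P, forall w, C0 0 w = EF}.
Proof.
apply: filterS x_cst => w xc; rewrite /C0 /limit_process (limsup_pathE (l := EF))//.
by rewrite (funext (fun n => xc n)); exact: x_cvg.
Qed.

Lemma limit_integrand_path : {ae P, forall w, pathL2 T (H0 ^~ w) /\ cvgL2 T (fun n => h n ^~ w) (H0 ^~ w)}.
Proof.
have ph : {ae P, forall w, forall n, pathL2 T (h n ^~ w)} by apply: ae_foralln => n; exact: (ito_path (hh n)).
apply: filterS2 ph good_eventually => w p [n0 good].
have [M hM] : exists M, forall n, \sum_(j < n) 4 ^+ j * qv (G j ^~ w) T <= M.
  apply: (@geometric_sum_bounded _ (fun j => 4 ^+ j * qv (G j ^~ w) T) n0) => n.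
    by rewrite mulr_ge0 ?exprn_ge0//; exact: (@ip_ge0 R T).
  move=> nn; have [_ hV _] := good n nn; apply: (le_trans (ler_wpM2l _ hV)); first by rewrite exprn_ge0.
  (* The weight [4 ^+ n] uses up two of the four powers of [q ^+ n] in the bound on the bracket. *)
  have e4 : 4 ^+ n * (q ^+ n) ^+ 2 = 1 by rewrite exprAC -exprMn /q expr2 -invfM -natrM mulfV ?pnatr_eq0// expr1n.
  rewrite (exprD _ 2 2) mulrA e4 mul1r expr2 ler_piMr ?(ltW (q0 n))//.
by split; [exact: (pathL2_limsup p hM)|exact: (cvgL2_limsup p hM)].
Qed.

(** [Ih n] is [W n] plus the inner product of [h n] and [N]. The former follows [X n] up to the
    vanishing [D n], the latter converges with the integrands, both uniformly in time. *)
Lemma limit_itoP : ito H0 limit_ito.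
Proof.
apply: (ito_lim hh limit_integrand_predictable).
  by apply: filterS limit_integrand_path => w [].
have ph : {ae P, forall w, forall n, pathL2 T (h n ^~ w)} by apply: ae_foralln => n; exact: (ito_path (hh n)).
apply: filterS2 (filterI limit_integrand_path limit_unif) (filterI (filterI x_cst D_nd) (filterI ph (ito_path hN))).
move=> w [[pH cH] [uX uD]] [[xc nd] [p pN]]; split=> // d d0.
have d4 : 0 < d / 4 by rewrite divr_gt0.
have cN : cvgL2 T (fun _ : nat => N ^~ w) (N ^~ w).
  rewrite /cvgL2 (_ : (fun n => _) = fun=> 0); first exact: cvg_cst.
  apply/funext => n; rewrite /ip (@rint_ext _ T _ (fun=> 0)) ?rint_cst ?mul0r// => s _.
  by rewrite subrr dotv0l.
have uI := ip_cvg T0 p pH (fun=> pN) pN cH cN d4.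
have lin (i c f i' X1 w1 x1 : R) : w1 = i - i' -> forall c' i0 dT, `|X1 - c'| <= d / 4 -> 0 <= x1 + w1 - X1 <= dT -> dT <= d / 4 ->
    `|f - x1| <= d / 4 -> `|i' - i0| <= d / 4 -> `|i - (c' - f + i0)| <= d.
  move=> -> c' i0 dT; rewrite !ler_norml => /andP[h1 h2] /andP[h3 h4] h5 /andP[h6 h7] /andP[h8 h9].
  by apply/andP; split; lra.
have/cvgrPdist_le xd := x_cvg.
apply: filterS2 (filterI (uX _ d4) (uD _ d4)) (filterI (xd _ d4) uI) => n [k1 k2] [k3 k4] t tT.
have k5 := nd n t tT; rewrite /limit_ito.
have k6 : 0 <= x n + W n t w - X n t w <= D n T w by move: k5; rewrite -[D n t w]/(X n 0 w + W n t w - X n t w) xc.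
exact: (lin (Ih n t w) 0 EF _ (X n t w) (W n t w) (x n) erefl _ _ _ (k1 t tT) k6 k2 k3 (k4 t tT)).
Qed.

(** On every event known at [t], the means of [X n t] and [F] differ by at most [delta n]. Comparing
    two terms where one exceeds the other, and on the complement, makes the sequence Cauchy in
    [L^1]; Fatou's lemma transfers this to the limit. *)
Lemma limit_conditional t E : 0 <= t <= T -> filtration P B t E ->
  L1 Q (C0 t) /\ Ex Q (fun w => \1_E w * C0 t w) = Ex Q (fun w => \1_E w * F w).
Proof.
move=> tT FE; have mE := filtration_measurable (andP tT).2 FE.
have iX n : L1 Q (X n t) := pert_L1 ts (hp n) (stopping_cst tT).
have aX n : measurable_at P B t (X n t) := pert_adapted (hp n) tT.
have iXT n : L1 Q (X n T) := pert_L1 ts (hp n) (stopping_cst TT).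
have cond n A : filtration P B t A -> 0 <= Ex Q (fun w => \1_A w * X n t w) - Ex Q (fun w => \1_A w * F w) <= delta n.
  move=> FA; have mA := filtration_measurable (andP tT).2 FA.
  have := pert_conditional ts (hp n) tT FA; rewrite EXT.
  have [i1 _] := integral_indic_Ex mA (iX n); have [i2 _] := integral_indic_Ex mA (iXT n).
  have [i3 _] := integral_indic_Ex mA iF.
  have -> : (fun w => \1_A w * (X n t w - X n T w)) = fun w => \1_A w * X n t w - \1_A w * X n T w.
    by apply/funext => w; rewrite mulrBr.
  rewrite (ExB i1 i2) (Ex_ae (L1_meas i2) (L1_meas i3)); last first.
    by apply/(tilted_ae ts); apply: filterS (XF n) => w ->.
  by have /andP[_ h2] := gap_le n; move=> /andP[-> h1]; exact: le_trans h1 h2.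
have dist n p : Ex Q (fun w => `|X n t w - X (n + p)%N t w|) <= 2 * delta n.
  pose l := (n + p)%N; pose A := [set w | X n t w < X l t w].
  have FA : filtration P B t A by exact: (mat_lt (aX n) (aX l)).
  have FC : filtration P B t (~` A) by exact: filtrationC.
  have mA := filtration_measurable (andP tT).2 FA; have mC := filtration_measurable (andP tT).2 FC.
  have [i1 _] := integral_indic_Ex mA (iX n); have [i2 _] := integral_indic_Ex mA (iX l).
  have [i3 _] := integral_indic_Ex mC (iX n); have [i4 _] := integral_indic_Ex mC (iX l).
  have dl : delta l <= delta n.
    rewrite /l; elim: p {A FA FC mA mC i1 i2 i3 i4 l} => [|p ih]; first by rewrite addn0.
    by rewrite addnS; exact: le_trans (delta_nd _) ih.
  have -> : (fun w => `|X n t w - X l t w|) =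
      fun w => (\1_A w * X l t w - \1_A w * X n t w) + (\1_(~` A) w * X n t w - \1_(~` A) w * X l t w).
    apply/funext => w; rewrite !indicE in_setC; have [/set_mem h1|h1] := boolP (w \in A).
      by rewrite ltr0_norm ?subr_lt0// !mul1r !mul0r subrr addr0 opprB.
    move: h1; rewrite notin_setE /A/= => /negP; rewrite -leNgt => h1.
    by rewrite ger0_norm ?subr_ge0// !mul1r !mul0r subrr add0r.
  rewrite (ExD (L1B i2 i1) (L1B i3 i4)) (ExB i2 i1) (ExB i3 i4).
  have /andP[h1 h2] := cond n _ FA; have /andP[h3 h4] := cond l _ FA.
  have /andP[h5 h6] := cond n _ FC; have /andP[h7 h8] := cond l _ FC.
  have lin (y1 y2 y3 y4 f1 f2 : R) : 0 <= y2 - f1 -> y1 - f1 <= delta l -> y3 - f2 <= delta n -> 0 <= y4 - f2 ->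
    y1 - y2 + (y3 - y4) <= 2 * delta n by move: dl; lra.
  exact: lin h1 h4 h6 h7.
have mC0 : measurable_fun setT (C0 t) := mat_meas (andP tT).2 (predictable_mat tT limit_predictable).
have fat n : L1 Q (fun w => `|X n t w - C0 t w|) /\ Ex Q (fun w => `|X n t w - C0 t w|) <= 2 * delta n.
  apply: (@fatou_Ex _ _ _ Q (fun p w => `|X n t w - X (n + p)%N t w|)) => //.
  - by move=> p; apply: L1_norm; exact: L1B.
  - by apply: measurableT_comp => //; apply: measurable_funB => //; exact: (L1_meas (iX n)).
  - apply/(tilted_ae ts); apply: filterS limit_unif => w [u _].
    apply: cvg_norm; apply: cvgB; first exact: cvg_cst.
    have := unif_cvg tT u; rewrite -(cvg_shiftn n); under eq_fun do rewrite addnC; exact.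
have iC : L1 Q (C0 t).
  have [i _] := fat 0%N; apply: (L1_le mC0 _ (L1D i (L1_norm (iX 0%N)))); apply: aeW => w.
  have := ler_normB (X 0%N t w) (X 0%N t w - C0 t w).
  by rewrite (_ : X 0%N t w - (X 0%N t w - C0 t w) = C0 t w) 1?addrC//; ring.
split=> //; have [i1 _] := integral_indic_Ex mE iC; have [i2 _] := integral_indic_Ex mE iF.
have bd n : `|Ex Q (fun w => \1_E w * C0 t w) - Ex Q (fun w => \1_E w * F w)| <= 3 * delta n.
  have [i3 _] := integral_indic_Ex mE (iX n); have [i4 le4] := fat n.
  have h1 : `|Ex Q (fun w => \1_E w * X n t w) - Ex Q (fun w => \1_E w * C0 t w)| <= 2 * delta n.
    rewrite -(ExB i3 i1); apply: (le_trans (Ex_norm (L1B i3 i1))); apply: le_trans le4.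
    apply: (Ex_le (L1_norm (L1B i3 i1)) i4); apply: aeW => w; rewrite -mulrBr normrM ler_piMl// indicE.
    by case: (_ \in _) => /=; rewrite ?normr1// normr0.
  have /andP[h2 h3] := cond n _ FE.
  move: h1; rewrite ler_norml => /andP[h4 h5]; rewrite ler_norml; move: h2 h3 h4 h5.
  by move: (Ex Q _) (Ex Q _) (Ex Q _) => u v z h2 h3 h4 h5; apply/andP; split; lra.
apply/eqP; rewrite -subr_eq0 -normr_le0; apply/ler_addgt0Pr => d d0; rewrite add0r.
have [n _ hn] := small d0; apply: (le_trans (bd n)); apply: le_trans (hn n (leqnn n)).
by have := q0 n; have := delta_small n; move: (q ^+ n) (delta n) => u v; lra.
Qed.

End limit.

(** * Uniqueness for the linear equation *)

Section uniqueness.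

Lemma conditional_expectation_le (Q : probability Omega R) (t : R) (F C C' : Omega -> R) : t <= T ->
  conditional_expectation P B Q t F C -> conditional_expectation P B Q t F C' ->
  {ae Q, forall w, C' w <= C w}.
Proof.
move=> tT [_ i1 m1 h1] [_ i2 m2 h2]; pose A := [set w | C w < C' w].
have FA : filtration P B t A := mat_lt m1 m2.
have mA := filtration_measurable tT FA.
have [j1 e1] := integral_indic_Ex mA i1; have [j2 e2] := integral_indic_Ex mA i2.
have E : Ex Q (fun w => \1_A w * C' w - \1_A w * C w) = 0.
  rewrite (ExB j2 j1); have := h1 A FA; rewrite -(h2 A FA) e1 e2 => -[->].
  by rewrite subrr.
have pos : {ae Q, forall w, 0 <= \1_A w * C' w - \1_A w * C w}.
  apply: aeW => w; rewrite indicE; have [/set_mem h|_] := boolP (w \in A).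
    by rewrite !mul1r subr_ge0 ltW.
  by rewrite !mul0r subrr.
apply: filterS (Ex_eq0 (L1B j2 j1) pos E) => w; rewrite indicE.
have [/set_mem h|h _] := boolP (w \in A).
  by rewrite !mul1r => /eqP; rewrite subr_eq0 => /eqP ->.
by rewrite leNgt; apply/negP => h'; move/negP: h; apply; rewrite inE.
Qed.

Variables (N : R -> Omega -> 'cV[R]_m) (J : R -> Omega -> R) (e : R) (Q : probability Omega R).
Hypothesis ts : tilting N J e Q.
Variables (F : Omega -> R).

Lemma linear_equation (C : R -> Omega -> R) (H : R -> Omega -> 'cV[R]_m) :
  bsde P T B (fun t w h => dotv h (N t w)) F C H -> exists2 I, ito H I &
  {ae P, forall w, forall t, 0 <= t <= T ->
    C t w = F w + (ip (H ^~ w) (N ^~ w) T - ip (H ^~ w) (N ^~ w) t) - (I T w - I t w)}.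
Proof.
move=> [_ _ [I hI eq]]; have hI' := ito_of hI; exists I => //.
apply: filterS3 eq (ito_path hI') (ito_path (tilting_ito ts)) => w E p1 p2 t tT.
have /andP[t0 tT'] := tT.
by rewrite (E t tT) /ip (rint_incr_cc t0 tT' (lexx T) (pathL2_dot p1 p2)).
Qed.

Lemma linear_unique (C C' : R -> Omega -> R) (H H' : R -> Omega -> 'cV[R]_m) :
  bsde P T B (fun t w h => dotv h (N t w)) F C H -> bsde P T B (fun t w h => dotv h (N t w)) F C' H' ->
  (forall t, 0 <= t <= T -> conditional_expectation P B Q t F (C t)) ->
  (forall t, 0 <= t <= T -> conditional_expectation P B Q t F (C' t)) ->
  same_solution P T C C' H H'.
Proof.
move=> b1 b2 ce ce'; have [I hI eq] := linear_equation b1; have [I' hI' eq'] := linear_equation b2.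
have [_ cC _] := b1; have [_ cC' _] := b2.
have CC t : 0 <= t <= T -> {ae P, forall w, C t w = C' t w}.
  move=> tT; apply/(tilted_ae ts).
  have l1 := conditional_expectation_le (andP tT).2 (ce t tT) (ce' t tT).
  have l2 := conditional_expectation_le (andP tT).2 (ce' t tT) (ce t tT).
  by apply: filterS2 l1 l2 => w h1 h2; apply/eqP; rewrite eq_le h1 h2.
have CCt : {ae P, forall w, forall t, 0 <= t <= T -> C t w = C' t w}.
  (* Equality at each fixed time is first collected over rational times, outside one null set, and
     then extended by continuity. *)
  have CCq : {ae P, forall w, forall n : nat, forall r : rat, unpickle n = Some r ->
      0 <= (ratr r : R) <= T -> C (ratr r) w = C' (ratr r) w}.
    apply: ae_foralln => n; case: (unpickle n) => [r|]; last exact: aeW.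
    have [rT|rT] := boolP (0 <= (ratr r : R) <= T).
      by apply: filterS (CC _ rT) => w h r' [<-].
    by apply: aeW => w r' [<-] h; rewrite h in rT.
  apply: filterS3 CCq cC cC' => w hq c c' t tT.
  have half (x y : R -> R) : {within `[0, T], continuous x} -> {within `[0, T], continuous y} ->
      (forall r : rat, 0 <= (ratr r : R) <= T -> x (ratr r) = y (ratr r)) -> y t <= x t.
    move=> cx cy E; rewrite -subr_le0 leNgt; apply/negP => lt.
    have [r rT] := rational_near (within_continuousB cy cx) tT lt.
    by rewrite -[ltRHS]/(y (ratr r) - x (ratr r)) E// subrr ltxx.
  have hr (r : rat) (rT : 0 <= (ratr r : R) <= T) : C (ratr r) w = C' (ratr r) w.
    exact: (hq _ _ (pickleK r) rT).
  apply/eqP; rewrite eq_le (half _ _ c' c) ?(half _ _ c c')// => r rT; first by rewrite hr.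
have dE : {ae P, forall w, forall t, 0 <= t <= T ->
    drifted N (fun t w => H t w - H' t w) (fun t w => I t w - I' t w) t w = 0}.
  apply: filterS3 (filterI CCt (filterI eq eq')) (filterI (ito_at0 hI) (ito_at0 hI'))
    (filterI (ito_path (tilting_ito ts)) (filterI (ito_path hI) (ito_path hI'))).
  move=> w [cc [E E']] [I0 I0'] [pN [p p']] t tT.
  have lin (f u v i j u' v' i' j' u0 v0 : R) :
      f + (u - v) - (i - j) = f + (u' - v') - (i' - j') -> f + (u - u0) - (i - 0) = f + (u' - v0) - (i' - 0) ->
      u0 = 0 -> v0 = 0 -> j - j' - (v - v') = 0 by lra.
  rewrite /drifted (ipBl tT p p' pN).
  have h1 := cc t tT; rewrite (E t tT) (E' t tT) in h1.
  have h2 := cc 0 T00; rewrite (E 0 T00) (E' 0 T00) I0 I0' in h2.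
  by apply: (lin _ _ _ _ _ _ _ _ _ _ _ h1 h2); rewrite /ip rint0.
have hG := ito_sub hI hI'; set G := (fun t w => H t w - H' t w) in hG dE.
have st := stopping_cst TT.
have bd : {ae P, forall w, forall t, 0 <= t <= T -> drifted N G (fun t w => I t w - I' t w) t w <= 0}.
  by apply: filterS dE => w h t tT; rewrite h.
(* With [lam = 1] and [eps = 0]: the mean of [expR] of minus half the bracket is at least 1, so the
   bracket vanishes. *)
have := tilted_bracket_exp ts hG st ler01 bd.
rewrite mulr0 expR0 mul1r; set X := fun w => expR _ => ge1.
have V0 w : 0 <= qv (G ^~ w) T by exact: (@ip_ge0 R T).
have X1 w : X w <= 1.
  by rewrite -[leRHS]expR0 ler_expR oppr_le0 mulr_ge0// divr_ge0// sqr_ge0.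
have mX : measurable_fun setT X.
  apply: measurableT_comp => //; apply: measurableT_comp => //; apply: measurable_funM => //.
  exact: (bracket_meas hG st).
have iX : L1 Q X by apply: (@L1_bounded _ _ _ _ _ 1) => //; apply: aeW => w; rewrite ger0_norm ?expR_ge0.
have i1 := L1B (L1_cst Q 1) iX.
have z : Ex Q (fun w => 1 - X w) = 0.
  apply/eqP; rewrite eq_le Ex_ge0 ?andbT//; last by move=> w; rewrite subr_ge0.
  by rewrite (ExB (L1_cst Q 1) iX) Ex_cst subr_le0.
have : {ae P, forall w, 1 - X w = 0}.
  by apply/(tilted_ae ts); apply: (Ex_eq0 i1 _ z); apply: aeW => w; rewrite subr_ge0.
move=> Xe; split=> //; apply: filterS2 Xe (ito_path hG) => w Xw pG.
have ipz : qv (G ^~ w) T = 0.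
  move/eqP: Xw; rewrite subr_eq0 eq_sym -expR0 /X => /eqP/expR_inj/eqP.
  by rewrite oppr_eq0 mulf_eq0 => /orP[|/eqP//]; rewrite expr1n mul1r invr_eq0 pnatr_eq0.
have mG : measurable_fun `[0, T] (fun s => (dotv (G s w) (G s w))%:E).
  by apply/measurable_EFinP; apply: measurable_dotv; exact: pG.1.
have : ae_eq (@lebesgue_measure R) `[0, T]%classic (fun s => (dotv (G s w) (G s w))%:E) (cst 0%E).
  apply: (ae_eq_integral_abs (@lebesgue_measure R) (measurable_itv `[0, T]) mG).1.
  rewrite -[RHS](_ : (qv (G ^~ w) T)%:E = 0%E); last by rewrite ipz.
  by rewrite -(ip_EFin pG); apply: eq_integral => s _; rewrite enormK/= ger0_norm ?dotv_ge0.
apply: filterS => s h sT; have : (dotv (G s w) (G s w))%:E = 0%E by apply: h; rewrite /= in_itv.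
by move=> -[/dotv_eq0/eqP]; rewrite subr_eq0 => /eqP.
Qed.

End uniqueness.

(** * The market *)

Section market.
Context {d : nat}.
Variables (b : R -> Omega -> 'cV[R]_d) (sigma : R -> Omega -> 'M[R]_(d, m)).
Variable C : set 'cV[R]_d.
Local Notation th := (theta b sigma).
Local Notation Kt := (sigmaC sigma C).
Local Notation tilt := (tilt b sigma C).
Local Notation driver := (driver b sigma C).

Record market_setting : Prop := MarketSetting {
  market_sigma : prdmx sigma;
  market_theta : prdmx th;
  market_bounded : bounded_mx T th;
  market_unit : forall t w, 0 <= t <= T -> sigma t w *m (sigma t w)^T \in unitmx;
  market_cone : closed_convex_cone C;
  market_cone0 : C 0 }.

Variable ms : market_setting.
Let hs := market_unit ms.
Let hC := market_cone ms.
Let C0 := market_cone0 ms.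
Let pth := market_theta ms.

Implicit Types (Z : R -> Omega -> 'cV[R]_m) (z h : 'cV[R]_m).

Lemma sigmaC_cone t w : 0 <= t <= T -> approx_closed_cone (Kt t w).
Proof. by move=> tT; apply: image_approx_closed_cone => //; exact: hs. Qed.

(** The optimal strategy without claim at risk aversion 1, seen as a point of [sigma^T C]; at risk
    aversion [alpha] it is divided by [alpha]. *)
Definition hedge Z t w : 'cV[R]_m := proj_set (Kt t w) (Z t w + th t w).

Lemma hedge_in Z t w : 0 <= t <= T -> Kt t w (hedge Z t w).
Proof. by move=> tT; exact: (proj_setP (sigmaC_cone w tT) _).1. Qed.

Lemma hedgeE Z t w : hedge Z t w = Z t w - tilt Z t w.
Proof. by rewrite /tilt opprB addrC subrK. Qed.

Let tiltE Z t w : tilt Z t w + th t w = Z t w + th t w - hedge Z t w.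
Proof. by rewrite /Defs.tilt addrAC. Qed.

Lemma tilt_polar Z t w h : 0 <= t <= T -> Kt t w h -> dotv (tilt Z t w + th t w) h <= 0.
Proof. by move=> tT; rewrite tiltE; exact: (proj_polar (sigmaC_cone w tT)). Qed.

Lemma tilt_orthogonal Z t w : 0 <= t <= T -> dotv (tilt Z t w + th t w) (hedge Z t w) = 0.
Proof. by move=> tT; rewrite tiltE; exact: (proj_orthogonal (sigmaC_cone w tT)). Qed.

(** The distance to the cone is at most that to its point [h], and expanding the square cancels the
    terms in [theta]. With [h = 0] it bounds the driver by [a / 2 * |z| ^+ 2]. *)
Lemma driver_le (a : R) t w z h : 0 < a -> 0 <= t <= T -> Kt t w h ->
  driver a t w z <= a / 2 * dotv (z - h) (z - h) - dotv h (th t w).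
Proof.
move=> a0 tT Kh; rewrite /Defs.driver enormK.
have le : dist_set (Kt t w) (z + a^-1 *: th t w) ^+ 2 <=
    dotv (z - h + a^-1 *: th t w) (z - h + a^-1 *: th t w).
  rewrite addrAC -enormK ler_pXn2r ?nnegrE ?enorm_ge0 ?dist_set_le//.
  exact: dist_set_ge0 Kh.
have a20 : 0 <= a / 2 by rewrite divr_ge0 ?ltW.
have := ler_wpM2l a20 le.
rewrite !(dotvDl _ (a^-1 *: _)) !(dotvDr _ (a^-1 *: _)) !dotvZl !dotvZr (dotvC (th t w) (z - h)) (dotvBl z h (th t w)).
have ai : a * a^-1 = 1 by rewrite divff ?gt_eqF.
have -> : (2 * a)^-1 = a^-1 / 2 by rewrite invfM mulrC.
move: (dotv (z - h) (z - h)) (dotv z (th t w)) (dotv h (th t w)) (dotv (th t w) (th t w)) => x y v u.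
move: (dist_set _ _ ^+ 2) => q; move: (a^-1) ai => c ac.
have -> : a / 2 * (x + c * (y - v) + (c * (y - v) + c * (c * u))) = a / 2 * x + (a * c) * (y - v) + (a * c) * c / 2 * u by field.
by rewrite ac; lra.
Qed.

(** The supporting affine function of [driver a] at [a^-1 *: Z]; its slope is [tilt Z]. *)
Definition drift_base (a : R) (Z : R -> Omega -> 'cV[R]_m) t w z : R :=
  a^-1 * (dotv (tilt Z t w) (tilt Z t w) / 2 - dotv (hedge Z t w) (th t w)) +
  dotv (z - a^-1 *: Z t w) (tilt Z t w).

(** By homogeneity the distance is computed at [a *: (z + a^-1 *: theta) = (Z + theta) + a *: k]
    with [k = z - a^-1 *: Z], and [dist_set_sqr] applies at [Z + theta]. Its remainder, the squared
    norm of [a *: k], becomes [a / 2] times that of [k]. *)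
Lemma driver_taylor (a : R) t w z Z : 0 < a -> 0 <= t <= T ->
  drift_base a Z t w z <= driver a t w z <=
  drift_base a Z t w z + a / 2 * dotv (z - a^-1 *: Z t w) (z - a^-1 *: Z t w).
Proof.
move=> a0 tT; have hK := sigmaC_cone w tT.
have aN : a != 0 by rewrite gt_eqF.
pose k := z - a^-1 *: Z t w.
have zE : a *: (z + a^-1 *: th t w) = (Z t w + th t w) + a *: k.
  rewrite /k scalerDr scalerBr !scalerA divff// !scale1r [RHS]addrC addrA.
  by rewrite -[in RHS](addrA _ _ (Z t w)) addNr addr0.
have := dist_set_sqr (Z t w + th t w) (a *: k) hK; rewrite -zE dist_set_scale// -/(hedge Z t w) -tiltE.
rewrite !(dotvDl (tilt Z t w)) !(dotvDr (tilt Z t w)) !dotvZl !dotvZr (dotvC (th t w) (tilt Z t w)).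
rewrite /Defs.driver /drift_base -/k enormK hedgeE dotvBl (dotvC k).
have -> : dotv z (th t w) = dotv (th t w) k + a^-1 * dotv (Z t w) (th t w).
  by rewrite (dotvC _ k) /k dotvBl dotvZl subrK.
have -> : (2 * a)^-1 = a^-1 / 2 by rewrite invfM mulrC.
have ac : a * a^-1 = 1 by rewrite divff.
move: (dist_set _ _ ^+ 2) (dotv (tilt Z t w) (tilt Z t w)) (dotv (tilt Z t w) (th t w)) (dotv (th t w) (th t w)) (dotv (tilt Z t w) k) (dotv (th t w) k) (dotv (Z t w) (th t w)) (dotv k k) => D x y u v s r q /andP[h1 h2].
have ai : 0 <= a^-1 / 2 by rewrite divr_ge0// invr_ge0 ltW.
have {h1} := ler_wpM2l ai h1; have {h2} := ler_wpM2l ai h2.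
have -> : a^-1 / 2 * (a ^+ 2 * D) = a / 2 * D by field.
have -> : a^-1 / 2 * (x + y + (y + u) + 2 * (a * v + a * s) + a * (a * q)) = a^-1 / 2 * (x + u) + a^-1 * y + v + s + a / 2 * q by field.
have -> : a^-1 / 2 * (x + y + (y + u) + 2 * (a * v + a * s)) = a^-1 / 2 * (x + u) + a^-1 * y + v + s by field.
by move: (a^-1) => c; rewrite !mulrBr !mulrDr; lra.
Qed.

Lemma driver1 t w Z : 0 <= t <= T ->
  driver 1 t w (Z t w) = dotv (tilt Z t w) (tilt Z t w) / 2 - dotv (hedge Z t w) (th t w).
Proof.
move=> tT; have := driver_taylor w (Z t w) Z ltr01 tT.
rewrite /drift_base invr1 scale1r subrr !dotv0l mul1r mulr0 !addr0.
by move=> h; apply/eqP; rewrite eq_le andbC.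
Qed.

(** The squared distance is an infimum over the images of the countable family [rational_point],
    hence a limit of running minima of predictable processes. *)
Lemma predictable_dist (S : R -> Omega -> 'cV[R]_m) : prdmx sigma -> prdmx S ->
  prd (fun t w => dist_set (Kt t w) (S t w) ^+ 2).
Proof.
move=> ps pS.
pose c i := if unpickle i is Some qn then rational_point C qn else 0.
have Cc i : C (c i) by rewrite /c; case: unpickle => // qn; exact: rational_point_in.
pose g i t w := dotv (S t w - (sigma t w)^T *m c i) (S t w - (sigma t w)^T *m c i).
have pg i : prd (g i).
  have h : prdmx (fun t w => S t w - (sigma t w)^T *m c i).
    move=> k j; apply: (@predictable_ext (fun t w => S t w k j - \sum_l sigma t w l k * c i l j)).
      by move=> t w _; rewrite !mxE; congr (_ - _); apply: eq_bigr => l _; rewrite mxE.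
    apply: (predictableB) => //; apply: (predictable_sum) => l.
    by apply: (predictableM) => //; exact: (predictable_cst).
  exact: (predictable_dotv).
apply: (@predictable_lim (fun n t w => running_min (fun i => g i t w) n)).
  elim=> [|n ih] /=; first exact: pg.
  apply: (@predictable_ext (fun t w => running_min (fun i => g i t w) n + Num.min 0 (g n.+1 t w - running_min (fun i => g i t w) n))).
    by move=> t w _; rewrite addr_minr addr0 addrC subrK.
  apply: (predictableD) => //.
  apply: (@predictable_comp (fun x => Num.min 0 x)).
    by apply: measurable_minr.
  exact: (predictableB).
move=> t w tT; apply: running_min_cvg => [i|e e0].
  have Kc : Kt t w ((sigma t w)^T *m c i) by exists (c i).
  by rewrite /g -enormK ler_pXn2r ?nnegrE ?enorm_ge0 ?(dist_set_le _ Kc) ?(dist_set_ge0 _ Kc).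
have [qn hq] := dist_set_image_dense (S t w) hC C0 (hs w tT) e0.
by exists (pickle qn); rewrite /g /c pickleK.
Qed.

Lemma predictable_driver (a : R) Z : prdmx Z ->
  prd (fun t w => driver a t w (Z t w)).
Proof.
move=> pZ; have ps := market_sigma ms.
have pS : prdmx (fun t w => Z t w + a^-1 *: th t w).
  move=> i j; apply: (@predictable_ext (fun t w => Z t w i j + a^-1 * th t w i j)).
    by move=> t w _; rewrite !mxE.
  apply: (predictableD) => //; apply: (predictableM) => //; exact: (predictable_cst).
apply: (@predictable_ext (fun t w => a / 2 * dist_set (Kt t w) (Z t w + a^-1 *: th t w) ^+ 2 - dotv (Z t w) (th t w) - (2 * a)^-1 * dotv (th t w) (th t w))).
  by move=> t w _; rewrite /Defs.driver enormK.
have pc (x : R) X : prd X -> prd (fun t w => x * X t w).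
  by move=> pX; apply: (predictableM) => //; exact: (predictable_cst).
apply: (predictableB); last by apply: pc; exact: (predictable_dotv).
apply: (predictableB); last exact: (predictable_dotv).
by apply: pc; exact: predictable_dist.
Qed.

Lemma theta_bounded : exists K, forall t w, 0 <= t <= T -> dotv (th t w) (th t w) <= K.
Proof.
have [K hK] := market_bounded ms; exists (\sum_(i < m) `|K| ^+ 2) => t w tT.
rewrite dotvE; apply: ler_sum => i _; rewrite -expr2 -real_normK ?num_real//.
by rewrite lerXn2r ?nnegrE//; apply: le_trans (hK t w i 0 tT) (ler_norm _).
Qed.

Lemma theta_pathL2 w : pathL2 T (th ^~ w).
Proof.
have [K hK] := theta_bounded; apply: (@pathL2_bounded _ _ _ _ K) => [i|s hs']; last exact: hK.
exact: (predictable_section w (pth i 0)).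
Qed.

Lemma theta_bracket : exists K, {ae P, forall w, qv (fun t => - th t w) T <= K}.
Proof.
have [K hK] := theta_bounded; exists (K * T).
apply: aeW => w; have p := theta_pathL2 w; have pN := pathL2N p.
rewrite (ipNl TT p pN) ipC (ipNl TT p p) opprK -(rint_cst K T0).
by apply: (rint_le TT (proj2 p) (path_integrable_cst T K)) => s sT; exact: hK.
Qed.

Lemma Kt0 t w : Kt t w 0.
Proof. by exists 0; rewrite ?mulmx0. Qed.

Lemma driver_integrable (a : R) (Z : R -> Omega -> 'cV[R]_m) w : 0 < a -> prdmx Z ->
  pathL2 T (Z ^~ w) -> path_integrable T (fun s => driver a s w (Z s w)).
Proof.
move=> a0 pZ hZ; have pth' := theta_pathL2 w.
apply: (@path_integrable_le _ _ _ (fun s => (a / 2 + 1) * dotv (Z s w) (Z s w) + (1 + (2 * a)^-1) * dotv (th s w) (th s w))).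
- have pd := predictable_driver a pZ.
  exact: (predictable_section w pd).
- move=> s sT; have h1 := driver_le (Z s w) a0 sT (Kt0 s w).
  have h2 := dotv_young (Z s w) (th s w) ltr01.
  have h3 := dotv_ge0 (Z s w); have h4 := dotv_ge0 (th s w).
  have ai : 0 < (2 * a)^-1 by rewrite invr_gt0 mulr_gt0.
  have h6 : 0 <= a / 2 * dotv (Z s w) (Z s w) by apply: mulr_ge0 => //; rewrite divr_ge0 ?ltW.
  have h7 : 0 <= (2 * a)^-1 * dotv (th s w) (th s w) by apply: mulr_ge0 => //; exact: ltW.
  rewrite subr0 dotv0l subr0 in h1.
  have h5 : - dotv (Z s w) (th s w) - (2 * a)^-1 * dotv (th s w) (th s w) <= driver a s w (Z s w).
    rewrite /Defs.driver enormK lerD2r lerDr mulr_ge0 ?sqr_ge0// divr_ge0// ltW//.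
  rewrite invr1 !mul1r in h2; have h8 := ler_norm (dotv (Z s w) (th s w)).
  have h9 := ler_norm (- dotv (Z s w) (th s w)); rewrite normrN in h9.
  by rewrite ler_norml; apply/andP; split; rewrite mulrDl mulrDl !mul1r; lra.
- by have [_ i1] := hZ; have [_ i2] := pth'; apply: path_integrableD; exact: path_integrableZ.
Qed.

(** A form of [utility_bsde] with the integral named, the equation written forward from time 0, and
    exponential moments at stopping times, where measurability is available, in place of path
    suprema. *)
Record solves (a : R) (G : Omega -> R) (Y : R -> Omega -> R) (Z : R -> Omega -> 'cV[R]_m)
    (I : R -> Omega -> R) : Prop := Solves {
  sol_ito : ito Z I;
  sol_predictable : prd Y;
  sol_cont : aecont Y;
  sol_eq : {ae P, forall w, forall t, 0 <= t <= T ->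
    Y t w = Y 0 w + I t w - rint (fun s => driver a s w (Z s w)) t};
  sol_end : {ae P, forall w, Y T w = G w};
  sol_lb : exists c, {ae P, forall w, forall t, 0 <= t <= T -> - c <= Y t w};
  sol_exp : forall p : R, 1 <= p -> exists M, forall tau, stop tau ->
    L1 P (fun w => expR (p * a * Num.max (Y (tau w) w) 0)) /\
    Ex P (fun w => expR (p * a * Num.max (Y (tau w) w) 0)) <= M }.

Lemma predictable_adapted Y : prd Y -> adapted Y.
Proof. by move=> pY t tT; exact: (predictable_mat). Qed.

Lemma utility_solves a G Y Z : 0 < a -> utility_bsde P T B b sigma C a G Y Z ->
  exists I, solves a G Y Z I.
Proof.
move=> a0 [[pY cY [I hI eqY]] expY _ lbY]; exists I; have hI' := ito_of hI.
have iD : {ae P, forall w, path_integrable T (fun s => driver a s w (Z s w))}.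
  apply: filterS (ito_path hI') => w; apply: driver_integrable => //; exact: (ito_prd hI').
have eq2 : {ae P, forall w, forall t, 0 <= t <= T -> Y t w = G w +
    (rint (fun s => driver a s w (Z s w)) T - rint (fun s => driver a s w (Z s w)) t) - (I T w - I t w)}.
  apply: filterS2 iD eqY => w iw h t tT; have /andP[t0 tT'] := tT.
  by rewrite h// (rint_incr_cc t0 tT' (lexx T) iw).
split=> //.
- apply: filterS2 eq2 (ito_at0 hI') => w h I0 t tT.
  by rewrite (h t tT) (h 0 T00) rint0 I0; ring.
- by apply: filterS eq2 => w h; rewrite (h T TT); ring.
- have [c hc] := lbY; exists c; apply: filterS hc => w h t tT; have := h t tT.
  by rewrite ge_max => /andP[+ _]; rewrite lerNl.
move=> p p1; have := expY p p1; set S := (\int[P]_w _)%E => Sfin.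
have S0 : (0 <= S)%E.
  apply: integral_ge0 => w _; apply: (@le_trans _ _ (expR (p * a * Num.max (Y 0 w) 0))%:E).
    by rewrite lee_fin expR_ge0.
  by apply: ereal_sup_ubound; exists 0 => //; rewrite /= in_itv/= T0 lexx.
have Sf : S \is a fin_num by rewrite ge0_fin_numE.
exists (fine S) => tau htau.
have mX : measurable_fun setT (fun w => expR (p * a * Num.max (Y (tau w) w) 0)).
  apply: measurableT_comp => //; apply: measurable_funM => //; apply: measurable_maxr => //.
  exact: (stopped_meas (predictable_adapted pY) cY htau).
have le : (\int[P]_w (expR (p * a * Num.max (Y (tau w) w) 0))%:E <= S)%E.
  apply: integral_le_nonmeasurable => w; first by rewrite lee_fin expR_ge0.
  by apply: ereal_sup_ubound; exists (tau w) => //; rewrite /= in_itv/=; exact: (stopping_itv w htau).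
have iX : L1 P (fun w => expR (p * a * Num.max (Y (tau w) w) 0)).
  apply/integrableP; split; first exact/measurable_EFinP.
  under eq_integral => w _ do rewrite gee0_abs ?lee_fin ?expR_ge0//.
  exact: le_lt_trans le Sfin.
by split=> //; rewrite -lee_fin (EFin_Ex iX) fineK.
Qed.

(** * The solution without claim *)

Section base.
Variables (Y : R -> Omega -> R) (Z : R -> Omega -> 'cV[R]_m) (I J : R -> Omega -> R).
Hypothesis hY : solves 1 (fun=> 0) Y Z I.
Hypothesis hJ : ito (tilt Z) J.
Let tl := tilt Z.
Let hd := hedge Z.
Let hI := sol_ito hY.

Definition log_density t w : R := J t w - qv (tl ^~ w) t / 2.
Definition hedge_ito t w : R := I t w - J t w.
Definition hedge_wealth t w : R := drifted tl hd hedge_ito t w.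

Lemma hedge_itoP : ito hd hedge_ito.
Proof.
apply: (ito_ext (H := fun t w => Z t w - tl t w) (I := hedge_ito)).
- by move=> t w tT; rewrite /hd hedgeE.
- by apply: aeW.
- exact: (ito_sub hI hJ).
Qed.

Lemma tilt_path : {ae P, forall w, pathL2 T (tl ^~ w)}.
Proof. exact: ito_path hJ. Qed.

Lemma hedge_path : {ae P, forall w, pathL2 T (hd ^~ w)}.
Proof. exact: ito_path hedge_itoP. Qed.

Lemma hedge_theta_ip w t : 0 <= t <= T -> pathL2 T (tl ^~ w) -> pathL2 T (hd ^~ w) ->
  ip (hd ^~ w) (th ^~ w) t = - ip (hd ^~ w) (tl ^~ w) t.
Proof.
move=> tt p1 p2; have /andP[t0 tT] := tt.
apply/eqP; rewrite -addr_eq0 -(ipDr tt (theta_pathL2 w) p1 p2); apply/eqP.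
rewrite /ip (@rint_ext _ T _ (fun=> 0)) ?rint_cst ?mul0r// => s sT.
by rewrite dotvC addrC; exact: (tilt_orthogonal Z w sT).
Qed.

Lemma driver_rint w t : 0 <= t <= T -> pathL2 T (tl ^~ w) -> pathL2 T (hd ^~ w) ->
  rint (fun s => driver 1 s w (Z s w)) t = qv (tl ^~ w) t / 2 + ip (hd ^~ w) (tl ^~ w) t.
Proof.
move=> tt p1 p2; have /andP[t0 tT] := tt.
rewrite (@rint_ext _ T _ (fun s => 2^-1 * dotv (tl s w) (tl s w) - dotv (hd s w) (th s w)))//; last first.
  by move=> s sT; rewrite (driver1 w Z sT) mulrC.
have [_ i1] := p1; have i2 := pathL2_dot p2 (theta_pathL2 w).
rewrite (rintB tt (path_integrableZ 2^-1 i1) i2) (rintZ _ tt i1).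
by rewrite mulrC -[rint _ t in X in _ - X]/(ip (hd ^~ w) (th ^~ w) t) (hedge_theta_ip tt p1 p2) opprK.
Qed.

(** At [T], where [Y] vanishes, [expR] of minus the hedge wealth equals [expR (Y 0)] times the
    density of the tilted measure. This is the duality between optimal strategy and optimal
    measure. *)
Lemma base_decomposition : {ae P, forall w, forall t, 0 <= t <= T ->
  Y t w = Y 0 w + log_density t w + hedge_wealth t w}.
Proof.
near=> w => t tT.
have p1 : pathL2 T (tl ^~ w) by near: w; exact: tilt_path.
have p2 : pathL2 T (hd ^~ w) by near: w; exact: hedge_path.
have -> : Y t w = Y 0 w + I t w - rint (fun s => driver 1 s w (Z s w)) t.
  by move: t tT; near: w; exact: (sol_eq hY).
rewrite (driver_rint tT p1 p2) /log_density /hedge_wealth /drifted /hedge_ito.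
by move: (ip _ _ _) (ip _ _ _) => x y; ring.
Unshelve. all: end_near.
Qed.

(** The hypothesis [YE] of the reverse Hoelder inequality, with [G = Z]. *)
Lemma base_drifted : {ae P, forall w, forall t, 0 <= t <= T ->
  drifted tl Z I t w = Y t w - Y 0 w - qv (tl ^~ w) t / 2}.
Proof.
near=> w => t tT.
have p1 : pathL2 T (tl ^~ w) by near: w; exact: tilt_path.
have p2 : pathL2 T (hd ^~ w) by near: w; exact: hedge_path.
have -> : Y t w = Y 0 w + I t w - rint (fun s => driver 1 s w (Z s w)) t.
  by move: t tT; near: w; exact: (sol_eq hY).
rewrite (driver_rint tT p1 p2) /drifted.
have -> : ip (Z ^~ w) (tl ^~ w) t = ip (hd ^~ w) (tl ^~ w) t + qv (tl ^~ w) t.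
  rewrite -(ipDl tT p2 p1 p1); congr (ip _ _ _); apply/funext => s.
  by rewrite /hd hedgeE subrK.
by move: (ip _ _ _) (ip _ _ _) => x y; lra.
Unshelve. all: end_near.
Qed.

(** The strategy 0 bounds the driver by [|z| ^+ 2 / 2], so the mean of [expR (Y T - Y s)] is at
    least 1 for [s] the first time that [Y] reaches 1. As [Y T = 0], this variable is below 1
    wherever the level is reached, which therefore happens with probability 0. *)
Lemma base_upper : {ae P, forall w, forall t, 0 <= t <= T -> Y t w <= 1}.
Proof.
have e4 : 2 * (1 + 1) / 1 = 4 * 1 :> R by lra.
have aY := predictable_adapted (sol_predictable hY); have cY := sol_cont hY.
have pZ := ito_prd hI; have hZ := ito_path hI.
have [c hc] := sol_lb hY.
pose sigma0 w := hitting T 1 (Y ^~ w).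
have ss : stop sigma0 by exact: (stopping_hitting).
pose X t w := qv (Z ^~ w) t.
have lX : localizing X (fun n w => hitting T n%:R (X ^~ w)).
  apply: (localizing_hitting (adapted_ip pZ pZ) (aecont_ip hZ hZ)).
  by apply: aeW => w; rewrite /X /ip rint0.
set rho := (fun n w => hitting T n%:R (X ^~ w)) in lX.
have [srho bX eX] := lX.
pose s' n w := Num.min (sigma0 w) (rho n w).
have ss' n : stop (s' n) by exact: (stopping_min ss (srho n)).
have sr n w : s' n w <= rho n w by rewrite ge_min lexx orbT.
have sT w : 0 <= sigma0 w <= T by exact: (stopping_itv w ss).
have rT n w : 0 <= rho n w <= T by exact: (stopping_itv w (srho n)).
have s'T n w : 0 <= s' n w <= T by exact: (stopping_itv w (ss' n)).
have b1 n : {ae P, forall w, X (rho n w) w <= n%:R}.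
  by apply: filterS bX => w h; apply: h; have /andP[-> _] := rT n w; rewrite lexx.
have b2 n : {ae P, forall w, X (s' n w) w <= n%:R}.
  by apply: filterS bX => w h; apply: h; have /andP[-> _] := s'T n w; rewrite sr.
(* [girsanov_exp] with both integrands equal to [Z] and [c = -1] yields the stochastic exponential
   between [s' n] and [rho n]. *)
pose E n w := doleans Z I (rho n w) w * expR (-1 * drifted Z Z I (s' n w) w - (-1) ^+ 2 / 2 * X (s' n w) w).
have hE n : L1 P (E n) /\ Ex P (E n) = 1 by exact: (girsanov_exp hI hI (srho n) (ss' n) (sr n) (b1 n) (b2 n)).
have iD : {ae P, forall w, path_integrable T (fun s => driver 1 s w (Z s w))}.
  by apply: filterS hZ => w; apply: driver_integrable.
have leE n : {ae P, forall w, E n w <= expR (Y (rho n w) w - Y (s' n w) w)}.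
  apply: filterS3 iD hZ (sol_eq hY) => w iw pw eY; rewrite /E /doleans -expRD ler_expR.
  rewrite (eY _ (rT n w)) (eY _ (s'T n w)) /drifted -/(X (rho n w) w) -/(X (s' n w) w).
  set f := fun s => driver 1 s w (Z s w).
  have [_ iZ] := pw.
  have ig : path_integrable T (fun s => 2^-1 * dotv (Z s w) (Z s w) - f s).
    by apply: path_integrableB => //; exact: path_integrableZ.
  have /andP[s0 _] := s'T n w; have /andP[r0 r1] := rT n w.
  have := rint_nd s0 (sr n w) r1 ig; have iz := path_integrableZ 2^-1 iZ.
  rewrite (rintB (rT n w) iz iw) (rintB (s'T n w) iz iw) (rintZ _ (rT n w) iZ) (rintZ _ (s'T n w) iZ).
  have g0 r : 0 <= r <= T -> 0 <= 2^-1 * dotv (Z r w) (Z r w) - f r.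
    move=> rr; have := driver_le (Z r w) ltr01 rr (Kt0 r w).
    by rewrite subr0 dotv0l subr0 mul1r subr_ge0.
  move=> /(_ g0); rewrite -!/(qv (Z ^~ w) _) -/(X (rho n w) w) -/(X (s' n w) w).
  move: (X (rho n w) w) (X (s' n w) w) (rint f (rho n w)) (rint f (s' n w)) => x y u v.
  rewrite sqrrN expr1n; lra.
have mY (tau : Omega -> R) : stop tau -> measurable_fun setT (fun w => Y (tau w) w).
  by move=> st; exact: (stopped_meas aY cY st).
have [M hM] := sol_exp hY (ler1n R 4).
pose X1 n w := expR (Y (rho n w) w - Y (s' n w) w).
pose Xl w := expR (Y T w - Y (sigma0 w) w).
have mX1 n : measurable_fun setT (X1 n).
  by apply: measurableT_comp => //; apply: measurable_funB; apply: mY.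
have mXl : measurable_fun setT Xl.
  by apply: measurableT_comp => //; apply: measurable_funB; apply: mY => //; exact: stopping_cst.
pose L0 (n : nat) (w : Omega) : R := 0.
have h1 n : L1 P (fun w => expR ((1 + 1) * L0 n w)) /\ Ex P (fun w => expR ((1 + 1) * L0 n w)) <= 2.
  rewrite (_ : (fun w => _) = fun=> 1); last by apply/funext => w; rewrite mulr0 expR0.
  by rewrite Ex_cst ler1n; split=> //; exact: L1_cst.
have h2 n : L1 P (fun w => expR (2 * (1 + 1) / 1 * Num.max (Y (rho n w) w) 0)) /\
    Ex P (fun w => expR (2 * (1 + 1) / 1 * Num.max (Y (rho n w) w) 0)) <= M.
  by rewrite e4; exact: hM.
have h3 n : {ae P, forall w, `|X1 n w| <= expR c * expR (Num.max (Y (rho n w) w) 0)}.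
  apply: filterS hc => w h; rewrite ger0_norm ?expR_ge0// -expRD ler_expR.
  have := h _ (s'T n w); have : Y (rho n w) w <= Num.max (Y (rho n w) w) 0 by rewrite le_max lexx.
  by move: (Num.max _ _) => u; lra.
have h4 : {ae P, forall w, expR (L0 n w) * X1 n w @[n --> \oo] --> Xl w}.
  apply: filterS eX => w h; apply: cvg_near_cst; apply: filterS h => n h.
  by rewrite /L0 expR0 mul1r /X1 /s' h min_l//; have /andP[] := sT w.
have [iY iX1 cE] := weighted_vitali ltr01 (expR_ge0 c) (fun n => measurable_cst (0 : R) : measurable_fun setT (L0 n)) mX1 mXl h1 h2 h3 h4.
have ge1 : 1 <= Ex P Xl.
  rewrite -(cvg_lim _ cE)//; apply: limr_ge; first by apply/cvg_ex; exists (Ex P Xl).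
  apply: nearW => n; rewrite -[leLHS](hE n).2; apply: Ex_le => //; first exact: (hE n).1.
  by apply: filterS (leE n) => w h; rewrite /L0 expR0 mul1r.
have hit : {ae P, forall w, Xl w <= 1 /\ (Xl w = 1 -> forall t, 0 <= t <= T -> Y t w <= 1)}.
  apply: filterS2 cY (sol_end hY) => w cw eT; rewrite /Xl eT.
  have [[t tT Yt]|h] := pselect (exists2 t, 0 <= t <= T & 1 <= Y t w).
    have k : 1 <= Y (sigma0 w) w by apply: (hitting_ge T0 cw); exists t.
    split; first by rewrite -expR0 ler_expR; lra.
    have lt : expR (0 - Y (sigma0 w) w) < 1 by rewrite -[ltRHS]expR0 ltr_expR; lra.
    by move=> e; move: lt; rewrite e ltxx.
  have lt t : 0 <= t <= T -> Y t w < 1.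
    by move=> tT; rewrite ltNge; apply/negP => k; apply: h; exists t.
  have -> : sigma0 w = T by exact: hitting_last.
  by rewrite eT subrr expR0; split=> // _ t tT; exact/ltW/lt.
have : {ae P, forall w, 1 - Xl w = 0}.
  have i1 : L1 P (fun w => 1 - Xl w) by apply: L1B => //; exact: L1_cst.
  apply: (Ex_eq0 i1); first by apply: filterS hit => w [h _]; rewrite subr_ge0.
  have i2 : 0 <= Ex P (fun w => 1 - Xl w).
    by apply: (Ex_ae_ge0 i1); apply: filterS hit => w [h _]; rewrite subr_ge0.
  apply/eqP; rewrite eq_le i2 andbT ExB ?Ex_cst//; last exact: L1_cst.
  by rewrite subr_le0.
by apply: filterS2 hit => w [_ h] /eqP; rewrite subr_eq0 eq_sym => /eqP/h.
Qed.

Lemma base_bounded : exists2 c, 0 < c & {ae P, forall w, forall t, 0 <= t <= T -> `|Y t w| <= c}.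
Proof.
have [c hc] := sol_lb hY; exists (Num.max c 1); first by rewrite lt_max ltr01 orbT.
apply: filterS2 hc base_upper => w h1 h2 t tT; rewrite ler_norml.
have := h1 t tT; have := h2 t tT; have : c <= Num.max c 1 by rewrite le_max lexx.
have : 1 <= Num.max c 1 by rewrite le_max lexx orbT.
by move: (Num.max c 1) => u; move=> *; apply/andP; split; lra.
Qed.

End base.

(** * Comparison with the solution without claim *)

Section comparison.
Variables (Y : R -> Omega -> R) (Z : R -> Omega -> 'cV[R]_m) (I J : R -> Omega -> R).
Hypothesis hY : solves 1 (fun=> 0) Y Z I.
Hypothesis hJ : ito (tilt Z) J.
Let tl := tilt Z.

Variables (a : R) (F : Omega -> R) (YF : R -> Omega -> R) (ZF : R -> Omega -> 'cV[R]_m) (IF : R -> Omega -> R).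
Hypotheses (a0 : 0 < a) (hF : solves a F YF ZF IF).

Definition gap t w : R := YF t w - a^-1 * Y t w.
Definition gap_integrand t w : 'cV[R]_m := ZF t w - a^-1 *: Z t w.
Definition gap_ito t w : R := IF t w - a^-1 * I t w.
Definition positive_part t w : R := a * Num.max (YF t w) 0.

Lemma gap_itoP : ito gap_integrand gap_ito.
Proof. exact: (ito_sub (sol_ito hF) (ito_scale a^-1 (sol_ito hY))). Qed.

Lemma positive_part_bounded : exp_bounded positive_part.
Proof.
move=> p p1; have [M hM] := sol_exp hF p1; exists M => tau st.
rewrite (_ : (fun w => _) = fun w => expR (p * a * Num.max (YF (tau w) w) 0)); first exact: hM.
by apply/funext => w; rewrite /positive_part mulrA.
Qed.

(** The density [g] is the driver for [a] at [ZF] minus its supporting affine function at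
    [a^-1 *: Z], whose constant part is [a^-1] times the driver for 1 at [Z]. *)
Lemma gap_drift : {ae P, forall w, exists g : R -> R, [/\ path_integrable T g,
  forall s, 0 <= s <= T -> 0 <= g s <= a / 2 * dotv (gap_integrand s w) (gap_integrand s w) &
  forall t, 0 <= t <= T -> gap t w = gap 0 w + drifted tl gap_integrand gap_ito t w - rint g t]}.
Proof.
have lin (x y u v r s q : R) : x + u - r - a^-1 * (y + v - s) = x - a^-1 * y + (u - a^-1 * v - q) - (r - a^-1 * s - q).
  ring.
apply: filterS2 (filterI (ito_path hJ) (ito_path gap_itoP)) (filterI (filterI (ito_path (sol_ito hY)) (ito_path (sol_ito hF))) (filterI (sol_eq hY) (sol_eq hF))).
move=> w [pt ph] [[pZ pZF] [eY eF]].
have i1 := driver_integrable a0 (ito_prd (sol_ito hF)) pZF.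
have i2 := driver_integrable ltr01 (ito_prd (sol_ito hY)) pZ.
have i3 := pathL2_dot ph pt; have i2' := path_integrableZ a^-1 i2.
exists (fun s => driver a s w (ZF s w) - a^-1 * driver 1 s w (Z s w) - dotv (gap_integrand s w) (tl s w)).
split.
- by apply: path_integrableB => //; exact: path_integrableB.
- move=> s sT; have := driver_taylor w (ZF s w) Z a0 sT.
  rewrite /drift_base (driver1 w Z sT) -/(gap_integrand s w).
  move: (driver _ _ _ _) (_ * dotv (gap_integrand s w) (gap_integrand s w)) (dotv _ _) (a^-1 * _) => x y z u.
  by move=> /andP[h1 h2]; apply/andP; split; lra.
- move=> t tT; rewrite (rintB tT (path_integrableB i1 i2') i3) (rintB tT i1 i2') (rintZ _ tT i2).
  rewrite /gap (eY t tT) (eF t tT) (eY 0 T00) (eF 0 T00) !rint0 /drifted /gap_ito /ip.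
  exact: lin.
Qed.

(** The constants [k1] and [k2] collect the lower bound of [YF] and the bound of [Y]; the positive
    part of [YF] is absorbed into the exponential by [1 + x <= expR x]. *)
Lemma gap_perturbed : exists k, perturbed tl gap_integrand gap_ito gap positive_part a k.
Proof.
have [cY cY0 hcY] := base_bounded hY; have [c hc] := sol_lb hF.
have ai : 0 < a^-1 by rewrite invr_gt0.
pose k1 := `|c| + a^-1 + a^-1 * cY; pose k2 := expR cY.
have k10 : 0 <= k1 by rewrite !addr_ge0// ?mulr_ge0// ltW.
have bd : {ae P, forall w, forall t, 0 <= t <= T -> - c <= YF t w /\ `|Y t w| <= cY}.
  by apply: filterS2 hc hcY => w h1 h2 t tT; split; [exact: h1|exact: h2].
exists (k1 + k2); split=> //.
- exact: gap_itoP.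
- exact: adaptedB (predictable_adapted (sol_predictable hF)) (adaptedZ _ (predictable_adapted (sol_predictable hY))).
- exact: aecontB (sol_cont hF) (aecontZ _ (sol_cont hY)).
- by rewrite addr_ge0// expR_ge0.
- exact: positive_part_bounded.
- apply: filterS bd => w h t tT; have [h1 h2] := h t tT.
  set U := positive_part t w; have U0 : 0 <= U by rewrite mulr_ge0 ?(ltW a0)// le_max lexx orbT.
  have e1 : 1 <= expR U by rewrite -expR0 ler_expR.
  have e2 : Num.max (YF t w) 0 <= a^-1 * expR U.
    rewrite -(ler_pM2l a0) mulrA mulfV ?gt_eqF// mul1r -/U.
    by apply: le_trans (expR_ge1Dx _); rewrite lerDr.
  have e3 : `|YF t w| <= `|c| + Num.max (YF t w) 0.
    have := ler_norm c; have := normr_ge0 c.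
    have : YF t w <= Num.max (YF t w) 0 by rewrite le_max lexx.
    have : 0 <= Num.max (YF t w) 0 by rewrite le_max lexx orbT.
    by move: (Num.max _ _) (`|c|) => *; rewrite ler_norml; apply/andP; split; lra.
  have e4 : `|gap t w| <= `|YF t w| + a^-1 * `|Y t w|.
    by apply: (le_trans (ler_normB _ _)); rewrite normrM (ger0_norm (ltW ai)).
  have e5 : a^-1 * `|Y t w| <= a^-1 * cY by rewrite ler_pM2l.
  have e6 : `|c| <= `|c| * expR U by rewrite ler_peMr.
  have e7 : a^-1 * cY <= a^-1 * cY * expR U by rewrite ler_peMr// mulr_ge0 ?ltW.
  have e8 : 0 <= k2 * expR U by rewrite mulr_ge0 ?expR_ge0.
  rewrite mulrDl /k1 !mulrDl; move: e2 e3 e4 e5 e6 e7 e8.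
  move: (Num.max _ _) (`|gap t w|) (`|YF t w|) (a^-1 * _) (a^-1 * cY) (a^-1 * expR U) => x1 x2 x3 x4 x5 x6.
  by move: (`|c|) (k2 * expR U) (x5 * expR U) (`|c| * expR U) => y1 y2 y3 y4; lra.
- apply: filterS bd => w h t tT; have [h1 h2] := h t tT.
  have e : a * gap t w <= cY + positive_part t w.
    rewrite /gap /positive_part mulrBr mulrA mulfV ?gt_eqF// mul1r.
    have : a * YF t w <= a * Num.max (YF t w) 0 by rewrite ler_pM2l// le_max lexx.
    by have := ler_norm (- Y t w); rewrite normrN; move: (a * _) (a * _) => x y; lra.
  apply: (@le_trans _ _ (k2 * expR (positive_part t w))); first by rewrite -expRD ler_expR.
  by rewrite ler_wpM2r ?expR_ge0// lerDr.
- apply: filterS gap_drift => w [g [ig g0 eg]] s t s0 st tT.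
  have sT : 0 <= s <= T by rewrite s0 (le_trans st).
  have tT' : 0 <= t <= T by rewrite (le_trans s0 st).
  have := rint_nd s0 st tT ig (fun r rT => (andP (g0 r rT)).1).
  rewrite (eg s sT) (eg t tT'); move: (drifted _ _ _ _ _) (drifted _ _ _ _ _) (gap 0 w) (rint _ _) (rint _ _) => *; lra.
- apply: filterS2 gap_drift (ito_path gap_itoP) => w [g [ig g0 eg]] ph t tT.
  have [_ ihh] := ph.
  have := rint_le tT ig (path_integrableZ (a / 2) ihh) (fun r rT => (andP (g0 r rT)).2).
  rewrite (rintZ _ tT ihh) (eg t tT) -[rint _ t in X in X -> _]/(rint _ t).
  rewrite /ip; move: (drifted _ _ _ _ _) (gap 0 w) (rint _ _) (_ * _) => *; lra.
Qed.

End comparison.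

(** * Wealth and prices *)

Section wealth.

Variables (x : R) (pi : R -> Omega -> 'cV[R]_d) (X : R -> Omega -> R).
Hypothesis hw : constrained_wealth P T B b sigma C x pi X.
Let H t w : 'cV[R]_m := (sigma t w)^T *m pi t w.

Lemma wealth_ito : exists2 IH, ito H IH & {ae P, forall w, forall t, 0 <= t <= T ->
  X t w = x + (IH t w + ip (H ^~ w) (th ^~ w) t)}.
Proof.
have [_ _ _ [IH hI eX]] := hw; exists IH => //; exact: ito_of.
Qed.

Lemma wealth_in t : 0 <= t <= T -> {ae P, forall w, Kt t w (H t w)}.
Proof.
by have [_ _ h _] := hw => tT; apply: filterS (h t tT) => w Cw; exists (pi t w).
Qed.

Lemma wealth_process : adapted X /\ aecont X.
Proof.
have [IH hI eX] := wealth_ito.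
pose Y t w := IH t w + ip (H ^~ w) (th ^~ w) t.
have aY : adapted Y by exact: adaptedD (adapted_ito hI) (adapted_ip (ito_prd hI) pth).
have pth' : {ae P, forall w, pathL2 T (th ^~ w)} by apply: aeW => w; exact: (theta_pathL2 w).
have cY : aecont Y by exact: aecontD (ito_continuous hI) (aecont_ip (ito_path hI) pth').
split=> [t tT|].
  have mX : measurable_at P B t (fun w => x + Y t w) by apply: matD; [exact: mat_cst|exact: aY].
  by apply: (mat_ae mX); apply: filterS eX => w ->.
apply: filterS2 eX cY => w E c.
apply: (within_continuous_ext (x := fun t => x + Y t w)) => [t tT|]; first by rewrite E.
by apply: within_continuousD => // t; exact: cvg_cst.
Qed.

Section tilted_wealth.
Variables (Z : R -> Omega -> 'cV[R]_m) (J IH : R -> Omega -> R).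
Hypotheses (hJ : ito (tilt Z) J) (hI : ito H IH).
Hypothesis eX : {ae P, forall w, forall t, 0 <= t <= T -> X t w = x + (IH t w + ip (H ^~ w) (th ^~ w) t)}.

(** On the constraint cone the inner product with [tilt + theta] is at most 0, so the drift of an
    admissible wealth under the tilted measure is nonpositive. *)
Lemma wealth_le : {ae P, forall w, forall t, 0 <= t <= T -> X t w <= x + drifted (tilt Z) H IH t w}.
Proof.
have pt := predictable_dotv (ito_prd hI) (ito_prd hJ); have pt' := predictable_dotv (ito_prd hI) pth.
pose g s w := dotv (H s w) (tilt Z s w) + dotv (H s w) (th s w).
have ig : {ae P, forall w, path_integrable T (g ^~ w)}.
  apply: filterS2 (ito_path hI) (ito_path hJ) => w p1 p2; apply: path_integrableD; first exact: pathL2_dot.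
  by apply: pathL2_dot => //; exact: (theta_pathL2 w).
have le : {ae P, forall w, forall t, 0 <= t <= T ->
    rint (g ^~ w) t <= 0}.
  apply: (ae_rint_le0 (g := g) _ _ ig) => [|t tT]; first exact: (predictableD pt pt').
  apply: filterS (wealth_in tT) => w k; rewrite /g; have := tilt_polar Z tT k.
  by rewrite dotvC dotvDr.
apply: filterS2 (filterI eX le) (filterI (ito_path hI) (ito_path hJ)) => w [E l] [p1 p2] t tT.
rewrite (E t tT) /drifted lerD2l lerD2l; have := l t tT.
rewrite (rintD tT (pathL2_dot p1 p2) (pathL2_dot p1 (theta_pathL2 w))) -!/(ip _ _ _).
by rewrite addrC -lerBrDr sub0r.
Qed.

(** The martingale optimality principle: by [driver_le], [expR (a * (YF - X))] dominates its initial
    value times the stochastic exponential of [a *: (ZF - H)]. *)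
Lemma wealth_drift_le (a : R) (F : Omega -> R) (YF : R -> Omega -> R) (ZF : R -> Omega -> 'cV[R]_m) (IF : R -> Omega -> R) :
  0 < a -> solves a F YF ZF IF ->
  {ae P, forall w, forall t, 0 <= t <= T ->
    YF 0 w - x + (IF t w - IH t w) - a / 2 * qv (fun s => ZF s w - H s w) t <= YF t w - X t w}.
Proof.
move=> a0 hF; have hZ := sol_ito hF.
have lin (y x' i h r u v : R) : r - a / 2 * u + v <= 0 ->
  y - x' + (i - h) - a / 2 * u <= y + i - r - (x' + (h + v)) by lra.
have pD := predictable_driver a (ito_prd hZ).
have pB := predictable_mxB (ito_prd hZ) (ito_prd hI).
have pQ := predictable_dotv pB pB; have pT := predictable_dotv (ito_prd hI) pth.
pose g s w := driver a s w (ZF s w) - a / 2 * dotv (ZF s w - H s w) (ZF s w - H s w) + dotv (H s w) (th s w).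
have pg : prd g.
  apply: predictableD => //; apply: predictableB => //; apply: predictableM => //.
  exact: (predictable_cst).
have ints : {ae P, forall w, [/\ path_integrable T (fun s => driver a s w (ZF s w)),
    path_integrable T (fun s => dotv (ZF s w - H s w) (ZF s w - H s w)) & path_integrable T (fun s => dotv (H s w) (th s w))]}.
  apply: filterS2 (ito_path hI) (ito_path hZ) => w p1 p2; split.
  - exact: (driver_integrable a0 (ito_prd hZ) p2).
  - by have [] := pathL2B p2 p1.
  - by apply: pathL2_dot => //; exact: (theta_pathL2 w).
have le : {ae P, forall w, forall t, 0 <= t <= T -> rint (g ^~ w) t <= 0}.
  apply: (ae_rint_le0 pg) => [t tT|].
    apply: filterS (wealth_in tT) => w k.
    by have := driver_le (ZF t w) a0 tT k; rewrite /g; move: (driver _ _ _ _) (_ * _) (dotv _ _) => *; lra.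
  apply: filterS ints => w [i1 i2 i3]; apply: path_integrableD => //.
  by apply: path_integrableB => //; exact: path_integrableZ.
apply: filterS2 (filterI eX le) (filterI ints (sol_eq hF)) => w [E l] [[i1 i2 i3] eF] t tT.
rewrite (E t tT) (eF t tT); apply: lin; have := l t tT.
have i2' := path_integrableZ (a / 2) i2.
by rewrite (rintD tT (path_integrableB i1 i2') i3) (rintB tT i1 i2') (rintZ _ tT i2).
Qed.

End tilted_wealth.

(** Up to the time when the bracket of [ZF - H] reaches [n], the dominated exponential has mean 1;
    the uniform integrability that defines the class carries the lower bound to [T]. *)
Lemma class_D_bound (a c : R) (F : Omega -> R) (YF : R -> Omega -> R) (ZF : R -> Omega -> 'cV[R]_m) (IF : R -> Omega -> R) :
  0 < a -> solves a F YF ZF IF ->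
  {ae P, forall w, YF 0 w = c} ->
  uniformly_integrable P [set (fun w => expR (- a * (X (tau w) w - YF (tau w) w))) | tau in stop] ->
  L1 P (fun w => expR (- a * (X T w - YF T w))) /\
  expR (a * (c - x)) <= Ex P (fun w => expR (- a * (X T w - YF T w))).
Proof.
move=> a0 hF Yc ui.
have lin (i h v y X' : R) : c - x + (i - h) - a / 2 * v <= y - X' ->
    a * (c - x) + (a * (i - h) - a ^+ 2 * v / 2) <= - a * (X' - y).
  by move=> k; have := ler_wpM2l (ltW a0) k; rewrite expr2; lra.
have hZ := sol_ito hF.
have [aX cX] := wealth_process; have [IH hI eX] := wealth_ito.
have hD := ito_sub hZ hI; set G := (fun t w => ZF t w - H t w) in hD.
set ID := (fun t w => IF t w - IH t w) in hD.
have le := wealth_drift_le hI eX a0 hF.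
pose V t w := qv (G ^~ w) t.
have locV : localizing V (fun n w => hitting T n%:R (V ^~ w)).
  apply: (localizing_hitting (adapted_ip (ito_prd hD) (ito_prd hD)) (aecont_ip (ito_path hD) (ito_path hD))).
  by apply: aeW => w; rewrite /V /ip rint0.
set rho := (fun n w => hitting T n%:R (V ^~ w)) in locV.
have [srho bV ev] := locV.
have rT n w : 0 <= rho n w <= T by exact: (stopping_itv w (srho n)).
have mE tau : stop tau -> measurable_fun setT (fun w => expR (- a * (X (tau w) w - YF (tau w) w))).
  move=> st; apply: measurableT_comp => //; apply: measurable_funM => //; apply: measurable_funB.
    exact: (stopped_meas aX cX st).
  exact: (stopped_meas (predictable_adapted (sol_predictable hF)) (sol_cont hF) st).
apply: (uniformly_integrable_ge (Xn := fun n w => expR (- a * (X (rho n w) w - YF (rho n w) w))) ui) => //.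
- by move=> n; exists (rho n).
- by exists (fun=> T) => //; exact: stopping_cst.
- by move=> n; exact: mE.
- by apply: mE; exact: stopping_cst.
- exact: (@stopped_continuous_cvg (fun t w => expR (- a * (X t w - YF t w))) rho (fun=> T) ev).
move=> n iXn.
have hs' := ito_scale a (ito_stop (srho n) hD).
have bE : {ae P, forall w, qv (fun t => a *: stopped (rho n w) (G ^~ w) t) T = a ^+ 2 * V (rho n w) w}.
  apply: filterS (ito_path hD) => w pN; have pS := pathL2_stopped (rho n w) pN.
  have /andP[t0 t1] := rT n w.
  rewrite (ipZl a TT pS (pathL2Z a pS)) (ipZr a TT pS pS) mulrA -expr2.
  by rewrite (ip_stopped2 t0 t0 TT pN pN) minxx min_l.
have hb : {ae P, forall w, qv (fun t => a *: stopped (rho n w) (G ^~ w) t) T <= a ^+ 2 * n%:R}.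
  apply: filterS2 bE bV => w -> k; rewrite ler_wpM2l ?sqr_ge0//.
  by apply: k; have /andP[-> _] := rT n w; rewrite lexx.
have [i1 e1] := ito_exp hs' hb.
rewrite -[leLHS]mulr1 -e1 -(ExZ _ i1); apply: (Ex_le (L1Z _ i1) iXn).
apply: filterS2 (filterI bE le) Yc => w [-> l] Y0; rewrite -expRD ler_expR.
have := l _ (rT n w); rewrite Y0 -/(V (rho n w) w); have /andP[_ r1] := rT n w.
rewrite (min_r r1) /ID; exact: lin.
Qed.

End wealth.

(** * Optimal hedge and martingale strategies *)

Section hedging.

Variables (Y : R -> Omega -> R) (Z : R -> Omega -> 'cV[R]_m) (I J : R -> Omega -> R).
Variables (e : R) (Q : probability Omega R).
Hypothesis hY : solves 1 (fun=> 0) Y Z I.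
Let tl := tilt Z.
Let hd := hedge Z.
Let hw := hedge_wealth Z I J.
Hypothesis ts : tilting tl J e Q.
Let hJ : ito tl J := tilting_ito ts.
Let hH : ito hd (hedge_ito I J) := hedge_itoP hY hJ.
Let L t w := J t w - qv (tl ^~ w) t / 2.
Let e0 : 0 < e := tilting_gt0 ts.
Let power tau : stop tau -> L1 P (fun w => expR ((1 + e) * L (tau w) w)) /\
  Ex P (fun w => expR ((1 + e) * L (tau w) w)) <= 2.
Proof. exact: tilting_power ts tau. Qed.
Let mL tau : stop tau -> measurable_fun setT (fun w => L (tau w) w) := @log_doleans_meas _ _ _ _ ts tau.

Lemma base_log : {ae P, forall w, forall t, 0 <= t <= T -> hw t w = Y t w - Y 0 w - L t w}.
Proof.
apply: filterS (base_decomposition hY hJ) => w E t tT.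
by rewrite (E t tT) /log_density -/(L t w) -/(hw t w); ring.
Qed.

Let A t w := qv (tl ^~ w) t + qv (hd ^~ w) t.

Definition hedge_stop (n : nat) w : R := hitting T n%:R (A ^~ w).
Let rho := hedge_stop.

Let locA : localizing A rho.
Proof.
apply: (localizing_hitting).
- exact: adaptedD (adapted_ip (ito_prd hJ) (ito_prd hJ)) (adapted_ip (ito_prd hH) (ito_prd hH)).
- exact: aecontD (aecont_ip (ito_path hJ) (ito_path hJ)) (aecont_ip (ito_path hH) (ito_path hH)).
- by apply: aeW => w; rewrite /A /ip !rint0 addr0.
Qed.

Lemma hedge_stopping n : stop (rho n). Proof. by case: locA. Qed.

Let srho := hedge_stopping.
Let rT n w : 0 <= rho n w <= T. Proof. exact: (stopping_itv w (srho n)). Qed.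

Lemma hedge_stop_eventually : {ae P, forall w, \forall n \near \oo, rho n w = T}.
Proof. by case: locA. Qed.

Let bound n : {ae P, forall w, qv (tl ^~ w) (rho n w) <= n%:R} /\
  {ae P, forall w, qv (hd ^~ w) (rho n w) <= n%:R}.
Proof.
have [_ bA _] := locA.
have h : {ae P, forall w, A (rho n w) w <= n%:R}.
  by apply: filterS bA => w; apply; have /andP[-> _] := rT n w; rewrite lexx.
split; apply: filterS h => w; apply: le_trans; rewrite /A ?lerDl ?lerDr.
  by apply: (@ip_ge0 R T); case/andP: (rT n w).
by apply: (@ip_ge0 R T); case/andP: (rT n w).
Qed.

Lemma hedge_stop_bracket n : {ae P, forall w, qv (hd ^~ w) (rho n w) <= n%:R}.
Proof. exact: (bound n).2. Qed.

Let mhw tau : stop tau -> measurable_fun setT (fun w => hw (tau w) w).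
Proof. by move=> st; exact: (drifted_meas hJ hH st). Qed.

(** Taken to the limit from stopped densities: the wealth is minus the log-density up to a bounded
    term, so density times wealth is dominated through [expR_linear_young]. *)
Lemma hedge_mean0 : L1 Q (fun w => hw T w) /\ Ex Q (fun w => hw T w) = 0.
Proof.
have [c cp hc] := base_bounded hY.
have bdE := expR_linear_young e0 cp.
pose Xn n w := expR (L (rho n w) w) * hw (rho n w) w.
pose Zn n w := expR ((1 + e) * L (rho n w) w).
have hX n : L1 P (Xn n) /\ Ex P (Xn n) = 0.
  exact: (drifted_mean0 hJ hH (srho n) (srho n) (fun w => lexx _) (bound n).1 (bound n).2).
have UI (k : R) : 0 < k -> exists K : R, forall n, {ae P, forall w, `|Xn n w| <= K + k * Zn n w}.
  move=> k0; have [K hK] := bdE k k0; exists K => n.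
  apply: filterS2 base_log hc => w E hcw; rewrite /Xn normrM ger0_norm ?expR_ge0//.
  apply: le_trans (hK _); apply: ler_wpM2l; first exact: expR_ge0.
  rewrite (E _ (rT n w)) (le_trans (ler_normB _ _))// lerD2r (le_trans (ler_normB _ _))//.
  by have := hcw _ (rT n w); have := hcw _ T00; lra.
have cX : {ae P, forall w, Xn n w @[n --> \oo] --> expR (L T w) * hw T w}.
  exact: (@stopped_continuous_cvg (fun t w => expR (L t w) * hw t w) rho (fun=> T) hedge_stop_eventually).
have mY : measurable_fun setT (fun w => expR (L T w) * hw T w).
  have st := stopping_cst TT.
  by apply: measurable_funM; [apply: measurableT_comp => //; exact: (mL st)|exact: (mhw st)].
have [iY iX cE] := vitali (fun n => L1_meas (hX n).1) mY cX (fun n => (power (srho n)).1)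
  (fun n w => expR_ge0 _) (fun n => (power (srho n)).2) UI.
have [iQ ->] := tilted_L1 ts iY (mhw (stopping_cst TT)); split=> //.
have := cvg_Ex iY iX cE; rewrite (funext (fun n => (hX n).2)) => h.
by rewrite -(cvg_lim _ h)// lim_cst.
Qed.

Section class_Q.
Variables (a x y0 : R) (pi : R -> Omega -> 'cV[R]_d) (X : R -> Omega -> R).
Variables (Jth : R -> Omega -> R) (eth : R) (Qth : probability Omega R).
Hypothesis a0 : 0 < a.
Hypothesis tth : tilting (fun t w => - th t w) Jth eth Qth.
Hypothesis hcw : constrained_wealth P T B b sigma C x pi X.
Hypothesis hM : martingale P T B Qth X.
Hypothesis iE : L1 P (fun w => expR (- a * X T w)).
Hypothesis Yy : {ae P, forall w, Y 0 w = y0}.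

Let aX : adapted X := (wealth_process hcw).1.
Let cX : aecont X := (wealth_process hcw).2.
(** Half of the risk aversion is given up to pass from [P] to [Qth] by an arithmetic-geometric mean;
    the further factor [2^-1] in [class_Q_negative_part] pays for the way back to [P]. *)
Let U t w := Num.max (- (a / 2) * X t w) 0.
Let Lth w := Jth T w - qv (fun t => - th t w) T / 2.

Let mU tau : stop tau -> measurable_fun setT (fun w => U (tau w) w).
Proof.
move=> st; apply: measurable_maxr => //; apply: measurable_funM => //.
exact: (stopped_meas aX cX st).
Qed.

Let Lth_power (c : R) : exists M : R, L1 P (fun w => expR (c * Lth w)) /\ Ex P (fun w => expR (c * Lth w)) <= M.
Proof.
have [K bd] := theta_bracket.
eexists; exact: (bounded_doleans_power (tilting_ito tth) bd c (stopping_cst TT)).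
Qed.

Let amgm (u v : R) : expR (u + v) <= 2^-1 * (expR (2 * u) + expR (2 * v)).
Proof. by apply: le_trans (expR_amgm _ _); rewrite ler_expR; lra. Qed.

Lemma class_Q_negative_part : exists M : R, forall tau, stop tau ->
  L1 P (fun w => expR (2^-1 * U (tau w) w)) /\ Ex P (fun w => expR (2^-1 * U (tau w) w)) <= M.
Proof.
have [M2 [i2 _]] := Lth_power 2; have [M1 [i1 E1]] := Lth_power (-1).
have mLth : measurable_fun setT Lth.
  have := L1_meas i1 => mm.
  exact: (log_doleans_meas tth (stopping_cst TT)).
have mexp (f : Omega -> R) : measurable_fun setT f -> measurable_fun setT (fun w => expR (f w)).
  by move=> mf; exact: measurableT_comp.
have mUT := mU (stopping_cst TT).
have i3 : L1 P (fun w => expR (2 * U T w)).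
  apply: (L1_le _ _ (L1D (L1_cst P 1) iE)); first by apply: mexp; exact: measurable_funM.
  apply: aeW => w; rewrite ger0_norm ?expR_ge0// /U; case: (lerP (- (a / 2) * X T w) 0) => h.
    by rewrite mulr0 expR0 lerDl expR_ge0.
  by rewrite (_ : 2 * _ = - a * X T w) ?lerDr//; lra.
have i4 : L1 P (fun w => expR (Lth w) * expR (U T w)).
  apply: (L1_le _ _ (L1Z 2^-1 (L1D i2 i3))); first by apply: measurable_funM; exact: mexp.
  by apply: aeW => w; rewrite -expRD ger0_norm ?expR_ge0// amgm.
have [iT _] := tilted_L1 tth i4 (mexp _ mUT).
have ac (S : set Omega) : {ae P, forall w, S w} -> {ae Qth, forall w, S w} by move=> h; exact/(tilted_ae tth).
have hst := martingale_exp_stopped hM cX ac iT.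
exists (2^-1 * (expR 1 * Ex Qth (fun w => expR (U T w)) + M1)) => tau st.
have [iq lq] := hst tau st.
have mt := mexp _ (mU st).
have ip' : L1 P (fun w => expR (Lth w) * expR (U (tau w) w)).
  by apply/(change_L1 mLth (tilting_density tth) mt).
have Eq := change_Ex mLth (tilting_density tth) ip' mt.
have le : {ae P, forall w, expR (2^-1 * U (tau w) w) <=
    2^-1 * (expR (Lth w) * expR (U (tau w) w) + expR (-1 * Lth w))}.
  apply: aeW => w; rewrite -expRD.
  have := amgm (2^-1 * (Lth w + U (tau w) w)) (2^-1 * (-1 * Lth w)).
  by rewrite !(mulrA 2) !mulfV ?pnatr_eq0// !mul1r (_ : _ + _ = 2^-1 * U (tau w) w)//; lra.
have iS := L1Z 2^-1 (L1D ip' i1).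
have iX : L1 P (fun w => expR (2^-1 * U (tau w) w)).
  apply: (L1_le _ _ iS); first by apply: mexp; apply: measurable_funM => //; exact: mU.
  by apply: filterS le => w h; rewrite ger0_norm ?expR_ge0.
split=> //; apply: (le_trans (Ex_le iX iS le)).
rewrite (ExZ _ (L1D ip' i1)) (ExD ip' i1); apply: ler_wpM2l; first by rewrite invr_ge0.
by apply: lerD E1; rewrite -Eq.
Qed.

(** At localised times the wealth lies below [x] plus a variable of mean 0. Only the losses have
    uniform exponential moments, so the limit is that of [fatou_upper]. *)
Lemma class_Q_mean : L1 Q (X T) /\ Ex Q (X T) <= x.
Proof.
have [M hM'] := class_Q_negative_part; have [IH hI eX] := wealth_ito hcw.
have wl := wealth_le hcw hJ hI eX.
set G := (fun t w => (sigma t w)^T *m pi t w) in hI wl.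
pose W t w := drifted tl G IH t w.
pose V t w := qv (tl ^~ w) t + qv (G ^~ w) t.
have locV : localizing V (fun n w => hitting T n%:R (V ^~ w)).
  apply: (localizing_hitting).
  - exact: adaptedD (adapted_ip (ito_prd hJ) (ito_prd hJ)) (adapted_ip (ito_prd hI) (ito_prd hI)).
  - exact: aecontD (aecont_ip (ito_path hJ) (ito_path hJ)) (aecont_ip (ito_path hI) (ito_path hI)).
  - by apply: aeW => w; rewrite /V /ip !rint0 addr0.
set s := (fun n w => hitting T n%:R (V ^~ w)) in locV.
have [ss bV ev] := locV.
have sT n w : 0 <= s n w <= T by exact: (stopping_itv w (ss n)).
have bd n : {ae P, forall w, qv (tl ^~ w) (s n w) <= n%:R} /\ {ae P, forall w, qv (G ^~ w) (s n w) <= n%:R}.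
  have h : {ae P, forall w, V (s n w) w <= n%:R}.
    by apply: filterS bV => w; apply; have /andP[-> _] := sT n w; rewrite lexx.
  split; apply: filterS h => w; apply: le_trans; rewrite /V ?lerDl ?lerDr.
    by apply: (@ip_ge0 R T); case/andP: (sT n w).
  by apply: (@ip_ge0 R T); case/andP: (sT n w).
have mW n := drifted_mean0 hJ hI (ss n) (ss n) (fun w => lexx _) (bd n).1 (bd n).2.
have mD n := doleans_mean1 hJ hJ (ss n) (ss n) (fun w => lexx _) (bd n).1 (bd n).1.
pose p := 2 * (1 + e) / e.
have p0 : 0 < p by rewrite divr_gt0 ?mulr_gt0 ?addr_gt0.
(* From [max (- X) 0 = 2 / a * U], [U = 2 * p * Un] and [Un <= expR Un]. *)
pose k := 2 / a * (2 * p).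
have k0 : 0 <= k by apply: mulr_ge0; [apply/ltW/divr_gt0|apply/ltW/mulr_gt0].
pose Un n w := 2^-1 * U (s n w) w / p.
have pU n w : p * Un n w = 2^-1 * U (s n w) w by rewrite /Un mulrC divfK// gt_eqF.
have neg n w : Num.max (- X (s n w) w) 0 <= k * expR (Un n w).
  have -> : Num.max (- X (s n w) w) 0 = 2 / a * U (s n w) w.
    rewrite /U; move: (X _ _) => u; have ai : 0 < 2 / a by rewrite divr_gt0.
    rewrite maxr_pMr ?ltW// mulr0; congr (Num.max _ _).
    by rewrite mulrA mulrN mulf_div mulrC (mulrC a) divff ?mulr1 ?mulrN1// mulf_neq0// gt_eqF.
  rewrite /k -(mulrA (2 / a)) ler_pM2l ?divr_gt0//.
  have -> : U (s n w) w = 2 * p * Un n w by rewrite -mulrA pU mulrA mulfV ?mul1r// pnatr_eq0.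
  apply: ler_wpM2l; first exact/ltW/mulr_gt0.
  by have := expR_ge1Dx (Un n w); lra.
have hU n : L1 P (fun w => expR (2 * (1 + e) / e * Un n w)) /\ Ex P (fun w => expR (2 * (1 + e) / e * Un n w)) <= M.
  rewrite (_ : (fun w => _) = fun w => expR (2^-1 * U (s n w) w)); first exact: hM'.
  by apply/funext => w; rewrite -/p pU.
have mX n : measurable_fun setT (fun w => X (s n w) w) := stopped_meas aX cX (ss n).
have [K K0 hK] := expR_add_young e0 ltr01.
have iX n : L1 P (fun w => expR (L (s n w) w) * X (s n w) w).
  have i1 : L1 P (fun w => k * (K + 1 * (expR ((1 + e) * L (s n w) w) + expR (2 * (1 + e) / e * Un n w)))).
    apply: L1Z; apply: L1D; first exact: L1_cst.
    by apply: L1Z; apply: L1D; [exact: (power (ss n)).1|exact: (hU n).1].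
  have i2 : L1 P (fun w => `|x * doleans tl J (s n w) w + doleans tl J (s n w) w * W (s n w) w|).
    by apply: L1_norm; apply: L1D; [apply: L1Z; exact: (mD n).1|exact: (mW n).1].
  apply: (L1_le _ _ (L1D i1 i2)).
    by apply: measurable_funM => //; apply: measurableT_comp => //; exact: (mL (ss n)).
  apply: filterS wl => w l; have := l _ (sT n w); rewrite -/(W _ _).
  rewrite normrM ger0_norm ?expR_ge0// mulrC => le1.
  have l0 := expR_ge0 (L (s n w) w).
  rewrite /doleans -/(L (s n w) w) (mulrC (expR _) (W _ _)) -mulrDl normrM (ger0_norm l0).
  have h1 : expR (L (s n w) w) * expR (Un n w) <= K + 1 * (expR ((1 + e) * L (s n w) w) + expR (2 * (1 + e) / e * Un n w)).
    by rewrite -expRD; exact: hK.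
  have h2 := ler_wpM2l k0 h1; apply: (le_trans _ (lerD h2 (lexx _))).
  rewrite mulrA (mulrAC k) -mulrDl; apply: ler_wpM2r => //.
  have h3 := neg n w; case: (lerP 0 (X (s n w) w)) => X0.
    rewrite ger0_norm//; apply: (le_trans le1); apply: (le_trans (ler_norm _)).
    by rewrite lerDr mulr_ge0 ?expR_ge0.
  rewrite ltr0_norm//; move: h3; rewrite ge_max => /andP[h3 _]; apply: (le_trans h3).
  by rewrite lerDl.
have EX n : Ex P (fun w => expR (L (s n w) w) * X (s n w) w) <= x.
  have i2 : L1 P (fun w => x * doleans tl J (s n w) w + doleans tl J (s n w) w * W (s n w) w).
    by apply: L1D; [apply: L1Z; exact: (mD n).1|exact: (mW n).1].
  apply: (le_trans (Ex_le (iX n) i2 _)).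
    apply: filterS wl => w l; have := ler_wpM2l (expR_ge0 (L (s n w) w)) (l _ (sT n w)).
    by rewrite mulrDr (mulrC _ x).
  rewrite (ExD (L1Z x (mD n).1) (mW n).1) (ExZ _ (mD n).1) (mD n).2 (mW n).2.
  by rewrite mulr1 addr0.
have mY : measurable_fun setT (fun w => expR (L T w) * X T w).
  have st := stopping_cst TT.
  apply: measurable_funM; first by apply: measurableT_comp => //; exact: (mL st).
  exact: (stopped_meas aX cX st).
have cvX : {ae P, forall w, expR (L (s n w) w) * X (s n w) w @[n --> \oo] --> expR (L T w) * X T w}.
  exact: (@stopped_continuous_cvg (fun t w => expR (L t w) * X t w) s (fun=> T) ev).
have [iY EY] := fatou_upper e0 k0 (fun n => mL (ss n)) mX mY (fun n => power (ss n)) hU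
  (fun n => aeW _ (neg n)) cvX iX EX.
have mXT : measurable_fun setT (X T) := stopped_meas aX cX (stopping_cst TT).
by have [iQ ->] := tilted_L1 ts iY mXT.
Qed.

(** [expR (- a * X T)] is the density of [Q] times [expR S], and [S] has mean at least [v] under
    [Q]; the tangent of exp at [v] replaces Jensen's inequality. *)
Lemma class_Q_utility : expR (y0 - a * x) <= Ex P (fun w => expR (- a * X T w)).
Proof.
have [iX EX] := class_Q_mean; have [ih Eh] := hedge_mean0.
pose v := y0 - a * x; pose S w := - a * X T w + (y0 + hw T w).
have iS : L1 Q S by apply: L1D; [exact: L1Z|apply: L1D => //; exact: L1_cst].
have ES : v <= Ex Q S.
  rewrite (ExD (L1Z _ iX) (L1D (L1_cst Q y0) ih)) (ExD (L1_cst Q y0) ih) Eh Ex_cst (ExZ _ iX) addr0.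
  by have := ler_wpM2l (ltW a0) EX; rewrite /v; lra.
have i1 : L1 Q (fun w => expR v * (1 + (S w - v))).
  by apply: L1Z; apply: L1D; [exact: L1_cst|apply: L1B => //; exact: L1_cst].
have mLT := mL (stopping_cst TT).
have i2 : L1 P (fun w => expR (L T w) * (expR v * (1 + (S w - v)))).
  by apply/(change_L1 mLT (tilting_density ts) (L1_meas i1)).
have E2 := change_Ex mLT (tilting_density ts) i2 (L1_meas i1).
apply: (@le_trans _ _ (Ex Q (fun w => expR v * (1 + (S w - v))))).
  have i3 := L1B iS (L1_cst Q v).
  rewrite (ExZ _ (L1D (L1_cst Q 1) i3)) (ExD (L1_cst Q 1) i3) (ExB iS (L1_cst Q v)) !Ex_cst.
  by rewrite ler_peMr ?expR_ge0//; lra.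
rewrite E2; apply: (Ex_le i2 iE).
apply: filterS3 base_log Yy (sol_end hY) => w E yw YT.
have := E T TT; rewrite YT yw => Ew.
apply: (@le_trans _ _ (expR (L T w) * expR (S w))).
  apply: ler_wpM2l; first exact: expR_ge0.
  apply: (@le_trans _ _ (expR v * expR (S w - v))); last by rewrite -expRD addrC subrK.
  by apply: ler_wpM2l; [exact: expR_ge0|exact: expR_ge1Dx].
by rewrite -expRD ler_expR /S Ew; lra.
Qed.

End class_Q.
End hedging.

(** * Stopped optimal strategies *)

Section strategies.

Variables (Y : R -> Omega -> R) (Z : R -> Omega -> 'cV[R]_m) (I J : R -> Omega -> R).
Variables (e : R) (Q : probability Omega R).
Hypothesis hY : solves 1 (fun=> 0) Y Z I.
Let tl := tilt Z.
Let hd := hedge Z.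
Let hw := hedge_wealth Z I J.
Hypothesis ts : tilting tl J e Q.
Let hJ : ito tl J := tilting_ito ts.
Let hH : ito hd (hedge_ito I J) := hedge_itoP hY hJ.
Let L t w := J t w - qv (tl ^~ w) t / 2.
Let e0 : 0 < e := tilting_gt0 ts.
Let power tau : stop tau -> L1 P (fun w => expR ((1 + e) * L (tau w) w)) /\
  Ex P (fun w => expR ((1 + e) * L (tau w) w)) <= 2.
Proof. exact: tilting_power ts tau. Qed.
Let rho n := hedge_stop Z n.
Let srho n : stop (rho n) := hedge_stopping hY ts n.
Let rT n w : 0 <= rho n w <= T. Proof. exact: (stopping_itv w (srho n)). Qed.

Variables (a x : R) (n : nat).
Hypothesis a0 : 0 < a.
Let ai : 0 < a^-1. Proof. by rewrite invr_gt0. Qed.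

Definition stopped_hedge t w : 'cV[R]_m := a^-1 *: stopped (rho n w) (hd ^~ w) t.
Definition stopped_hedge_ito t w : R := a^-1 * hedge_ito I J (Num.min t (rho n w)) w.
(** Recovers the strategy from its image under [sigma^T], on which
    [invmx (sigma *m sigma^T) *m sigma] is a left inverse. *)
Definition stopped_strategy t w : 'cV[R]_d :=
  invmx (sigma t w *m (sigma t w)^T) *m (sigma t w *m stopped_hedge t w).
Definition stopped_wealth t w : R := x + a^-1 * hw (Num.min t (rho n w)) w.

Lemma stopped_hedge_itoP : ito stopped_hedge stopped_hedge_ito.
Proof. exact: (ito_scale a^-1 (ito_stop (srho n) hH)). Qed.

Lemma stopped_strategyE t w : 0 <= t <= T ->
  (sigma t w)^T *m stopped_strategy t w = stopped_hedge t w /\ C (stopped_strategy t w).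
Proof.
move=> tT; have [p Cp pE] := hedge_in Z w tT.
have uS := hs w tT.
rewrite /stopped_strategy /stopped_hedge /stopped /hd -/(hedge Z t w); case: ifP => _.
  have -> : hedge Z t w = (sigma t w)^T *m p by rewrite -pE.
  rewrite -!scalemxAr (mulmxA (sigma t w)) mulKmx//; split=> //.
  by have [_ _ h] := hC; exact: h.
by rewrite scaler0 !mulmx0.
Qed.

Lemma stopped_wealthE : {ae P, forall w, forall t, 0 <= t <= T ->
  stopped_wealth t w = x + (stopped_hedge_ito t w + ip (stopped_hedge ^~ w) (th ^~ w) t)}.
Proof.
apply: filterS2 (ito_path hH) (ito_path hJ) => w pH pJ t tT; have pt := theta_pathL2 w.
have /andP[r0 r1] := rT n w; have /andP[t0 t1] := tT.
have pS := pathL2_stopped (rho n w) pH.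
have mT : 0 <= Num.min t (rho n w) <= T by rewrite le_min t0 r0 ge_min t1.
rewrite /stopped_wealth /stopped_hedge_ito /stopped_hedge (ipZl _ tT pS pt) (ip_stopped r0 tT pH pt) (minC (rho n w)).
rewrite (hedge_theta_ip mT pJ pH) /hw /hedge_wealth /drifted -/hd -/tl.
by rewrite mulrDr.
Qed.

Lemma stopped_constrained : constrained_wealth P T B b sigma C x stopped_strategy stopped_wealth.
Proof.
have hI := stopped_hedge_itoP.
have hI' : ito (fun t w => (sigma t w)^T *m stopped_strategy t w) stopped_hedge_ito.
  apply: (ito_ext _ _ hI) => [t w tT|]; last exact: aeW.
  by rewrite (stopped_strategyE w tT).1.
split.
- have ps := market_sigma ms; have pt := predictable_tr ps.
  apply: (predictable_mulmx); last exact: (predictable_mulmx ps (ito_prd hI)).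
  apply: (predictable_invmx); last exact: (predictable_mulmx ps pt).
  by move=> t w tT; exact: hs.
- exact: (path_square_integrable (ito_path hI')).
- by move=> t tT; apply: aeW => w; exact: (stopped_strategyE w tT).2.
- exists stopped_hedge_ito; first exact: ito_to.
  apply: filterS stopped_wealthE => w E t tT; rewrite (E t tT); congr (_ + (_ + _)).
  apply: (rint_ext (T := T)); first by case/andP: tT.
  by move=> s sT; rewrite (stopped_strategyE w sT).1.
Qed.

(** By [base_log], the variables of the class are at most a constant times the stopped density times
    [expR] of [a] times the positive part of [YF]; [expR_add_young] splits this product with
    arbitrarily small weight. *)
Lemma stopped_class_D (F : Omega -> R) (YF : R -> Omega -> R) (ZF : R -> Omega -> 'cV[R]_m) (IF : R -> Omega -> R) :
  solves a F YF ZF IF ->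
  admissible_D P T B b sigma C a YF x stopped_strategy stopped_wealth.
Proof.
move=> hF; split; first exact: stopped_constrained.
have [aX cX] := wealth_process stopped_constrained.
have [c cp hc] := base_bounded hY.
have lin (y1 y2 l y v : R) : `|y1| <= c -> `|y2| <= c -> a * y <= v ->
    - a * (x + a^-1 * (y1 - y2 - l) - y) <= - a * x + 2 * c + (l + v).
  rewrite !ler_norml => /andP[h3 h4] /andP[h5 h6] h7.
  have -> : - a * (x + a^-1 * (y1 - y2 - l) - y) = - a * x - a * a^-1 * (y1 - y2 - l) + a * y by ring.
  by rewrite mulfV ?gt_eqF// mul1r; lra.
pose p := 2 * (1 + e) / e.
have p1 : 1 <= p by exact: (tilting_exponent_ge1 ts).
have [M hM] := sol_exp hF p1.
pose kk := expR (- a * x + 2 * c).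
have kk0 : 0 < kk by exact: expR_gt0.
apply: (@dominated_uniformly_integrable _ _ _ P _ (2 + M)) => dd dd0.
have [K K0 hK] := expR_add_young e0 (divr_gt0 dd0 kk0).
exists (kk * K) => [|_ [tau st <-]]; first by rewrite mulr_ge0 ?ltW.
have tT w : 0 <= tau w <= T by exact: (stopping_itv w st).
pose ka w := Num.min (tau w) (rho n w).
have ska : stop ka by exact: stopping_min.
have kT w : 0 <= ka w <= T by exact: (stopping_itv w ska).
split.
  apply: measurableT_comp => //; apply: measurable_funM => //; apply: measurable_funB.
    exact: (stopped_meas aX cX st).
  exact: (stopped_meas (predictable_adapted (sol_predictable hF)) (sol_cont hF) st).
exists (fun w => expR ((1 + e) * L (ka w) w) + expR (p * a * Num.max (YF (tau w) w) 0)).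
have [i1 e1] := power ska; have [i2 e2] := hM _ st.
split.
- exact: L1D.
- by rewrite (ExD i1 i2) lerD.
- by move=> w; rewrite addr_ge0 ?expR_ge0.
apply: filterS2 (base_log hY ts) hc => w E cw.
rewrite ger0_norm ?expR_ge0//.
have h1 := hK (L (ka w) w) (a * Num.max (YF (tau w) w) 0).
have h2 := ler_wpM2l (ltW kk0) h1.
rewrite mulrDr (mulrA kk) (mulrC kk (dd / kk)) divfK ?gt_eqF// -/p (mulrA p) in h2.
apply: le_trans h2; rewrite /kk -expRD ler_expR /stopped_wealth -/(ka w).
have Ek : hw (ka w) w = Y (ka w) w - Y 0 w - L (ka w) w by exact: (E _ (kT w)).
rewrite Ek.
have h3 : a * YF (tau w) w <= a * Num.max (YF (tau w) w) 0 by rewrite ler_pM2l// le_max lexx.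
exact: lin (cw _ (kT w)) (cw _ T00) h3.
Qed.

Section class_Q.
Variables (Jth : R -> Omega -> R) (eth : R) (Qth : probability Omega R).
Hypothesis tth : tilting (fun t w => - th t w) Jth eth Qth.

Let W t w := drifted (fun t w => - th t w) stopped_hedge stopped_hedge_ito t w.

Let mean0 kappa : stop kappa -> L1 Qth (fun w => W (kappa w) w) /\ Ex Qth (fun w => W (kappa w) w) = 0.
Proof.
move=> sk; have [K hK] := theta_bounded.
have pN w : pathL2 T (fun t => - th t w) by exact/pathL2N/(theta_pathL2).
pose K' := Num.max (K * T) (a^-1 * (a^-1 * n%:R)).
have kT w : 0 <= kappa w <= T by exact: (stopping_itv w sk).
apply: (@tilted_drift_mean0 _ _ _ _ tth _ _ _ K' stopped_hedge_itoP sk).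
  apply: aeW => w; have /andP[k0 k1] := kT w; rewrite le_max; apply/orP; left.
  apply: (le_trans (ip_nd k0 k1 (lexx T) (pN w))).
  rewrite -(rint_cst K T0); have pp := theta_pathL2 w.
  rewrite (ipNl TT pp (pN w)) ipC (ipNl TT pp pp) opprK.
  by apply: (rint_le TT (proj2 pp) (path_integrable_cst T K)) => s sT; exact: hK.
have bnd : {ae P, forall w, qv (hd ^~ w) (rho n w) <= n%:R}.
  exact: (hedge_stop_bracket hY ts n).
apply: filterS2 bnd (ito_path hH) => w bw pH; rewrite le_max; apply/orP; right.
have pS := pathL2_stopped (rho n w) pH; have /andP[r0 r1] := rT n w.
have /andP[k0 k1] := kT w.
rewrite /stopped_hedge (ipZl _ (kT w) pS (pathL2Z _ pS)) (ipZr _ (kT w) pS pS).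
rewrite (ip_stopped2 r0 r0 (kT w) pH pH) minxx ler_pM2l// ler_pM2l//.
apply: le_trans bw; apply: (ip_nd _ _ r1 pH); first by rewrite le_min r0.
by rewrite ge_min lexx.
Qed.

Let WE : {ae Qth, forall w, forall t, 0 <= t <= T -> stopped_wealth t w = x + W t w}.
Proof.
apply/(tilted_ae tth); apply: filterS2 stopped_wealthE (ito_path hH) => w E pH t tT.
rewrite (E t tT) /W /drifted; congr (_ + (_ + _)).
have pS := pathL2Z a^-1 (pathL2_stopped (rho n w) pH); have pp := theta_pathL2 w.
by rewrite [X in - X]ipC (ipNl tT pp pS) opprK ipC.
Qed.

(** Under [Qth] the drift cancels, and the stopped hedge has a bounded bracket, so its integral has
    mean 0 at every stopping time. At [restricted_time] this is the martingale property. *)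
Lemma stopped_class_Q : admissible_Q P T B b sigma C Qth x stopped_strategy stopped_wealth.
Proof.
split; first exact: stopped_constrained.
have [aX cX] := wealth_process stopped_constrained.
have mX t : 0 <= t <= T -> measurable_fun setT (stopped_wealth t).
  by move=> tT; exact: (mat_meas (andP tT).2 (aX t tT)).
have iW t : 0 <= t <= T -> L1 Qth (W t) by move=> tT; exact: (mean0 (stopping_cst tT)).1.
have iX t : 0 <= t <= T -> L1 Qth (stopped_wealth t).
  move=> tT; apply: (L1_ae (mX t tT) _ (L1D (L1_cst Qth x) (iW t tT))).
  by apply: filterS WE => w E; rewrite (E t tT).
have lin0 (v v' : R) : v + (0 - v') = 0 -> v = v' by lra.
have key u t E : 0 <= u <= T -> filtration P B u E -> 0 <= t <= T -> u <= t ->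
    Ex Qth (fun w => \1_E w * W t w) = Ex Qth (fun w => \1_E w * W T w).
  move=> uT FE tT ut; have FE' := filtration_mono ut FE.
  have mE := filtration_measurable (andP uT).2 FE.
  have [i1 h1] := mean0 (stopping_restricted tT FE').
  have [i2 _] := integral_indic_Ex mE (iW t tT); have [i3 _] := integral_indic_Ex mE (iW T TT).
  have iT := iW T TT; have eT := (mean0 (stopping_cst TT)).2.
  have eE : (fun w => W (restricted_time t E w) w) =
      (fun w => \1_E w * W t w + (W T w - \1_E w * W T w)).
    apply/funext => w; rewrite /restricted_time indicE; case: (w \in E); rewrite ?mul1r ?mul0r ?subrr ?addr0 ?add0r ?subr0//.
  rewrite eE (ExD i2 (L1B iT i3)) (ExB iT i3) eT in h1.
  exact: lin0.
split; [exact: aX|exact: iX|move=> u t E u0 ut tT FE].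
have uT : 0 <= u <= T by rewrite u0 (le_trans ut).
have tT' : 0 <= t <= T by rewrite (le_trans u0 ut).
have mE := filtration_measurable (andP uT).2 FE.
have [i1 ->] := integral_indic_Ex mE (iX t tT'); have [i2 ->] := integral_indic_Ex mE (iX u uT).
have [i3 _] := integral_indic_Ex mE (iW t tT'); have [i4 _] := integral_indic_Ex mE (iW u uT).
have [i5 _] := integral_indic_Ex mE (L1_cst Qth x).
have step v (vT : 0 <= v <= T) (i : L1 Qth (fun w => \1_E w * W v w)) (iv : L1 Qth (fun w => \1_E w * stopped_wealth v w)) :
    Ex Qth (fun w => \1_E w * stopped_wealth v w) = Ex Qth (fun w => \1_E w * x) + Ex Qth (fun w => \1_E w * W v w).
  rewrite -(ExD i5 i); apply: (Ex_ae (L1_meas iv) (L1_meas (L1D i5 i))).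
  by apply: filterS WE => w Ew; rewrite (Ew v vT) mulrDr.
apply: (congr1 EFin); rewrite (step t tT' i3 i1) (step u uT i4 i2); apply: (congr1 (fun v => _ + v)).
by rewrite (key u t E uT FE tT' ut) (key u u E uT FE uT (lexx u)).
Qed.

End class_Q.

Lemma stopped_weight : {ae P, forall w, - hw (rho n w) w = Y 0 w - Y (rho n w) w + L (rho n w) w}.
Proof.
apply: filterS (base_log hY ts) => w E.
have -> : hw (rho n w) w = Y (rho n w) w - Y 0 w - L (rho n w) w by exact: (E _ (rT n w)).
by ring.
Qed.

End strategies.

(** * Bounds for the price *)

Section price.
Variables (Y : R -> Omega -> R) (Z : R -> Omega -> 'cV[R]_m) (I J : R -> Omega -> R).
Variables (e : R) (Q : probability Omega R).
Hypothesis hY : solves 1 (fun=> 0) Y Z I.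
Let tl := tilt Z.
Hypothesis ts : tilting tl J e Q.
Let L t w := J t w - qv (tl ^~ w) t / 2.
Variables (Jth : R -> Omega -> R) (eth : R) (Qth : probability Omega R).
Hypothesis tth : tilting (fun t w => - th t w) Jth eth Qth.
Variables (a x c cF y0 : R) (F : Omega -> R).
Variables (YF : R -> Omega -> R) (ZF : R -> Omega -> 'cV[R]_m) (IF : R -> Omega -> R).
Hypotheses (a0 : 0 < a) (hF : solves a F YF ZF IF) (mF : measurable_fun setT F).
Hypotheses (YFc : {ae P, forall w, YF 0 w = cF}) (Yy : {ae P, forall w, Y 0 w = y0}).
Hypothesis hc : indifference_price P T B b sigma C Qth x F a YF c.

Let expectationE (f : Omega -> R) : L1 P f -> ('E_P[f] = (Ex P f)%:E)%E.
Proof. by move=> i; rewrite unlock (EFin_Ex i). Qed.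

Let sT := stopping_cst TT.

Lemma utility_D_le : (maximal_utility P T a (fun w => (c - F w)%R) (admissible_D P T B b sigma C a YF x) <=
  (- expR (a * (cF - x - c))%R)%:E)%E.
Proof.
apply: ge_ereal_sup => _ [pi [X [[hw ui] ->]]].
have [i le] := class_D_bound hw a0 hF YFc ui.
have [aX cX] := wealth_process hw.
have mX := stopped_meas aX cX sT.
have E : {ae P, forall w, expR (- (a * c)) * expR (- a * (X T w - YF T w)) = expR (- a * (X T w + (c - F w)))}.
  by apply: filterS (sol_end hF) => w ->; rewrite -expRD; congr expR; ring.
have mE : measurable_fun setT (fun w => expR (- a * (X T w + (c - F w)))).
  apply: measurableT_comp => //; apply: measurable_funM => //; apply: measurable_funD => //.
  exact: measurable_funB.
have i1 := L1Z (expR (- (a * c))) i; have i2 := L1_ae mE E i1.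
rewrite (expectationE (L1N i2)) lee_fin (ExN i2) -(Ex_ae (L1_meas i1) mE E) (ExZ _ i) lerN2.
apply: (@le_trans _ _ (expR (- (a * c)) * expR (a * (cF - x)))).
  by rewrite -expRD le_eqVlt; apply/orP; left; apply/eqP; congr expR; ring.
by rewrite ler_pM2l// expR_gt0.
Qed.

Lemma utility_Q_le : (maximal_utility P T a (fun=> 0%R) (admissible_Q P T B b sigma C Qth x) <=
  (- expR (y0 - a * x)%R)%:E)%E.
Proof.
apply: ge_ereal_sup => _ [pi [X [[hw hM] ->]]].
have [aX cX] := wealth_process hw; have mX := stopped_meas aX cX sT.
have -> : (fun w => - expR (- a * (X T w + 0))) = fun w => - expR (- a * X T w).
  by apply/funext => w; rewrite addr0.
have mE : measurable_fun setT (fun w => expR (- a * X T w)).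
  by apply: measurableT_comp => //; exact: measurable_funM.
have [i|ni] := pselect (L1 P (fun w => expR (- a * X T w))).
  rewrite (expectationE (L1N i)) lee_fin (ExN i) lerN2.
  exact: (class_Q_utility hY ts a0 tth hw hM i Yy).
(* If [expR (- a * X T)] is not integrable, the expected utility is minus infinity. *)
rewrite unlock; have -> : (\int[P]_w (- expR (- a * X T w)%R)%:E = - \int[P]_w (expR (- a * X T w)%R)%:E)%E.
  by rewrite -integralN//; apply: fin_num_adde_defl; rewrite (_ : (_ ^\-)%E = cst 0%E) ?integral0//; apply/funext => w; rewrite funenegE -EFinN -EFin_max max_r// oppr_le0 expR_ge0.
have -> : (\int[P]_w (expR (- a * X T w)%R)%:E = +oo)%E; last by rewrite leNye.
apply: contrapT => /eqP ne; apply: ni; apply/integrableP; split; first exact/measurable_EFinP.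
under eq_integral => w _ do rewrite gee0_abs ?lee_fin ?expR_ge0//.
by rewrite ltey.
Qed.

(** Disutility of the stopped hedge weighted by [V], which is 1 without the claim and [expR (a * F)]
    with it. *)
Let U (V : Omega -> R) n w := expR (- a * stopped_wealth Z I J a x n T w) * V w.

Let UE V n : {ae P, forall w, expR (- a * x) * (expR (L (hedge_stop Z n w) w) *
  (expR (Y 0 w - Y (hedge_stop Z n w) w) * V w)) = U V n w}.
Proof.
apply: filterS (stopped_weight hY ts n) => w E; rewrite /U /stopped_wealth.
have rT := stopping_itv w (hedge_stopping hY ts n); rewrite (min_r (andP rT).2).
rewrite mulrA mulrA -!expRD; congr (expR _ * _).
have -> : - a * (x + a^-1 * hedge_wealth Z I J (hedge_stop Z n w) w) =
    - a * x + a * a^-1 * (- hedge_wealth Z I J (hedge_stop Z n w) w) by ring.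
by rewrite E -/(L _ w) mulfV ?gt_eqF// mul1r; ring.
Qed.

(** [UE] rewrites the disutility as a stopped density times a bounded factor times [V]. As the
    stopping times reach [T], where [Y] vanishes, the mean tends to that of [V] under [Q]. *)
Lemma stopped_utility_cvg (V S : Omega -> R) : measurable_fun setT V -> (forall w, 0 <= V w) ->
  {ae P, forall w, V w <= expR (S w)} -> L1 P (fun w => expR (2 * (1 + e) / e * S w)) ->
  L1 Q V /\ forall v : R, (forall n, L1 P (U V n) -> v <= Ex P (U V n)) -> v <= expR (y0 - a * x) * Ex Q V.
Proof.
move=> mV V0 VS iS; have [k kp hk] := base_bounded hY.
have e0 := tilting_gt0 ts; have sr := hedge_stopping hY ts.
have aY := predictable_adapted (sol_predictable hY); have mY0 : measurable_fun setT (Y 0).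
  exact: (mat_meas T0 (aY 0 T00)).
set rho := fun n => hedge_stop Z n in sr *.
have mYr n : measurable_fun setT (fun w => Y (rho n w) w) := stopped_meas aY (sol_cont hY) (sr n).
pose X n w := expR (Y 0 w - Y (rho n w) w) * V w.
have mX n : measurable_fun setT (X n).
  by apply: measurable_funM => //; apply: measurableT_comp => //; exact: measurable_funB.
have mLr tau : stop tau -> measurable_fun setT (fun w => L (tau w) w) by exact: (log_doleans_meas ts).
have bX n : {ae P, forall w, `|X n w| <= expR (2 * k) * expR (S w)}.
  apply: filterS2 VS hk => w vs kw; rewrite ger0_norm ?mulr_ge0 ?expR_ge0//.
  apply: ler_pM => //; rewrite ?expR_ge0// ler_expR.
  have := kw _ T00; have := kw _ (stopping_itv w (sr n)); rewrite !ler_norml => /andP[? ?] /andP[? ?].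
  lra.
have mYT : measurable_fun setT (fun w => expR (L T w) * (expR y0 * V w)).
  apply: measurable_funM; last exact: measurable_funM.
  by apply: measurableT_comp => //; exact: (mLr _ sT).
have cX : {ae P, forall w, expR (L (rho n w) w) * X n w @[n --> \oo] --> expR (L T w) * (expR y0 * V w)}.
  apply: filterS3 (hedge_stop_eventually hY ts) (sol_end hY) Yy => w ev YT Y0.
  apply: cvg_near_cst; apply: filterS ev => n h; rewrite /X /rho h YT Y0 subr0//.
have [iY iX cE] := weighted_vitali e0 (expR_ge0 (2 * k)) (fun n => mLr _ (sr n)) mX mYT
  (fun n => tilting_power ts (sr n)) (fun n => conj iS (lexx _)) bX cX.
have iV : L1 P (fun w => expR (L T w) * V w).
  have := L1Z (expR (- y0)) iY; rewrite (_ : (fun w => _) = fun w => expR (L T w) * V w)//.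
  by apply/funext => w; rewrite mulrCA (mulrA (expR (- y0))) -expRD addNr expR0 mul1r.
have [iQ EQ] := tilted_L1 ts iV mV; split=> // v hv.
have EY : Ex P (fun w => expR (L T w) * (expR y0 * V w)) = expR y0 * Ex Q V.
  by rewrite EQ -(ExZ _ iV); congr (Ex P _); apply/funext => w; rewrite mulrCA.
have iU n : L1 P (U V n) /\ Ex P (U V n) = expR (- a * x) * Ex P (fun w => expR (L (rho n w) w) * X n w).
  have i1 := L1Z (expR (- a * x)) (iX n).
  have mU : measurable_fun setT (U V n).
    by apply: (ae_measurable (setting_complete bs) (L1_meas i1)); exact: UE.
  by split; [exact: (L1_ae mU (UE V n) i1)|rewrite -(ExZ _ (iX n)); apply/esym/(Ex_ae (L1_meas i1) mU (UE V n))].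
have -> : expR (y0 - a * x) * Ex Q V = expR (- a * x) * Ex P (fun w => expR (L T w) * (expR y0 * V w)).
  by rewrite EY mulrA -expRD; congr (expR _ * _); ring.
have cE' : expR (- a * x) * Ex P (fun w => expR (L (rho n w) w) * X n w) @[n --> \oo] -->
    expR (- a * x) * Ex P (fun w => expR (L T w) * (expR y0 * V w)) by exact: cvgMr.
rewrite -(cvg_lim _ cE')//; apply: limr_ge; first by apply/cvg_ex; eexists; exact: cE'.
by apply: nearW => n; rewrite -(iU n).2; exact: (hv n (iU n).1).
Qed.

(** The stopped hedges are admissible without claim and their disutility tends to
    [expR (y0 - a * x)]; by indifference this cannot beat the bound [utility_D_le]. *)
Lemma price_ge : cF - a^-1 * y0 <= c.
Proof.
have [_ h] : L1 Q (fun=> 1 : R) /\ forall v : R, (forall n, L1 P (U (fun=> 1) n) -> v <= Ex P (U (fun=> 1) n)) ->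
    v <= expR (y0 - a * x) * Ex Q (fun=> 1).
  apply: (@stopped_utility_cvg _ (fun=> 0)) => //; first by apply: aeW => w; rewrite expR0.
  exact: L1_cst.
have := h (expR (a * (cF - x - c))); rewrite Ex_cst mulr1 ler_expR => h'.
have : a * (cF - x - c) <= y0 - a * x.
  apply: h' => n i; rewrite -lerN2 -(ExN i) -lee_fin -expectationE; last exact: L1N.
  apply: le_trans utility_D_le; rewrite hc; apply: ereal_sup_ubound.
  have ad := stopped_class_Q hY ts x n a0 tth.
  do 2 eexists; split; first exact: ad.
  by congr expectation; apply/funext => w; rewrite /U mulr1 addr0.
move=> h2; rewrite -(ler_pM2l a0) mulrBr mulrA mulfV ?gt_eqF// mul1r; lra.
Qed.

(** With the claim the stopped hedges are admissible too. The limit of their disutility, compared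
    with [utility_Q_le], leaves the mean of [expR (a * F)] under [Q]. *)
Lemma price_le : L1 P (fun w => expR (2 * (1 + e) / e * (a * F w))) ->
  L1 Q (fun w => expR (a * F w)) /\ expR (a * c) <= Ex Q (fun w => expR (a * F w)).
Proof.
move=> iF; have mV : measurable_fun setT (fun w => expR (a * F w)).
  by apply: measurableT_comp => //; exact: measurable_funM.
have [iQ h] := stopped_utility_cvg mV (fun w => expR_ge0 _) (aeW _ (fun=> lexx _)) iF.
split=> //; have h2 : expR (a * c) * expR (y0 - a * x) <= expR (y0 - a * x) * Ex Q (fun w => expR (a * F w)).
  apply: h => n i; have i' := L1Z (expR (- (a * c))) i.
  have eq w : expR (- (a * c)) * U (fun w => expR (a * F w)) n w =
      expR (- a * (stopped_wealth Z I J a x n T w + (c - F w))).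
    by rewrite /U -!expRD; congr expR; ring.
  have le : expR (y0 - a * x) <= Ex P (fun w => expR (- (a * c)) * U (fun w => expR (a * F w)) n w).
    rewrite -lerN2 -(ExN i') -lee_fin -(expectationE (L1N i')).
    apply: le_trans utility_Q_le; rewrite -hc; apply: ereal_sup_ubound.
    have ad := stopped_class_D hY ts x n a0 hF.
    do 2 eexists; split; first exact: ad.
    by congr expectation; apply/funext => w; rewrite eq.
  rewrite (ExZ _ i) in le; have := ler_wpM2l (expR_ge0 (a * c)) le.
  by rewrite (mulrA (expR (a * c)) (expR (- (a * c)))) -expRD subrr expR0 mul1r.
by move: h2; rewrite mulrC ler_pM2l// expR_gt0.
Qed.

End price.

(** * Existence for the linear equation and rate of convergence *)

Section final.
Variables (Y : R -> Omega -> R) (Z : R -> Omega -> 'cV[R]_m) (I J : R -> Omega -> R).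
Variables (e : R) (Q : probability Omega R).
Hypothesis hY : solves 1 (fun=> 0) Y Z I.
Let tl := tilt Z.
Hypothesis ts : tilting tl J e Q.
Let hJ := tilting_ito ts.
Variable F : Omega -> R.
Hypotheses (mF : measurable_fun setT F).
Hypothesis expF : forall p : R, 1 <= p -> L1 P (fun w => expR (p * Num.max (F w) 0)).
Variable k : R.
Hypothesis Fk : {ae P, forall w, Num.max (- F w) 0 <= k}.
Variables (YF : R -> R -> Omega -> R) (ZF : R -> R -> Omega -> 'cV[R]_m).
Hypothesis hF : forall a, 0 < a -> exists I, solves a F (YF a) (ZF a) I.

Let p1 : 1 <= 2 * (1 + e) / e := tilting_exponent_ge1 ts.

Lemma exp_terminal_L1 : L1 Q (fun w => expR (2 * `|F w|)).
Proof.
have p2 : 1 <= 2 * (1 + e) / e * 2 by move: p1; lra.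
have mX : measurable_fun setT (fun w => expR (2 * `|F w|)).
  by apply: measurableT_comp => //; apply: measurable_funM => //; exact: measurableT_comp.
apply: (@tilted_L1_exp _ _ _ _ ts (expR (2 * k)) (fun w => 2 * Num.max (F w) 0)) => //.
- rewrite (_ : (fun w => _) = fun w => expR (2 * (1 + e) / e * 2 * Num.max (F w) 0)); first exact: expF.
  by apply/funext => w; rewrite mulrA.
- apply: filterS Fk => w; rewrite ger0_norm ?expR_ge0// -expRD ler_expR ge_max => /andP[h1 h2].
  have [F0|F0] := lerP 0 (F w).
    by rewrite ger0_norm//; lra.
  by rewrite ltr0_norm//; lra.
Qed.

Let K := 4 * Ex Q (fun w => expR (2 * `|F w|)).

Let K0 : 0 <= K. Proof. by rewrite mulr_ge0// Ex_ge0// => w; exact: expR_ge0. Qed.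

Let mean (a : R) := Ex Q (gap Y a (YF a) 0).

Let gap_end (a : R) (IF : R -> Omega -> R) : solves a F (YF a) (ZF a) IF -> {ae P, forall w, gap Y a (YF a) T w = F w}.
Proof.
by move=> h; apply: filterS2 (sol_end h) (sol_end hY) => w h1 h2; rewrite /gap h1 h2 mulr0 subr0.
Qed.

Lemma gap_mean_bounds (a : R) : 0 < a -> a <= 1 -> 0 <= mean a - Ex Q F <= a * K.
Proof.
move=> a0 a1; have [IF h] := hF a0; have [k' hp] := gap_perturbed hY hJ a0 h.
exact: (pert_gap ts hp (gap_end h) mF exp_terminal_L1 a1).
Qed.

Lemma price_bounds (Jth : R -> Omega -> R) (eth : R) (Qth : probability Omega R) (x a c : R) :
  tilting (fun t w => - th t w) Jth eth Qth -> 0 < a -> a <= 1 ->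
  indifference_price P T B b sigma C Qth x F a (YF a) c -> Ex Q F <= c <= Ex Q F + a * K.
Proof.
move=> tth a0 a1 hc; have [IF h] := hF a0; have [k' hp] := gap_perturbed hY hJ a0 h.
have aY := predictable_adapted (sol_predictable hY).
have [cY _ Yb] := base_bounded hY.
have mY0 : measurable_fun setT (Y 0) := mat_meas T0 (aY 0 T00).
have iY : L1 P (Y 0) by apply: (L1_bounded (K := cY)) => //; apply: filterS Yb => w; exact.
have Yc := mat0_const (aY 0 T00) iY; set y0 := Ex P (Y 0) in Yc.
have YFc : {ae P, forall w, YF a 0 w = mean a + a^-1 * y0}.
  by apply: filterS2 (pert_start ts hp) Yc => w; rewrite /gap -/(mean a) => <- ->; rewrite subrK.
have /andP[g1 g2] := gap_mean_bounds a0 a1.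
have ge := price_ge hY ts tth a0 h mF YFc Yc hc.
have iE : L1 P (fun w => expR (2 * (1 + e) / e * (a * F w))).
  apply: (L1_le _ _ (expF p1)).
    by apply: measurableT_comp => //; apply: measurable_funM => //; exact: measurable_funM.
  apply: aeW => w; rewrite ger0_norm ?expR_ge0// ler_expR ler_wpM2l ?(le_trans ler01 p1)//.
  apply: (@le_trans _ _ (a * Num.max (F w) 0)); first by rewrite ler_pM2l// le_max lexx.
  by rewrite ler_piMl// le_max lexx orbT.
have [iQ le] := price_le hY ts tth a0 h mF Yc hc iE.
have iF := pert_terminal_L1 ts hp (gap_end h) mF.
have := le_trans le (exp_mean_le a0 a1 mF iF exp_terminal_L1 iQ); rewrite ler_expR -/K => le2.
apply/andP; split; first by move: ge; rewrite addrK; lra.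
by rewrite -(ler_pM2l a0) mulrDr mulrA -expr2.
Qed.

Lemma linear_solution : exists C0 : R -> Omega -> R, exists H0 : R -> Omega -> 'cV[R]_m,
  linear_bsde P T B b sigma C Q Z F C0 H0 /\ {ae P, forall w, C0 0 w = Ex Q F}.
Proof.
(* Chosen so that [a n * K] is at most the gap [(2^-1 ^+ n) ^+ 4 / 256] under which the processes
   converge; [K + 1] is positive even if [K] is 0. *)
pose a (n : nat) : R := (2^-1 ^+ n) ^+ 4 / 256 / (K + 1).
have K1 : 0 < K + 1 by rewrite ltr_wpDl.
have a0 n : 0 < a n by rewrite !divr_gt0// !exprn_gt0.
have aK n : a n * K <= (2^-1 ^+ n) ^+ 4 / 256.
  rewrite /a mulrAC ler_pdivrMr// ler_wpM2l ?lerDl// divr_ge0// !exprn_ge0//.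
have a1 n : a n <= 1.
  rewrite /a ler_pdivrMr// mul1r (@le_trans _ _ 1) ?lerDr//.
  by rewrite ler_pdivrMr// mul1r (@le_trans _ _ 1) ?ler1n// exprn_ile1 ?exprn_ge0// exprn_ile1// invf_le1// ler1n.
have [IF hIF] := choice (fun n => hF (a0 n)).
have [ks hk] := choice (fun n => gap_perturbed hY hJ (a0 n) (hIF n)).
have pX n : predictable P T B (gap Y (a n) (YF (a n))).
  apply: (predictableB); first exact: (sol_predictable (hIF n)).
  by apply: (predictableM); [exact: predictable_cst|exact: (sol_predictable hY)].
have XF n := gap_end (hIF n).
have gl n : 0 <= Ex Q (gap Y (a n) (YF (a n)) 0) - Ex Q F <= (2^-1 ^+ n) ^+ 4 / 256.
  by have /andP[-> h] := gap_mean_bounds (a0 n) (a1 n); exact: le_trans h (aK n).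
have hI := limit_itoP ts hk mF XF gl.
set X := fun n => gap Y (a n) (YF (a n)) in pX XF gl hI.
set h := fun n => gap_integrand Z (a n) (ZF (a n)) in hI.
exists (limit_process X), (limit_integrand h); split; last exact: (limit_initial ts hk gl).
split; last first.
  move=> t tT; have cond := limit_conditional ts hk pX mF XF gl tT.
  have FT : filtration P B t setT by exact: filtrationT.
  have iF := pert_terminal_L1 ts (hk 0%N) (XF 0%N) mF.
  split=> //; first exact: (cond _ FT).1.
    exact: (predictable_mat tT (limit_predictable pX)).
  move=> A FA; have mA := filtration_measurable (andP tT).2 FA; have [i E] := cond _ FA.
  by rewrite (integral_indic_Ex mA i).2 (integral_indic_Ex mA iF).2 E.
split; [exact: (limit_predictable pX)|exact: (limit_continuous ts hk mF XF gl)|].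
eexists; first exact: (ito_to hI).
apply: filterS3 (limit_terminal ts hk mF XF gl) (ito_path hI) (ito_path hJ) => w CT pH pN t tT.
have /andP[t0 tT'] := tT.
rewrite -(rint_incr_cc t0 tT' (lexx T) (pathL2_dot pH pN)) /limit_ito CT -!/(ip _ _ _).
by move: (ip _ _ _) (ip _ _ _) => u v; ring.
Qed.

End final.

Lemma predictable_mx_opp (H : R -> Omega -> 'cV[R]_m) :
  predictable_mx P T B (fun t w => - H t w) -> predictable_mx P T B H.
Proof.
move=> h i j; have := predictableM (predictable_cst (-1)) (h i j).
by apply: predictable_ext => t w _; rewrite mxE mulN1r opprK.
Qed.

Lemma theta_tilting (Q : probability Omega R) :
  exponential_measure P T B (fun t w => - th t w) Q ->
  exists J, exists e, tilting (fun t w => - th t w) J e Q.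
Proof.
move=> /exponential_ito[J hJ hQ]; exists J.
have [K bd] := theta_bracket; exact: bounded_tilting hJ bd _ hQ.
Qed.

Lemma tilt_tilting
    (Y : R -> Omega -> R) (Z : R -> Omega -> 'cV[R]_m) (I : R -> Omega -> R) (Q : probability Omega R) :
  solves 1 (fun=> 0) Y Z I ->
  exponential_measure P T B (tilt Z) Q ->
  exists J, exists e, tilting (tilt Z) J e Q.
Proof.
move=> hY /exponential_ito[J hJ hQ]; exists J.
have [c c0 Yc] := base_bounded hY.
have [e e0 he] := doleans_power hJ (sol_ito hY) c0 Yc (base_drifted hY hJ).
by exists e.
Qed.

Lemma exp_moment_L1 (F : Omega -> R) (p : R) : measurable_fun setT F ->
  ('E_P[fun w => expR (p * Num.max (F w) 0)%R] < +oo)%E -> L1 P (fun w => expR (p * Num.max (F w) 0)).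
Proof.
move=> mF; rewrite unlock => h.
have mX : measurable_fun setT (fun w => expR (p * Num.max (F w) 0)).
  by apply: measurableT_comp => //; apply: measurable_funM => //; exact: measurable_maxr.
apply/integrableP; split; first exact/measurable_EFinP.
apply: le_lt_trans h; apply: ge0_le_integral => //.
- by apply: measurableT_comp => //; exact/measurable_EFinP.
- exact/measurable_EFinP.
- by move=> w _; rewrite /= ger0_norm ?expR_ge0.
Qed.

End market.
End brownian.

Theorem theorem5p7 (R : realType) (disp : measure_display)
  (Omega : measurableType disp) (P : probability Omega R)
  (T : R) (d m : nat) (B : R -> Omega -> 'cV[R]_m)
  (b : R -> Omega -> 'cV[R]_d) (sigma : R -> Omega -> 'M[R]_(d, m))
  (C : set 'cV[R]_d) (F : Omega -> R) (k x : R)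
  (YF : R -> R -> Omega -> R) (ZF : R -> R -> Omega -> 'cV[R]_m)
  (Y10 : R -> Omega -> R) (Z10 : R -> Omega -> 'cV[R]_m)
  (Qtheta QZ : probability Omega R) (price : R -> R) :
  0 < T -> (1 <= d)%N -> (d <= m)%N ->
  measure_is_complete P ->
  brownian_motion P T B ->
  market_assumptions P T B b sigma ->
  closed_convex_cone C -> C 0 ->
  measurable_at P B T F ->
  (forall p : R, 1 <= p -> ('E_P[fun w => expR (p * Num.max (F w) 0)%R] < +oo)%E) ->
  0 < k -> {ae P, forall w, Num.max (- F w) 0 <= k} ->
  (forall alpha, 0 < alpha ->
     utility_bsde P T B b sigma C alpha F (YF alpha) (ZF alpha)) ->
  utility_bsde P T B b sigma C 1 (fun=> 0) Y10 Z10 ->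
  exponential_measure P T B (fun t w => - theta b sigma t w) Qtheta ->
  exponential_measure P T B (tilt b sigma C Z10) QZ ->
  (forall alpha, 0 < alpha ->
     indifference_price P T B b sigma C Qtheta x F alpha (YF alpha)
       (price alpha)) ->
  exists C0 : R -> Omega -> R, exists H0 : R -> Omega -> 'cV[R]_m,
    [/\ linear_bsde P T B b sigma C QZ Z10 F C0 H0,
        forall C0' H0', linear_bsde P T B b sigma C QZ Z10 F C0' H0' ->
          same_solution P T C0 C0' H0 H0' &
        {ae P, forall w, price alpha @[alpha --> 0^'+] --> C0 0 w}].
Proof.
move=> T0 _ _ Pc hB [_ [psg _] inv bth] cone C0 hF expF _ Fk hYF hY hQth hQ hprice.
have bs := BrownianSetting Pc T0 hB.
(* Predictability of [theta] is read off from the integral whose exponential defines [Qtheta]. *)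
have pth : predictable_mx P T B (theta b sigma).
  by have [J [p _ _] _] := exponential_ito bs hQth; exact: (predictable_mx_opp bs p).
have ms : market_setting (P := P) (T := T) (B := B) b sigma C by [].
have [I hY1] := utility_solves bs ms ltr01 hY.
have [Jth [eth tth]] := theta_tilting bs ms hQth.
have [J [e ts]] := tilt_tilting bs ms hY1 hQ.
have mF : measurable_fun setT F := mat_meas bs (lexx T) hF.
have iF p : 1 <= p -> L1 P (fun w => expR (p * Num.max (F w) 0)).
  by move=> p1; exact: (exp_moment_L1 mF (expF p p1)).
have hYa a : 0 < a -> exists I, solves (P := P) (T := T) (B := B) b sigma C a F (YF a) (ZF a) I.
  by move=> a0; exact: (utility_solves bs ms a0 (hYF a a0)).
have [C' [H' [lin C'0]]] := linear_solution bs ms hY1 ts mF iF Fk hYa.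
exists C', H'; split=> //.
  by move=> C'' H'' lin'; exact: (linear_unique bs ts lin.1 lin'.1 lin.2 lin'.2).
set K := 4 * Ex QZ (fun w => expR (2 * `|F w|)).
have bound a : 0 < a -> a <= 1 -> Ex QZ F <= price a <= Ex QZ F + a * K.
  by move=> a0 a1; exact: (price_bounds bs ms hY1 ts mF iF Fk hYa tth a0 a1 (hprice a a0)).
apply: filterS C'0 => w ->.
apply: (@squeeze_cvgr _ _ _ _ (fun=> Ex QZ F) (fun a => Ex QZ F + a * K)).
- near=> a; apply: bound; first by near: a; exact: nbhs_right_gt.
  by near: a; exact: nbhs_right_le.
- exact: cvg_cst.
- rewrite -[X in _ --> X]addr0 -[X in _ --> _ + X](mul0r K).
  apply: cvgD; first exact: cvg_cst.
  by apply: cvgMr_tmp; apply: cvg_at_right_filter; exact: cvg_id.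
Unshelve. all: by end_near. Qed.
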